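(* Let $\alpha,s\in(0,1)$, $H_1,H_2\in(0,\tfrac12]$, $T>0$, and let $f$ be a deterministic mapping with $\|f(v)\|_{L^2(D)}\le C_f(1+\|v\|_{L^2(D)})$ and $\|f(v)-f(w)\|_{L^2(D)}\le C_f\|v-w\|_{L^2(D)}$ for all $v,w\in L^2(D)$ and some constant $C_f>0$. Let $u$ be the (mild) solution of $\partial_t u+{}_0\partial_t^{1-\alpha}A^s u=f(u)+\xi^{H_1,H_2}$ in $D\times(0,T]$ with zero initial value and zero Dirichlet boundary condition. Assume $H_2+\frac{\alpha(H_1-1)}{2s}>0$. Then for every $\gamma\in\left(0,H_2+\frac{\alpha(H_1-1)}{2s}\right)$ there is a constant $C$ such that for all $0<\tau\le t\le T$ $$\mathbb{E}\left\|\frac{u(t)-u(t-\tau)}{\tau^{\gamma}}\right\|_{L^2(D)}^2\le C.$$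
   Context: $D=(0,1)$. $A=-\Delta$ on $D$ with zero Dirichlet boundary condition, with non-decreasing eigenvalues $\lambda_k$ and $L^2$-normalized eigenfunctions $\phi_k$, $k\ge1$; $A^{s}v=\sum_{k}\lambda_k^{s}(v,\phi_k)\phi_k$, where $(\cdot,\cdot)$ is the $L^2(D)$ inner product. ${}_0\partial_t^{1-\alpha}u=\frac{1}{\Gamma(\alpha)}\frac{\partial}{\partial t}\int_0^t(t-r)^{\alpha-1}u(r)dr$ is the Riemann--Liouville derivative. $E_{\alpha,\beta}(z)=\sum_{k\ge0}z^k/\Gamma(k\alpha+\beta)$ is the Mittag--Leffler function. Noise: $\xi^{H_1,H_2}=\frac{\partial^2W^{H_1,H_2}}{\partial x\partial t}$, where $W^{H_1,H_2}$ is a fractional Brownian sheet on $D\times[0,T]$, i.e. a centered Gaussian field on a stochastic basis $(\Omega,\mathcal F,(\mathcal F_t)_{t\in[0,T]},\mathbb P)$ with $\mathbb{E}[W^{H_1,H_2}(x,t)W^{H_1,H_2}(y,r)]=\frac{x^{2H_1}+y^{2H_1}-|x-y|^{2H_1}}{2}\cdot\frac{t^{2H_2}+r^{2H_2}-|t-r|^{2H_2}}{2}$. Integrals $\int\!\int g(y,r)\xi^{H_1,H_2}(y,r)\,dy\,dr$ of deterministic $g$ are Wiener integrals with respect to $W^{H_1,H_2}$ (rectangular increments for indicator functions, extended linearly and by $L^2(\Omega)$-closure). Mild solution: $u$ satisfies $u(x,t)=\int_0^t\mathcal S(t-r)f(u(r))dr+\int_0^t\int_D G(t-r,x,y)\xi^{H_1,H_2}(y,r)dydr$,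 where $\mathcal S(t)v=\sum_{k\ge1}E_{\alpha,1}(-\lambda_k^st^\alpha)(v,\phi_k)\phi_k$ and $G(t,x,y)=\sum_{k\ge1}E_{\alpha,1}(-\lambda_k^st^\alpha)\phi_k(x)\phi_k(y)$. *)

(* Defs.v *)
From HB Require Import structures.
From mathcomp Require Import all_boot all_order all_algebra.
From mathcomp Require Import all_classical all_reals all_analysis.

Set Implicit Arguments.
Unset Strict Implicit.
Unset Printing Implicit Defensive.

Import Order.TTheory GRing.Theory Num.Theory.
Import numFieldNormedType.Exports.

Local Open Scope classical_set_scope.
Local Open Scope ring_scope.

Definition D {R : realType} : set (measurableTypeR R) := `]0, 1[.

Fact measurable_D {R : realType} : measurable (@D R).
Proof. exact: measurable_itv. Qed.

Definition muD {R : realType} : {measure set (measurableTypeR R) -> \bar R} :=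
  mrestr lebesgue_measure measurable_D.

Fact le_1_2 {R : realType} : (1 <= 2%:E :> \bar R)%E.
Proof. by rewrite lee_fin ler1n. Qed.

(* Elements of L^2(D) are represented by functions on R that are square
   integrable for [muD]; they matter only up to [muD]-a.e. equality. *)
Notation L2D R := (LfunType (@muD R) (@le_1_2 R)).

Section L2.
Context {R : realType}.

Definition L2norm (v : L2D R) : \bar R := 'N[muD]_(2%:E)[EFin \o v].

Definition ip (v w : L2D R) : R := \int[muD]_x (v x * w x).

Definition L2_cvg (w : nat -> L2D R) (v : L2D R) : Prop :=
  L2norm (w n - v) @[n --> \oo] --> 0%E.

(* Some representative of the L^2(D)-limit; 0 if the sequence diverges. *)
Definition L2_lim (w : nat -> L2D R) : L2D R := xget 0 [set v | L2_cvg w v].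

(* Bochner integral of F over A: L^2(D) being separable, by Pettis' theorem F is
   Bochner integrable iff it is weakly measurable with integrable norm, and its
   integral is then determined by testing against the elements of L^2(D). *)
Definition is_bochner_integral (A : set (measurableTypeR R))
    (F : R -> L2D R) (I : L2D R) : Prop :=
  [/\ forall v : L2D R, measurable_fun A (fun r => ip (F r) v),
      (\int[lebesgue_measure]_(r in A) L2norm (F r) < +oo)%E &
      forall v : L2D R, ip I v = \int[lebesgue_measure]_(r in A) ip (F r) v].

End L2.

Section spectrum.
Context {R : realType}.

Definition dirichlet_eigenpair (l : R) (v : L2D R) : Prop :=
  [/\ {within `[0, 1], continuous (v : R -> R)},
      v 0 = 0 /\ v 1 = 0 &
      forall x, x \in `]0, 1[ ->
        [/\ derivable v x 1, derivable (derive1 v) x 1 &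
            - derive1 (derive1 v) x = l * v x] ].

(* The spectral decomposition of A, the Dirichlet Laplacian on D, indexed by
   k >= 1 (the values at k = 0 are irrelevant).  Completeness of the phi k
   expresses that every eigenvalue is listed, with its multiplicity. *)
Definition dirichlet_spectrum (lam : nat -> R) (phi : nat -> L2D R) : Prop :=
  [/\ forall k, (1 <= k)%N -> dirichlet_eigenpair (lam k) (phi k),
      forall j k, (1 <= j)%N -> (1 <= k)%N -> ip (phi j) (phi k) = (j == k)%:R,
      forall j k, (1 <= j)%N -> (j <= k)%N -> lam j <= lam k &
      forall v : L2D R, (forall k, (1 <= k)%N -> ip v (phi k) = 0) ->
        L2norm v = 0%E].

End spectrum.

Section solution_operators.
Context {R : realType}.

Definition Gamma (x : R) : R :=
  \int[lebesgue_measure]_(t in `]0, +oo[) (t `^ (x - 1) * expR (- t)).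

Definition mittag_leffler (a b z : R) : R :=
  limn (series (fun k : nat => z ^+ k / Gamma (k%:R * a + b))).

Variables (alpha s : R) (lam : nat -> R) (phi : nat -> L2D R).

Definition symbol (k : nat) (t : R) : R :=
  mittag_leffler alpha 1 (- (lam k `^ s * t `^ alpha)).

Definition sol_op (t : R) (v : L2D R) : L2D R :=
  L2_lim (fun n => \sum_(1 <= k < n.+1) (symbol k t * ip v (phi k)) *: phi k).

(* The series is not absolutely convergent in general: for t > 0 its partial sums
   converge pointwise for y != x. *)
Definition green (t x y : R) : R :=
  limn (fun n => \sum_(1 <= k < n.+1) symbol k t * phi k x * phi k y).

End solution_operators.

Section noise.
Context d (Omega : measurableType d) {R : realType} (P : probability Omega R).

Definition is_filtration (T : R) (F : R -> set (set Omega)) : Prop :=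
  [/\ forall t, 0 <= t <= T -> sigma_algebra setT (F t),
      forall t, 0 <= t <= T -> F t `<=` measurable &
      forall r t, 0 <= r -> r <= t -> t <= T -> F r `<=` F t].

(* The degenerate law is treated separately, since [normal_prob m 0] is not the
   Dirac measure at m but the uniform distribution. *)
Definition centered_gaussian (X : Omega -> R) : Prop :=
  {ae P, forall w, X w = 0} \/
  exists2 sigma : R, 0 < sigma &
    forall B : set (measurableTypeR R), measurable B ->
      P (X @^-1` B) = normal_prob 0 sigma B.

Definition fbm_cov (H x y : R) : R :=
  (x `^ (2 * H) + y `^ (2 * H) - `|x - y| `^ (2 * H)) / 2.

Definition is_fractional_brownian_sheet (H1 H2 T : R)
    (F : R -> set (set Omega)) (W : R -> R -> {RV P >-> R}) : Prop :=
  [/\ forall x t, x \in `]0, 1[ -> 0 <= t <= T ->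
        forall B : set (measurableTypeR R), measurable B ->
          F t (W x t @^-1` B),
      forall (n : nat) (a x t : 'I_n -> R),
        (forall i, (x i \in `]0, 1[) && (0 <= t i <= T)) ->
        centered_gaussian (fun w => \sum_(i < n) a i * W (x i) (t i) w) &
      forall x y t r, x \in `]0, 1[ -> y \in `]0, 1[ ->
        0 <= t <= T -> 0 <= r <= T ->
        ('E_P[(fun w => W x t w * W y r w)%R] =
         (fbm_cov H1 x y * fbm_cov H2 t r)%:E)%E].

Record box := Box { y_lo : R; y_hi : R; r_lo : R; r_hi : R }.

Definition box_in (t : R) (b : box) : Prop :=
  [/\ 0 < y_lo b, y_lo b <= y_hi b & y_hi b < 1] /\
  [/\ 0 <= r_lo b, r_lo b <= r_hi b & r_hi b <= t].

Definition box_set (b : box) : set (R * R) :=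
  `]y_lo b, y_hi b] `*` `]r_lo b, r_hi b].

Definition increment (W : R -> R -> {RV P >-> R}) (b : box) (w : Omega) : R :=
  W (y_hi b) (r_hi b) w - W (y_lo b) (r_hi b) w
  - W (y_hi b) (r_lo b) w + W (y_lo b) (r_lo b) w.

Definition step_fun (n : nat) (c : 'I_n -> R) (b : 'I_n -> box) (p : R * R) : R :=
  \sum_(i < n) c i * \1_(box_set (b i)) p.

Definition step_integral (W : R -> R -> {RV P >-> R})
    (n : nat) (c : 'I_n -> R) (b : 'I_n -> box) (w : Omega) : R :=
  \sum_(i < n) c i * increment W (b i) w.

(* X is the Wiener integral of g over D x [0,t].  When H1, H2 <= 1/2 the
   L^2(Omega)-norm of the integral of a step function dominates, up to a
   constant, the L^2-norm of the step function.  Hence the integrands obtained by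
   L^2(Omega)-closure are the square integrable functions g approximated by step
   functions as below, and X does not depend on the approximation. *)
Definition is_wiener_integral (W : R -> R -> {RV P >-> R}) (t : R)
    (g : R * R -> R) (X : Omega -> R) : Prop :=
  [/\ measurable_fun (D `*` `[0, t]) g,
      measurable_fun setT X &
      exists (n : nat -> nat) (c : forall m, 'I_(n m) -> R)
             (b : forall m, 'I_(n m) -> box),
        [/\ forall m i, box_in t (b m i),
            (\int[lebesgue_measure \x lebesgue_measure]_(p in D `*` `[0%R, t])
              ((step_fun (c m) (b m) p - g p) ^+ 2)%:E)%E
              @[m --> \oo] --> 0%E &
            'E_P[(fun w => (step_integral W (c m) (b m) w - X w) ^+ 2)%R]%E
              @[m --> \oo] --> 0%E] ].

End noise.

Section mild.
Context d (Omega : measurableType d) {R : realType} (P : probability Omega R).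
Variables (alpha s T : R) (lam : nat -> R) (phi : nat -> L2D R).
Variables (W : R -> R -> {RV P >-> R}) (f : L2D R -> L2D R).

(* The time integral is pathwise; the condition on the norm of u ensures that
   r |-> f (u r w) is integrable.  The stochastic convolution [conv w x] is, for
   almost every x, the Wiener integral of (y, r) |-> green (t - r) x y. *)
Definition mild_solution (u : R -> Omega -> L2D R) : Prop :=
  [/\ measurable_fun (`[0, T] `*` [set: Omega * measurableTypeR R])
        (fun p : measurableTypeR R * (Omega * measurableTypeR R) =>
          u p.1 p.2.1 p.2.2),
      {ae P, forall w,
        (\int[lebesgue_measure]_(r in `[0%R, T]) L2norm (u r w) < +oo)%E},
      {ae P, forall w, {ae muD, forall x, u 0 w x = 0}} &
      forall t, 0 < t -> t <= T ->
        exists drift conv : Omega -> L2D R,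
          [/\ {ae P, forall w, is_bochner_integral `[0, t]
                 (fun r => sol_op alpha s lam phi (t - r) (f (u r w))) (drift w)},
              measurable_fun [set: Omega * measurableTypeR R]
                (fun p : Omega * measurableTypeR R => conv p.1 p.2),
              {ae muD, forall x, is_wiener_integral W t
                 (fun p => green alpha s lam phi (t - p.2) x p.1)
                 (fun w => conv w x)} &
              {ae P, forall w, {ae muD, forall x,
                 u t w x = drift w x + conv w x}}] ].

End mild.

(* Main.v *)
Require Import Defs.
From HB Require Import structures.
From mathcomp Require Import all_boot all_order all_algebra.
From mathcomp Require Import all_classical all_reals all_analysis.
From mathcomp Require Import measurable_realfun ring lra.

Set Implicit Arguments.
Unset Strict Implicit.
Unset Printing Implicit Defensive.

Import Order.TTheory GRing.Theory Num.Theory.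
Import numFieldNormedType.Exports.

Local Open Scope classical_set_scope.
Local Open Scope ring_scope.

(* On [0, 1] the fractional Brownian covariance of index H <= 1/2 is a combination of the
   products (1 - cos k pi x)(1 - cos k pi y) and sin k pi x sin k pi y with nonnegative weights of
   order k^(-1-2H), because so is |t|^(2H) in terms of the functions 1 - cos k pi t.  Hence the
   mean square of a Wiener integral is a weighted sum of squared trigonometric moments of its
   integrand.  For the Green function these moments split into a spatial overlap with phi_k and a
   time response of E_{alpha,1}(-lam_k^s t^alpha); integrating in x by Parseval leaves a double
   series.  The Mittag-Leffler function being positive, nonincreasing and of order 1/x, time
   oscillations only see half a period, which bounds the differences of the responses, and the
   series converges exactly under the condition on gamma, provided 1 - H1 < 2 s.  If
   2 s <= 1 - H1, the integrand of the stochastic convolution has infinite energy, so that no mild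
   solution exists.

   The increment of the drift has coefficients int kappa_k a_k with |kappa_k| <= 1 and
   int |kappa_k| <= 2 tau; by Cauchy-Schwarz and Parseval it costs 2 tau times the integral of
   |f(u)|^2, whose mean is finite by Gronwall's inequality. *)


(** * Integrals on the real line *)

Local Notation pushforward_measure :=
  measure_function_pushforward__canonical__measure_function_Measure.

(** When H < 1/2 the formal covariance kernel of the noise is not integrable on the diagonal, so
    variances have no double-integral formula; a series of nonnegative squares avoids it, since
    finite partial sums, monotone limits and Fatou's lemma then suffice. All exponents come from one
    interpolation, E_{alpha,1}(-x) <= C x^(-theta) with 0 <= theta <= 1: the series over the
    eigenvalues needs 2 s theta > 1 - H1, the one over the time modes needs alpha theta + gamma <
    H2. A common theta <= 1 exists iff gamma < H2 + alpha (H1 - 1) / (2 s) and 1 - H1 < 2 s. The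
    second condition does not follow from the assumption of the theorem, because alpha may be small;
    this forces the separate treatment of the range without solutions, which needs matching lower
    bounds on the coefficients and on the Mittag-Leffler function. The Green series converges only
    conditionally, so its moments are reached through partial sums dominated by Abel summation.
    Completeness of the trigonometric functions is drawn from [dirichlet_spectrum] itself. *)

Lemma lebesgue_pushforward_scale (R : realType) (c b : R) (A : set R) : 0 < c ->
  measurable A ->
  (c%:E * pushforward lebesgue_measure
    ((fun x => c * x + b)%R : measurableTypeR R -> measurableTypeR R) A)%E =
  lebesgue_measure A.
Proof.
move=> c0 mA.
have mphi : measurable_fun [set: measurableTypeR R]
    ((fun x => c * x + b) : measurableTypeR R -> measurableTypeR R).
  by apply: measurable_funD => //; apply: measurable_funM.
pose cn : {nonneg R} := NngNum (ltW c0).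
pose m := mscale cn (pushforward_measure lebesgue_measure mphi).
have -> : lebesgue_measure A = m A; last by [].
apply: (lebesgue_measure_unique (mu := m)) => // _ [[x y]] _ <-.
rewrite /m/= /mscale/= /pushforward/=.
have -> : (fun z => c * z + b) @^-1` [set` `]x, y]] =
    [set` `](x - b) / c, (y - b) / c]].
  apply/seteqP; split=> z /=; rewrite !in_itv/= => /andP[h1 h2]; apply/andP; split.
  - by rewrite ltr_pdivrMr// ltrBlDr mulrC.
  - by rewrite ler_pdivlMr// lerBrDr mulrC.
  - by rewrite mulrC -ltrBlDr -ltr_pdivrMr.
  - by rewrite mulrC -lerBrDr -ler_pdivlMr.
rewrite !lebesgue_measure_itv/= !lte_fin ltr_pM2r ?invr_gt0// ltrD2r.
case: ifPn => _; last by rewrite mule0.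
by rewrite -!EFinD -EFinM; congr (_%:E); field; rewrite gt_eqF.
Qed.

Section affine.
Context {R : realType}.
Notation mu := (@lebesgue_measure R).
Local Open Scope ereal_scope.

Lemma ge0_integral_scale (c b : R) (B : set (measurableTypeR R))
    (f : measurableTypeR R -> \bar R) :
  (0 < c)%R -> measurable B -> measurable_fun B f -> (forall x, B x -> 0 <= f x) ->
  \int[mu]_(x in B) f x =
  c%:E * \int[mu]_(x in [set x | B (c * x + b)%R]) f (c * x + b)%R.
Proof.
move=> c0 mB mf f0.
have mphi : measurable_fun [set: measurableTypeR R]
    ((fun x => c * x + b)%R : measurableTypeR R -> measurableTypeR R).
  by apply: measurable_funD => //; apply: measurable_funM.
have := @ge0_integral_pushforward _ _ _ _ R _ mphi mu B f mB mf.
move=> /(_ (fun x xB => f0 x (set_mem xB))) => h.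
rewrite [X in _ = _ * X](_ : _ = \int[mu]_(x in (fun x => c * x + b)%R @^-1` B)
  (f \o (fun x => c * x + b)%R) x)// -h.
pose cn : {nonneg R} := NngNum (ltW c0).
have := @ge0_integral_mscale _ _ R (pushforward_measure mu mphi) B mB cn f mf f0.
move=> /= <-.
by apply: eq_measure_integral => A mA _; exact/esym/(lebesgue_pushforward_scale b c0 mA).
Qed.

(** The reflection x -> t - x is a negation followed by a translation, and both preserve Lebesgue
    measure. *)
Lemma ge0_integral_reflect (t : R) (B : set (measurableTypeR R))
    (f : measurableTypeR R -> \bar R) :
  measurable B -> measurable_fun B f -> (forall x, B x -> 0 <= f x) ->
  \int[mu]_(x in B) f x =
  \int[mu]_(x in [set x | B (t - x)%R]) f (t - x)%R.
Proof.
move=> mB mf f0.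
have mN : measurable_fun [set: measurableTypeR R]
    (-%R : measurableTypeR R -> measurableTypeR R).
  by apply: measurable_funN => //.
rewrite (ge0_integral_scale t (@ltr01 R))// mul1e.
under eq_integral do rewrite mul1r addrC.
rewrite (_ : [set x | B _] = [set x | B (t + x)%R]); last first.
  by apply/seteqP; split => x /=; rewrite mul1r addrC.
pose g := fun x => f (t + x)%R.
have mph : measurable_fun setT (fun x => t + x : measurableTypeR R)%R.
  exact: measurable_funD.
have mBt : measurable [set x | B (t + x)%R].
  by rewrite -[X in measurable X]setTI; exact: mph.
have mg : measurable_fun [set x | B (t + x)%R] g.
  apply: (measurable_comp mB) => //; first by move=> _ [x Bx <-].
  exact: measurable_funTS.
have := @ge0_integral_pushforward _ _ _ _ R _ mN mu _ g mBt mg.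
move=> /(_ (fun x xB => f0 _ (set_mem xB))) => /= <-.
apply: eq_measure_integral => A mA _.
exact/esym/lebesgue_measureN.
Qed.

Lemma integral_shift (b : R) (B : set (measurableTypeR R))
    (f : measurableTypeR R -> \bar R) :
  measurable B -> measurable_fun B f ->
  \int[mu]_(x in B) f x = \int[mu]_(x in [set x | B (x + b)%R]) f (x + b)%R.
Proof.
move=> mB mf; rewrite integralE [RHS]integralE.
rewrite (ge0_integral_scale b (@ltr01 R) mB (measurable_funepos mf)); last first.
  by move=> *; exact: funepos_ge0.
rewrite (ge0_integral_scale b (@ltr01 R) mB (measurable_funeneg mf)); last first.
  by move=> *; exact: funeneg_ge0.
rewrite !mul1e.
rewrite (_ : [set x | B (1 * x + b)%R] = [set x | B (x + b)%R]); last first.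
  by apply/seteqP; split => x /=; rewrite mul1r.
congr (_ - _)%E; apply: eq_integral => x _.
  by rewrite !funeposE mul1r.
by rewrite !funenegE mul1r.
Qed.

Lemma integral_shiftT (b : R) (f : measurableTypeR R -> \bar R) :
  measurable_fun setT f -> \int[mu]_x f x = \int[mu]_x f (x + b)%R.
Proof.
by move=> mf; rewrite (integral_shift b _ mf).
Qed.

Lemma integral_reflect (t : R) (B : set (measurableTypeR R))
    (f : measurableTypeR R -> \bar R) :
  measurable B -> measurable_fun B f ->
  \int[mu]_(x in B) f x = \int[mu]_(x in [set x | B (t - x)%R]) f (t - x)%R.
Proof.
move=> mB mf; rewrite integralE [RHS]integralE.
rewrite (ge0_integral_reflect t mB (measurable_funepos mf)); last first.
  by move=> *; exact: funepos_ge0.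
rewrite (ge0_integral_reflect t mB (measurable_funeneg mf)); last first.
  by move=> *; exact: funeneg_ge0.
by congr (_ - _)%E; apply: eq_integral => x _; rewrite ?funeposE ?funenegE.
Qed.

End affine.

Lemma le_of_eq (R : realType) (x y : R) : x = y -> x <= y.
Proof. by move=> ->. Qed.

Lemma ge0_le_int d (T : measurableType d) (R : realType)
    (mu : {measure set T -> \bar R}) (D : set T) (f g : T -> \bar R) :
  measurable D -> (forall x, D x -> 0 <= f x)%E -> measurable_fun D f ->
  measurable_fun D g -> (forall x, D x -> f x <= g x)%E ->
  (\int[mu]_(x in D) f x <= \int[mu]_(x in D) g x)%E.
Proof.
by move=> mD f0 mf mg fg; apply: ge0_le_integral => // x Dx; apply: le_trans (fg x Dx); exact: f0.
Qed.

Lemma measurable_fun_powR d (T : measurableType d) (R : realType) (D : set T)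
    (f : T -> R) (p : R) :
  measurable_fun D f -> measurable_fun D (fun x => f x `^ p).
Proof.
move=> mf; rewrite (_ : (fun _ => _) = (@powR R ^~ p) \o f)//.
by apply: measurableT_comp => //; exact: measurable_powR.
Qed.

Lemma measurable_fun_expR d (T : measurableType d) (R : realType) (D : set T)
    (f : T -> R) :
  measurable_fun D f -> measurable_fun D (fun x => expR (f x)).
Proof.
move=> mf; rewrite (_ : (fun _ => _) = expR \o f)//.
by apply: measurableT_comp => //; exact: measurable_expR.
Qed.

Lemma measurable_EFin_powR (R : realType) (p : R) (D : set (measurableTypeR R)) :
  measurable_fun D (fun x : measurableTypeR R => (x `^ p)%:E).
Proof. by apply: measurable_funTS; apply/measurable_EFinP; exact: measurable_powR. Qed.

Lemma FTC2_cc (R : realType) (F f : R -> R) (a b : R) : a <= b ->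
  (forall x, a <= x <= b -> is_derive x (1 : R) F (f x)) ->
  (forall x, a <= x <= b -> {for x, continuous f}) ->
  (\int[lebesgue_measure]_(x in `[a, b]) (f x)%:E = (F b - F a)%:E)%E.
Proof.
rewrite le_eqVlt => /predU1P[<- _ _|ab dF cf].
  by rewrite set_itv1 integral_set1 subrr.
have cF x : a <= x <= b -> {for x, continuous F}.
  move=> xab; apply: differentiable_continuous.
  by apply/derivable1_diffP; have [] := dF _ xab.
rewrite EFinB; apply: continuous_FTC2 => //.
- apply: continuous_in_subspaceT => x /set_mem/=; rewrite in_itv/=; exact: cf.
- split.
  + move=> x; rewrite in_itv/= => /andP[/ltW ax /ltW xb].
    by have [] := dF x; rewrite ?ax ?xb.
  + by apply: cvg_at_right_filter; apply: cF; rewrite lexx ltW.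
  + by apply: cvg_at_left_filter; apply: cF; rewrite lexx ltW.
- move=> x; rewrite in_itv/= => /andP[/ltW ax /ltW xb].
  by rewrite derive1E; have [|_ ->] := dF x; rewrite ?ax ?xb.
Qed.

Lemma powRD_gt0 (R : realType) (x r s : R) : 0 < x -> x `^ (r + s) = x `^ r * x `^ s.
Proof. by move=> x0; rewrite powRD// (gt_eqF x0) implybT. Qed.

Lemma le_powR (R : realType) (x y r : R) : 0 <= r -> 0 <= x -> x <= y -> x `^ r <= y `^ r.
Proof.
by move=> r0 x0 xy; apply: ge0_ler_powR => //; rewrite nnegrE// (le_trans x0).
Qed.

Lemma continuous_powR_gt0 (R : realType) (p x : R) : 0 < x ->
  {for x, continuous (fun y : R => y `^ p)}.
Proof.
move=> x0; apply: differentiable_continuous; apply/derivable1_diffP.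
by apply: derivable_powR; rewrite in_itv/= x0.
Qed.

(** For b < 1 the integrand blows up at 0, so the interval is exhausted by [t / (n+1), t], where the
    fundamental theorem applies, and monotone convergence gives the limit. *)
Lemma integral_powR (R : realType) (b t : R) : 0 < b -> 0 <= t ->
  (\int[lebesgue_measure]_(x in `]0%R, t]) (x `^ (b - 1))%:E = (t `^ b / b)%:E)%E.
Proof.
move=> b0; rewrite le_eqVlt => /predU1P[<-|t0].
  by rewrite set_itvoc0 integral_set0 powR0 ?gt_eqF// mul0r.
pose A n : set (measurableTypeR R) := `[t / n.+1%:R, t]%classic.
have AE : `]0, t]%classic = \bigcup_n A n.
  apply/seteqP; split => x /=.
    rewrite in_itv/= => /andP[x0 xt].
    have [n _ /(_ n (leqnn n))] := near_infty_natSinv_lt (PosNum (divr_gt0 x0 t0)).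
    move=> /= h; exists n => //=; rewrite /A/= in_itv/= xt andbT.
    by rewrite mulrC -ler_pdivlMr// ltW.
  move=> [n _]; rewrite /A/= !in_itv/= => /andP[h ->]; rewrite andbT.
  by rewrite (lt_le_trans _ h)// divr_gt0.
have nd : nondecreasing_seq A.
  apply/nondecreasing_seqP => n; apply/subsetPset => x; rewrite /A/= !in_itv/=.
  move=> /andP[h ->]; rewrite andbT (le_trans _ h)// ler_wpM2l ?ltW//.
  by rewrite ltf_pV2 ?posrE// ltr_nat.
have mf D : measurable_fun D (fun x : measurableTypeR R => (x `^ (b - 1))%:E).
  apply: measurable_funTS; apply/measurable_EFinP.
  exact: measurable_powR.
have h1 := @ge0_nondecreasing_set_cvg_integral _ (measurableTypeR R) _ A
  (fun x => (x `^ (b - 1))%:E) lebesgue_measure nd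
  (fun i => measurable_itv _) (fun i => mf _)
  (fun i x _ => powR_ge0 x (b - 1)).
rewrite -AE in h1.
apply: (cvg_unique _ h1) => //.
have E n : (\int[lebesgue_measure]_(x in A n) (x `^ (b - 1))%:E =
   (t `^ b / b - (t / n.+1%:R) `^ b / b)%:E)%E.
  have tn : 0 < t / n.+1%:R by rewrite divr_gt0.
  apply: (@FTC2_cc _ (fun x => x `^ b / b)).
  - by rewrite ler_pdivrMr// ler_peMr ?ler1n// ltW.
  - move=> x /andP[/(lt_le_trans tn) x0 _].
    have := is_derive1_powR b x0 => d.
    have -> : x `^ (b - 1) = (b * x `^ (b - 1)) * b^-1.
      by rewrite mulrAC mulfV ?mul1r// gt_eqF.
    have -> : (fun x0 : R => x0 `^ b / b) = (fun x0 : R => b^-1 *: x0 `^ b).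
      by apply/funext => y; rewrite mulrC.
    by rewrite [X in is_derive _ _ _ X]mulrC; exact: is_deriveZ.
  - move=> x /andP[/(lt_le_trans tn) x0 _].
    apply: differentiable_continuous; apply/derivable1_diffP.
    by apply: derivable_powR; rewrite in_itv/= x0.
apply: (@cvg_trans _ (EFin (t `^ b / b - (t / n.+1%:R) `^ b / b) @[n --> \oo])).
  by apply: near_eq_cvg; apply: nearW => n; rewrite -E.
apply: cvg_EFin; first by apply: nearW.
rewrite (_ : _ \o _ = fun n => t `^ b / b - (t / n.+1%:R) `^ b / b); last first.
  by apply/funext.
rewrite -[X in _ --> X]subr0; apply: cvgB; first exact: cvg_cst.
rewrite -[X in _ --> X](mul0r b^-1); apply: cvgMl.
have -> : (fun x : nat => (t / x.+1%:R) `^ b) =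
          (fun x : nat => t `^ b * (x.+1%:R^-1) `^ b).
  by apply/funext => n; rewrite powRM// ltW.
rewrite -[X in _ --> X](mulr0 (t `^ b)); apply: cvgMr.
have h2 := powR_cvg0 b0 (R := R).
apply: (cvg_comp _ _ _ h2).
move=> B [e /= e0 Be]; near=> n; apply: Be => //=.
rewrite sub0r normrN ger0_norm//.
by near: n; exact: (near_infty_natSinv_lt (PosNum e0)).
Unshelve. all: by end_near. Qed.

(** Comparison with the integral: [F] is a primitive of x^(-q), so by the mean value theorem each
    term is at most an increment of [F], and the increments telescope. *)
Lemma sum_invpowR_le (R : realType) (q : R) : 1 < q ->
  exists2 C : R, 0 < C & forall n, \sum_(1 <= k < n.+1) k%:R `^ (- q) <= C.
Proof.
move=> q1; exists (1 + (q - 1)^-1); first by rewrite addr_gt0// invr_gt0 subr_gt0.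
have q10 : 0 < q - 1 by rewrite subr_gt0.
pose F (x : R) := - (q - 1)^-1 * x `^ (1 - q).
have step k : (k.+2%:R : R) `^ (- q) <= F k.+2%:R - F k.+1%:R.
  have [|||c] := @MVT R F (fun x => x `^ (- q)) k.+1%:R k.+2%:R.
  - by rewrite ltr_nat.
  - move=> x; rewrite in_itv/= => /andP[kx _].
    have x0 : 0 < x by rewrite (lt_trans _ kx).
    have d := is_derive1_powR (1 - q) x0.
    have -> : x `^ (- q) = - (q - 1)^-1 *: ((1 - q) * x `^ (1 - q - 1)).
      rewrite /GRing.scale/= mulrA (_ : 1 - q - 1 = - q); last by ring.
      rewrite (_ : - _ * _ = 1) ?mul1r//; field.
      by rewrite gt_eqF.
    exact: is_deriveZ.
  - apply: continuous_in_subspaceT => x /set_mem/=; rewrite in_itv/= => /andP[kx _].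
    have x0 : 0 < x by rewrite (lt_le_trans _ kx).
    apply: cvgMr.
    exact: continuous_powR_gt0.
  rewrite in_itv/= => /andP[kc ck] ->.
  have c0 : 0 < c by rewrite (lt_trans _ kc).
  rewrite (_ : k.+2%:R - k.+1%:R = 1) ?mulr1; last by rewrite -natrB// subSnn.
  rewrite !powRN lef_pV2 ?posrE ?powR_gt0//.
  by rewrite ge0_ler_powR ?nnegrE ?ltW// (lt_trans ltr01).
have main n : \sum_(1 <= k < n.+2) (k%:R : R) `^ (- q) <= 1 + (F n.+1%:R - F 1).
  elim: n => [|n IH]; first by rewrite big_nat1 powR1 subrr addr0.
  rewrite big_nat_recr//=; apply: (le_trans (lerD IH (step n))).
  by rewrite (_ : 1 + (F n.+1%:R - F 1) + (F n.+2%:R - F n.+1%:R) = 1 + (F n.+2%:R - F 1))//; ring.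
case=> [|n]; first by rewrite big_geq// addr_ge0// invr_ge0 ltW.
apply: (le_trans (main n)); rewrite lerD2l /F powR1 mulr1 opprK.
rewrite gerDr mulNr oppr_le0 mulr_ge0// ?invr_ge0 ?powR_ge0//.
exact: ltW.
Qed.

(** * The Gamma and Beta functions *)

Section gamma_beta.
Context {R : realType}.
Notation mu := (@lebesgue_measure R).
Local Open Scope ereal_scope.

(** The extended-real integral whose finite part is [Gamma]. Positivity and Tonelli can be used on
    it before its finiteness is established. *)
Definition gammae (b : R) : \bar R :=
  \int[mu]_(t in `]0%R, +oo[) (t `^ (b - 1) * expR (- t))%:E.

Lemma measurable_gamma_integrand (b : R) (D : set (measurableTypeR R)) :
  measurable_fun D (fun t : measurableTypeR R => (t `^ (b - 1) * expR (- t))%:E).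
Proof.
apply: measurable_funTS; apply/measurable_EFinP; apply: measurable_funM.
  exact: measurable_powR.
apply: measurableT_comp; first exact: measurable_expR.
exact: measurable_funN.
Qed.

Lemma measurable_exp_half (D : set (measurableTypeR R)) :
  measurable_fun D (fun t : measurableTypeR R => (expR (- (t / 2)))%:E).
Proof.
apply: measurable_funTS; apply/measurable_EFinP.
apply: measurableT_comp; first exact: measurable_expR.
by apply: measurable_funN; exact: measurable_funM.
Qed.

Lemma gamma_integrand_ge0 (b t : R) : 0 <= (t `^ (b - 1) * expR (- t))%:E.
Proof. by rewrite lee_fin mulr_ge0 ?powR_ge0 ?expR_ge0. Qed.

Lemma integral_exp_half : \int[mu]_(t in `[1%R, +oo[) (expR (- (t / 2)))%:E < +oo.
Proof.
rewrite (@ge0_continuous_FTC2y _ _ (fun t => -2 * expR (- (t / 2)))%R _ 0%R) ?ltry//.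
- apply: continuous_subspaceT => x; apply: continuous_comp; last exact: continuous_expR.
  by apply: cvgN; apply: cvgMl; exact: cvg_id.
- rewrite -[X in _ --> X](mulr0 (-2 : R)%R); apply: cvgMr.
  apply: (@cvg_comp _ _ _ (fun t : R => t / 2)%R (fun t => expR (- t))%R
     _ (pinfty_nbhs R)); last exact: cvgr_expR.
  by apply: gt0_cvgMly => //; exact: cvg_id.
- apply: cvg_at_right_filter; apply: cvgMr.
  apply: continuous_comp; last exact: continuous_expR.
  by apply: cvgN; apply: cvgMl; exact: cvg_id.
- move=> x _; rewrite derive1E; apply: derive_val.
  by apply: is_derive_eq; rewrite !scaler0 add0r /GRing.scale/=; field.
Qed.

(** On ]0, 1] the integrand is at most t^(b-1). Beyond 1, a single term of the exponential series at
    t / 2 bounds t^(n+1) by C exp(t / 2), leaving the integrable exp(- t / 2). *)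
Lemma gammae_lty (b : R) : (0 < b)%R -> gammae b < +oo.
Proof.
move=> b0; rewrite /gammae.
rewrite (_ : `]0%R, +oo[%classic = `]0%R, 1%R] `|` `]1%R, +oo[); last first.
  by rewrite -itv_bndbnd_setU// bnd_simp.
rewrite ge0_integral_setU//=; last 3 first.
- exact: measurable_gamma_integrand.
- by move=> x _; exact: gamma_integrand_ge0.
- apply/disj_setPLR => x/=; rewrite !in_itv/= => /andP[_ h]; apply/negP.
  by rewrite andbT -leNgt.
apply: lte_add_pinfty.
  apply: (@le_lt_trans _ _ (\int[mu]_(x in `]0%R, 1%R]) (x `^ (b - 1))%:E)).
    apply: ge0_le_int; [exact: measurable_itv|..].
    - by move=> x _; exact: gamma_integrand_ge0.
    - exact: measurable_gamma_integrand.
    - exact: measurable_EFin_powR.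
    - move=> x /=; rewrite in_itv/= => /andP[x0 _]; rewrite lee_fin ler_piMr ?powR_ge0//.
      by rewrite expR_le1 oppr_le0 ltW.
  by rewrite integral_powR// ltry.
have [n bn] : exists n : nat, (b - 1 <= n.+1%:R)%R.
  exists (Num.truncn `|b - 1|%R); apply: (le_trans (ler_norm _)).
  by rewrite ltW// truncnS_gt.
pose C : R := (2 ^+ n.+1 * n.+1`!%:R)%R.
apply: (@le_lt_trans _ _ (\int[mu]_(x in `[1%R, +oo[) (C * expR (- (x / 2)))%:E)).
  apply: (@le_trans _ _ (\int[mu]_(x in `[1%R, +oo[) (x `^ (b - 1) * expR (- x))%:E)).
    apply: ge0_subset_integral => //=.
    - exact: measurable_gamma_integrand.
    - by move=> x _; exact: gamma_integrand_ge0.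
    - by move=> x /=; rewrite !in_itv/= !andbT => /ltW.
  apply: ge0_le_int; [exact: measurable_itv|..].
  - by move=> x _; exact: gamma_integrand_ge0.
  - exact: measurable_gamma_integrand.
  - apply/measurable_EFinP; apply: measurable_funM; first exact: measurable_cst.
    by apply/measurable_EFinP; exact: measurable_exp_half.
  - move=> x /=; rewrite in_itv/= andbT => x1; rewrite lee_fin.
    have x0 : (0 <= x / 2)%R by rewrite divr_ge0// (le_trans _ x1).
    have h := expR_ge1Dxn n x0.
    have -> : (expR (- (x / 2)) = expR (x / 2) * expR (- x))%R.
      by rewrite -expRD; congr expR; field.
    rewrite mulrA ler_wpM2r ?expR_ge0//.
    apply: (@le_trans _ _ (x ^+ n.+1)%R).
      by rewrite -powR_mulrn ?(le_trans _ x1)// ler_powR.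
    have h2 : ((x / 2) ^+ n.+1 / n.+1`!%:R <= expR (x / 2))%R.
      by apply: le_trans h; rewrite lerDr.
    rewrite ler_pdivrMr ?ltr0n ?fact_gt0// expr_div_n ler_pdivrMr ?exprn_gt0// in h2.
    by apply: (le_trans h2); apply: le_of_eq; rewrite /C; ring.
under eq_integral do rewrite EFinM.
rewrite ge0_integralZl//=; last 2 first.
- exact: measurable_exp_half.
- by rewrite lee_fin mulr_ge0// exprn_ge0.
by rewrite lte_mul_pinfty// ?integral_exp_half// lee_fin mulr_ge0// exprn_ge0.
Qed.

(** Only the interval [M, M + 1] is kept. Since M is arbitrary, the Gamma function outgrows every
    exponential in b, which is what gives the Mittag-Leffler series an infinite radius of
    convergence. *)
Lemma gammae_ge (b M : R) : (1 <= b)%R -> (0 < M)%R ->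
  (M `^ (b - 1) * expR (- (M + 1)))%:E <= gammae b.
Proof.
move=> b1 M0.
apply: (@le_trans _ _ (\int[mu]_(x in `[M, (M + 1)%R])
    (cst (M `^ (b - 1) * expR (- (M + 1)))%:E x))).
  by rewrite integral_cst//= lebesgue_measure_itv/= lte_fin ltrDl ltr01
    -EFinD addrAC subrr add0r mule1.
apply: (@le_trans _ _ (\int[mu]_(x in `[M, (M + 1)%R]) (x `^ (b - 1) * expR (- x))%:E)).
  apply: (@ge0_le_int _ (measurableTypeR R) R mu _ (cst (M `^ (b - 1) * expR (- (M + 1)))%:E)); [exact: measurable_itv|..].
  - by move=> x _; rewrite lee_fin mulr_ge0 ?powR_ge0 ?expR_ge0.
  - exact: measurable_cst.
  - exact: measurable_gamma_integrand.
  - move=> x /=; rewrite in_itv/= => /andP[Mx xM]; rewrite lee_fin ler_pM ?powR_ge0 ?expR_ge0//.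
      by rewrite ge0_ler_powR ?nnegrE ?subr_ge0// ?ltW// (lt_le_trans M0).
    by rewrite ler_expR lerN2.
apply: ge0_subset_integral => //=.
- exact: measurable_gamma_integrand.
- by move=> x _; exact: gamma_integrand_ge0.
- by move=> x /=; rewrite !in_itv/= andbT => /andP[+ _]; exact: lt_le_trans.
Qed.

Lemma gammae_gt0 (b : R) : (0 < b)%R -> 0 < gammae b.
Proof.
move=> b0; apply: (@lt_le_trans _ _ (\int[mu]_(x in `]0%R, 1%R])
    ((expR (-1))%:E * (x `^ (b - 1))%:E))).
  rewrite ge0_integralZl//=.
  - by rewrite integral_powR// powR1 -EFinM lte_fin mulr_gt0 ?expR_gt0 ?divr_gt0.
  - exact: measurable_EFin_powR.
  - by move=> *; rewrite lee_fin ?powR_ge0 ?expR_ge0.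
apply: (@le_trans _ _ (\int[mu]_(x in `]0%R, 1%R]) (x `^ (b - 1) * expR (- x))%:E)).
  apply: ge0_le_int; [exact: measurable_itv|..].
  - by move=> x _; rewrite -EFinM lee_fin mulr_ge0 ?powR_ge0 ?expR_ge0.
  - by apply: emeasurable_funM; [exact: measurable_cst|exact: measurable_EFin_powR].
  - exact: measurable_gamma_integrand.
  - move=> x /=; rewrite in_itv/= => /andP[x0 x1]; rewrite -EFinM lee_fin mulrC.
    by rewrite ler_wpM2l ?powR_ge0// ler_expR lerN2.
apply: ge0_subset_integral => //=.
- exact: measurable_gamma_integrand.
- by move=> x _; exact: gamma_integrand_ge0.
- by move=> x /=; rewrite !in_itv/= andbT => /andP[].
Qed.

Lemma gammaeE (b : R) : (0 < b)%R -> gammae b = (Gamma b)%:E.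
Proof.
move=> b0; rewrite /Gamma /Rintegral -/(gammae b) fineK// ge0_fin_numE.
  exact: gammae_lty.
exact/ltW/gammae_gt0.
Qed.

Lemma Gamma_gt0 (b : R) : (0 < b)%R -> (0 < Gamma b)%R.
Proof. by move=> b0; rewrite -lte_fin -gammaeE// gammae_gt0. Qed.

Lemma Gamma_ge (b M : R) : (1 <= b)%R -> (0 < M)%R ->
  (M `^ (b - 1) * expR (- (M + 1)) <= Gamma b)%R.
Proof.
move=> b1 M0; rewrite -lee_fin -gammaeE ?gammae_ge//.
by rewrite (lt_le_trans _ b1).
Qed.

End gamma_beta.

Section beta.
Context {R : realType}.
Notation mu := (@lebesgue_measure R).
Local Open Scope ereal_scope.

Definition gdens (a : R) : measurableTypeR R -> \bar R :=
  (fun x => (x `^ (a - 1) * expR (- x))%:E) \_ (`]0%R, +oo[%classic : set (measurableTypeR R)).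

Lemma gdens_ge0 a x : 0 <= gdens a x.
Proof. by apply: erestrict_ge0 => y _; exact: gamma_integrand_ge0. Qed.

Lemma measurable_gdens a : measurable_fun setT (gdens a).
Proof.
apply/(measurable_restrictT _ _).1 => //; exact: measurable_gamma_integrand.
Qed.

Lemma integral_gdens a : \int[mu]_x gdens a x = gammae a.
Proof. by rewrite -integral_mkcond. Qed.

(** The Beta integral in its convolution form: two power kernels of orders a and b convolved at time
    t. *)
Definition betae (a b t : R) : \bar R :=
  \int[mu]_(s in `]0%R, t[) ((t - s) `^ (a - 1) * s `^ (b - 1))%:E.

Lemma measurable_beta_integrand (a b t : R) (D : set (measurableTypeR R)) :
  measurable_fun D (fun s : measurableTypeR R => ((t - s) `^ (a - 1) * s `^ (b - 1))%:E).
Proof.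
apply: measurable_funTS; apply/measurable_EFinP; apply: measurable_funM.
  by apply: measurable_fun_powR; exact: measurable_funB.
exact: measurable_powR.
Qed.

Lemma betae_scale (a b t : R) : (0 < t)%R ->
  betae a b t = (t `^ (a + b - 1))%:E * betae a b 1.
Proof.
move=> t0; rewrite /betae (ge0_integral_scale 0 t0); last 3 first.
- exact: measurable_itv.
- exact: measurable_beta_integrand.
- by move=> x _; rewrite lee_fin mulr_ge0 ?powR_ge0.
rewrite (_ : [set x | _] = (`]0%R, 1%R[%classic : set R)); last first.
  apply/seteqP; split => x /=; rewrite !in_itv/= addr0 => /andP[x0 x1]; apply/andP; split.
  - by rewrite -(pmulr_rgt0 _ t0).
  - by rewrite -(ltr_pM2l t0) mulr1.
  - by rewrite pmulr_rgt0.
  - by rewrite -[ltRHS]mulr1 ltr_pM2l.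
have -> : (t `^ (a + b - 1) = t * (t `^ (a - 1) * t `^ (b - 1)))%R.
  rewrite -{2}(powRr1 (ltW t0)) -!powRD ?(gt_eqF t0) ?implybT//.
  by congr powR; ring.
rewrite EFinM -muleA; congr (_ * _).
rewrite -[RHS](@ge0_integralZl _ _ _ mu); last 4 first.
- exact: measurable_itv.
- exact: measurable_beta_integrand.
- by move=> x _; rewrite lee_fin mulr_ge0 ?powR_ge0.
- by rewrite lee_fin mulr_ge0 ?powR_ge0.
apply: eq_integral => x; rewrite inE/= in_itv/= => /andP[x0 x1].
rewrite -EFinM; congr (_%:E); rewrite addr0.
rewrite (_ : (t - t * x = t * (1 - x))%R); last by ring.
rewrite !powRM ?(ltW t0) ?(ltW x0) ?subr_ge0 ?(ltW x1)//.
by rewrite mulrACA.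
Qed.

(** The product of the two Gamma integrals is the total mass of the convolution of the two densities
    [gdens]. By Tonelli the mass can be computed after convolving, and at z the convolution equals
    exp(- z) times [betae a b z], that is z^(a+b-1) exp(- z) times [betae a b 1]. *)
Lemma gammaeM (a b : R) : (0 < a)%R -> (0 < b)%R ->
  gammae a * gammae b = betae a b 1 * gammae (a + b).
Proof.
move=> a0 b0.
have meas2 : measurable_fun setT (fun p : measurableTypeR R * measurableTypeR R =>
    gdens b p.1 * gdens a (p.2 - p.1)%R).
  apply: emeasurable_funM.
    by apply: measurableT_comp; [exact: measurable_gdens|exact: measurable_fst].
  apply: measurableT_comp; first exact: measurable_gdens.
  by apply: measurable_funB; [exact: measurable_snd|exact: measurable_fst].
have E1 : gammae a * gammae b = \int[mu]_y \int[mu]_z (gdens b y * gdens a (z - y)%R).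
  rewrite -!integral_gdens -[LHS](@ge0_integralZl _ _ _ mu); last 4 first.
  - exact: measurableT.
  - exact: measurable_gdens.
  - by move=> x _; exact: gdens_ge0.
  - by apply: integral_ge0 => x _; exact: gdens_ge0.
  apply: eq_integral => y _; rewrite muleC.
  rewrite (integral_shiftT (- y) (measurable_gdens a)).
  rewrite -[LHS](@ge0_integralZl _ _ _ mu); last 4 first.
  - exact: measurableT.
  - apply: measurable_funTS; apply: measurableT_comp; first exact: measurable_gdens.
    exact: measurable_funD.
  - by move=> x _; exact: gdens_ge0.
  - exact: gdens_ge0.
  by [].
rewrite E1 (@fubini_tonelli _ _ _ _ R mu mu _ meas2); last first.
  by move=> p; rewrite mule_ge0 ?gdens_ge0.
rewrite -[in RHS]integral_gdens -[RHS](@ge0_integralZl _ _ _ mu); last 4 first.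
- exact: measurableT.
- exact: measurable_gdens.
- by move=> x _; exact: gdens_ge0.
- by apply: integral_ge0 => x _; rewrite lee_fin mulr_ge0 ?powR_ge0.
apply: eq_integral => z _; rewrite [in RHS]/gdens patchE /=.
case: ifPn => [|zn]; last first.
  rewrite mule0 integral0_eq// => y _; rewrite /gdens !patchE.
  case: ifPn => [/set_mem/=|_]; last by rewrite mul0e.
  rewrite in_itv/= andbT => y0; case: ifPn => [/set_mem/=|_]; last by rewrite mule0.
  rewrite in_itv/= andbT subr_gt0 => yz; move: zn; rewrite notin_setE/= in_itv/= andbT.
  by move=> /negP; rewrite -leNgt => /(lt_le_trans yz)/(lt_trans y0); rewrite ltxx.
rewrite inE/= in_itv/= andbT => z0.
rewrite EFinM muleA (muleC (betae _ _ _)) -betae_scale// /betae muleC.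
rewrite -[RHS](@ge0_integralZl _ _ _ mu); last 4 first.
- exact: measurable_itv.
- exact: measurable_beta_integrand.
- by move=> x _; rewrite lee_fin mulr_ge0 ?powR_ge0.
- by rewrite lee_fin expR_ge0.
rewrite [RHS]integral_mkcond; apply: eq_integral => y _.
rewrite /gdens !patchE; case: ifPn => [/set_mem/=|].
  rewrite in_itv/= andbT => y0.
  case: ifPn => [/set_mem/=|]; rewrite ?notin_setE/= in_itv/= andbT subr_gt0 => yz.
    rewrite mem_set/= ?in_itv/= ?y0// -!EFinM; congr (_%:E).
    rewrite (_ : expR (- z) = expR (- y) * expR (- (z - y)))%R; last first.
      by rewrite -expRD; congr expR; ring.
    by ring.
  rewrite (memNset (A := `]0%R, z[%classic)) ?mule0//= in_itv/= y0/=; exact: yz.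
rewrite notin_setE/= in_itv/= andbT => y0.
rewrite (memNset (A := `]0%R, z[%classic)) ?mul0e//= in_itv/= => /andP[y1 _].
by apply: y0; rewrite y1.
Qed.

Lemma betaeE (a b t : R) : (0 < a)%R -> (0 < b)%R -> (0 < t)%R ->
  betae a b t = (t `^ (a + b - 1) * (Gamma a * Gamma b / Gamma (a + b)))%:E.
Proof.
move=> a0 b0 t0; have ab0 := addr_gt0 a0 b0.
rewrite betae_scale// EFinM; congr (_ * _).
have := gammaeM a0 b0; rewrite !gammaeE// -EFinM.
have : 0 <= betae a b 1.
  by apply: integral_ge0 => x _; rewrite lee_fin mulr_ge0 ?powR_ge0.
case: (betae a b 1) => [r _|_|//].
  rewrite -EFinM => -[->]; congr (_%:E); rewrite mulfK// gt_eqF//; exact: Gamma_gt0.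
by rewrite gt0_mulye// lte_fin Gamma_gt0.
Qed.

End beta.

(** * The Mittag-Leffler function *)

Section entire.
Context {R : realType}.

(** Infinite radius of convergence, phrased as boundedness of the terms at every radius: this form
    is inherited by the differentiated series and yields absolute convergence by comparison with a
    geometric series at a doubled radius. *)
Definition entire (c : nat -> R) :=
  forall M : R, 0 < M -> exists C, forall k, `|c k| * M ^+ k <= C.

(** The factor k + 1 produced by differentiation is absorbed by 2^(k+1), that is by the bound at
    radius 2 M. *)
Lemma entire_diffs c : entire c -> entire (pseries_diffs c).
Proof.
move=> ec M M0; have [C hC] := ec _ (mulr_gt0 (ltr0n R 2) M0).
exists (C / M) => k; rewrite /pseries_diffs normrM ger0_norm//.
rewrite ler_pdivlMr// -mulrA -exprSr.
apply: le_trans (hC k.+1); rewrite exprMn mulrA ler_wpM2r ?exprn_ge0 ?(ltW M0)//.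
rewrite mulrC ler_wpM2l// -natrX ler_nat; exact/ltnW/ltn_expl.
Qed.

Lemma entire_cvg_norm c (x : R) : entire c -> cvgn (series (fun k => `|c k| * `|x| ^+ k)).
Proof.
move=> ec; have x0 : 0 < 2 * (`|x| + 1) by rewrite mulr_gt0// ltr_wpDl.
have [C hC] := ec _ x0.
have h : cvgn (series (geometric C (2^-1 : R))).
  by apply: is_cvg_geometric_series; rewrite ger0_norm// invf_lt1// ltr1n.
apply: series_le_cvg h.
- by move=> k; rewrite mulr_ge0// exprn_ge0.
- move=> k; rewrite mulr_ge0//; first by apply: le_trans (hC 0%N); rewrite expr0 mulr1.
- move=> k /=; rewrite -[2^-1 ^+ k]/(_ ^+ k) exprVn ler_pdivlMr ?exprn_gt0//.
  apply: le_trans (hC k); rewrite -mulrA ler_wpM2l// exprMn mulrC ler_wpM2l ?exprn_ge0//.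
  by apply: lerXn2r; rewrite ?nnegrE ?addr_ge0 ?lerDl.
Qed.

Lemma entire_cvg c x : entire c -> cvgn (pseries c x).
Proof.
move=> ec; have h := @entire_cvg_norm c x ec; apply: normed_cvg; rewrite /normed_series_of/=.
by under eq_fun do rewrite normrM normrX.
Qed.

Lemma entire_continuous c : entire c -> continuous (fun x => limn (pseries c x)).
Proof.
move=> ec x; apply: differentiable_continuous; apply/derivable1_diffP.
have [||||//] := @pseries_snd_diffs R c (`|x| + 1) x.
- exact: entire_cvg.
- by apply: entire_cvg; exact: entire_diffs.
- by apply: entire_cvg; do 2 apply: entire_diffs.
- by rewrite [ltRHS]ger0_norm ?ltrDl// addr_ge0.
Qed.

End entire.

Section mittag_leffler.
Context {R : realType}.
Variables (alpha : R).
Hypotheses (alpha0 : 0 < alpha) (alpha1 : alpha < 1).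
Notation ML := (mittag_leffler alpha).

Definition mlc (b : R) (k : nat) : R := (Gamma (k%:R * alpha + b))^-1.

Lemma mlarg_gt0 b k : 0 < b -> 0 < k%:R * alpha + b.
Proof. by move=> b0; rewrite ltr_wpDl// mulr_ge0// ltW. Qed.

Lemma mlc_gt0 b k : 0 < b -> 0 < mlc b k.
Proof. by move=> b0; rewrite invr_gt0 Gamma_gt0// mlarg_gt0. Qed.

Lemma mlcS b k : mlc b k.+1 = mlc (b + alpha) k.
Proof. by rewrite /mlc -natr1 mulrDl mul1r -addrA (addrC alpha). Qed.

Lemma mlE b z : ML b z = limn (pseries (mlc b) z).
Proof.
rewrite /mittag_leffler /pseries; congr (limn (series _)).
by apply/funext => k; rewrite mulrC.
Qed.

(** With M' = M^(1 / alpha), [Gamma_ge] bounds Gamma (k alpha + b) below by a constant times M'^(k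
    alpha) = M^k. It requires k alpha + b >= 1, which holds from the index [N] on; the finitely many
    earlier terms are added to the bound. *)
Lemma mlc_entire b : 0 < b -> entire (mlc b).
Proof.
move=> b0 M M0.
pose N := (Num.truncn alpha^-1).+1.
have NP : 1 <= N%:R * alpha.
  by rewrite -ler_pdivrMr// div1r ltW// truncnS_gt.
pose M' := M `^ alpha^-1.
have M'0 : 0 < M' by rewrite powR_gt0.
pose C1 := expR (M' + 1) * M' `^ (1 - b).
exists (C1 + \sum_(k < N) `|mlc b k| * M ^+ k) => k.
have [kN|Nk] := ltnP k N.
  apply: ler_wpDl; first by rewrite mulr_ge0 ?expR_ge0 ?powR_ge0.
  rewrite (bigD1 (Ordinal kN))//= lerDl sumr_ge0// => i _.
  by rewrite mulr_ge0// exprn_ge0// ltW.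
apply: ler_wpDr; first by apply: sumr_ge0 => i _; rewrite mulr_ge0// exprn_ge0// ltW.
have h1 : 1 <= k%:R * alpha + b.
  apply: ler_wpDr; first exact: ltW.
  by apply: (le_trans NP); rewrite ler_wpM2r ?ler_nat// ltW.
have G0 := Gamma_gt0 (mlarg_gt0 k b0).
rewrite (ger0_norm (ltW (mlc_gt0 k b0))) /mlc mulrC ler_pdivrMr//.
have h2 := Gamma_ge h1 M'0.
apply: (@le_trans _ _ (C1 * (M' `^ (k%:R * alpha + b - 1) * expR (- (M' + 1))))); last first.
  by rewrite ler_wpM2l// mulr_ge0 ?expR_ge0 ?powR_ge0.
have -> : C1 * (M' `^ (k%:R * alpha + b - 1) * expR (- (M' + 1))) =
    M' `^ (k%:R * alpha + b - 1) * M' `^ (1 - b) * (expR (M' + 1) * expR (- (M' + 1))).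
  by rewrite /C1; ring.
rewrite -expRD subrr expR0 mulr1.
rewrite -powRD_gt0//.
rewrite (_ : _ + (1 - b) = k%:R * alpha); last by ring.
by rewrite /M' -powRrM mulrCA mulVf ?lt0r_neq0// mulr1 powR_mulrn// ltW.
Qed.

Lemma ml_continuous b : 0 < b -> continuous (ML b).
Proof.
move=> b0; rewrite (_ : ML b = fun z => limn (pseries (mlc b) z)).
  exact: entire_continuous (mlc_entire b0).
by apply/funext => z; rewrite mlE.
Qed.

Lemma ml_cvg b z : 0 < b -> cvgn (pseries (mlc b) z).
Proof. by move=> b0; apply: entire_cvg; exact: mlc_entire. Qed.

Lemma ml0 b : ML b 0 = (Gamma b)^-1.
Proof.
rewrite mlE; apply: cvg_lim => //; rewrite -(cvg_shiftS).
rewrite (_ : (fun n => _) = fun=> (Gamma b)^-1); first exact: cvg_cst.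
apply/funext => n; rewrite /pseries /series/= big_nat_recl// expr0 mulr1 /mlc mul0r add0r.
by rewrite big1 ?addr0// => i _; rewrite expr0n/= mulr0.
Qed.

Lemma ml_rec b z : 0 < b -> ML b z = (Gamma b)^-1 + z * ML (b + alpha) z.
Proof.
move=> b0; rewrite !mlE; apply: cvg_lim => //; rewrite -(cvg_shiftS).
rewrite (_ : (fun n => _) = fun n => (Gamma b)^-1 + z * pseries (mlc (b + alpha)) z n).
  by apply: cvgD; [exact: cvg_cst|apply: cvgMr; apply: ml_cvg; rewrite addr_gt0].
apply/funext => n; rewrite /pseries /series/= big_nat_recl// expr0 mulr1 {1}/mlc mul0r add0r.
congr (_ + _); rewrite mulr_sumr; apply: eq_bigr => k _.
by rewrite mlcS exprS; ring.
Qed.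

(* For b = alpha this is the resolvent kernel of the fractional relaxation equation,
   - d/dt E_{alpha,1}(- t ^ alpha). *)
Definition mlr (b t : R) := t `^ (b - 1) * ML b (- t `^ alpha).

Lemma mlr_rec b t : 0 < b -> 0 < t ->
  mlr b t = t `^ (b - 1) / Gamma b - mlr (b + alpha) t.
Proof.
move=> b0 t0; rewrite /mlr ml_rec// mulrDr mulNr mulrN mulrA -powRD_gt0//.
by rewrite (_ : b - 1 + alpha = b + alpha - 1)//; ring.
Qed.

Lemma mlr_continuous b t : 0 < b -> 0 < t -> {for t, continuous (mlr b)}.
Proof.
move=> b0 t0; apply: cvgM; first exact: continuous_powR_gt0.
apply: (@continuous_comp _ _ _ (fun x => - x `^ alpha) (ML b)).
  by apply: cvgN; exact: continuous_powR_gt0.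
exact: ml_continuous.
Qed.

End mittag_leffler.

(** * Fractional integration of the Mittag-Leffler function and positivity of the resolvent
    kernels *)

Section fractional_convolution.
Context {R : realType}.
Notation mu := (@lebesgue_measure R).
Variables (alpha : R).
Hypotheses (alpha0 : 0 < alpha) (alpha1 : alpha < 1).
Notation ML := (mittag_leffler alpha).
Notation mlca := (mlc alpha).
Notation mlra := (mlr alpha).

Lemma integrable_beta (a b t : R) : 0 < a -> 0 < b -> 0 < t ->
  mu.-integrable `]0, t[ (fun s => ((t - s) `^ (a - 1) * s `^ (b - 1))%:E).
Proof.
move=> a0 b0 t0; apply/integrableP; split; first exact: measurable_beta_integrand.
under eq_integral => s _ do rewrite gee0_abs ?lee_fin ?mulr_ge0 ?powR_ge0//.
by rewrite -/(betae a b t) betaeE// ltry.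
Qed.

Lemma pseries_mlr_term (a b t s : R) k : 0 < s ->
  (t - s) `^ (a - 1) / Gamma a * (s `^ (b - 1) * (mlca b k * (- s `^ alpha) ^+ k)) =
  ((-1) ^+ k * mlca b k / Gamma a) * ((t - s) `^ (a - 1) * s `^ (k%:R * alpha + b - 1)).
Proof.
move=> s0; rewrite -[- s `^ alpha]mulN1r exprMn.
have -> : (s `^ alpha) ^+ k = s `^ (k%:R * alpha).
  by rewrite -powR_mulrn ?powR_ge0// -powRrM mulrC.
have -> : s `^ (k%:R * alpha + b - 1) = s `^ (k%:R * alpha) * s `^ (b - 1).
  by rewrite -powRD_gt0//; congr powR; ring.
by ring.
Qed.

Lemma measurable_mlr_partial (b : R) (n : nat) (D : set (measurableTypeR R)) :
  measurable_fun D (fun s : measurableTypeR R =>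
    s `^ (b - 1) * pseries (mlca b) (- s `^ alpha) n).
Proof.
apply: measurable_funTS; apply: measurable_funM; first exact: measurable_powR.
rewrite /pseries/series/=; apply: measurable_sum => k.
apply: measurable_funM; first exact: measurable_cst.
by apply: measurable_funX; apply: measurable_funN; exact: measurable_powR.
Qed.

Lemma measurable_mlr (b : R) : 0 < b ->
  measurable_fun (`]0, +oo[%classic : set (measurableTypeR R)) (mlra b).
Proof.
move=> b0; apply: open_continuous_measurable_fun => // x.
by rewrite inE/= in_itv/= andbT => x0; exact: mlr_continuous.
Qed.

(** Fractional integration of order a acts on each term of the series through a Beta integral and
    turns the term of order b into the term of order a + b. Sum and integral are exchanged by
    dominated convergence: on ]0, t[ every partial sum is bounded by [S], the sum of absolute values
    at the right endpoint t^alpha. *)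
Lemma mlr_conv (a b t : R) : 0 < a -> 0 < b -> 0 < t ->
  (\int[mu]_(s in `]0%R, t[) ((t - s) `^ (a - 1) / Gamma a * mlra b s)%:E =
   (mlra (a + b) t)%:E)%E.
Proof.
move=> a0 b0 t0.
pose D : set (measurableTypeR R) := `]0, t[%classic.
pose f_ n (s : measurableTypeR R) := ((t - s) `^ (a - 1) / Gamma a *
  (s `^ (b - 1) * pseries (mlca b) (- s `^ alpha) n))%:E.
pose f (s : measurableTypeR R) := ((t - s) `^ (a - 1) / Gamma a * mlra b s)%:E.
pose S := limn (series (fun k => `|mlca b k| * `|t `^ alpha| ^+ k)).
have cS : cvgn (series (fun k => `|mlca b k| * `|t `^ alpha| ^+ k)).
  by apply: entire_cvg_norm; exact: mlc_entire.
pose g (s : measurableTypeR R) := ((S / Gamma a)%:E * ((t - s) `^ (a - 1) * s `^ (b - 1))%:E)%E.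
have Ga0 := Gamma_gt0 a0.
have mD : measurable D by exact: measurable_itv.
have mT : measurable_fun D (fun s : measurableTypeR R => (t - s) `^ (a - 1) / Gamma a).
  apply: measurable_funM; last exact: measurable_cst.
  by apply: measurable_fun_powR; exact: measurable_funB.
have mf_ n : measurable_fun D (f_ n).
  apply/measurable_EFinP; apply: measurable_funM => //.
  exact: measurable_mlr_partial.
have mf : measurable_fun D f.
  apply/measurable_EFinP; apply: measurable_funM => //.
  apply: measurable_funS (measurable_mlr b0) => //.
  by move=> x; rewrite /D/= !in_itv/= => /andP[->].
have ff x : D x -> f_ n x @[n --> \oo] --> f x.
  move=> Dx; apply: cvg_EFin; first exact: nearW.
  rewrite (_ : _ \o _ = fun n => (t - x) `^ (a - 1) / Gamma a *
    (x `^ (b - 1) * pseries (mlca b) (- x `^ alpha) n))//.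
  apply: cvgMr; apply: cvgMr; rewrite mlE; exact: ml_cvg.
have ig : mu.-integrable D g.
  by apply: integrableZl => //; exact: integrable_beta.
have fg n x : D x -> (`|f_ n x| <= g x)%E.
  rewrite /D/= in_itv/= => /andP[x0 xt].
  rewrite /f_ /g -EFinM -abse_EFin lee_fin !normrM.
  rewrite (ger0_norm (powR_ge0 _ _)) (ger0_norm (powR_ge0 x _)).
  rewrite (ger0_norm (x := (Gamma a)^-1)) ?invr_ge0 ?(ltW Ga0)//.
  rewrite [leLHS](_ : _ = `|pseries (mlca b) (- x `^ alpha) n| / Gamma a *
    ((t - x) `^ (a - 1) * x `^ (b - 1))); last by ring.
  rewrite ler_wpM2r ?mulr_ge0 ?powR_ge0//.
  rewrite ler_wpM2r ?invr_ge0 ?(ltW Ga0)//.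
  apply: (@le_trans _ _ (series (fun k => `|mlca b k| * `|t `^ alpha| ^+ k) n)); last first.
    apply: nondecreasing_cvgn_le => //; apply/nondecreasing_seqP => m.
    by rewrite /series/= big_nat_recr//= lerDl mulr_ge0// exprn_ge0.
  rewrite /pseries/series/=; apply: le_trans (ler_norm_sum _ _ _) _.
  apply: ler_sum => k _; rewrite normrM ler_wpM2l// normrX normrN.
  apply: lerXn2r; rewrite ?nnegrE// !ger0_norm ?powR_ge0//.
  by apply: ge0_ler_powR; rewrite ?nnegrE ?ltW// (lt_trans x0).
have [_ _ h] := @dominated_convergence _ (measurableTypeR R) R mu D mD f_ f g mf_ mf
  (aeW _ (fun x Dx => ff x Dx)) ig (aeW _ (fun x n Dx => fg n x Dx)).
apply: (cvg_unique _ h) => //.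
have E n : (\int[mu]_(s in D) f_ n s =
    (t `^ (a + b - 1) * pseries (mlca (a + b)) (- t `^ alpha) n)%:E)%E.
  have -> : (\int[mu]_(s in D) f_ n s = \int[mu]_(s in D) (\sum_(0 <= k < n)
    (((-1) ^+ k * mlca b k / Gamma a)%:E *
      ((t - s) `^ (a - 1) * s `^ (k%:R * alpha + b - 1))%:E)))%E.
    apply: eq_integral => s; rewrite inE /D/= in_itv/= => /andP[s0 st].
    rewrite /f_ /pseries/series/= mulr_sumr mulr_sumr -sumEFin.
    by apply: eq_bigr => k _; rewrite -EFinM; congr (_%:E); exact: pseries_mlr_term.
  have int k : mu.-integrable D (fun s : measurableTypeR R =>
      ((t - s) `^ (a - 1) * s `^ (k%:R * alpha + b - 1))%:E).
    by apply: integrable_beta => //; exact: mlarg_gt0.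
  rewrite (@integral_sum _ _ _ mu D mD _ (fun k s => (((-1) ^+ k * mlca b k / Gamma a)%:E *
      ((t - s) `^ (a - 1) * s `^ (k%:R * alpha + b - 1))%:E)%E)); last first.
    by move=> k; apply: integrableZl.
  rewrite /pseries/series/= mulr_sumr -sumEFin; apply: eq_bigr => k _.
  rewrite integralZl// -/(betae a (k%:R * alpha + b) t).
  have kb0 := mlarg_gt0 alpha0 k b0.
  have Gk0 := Gamma_gt0 kb0.
  rewrite betaeE// -EFinM; congr (_%:E).
  rewrite -[- t `^ alpha]mulN1r exprMn.
  have -> : (t `^ alpha) ^+ k = t `^ (k%:R * alpha).
    by rewrite -powR_mulrn ?powR_ge0// -powRrM mulrC.
  have -> : t `^ (a + (k%:R * alpha + b) - 1) = t `^ (a + b - 1) * t `^ (k%:R * alpha).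
    by rewrite -powRD_gt0//; congr powR; ring.
  rewrite /mlc (_ : k%:R * alpha + (a + b) = a + (k%:R * alpha + b)); last by ring.
  have G2 := Gamma_gt0 (addr_gt0 a0 kb0).
  move: (Gamma (a + _)) (Gamma (_ + b)) (Gamma a) G2 Gk0 Ga0 => x y z x0 y0 z0.
  move: (t `^ _) (t `^ _) ((-1) ^+ k) => p q r.
  by field; rewrite !lt0r_neq0.
rewrite /=; apply: (@cvg_trans _ ((t `^ (a + b - 1) *
    pseries (mlca (a + b)) (- t `^ alpha) n)%:E @[n --> \oo])).
  by apply: near_eq_cvg; apply: nearW => n; rewrite -E.
apply: cvg_EFin; first exact: nearW.
rewrite (_ : _ \o _ = fun n => t `^ (a + b - 1) *
    pseries (mlca (a + b)) (- t `^ alpha) n)//.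
by apply: cvgMr; rewrite mlE; apply: ml_cvg => //; exact: addr_gt0.
Qed.

(** Near 0 the sign is that of the value 1 / Gamma(b) of the series at 0. This is the starting point
    of the argument by a first zero in [volterra_gt0]. *)
Lemma mlr_near0 (b : R) : 0 < b ->
  exists2 d : R, 0 < d & forall t, 0 < t < d -> 0 < mlra b t.
Proof.
move=> b0; have G0 := Gamma_gt0 b0.
have c : {for 0, continuous (fun t : R => ML b (- t))}.
  apply: (@continuous_comp _ _ _ (fun x : R => - x) (ML b)).
    by apply: cvgN; exact: cvg_id.
  by rewrite oppr0; exact: ml_continuous.
have h : \forall x \near 0, 0 < ML b (- x).
  have : 0 < ML b (- (0 : R)) by rewrite oppr0 ml0 invr_gt0.
  by move=> /(cvgr_gt _ c).
have [e /= e0 he] := h.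
exists (e `^ alpha^-1); first by rewrite powR_gt0.
move=> t /andP[t0 te]; rewrite /mlra mulr_gt0 ?powR_gt0//.
apply: he; rewrite /= sub0r normrN ger0_norm ?powR_ge0//.
have -> : e = (e `^ alpha^-1) `^ alpha.
  by rewrite -powRrM mulVf ?lt0r_neq0// powRr1// ltW.
by apply: gt0_ltr_powR => //; rewrite nnegrE ?powR_ge0 ?ltW.
Qed.

(* The kernel ratio k(t0 - s) / k(t - s), for k(t) = t ^ (alpha - 1) and t < t0,
   is largest at s = 0. *)
Lemma kernel_ratio (t t0 s : R) : 0 < s -> s < t -> t < t0 ->
  (t0 - s) `^ (alpha - 1) <= (t0 / t) `^ (alpha - 1) * (t - s) `^ (alpha - 1).
Proof.
move=> s0 st tt0; have t_gt0 := lt_trans s0 st.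
have t0_gt0 := lt_trans t_gt0 tt0.
rewrite -powRM ?divr_ge0 ?subr_ge0 ?(ltW st) ?(ltW t_gt0) ?(ltW t0_gt0)//.
have h : t0 / t * (t - s) <= t0 - s.
  rewrite mulrBr mulfVK ?lt0r_neq0// lerD2l lerN2 ler_peMl ?(ltW s0)//.
  by rewrite ler_pdivlMr// mul1r ltW.
have -> : alpha - 1 = - (1 - alpha) by ring.
have h0 : 0 < t0 / t * (t - s) by rewrite mulr_gt0 ?divr_gt0 ?subr_gt0.
rewrite !powRN lef_pV2 ?posrE ?powR_gt0 ?(lt_le_trans h0)//.
by apply: le_powR => //; rewrite ?subr_ge0 ltW.
Qed.

Lemma integral_kernel_le (c t1 t0 M : R) : 0 < c -> 0 < t1 -> t1 < t0 -> 0 <= M ->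
  (\int[mu]_(s in `[t1, t0[) ((t0 - s) `^ (alpha - 1) / c * M)%:E <=
   ((t0 - t1) `^ alpha / alpha / c * M)%:E)%E.
Proof.
move=> Ga t10 t1t0 M0.
have mE D : measurable_fun D (fun s : measurableTypeR R =>
    ((t0 - s) `^ (alpha - 1) / c * M)%:E).
  apply/measurable_EFinP; apply: measurable_funM; last exact: measurable_cst.
  apply: measurable_funM; last exact: measurable_cst.
  by apply: measurable_fun_powR; exact: measurable_funB.
rewrite (integral_reflect t0) //.
rewrite (_ : [set x | _] = (`]0, t0 - t1]%classic : set (measurableTypeR R))); last first.
  apply/seteqP; split => x /=; rewrite !in_itv/= => /andP[a b]; apply/andP; split; lra.
under eq_integral => x _ do
  rewrite subKr mulrAC -mulrA mulrC EFinM.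
rewrite (@ge0_integralZl _ _ _ mu); last 4 first.
- exact: measurable_itv.
- exact: measurable_EFin_powR.
- by move=> x _; rewrite lee_fin powR_ge0.
- by rewrite lee_fin mulr_ge0// invr_ge0 ltW.
rewrite integral_powR ?subr_ge0 ?(ltW t1t0)// -EFinM lee_fin.
by apply: le_of_eq; ring.
Qed.

(** With k(t) = t^(alpha-1) / c and g(t) = t^(b-1) / cb the equation is r + k * r = g. Let t0 be the
    first zero of r and compare the equation at t0 with the one at a point ts slightly before it,
    rho = t0 / ts. On ]0, ts[ the kernel ratio is at most rho^(alpha-1), and g(t0) >= rho^(alpha-1)
    g(ts) because b >= alpha; the terms in g thus cancel. What remains is that rho^(alpha-1) r(ts)
    is at most the contribution of [ts, t0[ to the convolution, which is a small multiple of r(ts):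
    a contradiction. *)
Lemma volterra_gt0 (r : R -> R) (b c cb d : R) :
  0 < c -> 0 < cb -> 0 < d -> alpha <= b ->
  measurable_fun (`]0, +oo[%classic : set (measurableTypeR R)) r ->
  (forall t, 0 < t -> {for t, continuous r}) ->
  (forall t, 0 < t < d -> 0 < r t) ->
  (forall t, 0 < t ->
    (\int[mu]_(s in `]0%R, t[) ((t - s) `^ (alpha - 1) / c * r s)%:E =
     (t `^ (b - 1) / cb - r t)%:E)%E) ->
  forall t, 0 < t -> 0 < r t.
Proof.
move=> Ga Gb d0 ab mr cr hd conv t.
move=> tp; rewrite ltNge; apply/negP => rt.
pose Z := [set t : R | 0 < t /\ r t <= 0].
have Zne : Z !=set0 by exists t.
have Zd : lbound Z d.
  move=> z [z0 rz]; rewrite leNgt; apply/negP => zd.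
  by have := hd z; rewrite z0 zd => /(_ isT); rewrite ltNge rz.
have hlb : has_lbound Z by exists d.
pose t0 := inf Z.
have t00 : 0 < t0 by apply: (lt_le_trans d0); exact: lb_le_inf.
have rpos s : 0 < s -> s < t0 -> 0 < r s.
  move=> s0 st0; rewrite ltNge; apply/negP => rs.
  by move: st0; rewrite ltNge; apply/negP/negPn; apply: ge_inf.
have r0 : r t0 <= 0.
  rewrite leNgt; apply/negP => h.
  have ct := cr t0 t00.
  have [e /= e0 he] := cvgr_gt _ ct _ h.
  have [z [z0 rz] zt] := inf_adherent e0 (conj Zne hlb).
  have : 0 < r z.
    apply: he => /=; rewrite ltr_norml ltrBrDl.
    have zt0 : t0 <= z by apply: ge_inf.
    by rewrite ltrBlDr zt/= (le_lt_trans _ e0)// subr_le0.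
  by rewrite ltNge rz.
(* Chosen so that eps^alpha / (alpha c) = 1/2: the mass of the kernel over a window shorter than
   [eps] is then less than 1/2, whereas rho <= 2 keeps rho^(alpha-1) at least 1/2. *)
pose eps := (alpha * c / 2) `^ alpha^-1.
have aG0 : 0 < alpha * c / 2 by rewrite divr_gt0// mulr_gt0.
have eps0 : 0 < eps by rewrite powR_gt0.
have [t1 [t10 t1t0 t1h t1e]] : exists t1, [/\ 0 < t1, t1 < t0, t0 / 2 <= t1 & t0 - t1 < eps].
  exists (Num.max (t0 / 2) (t0 - eps / 2)); split.
  - by rewrite lt_max divr_gt0.
  - by rewrite gt_max gtrDl oppr_lt0 divr_gt0// gtr_pMr// invf_lt1// ltr1n.
  - by rewrite le_max lexx.
  - by rewrite ltrBlDr -ltrBlDl lt_max ltrD2l ltrN2 gtr_pMr// invf_lt1// ltr1n orbT.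
(* Taking a maximum point of r on [t1, t0] makes r <= r ts on [ts, t0], so the last piece of the
   convolution is controlled by r ts itself. *)
have [|ts] := @EVT_max R r t1 t0 (ltW t1t0).
  apply: continuous_in_subspaceT => x /set_mem/=; rewrite in_itv/= => /andP[t1x _].
  by apply: cr; exact: lt_le_trans t1x.
rewrite in_itv/= => /andP[t1ts tst0] hts.
have ts0 : 0 < ts by exact: lt_le_trans t1ts.
have rts : 0 < r ts.
  apply: (lt_le_trans (rpos _ t10 t1t0)).
  by apply: hts; rewrite in_itv/= lexx ltW.
have {}tst0 : ts < t0.
  rewrite lt_neqAle tst0 andbT; apply/eqP => E.
  by move: rts; rewrite E ltNge r0.
pose rho := t0 / ts.
have rho0 : 0 < rho by rewrite divr_gt0.
have rho1 : 1 <= rho by rewrite ler_pdivlMr// mul1r ltW.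
have ra0 : 0 < rho `^ (alpha - 1) by rewrite powR_gt0.
have mK (t' : R) D : measurable D -> D `<=` (`]0, +oo[%classic : set R) ->
    measurable_fun (D : set (measurableTypeR R)) (fun s : measurableTypeR R =>
      ((t' - s) `^ (alpha - 1) / c * r s)%:E).
  move=> mD DI; apply/measurable_EFinP; apply: measurable_funM.
    apply: measurable_funM; last exact: measurable_cst.
    by apply: measurable_fun_powR; exact: measurable_funB.
  by apply: measurable_funS mr => //; exact: measurable_itv.
have I1 : (\int[mu]_(s in `]0%R, ts[) ((t0 - s) `^ (alpha - 1) / c * r s)%:E
   <= (rho `^ (alpha - 1) * (ts `^ (b - 1) / cb - r ts))%:E)%E.
  rewrite EFinM -[X in (_ <= _ * X)%E](conv ts ts0).
  have sub x : (`]0, ts[%classic : set R) x -> (`]0, +oo[%classic : set R) x.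
    by rewrite /= !in_itv/= andbT => /andP[].
  rewrite -(@ge0_integralZl _ _ _ mu); last 4 first.
  - exact: measurable_itv.
  - by apply: mK => //; exact: measurable_itv.
  - move=> s /=; rewrite in_itv/= => /andP[s0 sts]; rewrite lee_fin.
    rewrite mulr_ge0 ?divr_ge0 ?powR_ge0 ?(ltW Ga)// ltW// rpos//.
    exact: lt_trans tst0.
  - by rewrite lee_fin ltW.
  apply: ge0_le_int; first exact: measurable_itv.
  - move=> s /=; rewrite in_itv/= => /andP[s0 sts]; rewrite lee_fin.
    rewrite mulr_ge0 ?divr_ge0 ?powR_ge0 ?(ltW Ga)// ltW// rpos//.
    exact: lt_trans tst0.
  - by apply: mK => //; exact: measurable_itv.
  - apply: emeasurable_funM; first exact: measurable_cst.
    by apply: mK => //; exact: measurable_itv.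
  - move=> s /=; rewrite in_itv/= => /andP[s0 sts]; rewrite -EFinM lee_fin.
    rewrite mulrA ler_wpM2r//; first by rewrite ltW// rpos// (lt_trans sts).
    by rewrite mulrA ler_wpM2r ?invr_ge0 ?(ltW Ga)// kernel_ratio.
have I2 : (\int[mu]_(s in `[ts, t0[) ((t0 - s) `^ (alpha - 1) / c * r s)%:E
   <= ((t0 - ts) `^ alpha / alpha / c * r ts)%:E)%E.
  apply: le_trans (integral_kernel_le Ga ts0 tst0 (ltW rts)).
  apply: ge0_le_int; first exact: measurable_itv.
  - move=> s /=; rewrite in_itv/= => /andP[s0 sts]; rewrite lee_fin.
    rewrite mulr_ge0 ?divr_ge0 ?powR_ge0 ?(ltW Ga)// ltW// rpos//.
    exact: lt_le_trans s0.
  - apply: mK; first exact: measurable_itv.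
    by move=> x /=; rewrite !in_itv/= andbT => /andP[+ _]; exact: lt_le_trans.
  - apply/measurable_EFinP; apply: measurable_funM; last exact: measurable_cst.
    apply: measurable_funM; last exact: measurable_cst.
    by apply: measurable_fun_powR; exact: measurable_funB.
  - move=> s /=; rewrite in_itv/= => /andP[s0 sts]; rewrite lee_fin.
    rewrite ler_wpM2l ?divr_ge0 ?powR_ge0 ?(ltW Ga)//.
    by apply: hts; rewrite in_itv/= (le_trans t1ts s0) ltW.
have I : t0 `^ (b - 1) / cb - r t0 <= rho `^ (alpha - 1) * (ts `^ (b - 1) / cb - r ts) +
     (t0 - ts) `^ alpha / alpha / c * r ts.
  rewrite -lee_fin -[leLHS](conv t0 t00) [leRHS]EFinD; apply: le_trans (leeD I1 I2).
  rewrite -ge0_integral_setU; first last.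
  - apply/disj_setPLR => x/=; rewrite !in_itv/= => /andP[_ h]; apply/negP.
    by rewrite negb_and -ltNge h.
  - move=> s [] /=; rewrite in_itv/= => /andP[s0 sts]; rewrite lee_fin;
    rewrite mulr_ge0 ?divr_ge0 ?powR_ge0 ?(ltW Ga)// ltW// rpos//.
      exact: lt_trans tst0.
    exact: lt_le_trans s0.
  - apply: mK; first by apply: measurableU; exact: measurable_itv.
    move=> x [] /=; rewrite !in_itv/= andbT => /andP[h _] //.
    exact: lt_le_trans h.
  - exact: measurable_itv.
  - exact: measurable_itv.
  rewrite (_ : `]0%R, ts[ `|` `[ts, t0[ = `]0%R, t0[%classic)//.
  by rewrite -itv_bndbnd_setU// bnd_simp ltW.
have gg : rho `^ (alpha - 1) * (ts `^ (b - 1) / cb) <= t0 `^ (b - 1) / cb.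
  rewrite mulrA ler_wpM2r ?invr_ge0 ?(ltW Gb)//.
  have -> : t0 `^ (b - 1) = rho `^ (b - 1) * ts `^ (b - 1).
    by rewrite -(powRM _ (ltW rho0) (ltW ts0)) /rho mulfVK ?lt0r_neq0.
  apply: ler_wpM2r; first exact: powR_ge0.
  by apply: ler_powR => //; rewrite lerD2r.
have key : rho `^ (alpha - 1) <= (t0 - ts) `^ alpha / alpha / c.
  rewrite -(ler_pM2r rts).
  have : t0 `^ (b - 1) / cb <= rho `^ (alpha - 1) * (ts `^ (b - 1) / cb - r ts)
     + (t0 - ts) `^ alpha / alpha / c * r ts.
    apply: (@le_trans _ _ (t0 `^ (b - 1) / cb - r t0)); first by rewrite lerDl oppr_ge0.
    exact: I.
  rewrite mulrBr => h.
  have := le_trans gg h; rewrite -addrA lerDl addrC subr_ge0; exact.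
have h1 : 2^-1 <= rho `^ (alpha - 1).
  have rho2 : rho <= 2.
    rewrite ler_pdivrMr// mulrC -ler_pdivrMr//; exact: le_trans t1ts.
  have -> : alpha - 1 = - (1 - alpha) by ring.
  rewrite powRN lef_pV2 ?posrE ?powR_gt0//.
  apply: (le_trans _ rho2); rewrite -[leRHS]powRr1 ?(ltW rho0)//.
  by apply: ler_powR => //; rewrite gerBl ltW.
have h2 : (t0 - ts) `^ alpha / alpha / c < 2^-1.
  rewrite ltr_pdivrMr// ltr_pdivrMr//.
  have -> : 2^-1 * c * alpha = eps `^ alpha.
    rewrite /eps -powRrM mulVf ?lt0r_neq0// powRr1 ?(ltW aG0)//; ring.
  apply: gt0_ltr_powR => //; rewrite ?nnegrE ?subr_ge0 ?(ltW tst0) ?(ltW eps0)//.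
  by apply: le_lt_trans t1e; rewrite lerD2l lerN2.
by have := lt_le_trans h2 h1; rewrite ltNge key.
Qed.


(** By [mlr_conv] with a = alpha and [mlr_rec], [mlr] of order b solves the equation of
    [volterra_gt0] with c = Gamma(alpha) and cb = Gamma(b). *)
Lemma mlr_gt0 (b t : R) : alpha <= b -> 0 < t -> 0 < mlra b t.
Proof.
move=> ab; have b0 : 0 < b by exact: lt_le_trans ab.
have [d d0 hd] := mlr_near0 b0.
apply: (volterra_gt0 (Gamma_gt0 alpha0) (Gamma_gt0 b0) d0 ab) => //.
- exact: measurable_mlr.
- by move=> z z0; exact: mlr_continuous.
- move=> z z0; rewrite (mlr_conv alpha0 b0 z0); congr (_%:E).
  by rewrite (mlr_rec alpha0 b0 z0) subKr addrC.
Qed.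

End fractional_convolution.

Lemma Gamma1 (R : realType) : Gamma (1 : R) = 1.
Proof.
have : gammae (1 : R) = 1%E.
  rewrite /gammae.
  under eq_integral => x _ do rewrite subrr powRr0 mul1r.
  have cE (x : R) : {for x, continuous (fun t : R => expR (- t))}.
    by apply: continuous_comp; [apply: cvgN; exact: cvg_id|exact: continuous_expR].
  rewrite integral_itv_obnd_cbnd; last first.
    by apply/measurable_EFinP; apply: measurable_fun_expR; exact: measurable_funN.
  rewrite (@ge0_continuous_FTC2y _ _ (fun t => - expR (- t)) _ 0%R) //.
  - by rewrite oppr0 expR0 EFinN sub0e oppeK.
  - by apply: continuous_subspaceT => x; exact: cE.
  - by rewrite -[X in _ --> X]oppr0; apply: cvgN; exact: cvgr_expR.
  - by apply: cvg_at_right_filter; apply: cvgN; exact: cE.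
  - by move=> x _; rewrite derive1E; apply: derive_val; apply: is_derive_eq;
      rewrite /GRing.scale/=; ring.
by rewrite gammaeE// => -[].
Qed.

(** * Monotonicity and two-sided bounds of the Mittag-Leffler function on the negative axis *)

Section mittag_leffler_bounds.
Context {R : realType}.
Notation mu := (@lebesgue_measure R).
Variables (alpha : R).
Hypotheses (alpha0 : 0 < alpha) (alpha1 : alpha < 1).
Notation E := (fun x => mittag_leffler alpha 1 (- x)).
Notation mlra := (mlr alpha).

Lemma mlr1E t : mlra 1 t = E (t `^ alpha).
Proof. by rewrite /mlr subrr powRr0 mul1r. Qed.

Opaque mlr mittag_leffler Gamma.


Lemma ml1_0 : E 0 = 1.
Proof. by rewrite /= oppr0 ml0 Gamma1 invr1. Qed.

Lemma ml_subst (x : R) : 0 < x -> exists2 t, 0 < t & x = t `^ alpha.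
Proof.
move=> x0; exists (x `^ alpha^-1); first exact: powR_gt0.
by rewrite -powRrM mulVf ?lt0r_neq0// powRr1// ltW.
Qed.

Lemma ml_gt0 (x : R) : 0 <= x -> 0 < E x.
Proof.
rewrite le_eqVlt => /predU1P[<-|]; first by rewrite ml1_0.
by move=> /ml_subst[t t0 ->]; rewrite -mlr1E; apply: mlr_gt0 => //; exact: ltW.
Qed.

Lemma resolvent_ge0 (s : R) : 0 < s -> 0 <= mlra alpha s.
Proof. by move=> s0; apply/ltW/(mlr_gt0 alpha0 alpha1 (lexx _) s0). Qed.

(** The integrated form of the fact that the resolvent kernel is minus the derivative of t ->
    E_{alpha,1}(- t^alpha), obtained from [mlr_conv] with a = 1. Positivity of the kernel then gives
    monotonicity without differentiating any series. *)
Lemma integral_resolvent (t : R) : 0 < t ->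
  (\int[mu]_(s in `]0%R, t[) (mlra alpha s)%:E = (1 - mlra 1 t)%:E)%E.
Proof.
move=> t0; rewrite (mlr_rec alpha0 ltr01 t0).
rewrite subrr powRr0 Gamma1 divr1 subKr -[RHS](mlr_conv alpha0 ltr01 alpha0 t0).
by apply: eq_integral => s _; rewrite subrr powRr0 Gamma1 divr1 mul1r.
Qed.

Lemma measurable_EFin_mlr (b t u : R) : 0 < b -> 0 <= t ->
  measurable_fun (`]t, u[%classic : set (measurableTypeR R)) (fun s => (mlra b s)%:E).
Proof.
move=> b0 t0; apply/measurable_EFinP; apply: measurable_funS (measurable_mlr alpha0 b0) => //.
by move=> x /=; rewrite !in_itv/= andbT => /andP[+ _]; exact: le_lt_trans.
Qed.

Lemma mlr1_nincr (t u : R) : 0 < t -> t <= u -> mlra 1 u <= mlra 1 t.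
Proof.
move=> t0 tu; have u0 := lt_le_trans t0 tu.
rewrite -lerN2 -(lerD2l 1) -lee_fin.
rewrite -[leLHS](integral_resolvent t0) -[leRHS](integral_resolvent u0); apply: ge0_subset_integral => //.
- exact: measurable_EFin_mlr.
- by move=> s /=; rewrite in_itv/= => /andP[s0 _]; rewrite lee_fin; exact: resolvent_ge0.
- by move=> s /=; rewrite !in_itv/= => /andP[-> h]; exact: lt_le_trans h tu.
Qed.

Lemma mlr1_le1 (t : R) : 0 < t -> mlra 1 t <= 1.
Proof.
move=> t0; rewrite -subr_ge0 -lee_fin -[leRHS](integral_resolvent t0).
apply: integral_ge0 => s /=; rewrite in_itv/= => /andP[s0 _].
by rewrite lee_fin; exact: resolvent_ge0.
Qed.

Lemma ml_nincr (x y : R) : 0 <= x -> x <= y -> E y <= E x.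
Proof.
rewrite le_eqVlt => /predU1P[<-|x0 xy].
  rewrite ml1_0 le_eqVlt => /predU1P[<-|/ml_subst[t t0 ->]]; first by rewrite ml1_0.
  by rewrite -mlr1E; exact: mlr1_le1.
have y0 := lt_le_trans x0 xy.
have h z : 0 < z -> E z = mlra 1 (z `^ alpha^-1).
  by move=> z0; rewrite mlr1E -powRrM mulVf ?lt0r_neq0// powRr1// ltW.
rewrite (h _ x0) (h _ y0); apply: mlr1_nincr; first exact: powR_gt0.
by apply: le_powR => //; rewrite ?invr_ge0 ltW.
Qed.

Lemma ml_le1 (x : R) : 0 <= x -> E x <= 1.
Proof. by move=> x0; apply: le_trans (ml_nincr (lexx 0) x0) _; rewrite ml1_0. Qed.

(** The relaxation equation says that E(t^alpha) plus its fractional integral of order alpha equals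
    1. As E is nonincreasing, that fractional integral is at least E(t^alpha) t^alpha / Gamma(alpha
    + 1), and it is at most 1. *)
Lemma ml_ub : exists2 C : R, 0 < C & forall x, 0 < x -> E x <= C / x.
Proof.
have Ga := Gamma_gt0 alpha0.
exists (alpha * Gamma alpha); first exact: mulr_gt0.
move=> x /ml_subst[t t0 ->]; rewrite -mlr1E.
have e0 : 0 < mlra 1 t by apply: mlr_gt0 => //; exact: ltW.
have h : (((t `^ alpha / alpha) / Gamma alpha * mlra 1 t)%:E <= 1%:E)%E.
  apply: (@le_trans _ _ (\int[mu]_(s in `]0%R, t[)
      ((t - s) `^ (alpha - 1) / Gamma alpha * mlra 1 s)%:E)%E); last first.
    rewrite (mlr_conv alpha0 alpha0 ltr01 t0) lee_fin addrC.
    have := mlr_rec alpha0 ltr01 t0; rewrite subrr powRr0 Gamma1 divr1.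
    by move: e0; move: (mlra 1 t) (mlra _ t) => a b; lra.
  apply: (@le_trans _ _ (\int[mu]_(s in `]0%R, t[)
      ((mlra 1 t / Gamma alpha)%:E * ((t - s) `^ (alpha - 1) * s `^ (1 - 1))%:E))%E).
    rewrite (@ge0_integralZl _ _ _ mu); last 4 first.
    - exact: measurable_itv.
    - exact: measurable_beta_integrand.
    - by move=> s _; rewrite lee_fin mulr_ge0 ?powR_ge0.
    - by rewrite lee_fin divr_ge0 ?ltW.
    rewrite -/(betae alpha 1 t) (betaeE alpha0 ltr01 t0) -EFinM lee_fin.
    rewrite addrK.
    (* The functional equation of the Gamma function, read off from the Beta integral with second
       parameter 1, whose value is 1 / alpha. *)
    have -> : Gamma (alpha + 1) = alpha * Gamma alpha.
      have := betaeE alpha0 ltr01 (@ltr01 R).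
      rewrite powR1 mul1r Gamma1 mulr1 /betae.
      rewrite (integral_reflect 1); last 2 first.
      - exact: measurable_itv.
      - exact: measurable_beta_integrand.
      rewrite (_ : [set x | _] = (`]0, 1[%classic : set (measurableTypeR R))); last first.
        apply/seteqP; split => z /=; rewrite !in_itv/= => /andP[a b]; apply/andP; split; lra.
      under eq_integral => z _ do rewrite subrr powRr0 mulr1 subKr.
      rewrite integral_itv_bndo_bndc; last exact: measurable_EFin_powR.
      rewrite (integral_powR alpha0 ler01) powR1 => -[].
      have G1 : 0 < Gamma (alpha + 1) by apply: Gamma_gt0; rewrite addr_gt0.
      move: (Gamma (alpha + 1)) (Gamma alpha) G1 Ga => u v u0 v0 /eqP.
      rewrite eqr_div ?lt0r_neq0// mul1r => /eqP ->; ring.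
    rewrite Gamma1; apply: le_of_eq.
    move: (Gamma alpha) Ga (mlra 1 t) (t `^ alpha) => v v0 p q.
    by field; rewrite !lt0r_neq0.
  apply: ge0_le_int; first exact: measurable_itv.
  - move=> s _; rewrite -EFinM lee_fin; apply: mulr_ge0.
      by apply: divr_ge0; exact: ltW.
    by apply: mulr_ge0; exact: powR_ge0.
  - apply: emeasurable_funM; first exact: measurable_cst.
    exact: measurable_beta_integrand.
  - apply/measurable_EFinP; apply: measurable_funM.
      apply: measurable_funM; last exact: measurable_cst.
      by apply: measurable_fun_powR; exact: measurable_funB.
    by apply/measurable_EFinP; exact: measurable_EFin_mlr.
  - move=> s /=; rewrite in_itv/= => /andP[s0 st]; rewrite -EFinM lee_fin.
    rewrite subrr powRr0 mulr1.
    have -> : mlra 1 t / Gamma alpha * (t - s) `^ (alpha - 1) =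
        (t - s) `^ (alpha - 1) / Gamma alpha * mlra 1 t by ring.
    apply: ler_wpM2l; first by apply: divr_ge0; [exact: powR_ge0|exact: ltW].
    by apply: mlr1_nincr => //; exact: ltW.
rewrite lee_fin in h; rewrite ler_pdivlMr ?powR_gt0//.
move: (mlra 1 t) (t `^ alpha) (Gamma alpha) Ga h => e p g g0.
have -> : e * p = (p / alpha / g * e) * (alpha * g) by field; rewrite !lt0r_neq0.
by apply: ler_piMl; rewrite mulr_ge0 ?ltW.
Qed.

(** E is the fractional integral of order 1 - alpha of the resolvent kernel. Its weight (t - s)^(-
    alpha) is at least t^(- alpha), and the kernel has mass 1 - E, so x E >= i (1 - E) with x =
    t^alpha and i = 1 / Gamma(1 - alpha). For x >= 1 one also has E <= x E, whence x E >= i / (1 +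
    i). *)
Lemma ml_lb : exists2 c : R, 0 < c & forall x, 1 <= x -> c / x <= E x.
Proof.
have b0 : 0 < 1 - alpha by rewrite subr_gt0.
have Gb := Gamma_gt0 b0.
exists ((Gamma (1 - alpha))^-1 * (1 + (Gamma (1 - alpha))^-1)^-1).
  by rewrite mulr_gt0 ?invr_gt0// ltr_pwDl// invr_ge0 ltW.
move=> x x1; have x0 : 0 < x by exact: lt_le_trans x1.
have [t t0 xE] := ml_subst x0; rewrite xE -mlr1E.
have e0 : 0 < mlra 1 t by apply: mlr_gt0 => //; exact: ltW.
have h : ((t `^ (- alpha) / Gamma (1 - alpha) * (1 - mlra 1 t))%:E <= (mlra 1 t)%:E)%E.
  have E1 := mlr_conv alpha0 b0 alpha0 t0; rewrite subrK in E1.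
  rewrite -[leRHS]E1 [leLHS]EFinM -[X in (_ * X <= _)%E](integral_resolvent t0).
  rewrite -(@ge0_integralZl _ _ _ mu); last 4 first.
  - exact: measurable_itv.
  - exact: measurable_EFin_mlr.
  - by move=> s /=; rewrite in_itv/= => /andP[s0 _]; rewrite lee_fin; exact: resolvent_ge0.
  - by rewrite lee_fin divr_ge0 ?powR_ge0 ?ltW.
  apply: ge0_le_int; first exact: measurable_itv.
  - move=> s /=; rewrite in_itv/= => /andP[s0 _]; rewrite -EFinM lee_fin.
    apply: mulr_ge0; last exact: resolvent_ge0.
    by apply: divr_ge0; [exact: powR_ge0|exact: ltW].
  - apply: emeasurable_funM; first exact: measurable_cst.
    exact: measurable_EFin_mlr.
  - apply/measurable_EFinP; apply: measurable_funM.
      apply: measurable_funM; last exact: measurable_cst.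
      by apply: measurable_fun_powR; exact: measurable_funB.
    by apply/measurable_EFinP; exact: measurable_EFin_mlr.
  - move=> s /=; rewrite in_itv/= => /andP[s0 st]; rewrite -EFinM lee_fin.
    apply: ler_wpM2r; first exact: resolvent_ge0.
    apply: ler_wpM2r; first by rewrite invr_ge0 ltW.
    rewrite (_ : 1 - alpha - 1 = - alpha); last by ring.
    rewrite !powRN lef_pV2 ?posrE ?powR_gt0 ?subr_gt0//.
    by apply: le_powR; rewrite ?subr_ge0 ?(ltW st) ?(ltW alpha0)// gerBl ltW.
rewrite lee_fin powRN -xE in h; rewrite -xE.
move: (mlra 1 t) (Gamma (1 - alpha)) Gb e0 h => e g g0 e0 h.
have i0 : 0 < g^-1 by rewrite invr_gt0.
move: (g^-1) i0 h => i i0 h.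
rewrite ler_pdivrMr// -ler_pdivlMr ?invr_gt0 ?ltr_pwDl ?(ltW i0)// invrK.
have h2 : i * (1 - e) <= e * x.
  by rewrite -ler_pdivrMr// mulrC mulrA.
have : e * 1 <= e * x by rewrite ler_pM2l.
move: (e * x) h2 => y; nra.
Qed.

End mittag_leffler_bounds.

(** * The Hilbert space L^2(D) *)

Section muD_integral.
Context {R : realType}.
Notation mu := (@lebesgue_measure R).

Lemma muD_setDT : (@muD R) (~` D) = 0%E.
Proof. by rewrite /muD/= /mrestr setICl measure0. Qed.

Lemma integral_muD (f : measurableTypeR R -> \bar R) : measurable_fun setT f ->
  (\int[muD]_x f x = \int[mu]_(x in D) f x)%E.
Proof.
move=> mf; transitivity (\int[muD]_(x in D) f x)%E; last first.
  apply: eq_measure_integral => A mA AD.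
  by rewrite /muD/= /mrestr setIidl.
rewrite [RHS]integral_mkcond; apply: ae_eq_integral => //.
  by apply/(measurable_restrictT _ _).1 => //; [exact: measurable_D|exact: measurable_funTS].
exists (~` D); split; first by apply: measurableC; exact: measurable_D.
  exact: muD_setDT.
move=> x /= h Dx; apply: h => _; rewrite patchE mem_set//.
Qed.

Lemma ae_muDP (Q : R -> Prop) :
  {ae (@muD R), forall x, Q x} -> {ae mu, forall x, D x -> Q x}.
Proof.
move=> [A [mA A0 QA]]; exists (A `&` D); split.
- by apply: measurableI => //; exact: measurable_D.
- exact: A0.
- by move=> x /= /not_implyP[Dx nQ]; split => //; exact: QA.
Qed.

Lemma measurable_L2 (v : L2D R) : measurable_fun setT v.
Proof. exact: measurable_funP. Qed.

Lemma ip_integrable (v w : L2D R) :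
  (@muD R).-integrable setT (fun x => (v x * w x)%:E).
Proof. by apply/Lfun1_integrable; apply: Lfun2_mul_Lfun1; exact: LfunP. Qed.

Lemma ipE (v w : L2D R) : (ip v w)%:E = (\int[muD]_x (v x * w x)%:E)%E.
Proof. by rewrite /ip /Rintegral fineK// integrable_fin_num// ip_integrable. Qed.

Lemma ipED (v w : L2D R) : (ip v w)%:E = (\int[mu]_(x in D) (v x * w x)%:E)%E.
Proof.
rewrite ipE integral_muD//; apply/measurable_EFinP; apply: measurable_funM; exact: measurable_L2.
Qed.

Lemma ipC (v w : L2D R) : ip v w = ip w v.
Proof. by apply: EFin_inj; rewrite !ipE; apply: eq_integral => x _; rewrite mulrC. Qed.

Lemma ipDl (u v w : L2D R) : ip (u + v) w = ip u w + ip v w.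
Proof.
apply: EFin_inj; rewrite [RHS]EFinD !ipE -integralD//; last 2 first.
- exact: ip_integrable.
- exact: ip_integrable.
by apply: eq_integral => x _; rewrite -EFinD /= mulrDl.
Qed.

Lemma ipZl a (u v : L2D R) : ip (a *: u) v = a * ip u v.
Proof.
apply: EFin_inj; rewrite [RHS]EFinM !ipE -integralZl//; last exact: ip_integrable.
by apply: eq_integral => x _; rewrite -EFinM /= mulrA.
Qed.

Lemma ipBl (u v w : L2D R) : ip (u - v) w = ip u w - ip v w.
Proof. by rewrite ipDl -scaleN1r ipZl mulN1r. Qed.

Lemma ipZr a (u v : L2D R) : ip u (a *: v) = a * ip u v.
Proof. by rewrite ipC ipZl ipC. Qed.

Lemma ipBr (u v w : L2D R) : ip w (u - v) = ip w u - ip w v.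
Proof. by rewrite ipC ipBl !(ipC w). Qed.

Lemma ip0l (v : L2D R) : ip 0 v = 0.
Proof. by rewrite -(scale0r (0 : L2D R)) ipZl mul0r. Qed.

Lemma ip_suml (I : Type) (r : seq I) (Q : pred I) (u : I -> L2D R) v :
  ip (\sum_(i <- r | Q i) u i) v = \sum_(i <- r | Q i) ip (u i) v.
Proof. by elim/big_rec2: _ => [|i x y _ <-]; [exact: ip0l|exact: ipDl]. Qed.

Lemma ip_ge0 (v : L2D R) : 0 <= ip v v.
Proof.
rewrite -lee_fin ipE; apply: integral_ge0 => x _; rewrite lee_fin; exact: sqr_ge0.
Qed.

Lemma L2normE (v : L2D R) : L2norm v = (Num.sqrt (ip v v))%:E.
Proof.
rewrite /L2norm unlock.
have -> : (\int[muD]_x `|(EFin \o v) x| `^ 2 = (ip v v)%:E)%E.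
  rewrite ipE; apply: eq_integral => x _ /=.
  by rewrite powR_mulrn ?normr_ge0// real_normK ?num_real// expr2.
by rewrite poweR_EFin powR12_sqrt// ip_ge0.
Qed.

Lemma L2norm_sqr (v : L2D R) : (L2norm v ^+ 2 = (ip v v)%:E)%E.
Proof. by rewrite L2normE expe2 -EFinM -expr2 sqr_sqrtr// ip_ge0. Qed.

Lemma L2norm_eq0 (v : L2D R) : L2norm v = 0%E -> ip v v = 0.
Proof.
rewrite L2normE => -[] /eqP; rewrite sqrtr_eq0 => h.
by apply/eqP; rewrite eq_le h ip_ge0.
Qed.

Lemma ip_CS (v w : L2D R) : (ip v w) ^+ 2 <= ip v v * ip w w.
Proof.
have h t : 0 <= ip v v - t * ip v w *+ 2 + t ^+ 2 * ip w w.
  have := ip_ge0 (v - t *: w).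
  rewrite ipBl [ip v (_ - _)]ipBr [ip (t *: w) (_ - _)]ipBr !ipZr !ipZl (ipC w v).
  by move=> h; apply: (le_trans h); apply: le_of_eq; ring.
have [w0|w0] := eqVneq (ip w w) 0.
  rewrite w0 mulr0; rewrite real_exprn_even_le0 ?num_real//=.
  apply/eqP; apply/eqP/negPn/negP => vw0.
  (* When (w, w) = 0 the quadratic polynomial is affine in t, and at this t it takes the value
     -1. *)
  have := h ((ip v v + 1) / ((ip v w) *+ 2)).
  rewrite w0 (_ : _ - _ + _ = - 1); last by field.
  by rewrite oppr_ge0 ler10.
have {}w0 : 0 < ip w w by rewrite lt_neqAle eq_sym w0 ip_ge0.
have := h (ip v w / ip w w).
have -> : ip v v - ip v w / ip w w * ip v w *+ 2 + (ip v w / ip w w) ^+ 2 * ip w w =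
   (ip v v * ip w w - (ip v w) ^+ 2) / ip w w by field; rewrite lt0r_neq0.
by rewrite pmulr_lge0 ?invr_gt0// subr_ge0.
Qed.

Lemma L2_cvgP (w : nat -> L2D R) (v : L2D R) :
  L2_cvg w v <-> ip (w n - v) (w n - v) @[n --> \oo] --> 0.
Proof.
rewrite /L2_cvg; split => [h|h].
  have : Num.sqrt (ip (w n - v) (w n - v)) @[n --> \oo] --> 0.
    apply: (cvg_trans _ (fine_cvg h)); apply: near_eq_cvg; apply: nearW => n.
    by rewrite /= L2normE.
  move=> {}h; rewrite -[X in _ --> X](mulr0 (0 : R)).
  apply: (cvg_trans _ (cvgM h h)).
  apply: near_eq_cvg; apply: nearW => n.
  by rewrite /= -[LHS]expr2 sqr_sqrtr// ip_ge0.
under eq_fun do rewrite L2normE.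
apply: cvg_EFin; first exact: nearW.
rewrite -(@sqrtr0 R); apply: (cvg_comp _ _ h).
exact: sqrt_continuous.
Qed.

Lemma sqr_cvg (x a : nat -> R) (l C : R) : a n @[n --> \oo] --> 0 ->
  (forall n, (x n - l) ^+ 2 <= a n * C) -> x n @[n --> \oo] --> l.
Proof.
move=> h0 h; have {}h0 : a n * C @[n --> \oo] --> 0.
  by rewrite -[X in _ --> X](mul0r C); exact: cvgMl.
apply/cvgrPdist_le => e e0.
have e20 : 0 < e ^+ 2 by exact: exprn_gt0.
apply: (filterS _ (cvgr_lt _ h0 _ e20)) => n hn.
rewrite -(@ler_pXn2r _ 2)// ?nnegrE ?(ltW e0)//.
by rewrite real_normK ?num_real// -sqrrN opprB (le_trans (h n))// ltW.
Qed.

Lemma ip_cvg (w : nat -> L2D R) (v g : L2D R) :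
  L2_cvg w v -> ip (w n) g @[n --> \oo] --> ip v g.
Proof.
move=> /L2_cvgP h; apply: (sqr_cvg h (C := ip g g)) => n.
by rewrite -ipBl; exact: ip_CS.
Qed.

Lemma ip_cvg_diag (w : nat -> L2D R) (v : L2D R) :
  L2_cvg w v -> ip (w n) (w n) @[n --> \oo] --> ip v v.
Proof.
move=> h; have h1 := ip_cvg (g := v) h; move/L2_cvgP : h => h.
have E n : ip (w n) (w n) = ip (w n - v) (w n - v) + (ip (w n) v) *+ 2 - ip v v.
  rewrite ipBl [ip _ (_ - v)]ipBr [ip v (_ - _)]ipBr (ipC v (w n)); ring.
rewrite (eq_cvg _ _ E).
have H : ip (w n - v) (w n - v) + ip (w n) v *+ 2 - ip v v @[n --> \oo] -->
    0 + (ip v v) *+ 2 - ip v v.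
  by apply: cvgB; [apply: cvgD => //; exact: cvgMn|exact: cvg_cst].
by move: H; rewrite (_ : 0 + (ip v v) *+ 2 - ip v v = ip v v)//; ring.
Qed.

Lemma exists_L2 (f : R -> R) : measurable_fun (setT : set (measurableTypeR R)) f ->
  (\int[mu]_(x in D) (f x ^+ 2)%:E < +oo)%E -> exists v : L2D R, (v : R -> R) = f.
Proof.
move=> mf ff.
have h : (f : measurableTypeR R -> R) \in Lfun (@muD R) 2%:E.
  apply/andP; split; rewrite inE//= /finite_norm unlock.
  apply: poweR_lty; rewrite [X in (X < _)%E](_ : _ = \int[mu]_(x in D) (f x ^+ 2)%:E)%E//.
  rewrite -integral_muD; last by apply/measurable_EFinP; exact: measurable_funX.
  apply: eq_integral => x _ /=.
  by rewrite powR_mulrn ?normr_ge0// real_normK ?num_real.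
exists (Lfun_Sub le_1_2 h); exact: (Lfun_valP le_1_2 h).
Qed.

End muD_integral.

Lemma fatou_le d (T : measurableType d) (R : realType)
    (mu : {measure set T -> \bar R}) (D : set T) (f_ : nat -> T -> \bar R)
    (f : T -> \bar R) (B : \bar R) :
  measurable D -> (forall n, measurable_fun D (f_ n)) ->
  (forall n x, D x -> 0 <= f_ n x)%E ->
  (forall x, D x -> f_ n x @[n --> \oo] --> f x) ->
  (forall n, \int[mu]_(x in D) f_ n x <= B)%E -> (\int[mu]_(x in D) f x <= B)%E.
Proof.
move=> mD mf f0 ff fB.
have -> : (\int[mu]_(x in D) f x = \int[mu]_(x in D) limn_einf (f_ ^~ x))%E.
  apply: eq_integral => x /set_mem Dx.
  rewrite is_cvg_limn_einfE; first by apply/esym/cvg_lim => //; exact: ff.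
  by apply/cvg_ex; exists (f x); exact: ff.
apply: (le_trans (fatou mu mD mf f0)).
rewrite limn_einf_lim; apply: lime_le; first exact: is_cvg_einfs.
apply: nearW => n; apply: le_trans (fB n).
by apply: ereal_inf_lbound; exists n => /=.
Qed.

Lemma cvgn_le (R : realType) (u : nat -> R) (l B : R) :
  u n @[n --> \oo] --> l -> (forall n, u n <= B) -> l <= B.
Proof.
move=> ul uB; rewrite -(cvg_lim (@Rhausdorff R) ul).
by apply: limr_le; [apply/cvg_ex; exists l|exact: nearW].
Qed.

(** * Orthonormal series: Riesz-Fischer and Parseval *)

Section orthonormal.
Context {R : realType}.
Notation mu := (@lebesgue_measure R).
Variable phi : nat -> L2D R.
Hypothesis ortho : forall j k, (1 <= j)%N -> (1 <= k)%N -> ip (phi j) (phi k) = (j == k)%:R.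

Definition psum (c : nat -> R) n : L2D R := \sum_(1 <= k < n.+1) c k *: phi k.

Lemma L2_sumE (I : Type) (r : seq I) (u : I -> L2D R) x :
  (\sum_(i <- r) u i : L2D R) x = \sum_(i <- r) u i x.
Proof. by elim: r => [|i r IH]; rewrite ?big_nil// !big_cons -IH. Qed.

Lemma psumE c n x : psum c n x = \sum_(1 <= k < n.+1) c k * phi k x.
Proof. by rewrite /psum L2_sumE. Qed.

Lemma psumS c n : psum c n.+1 = psum c n + c n.+1 *: phi n.+1.
Proof. by rewrite /psum big_nat_recr. Qed.

Lemma ip_psum_phi c n k : (1 <= k)%N ->
  ip (psum c n) (phi k) = if (k <= n)%N then c k else 0.
Proof.
move=> k1; elim: n => [|n IH].
  by rewrite /psum big_geq// ip0l leqn0 (gtn_eqF k1).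
rewrite psumS ipDl IH ipZl ortho// [in RHS]leq_eqVlt ltnS.
have [->|nk] := eqVneq k n.+1; first by rewrite ?eqxx ltnn mulr1 add0r.
by rewrite mulr0 addr0.
Qed.

Lemma ip_psum_psum c d n m : (n <= m)%N ->
  ip (psum c n) (psum d m) = \sum_(1 <= k < n.+1) c k * d k.
Proof.
move=> nm; rewrite /psum ip_suml; apply: eq_big_nat => k /andP[k1 kn].
by rewrite ipZl ipC ip_psum_phi// (leq_trans _ nm).
Qed.

Definition qsum (c : nat -> R) n := \sum_(1 <= k < n.+1) c k ^+ 2.

Lemma qsum_nd c : nondecreasing_seq (qsum c).
Proof.
apply/nondecreasing_seqP => n.
by rewrite /qsum [leRHS]big_nat_recr//= lerDl sqr_ge0.
Qed.

Lemma ip_psumB c n m : (n <= m)%N ->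
  ip (psum c m - psum c n) (psum c m - psum c n) = qsum c m - qsum c n.
Proof.
move=> nm; rewrite ipBl [ip _ (_ - _)]ipBr [ip (psum c n) (_ - _)]ipBr.
rewrite (ipC (psum c m) (psum c n)) !ip_psum_psum//.
have E p : \sum_(1 <= k < p.+1) c k * c k = qsum c p by apply: eq_bigr => k _; rewrite expr2.
by rewrite !E; ring.
Qed.

Lemma ip_sub_psum (v : L2D R) n : let c k := ip v (phi k) in
  ip (v - psum c n) (v - psum c n) = ip v v - qsum c n.
Proof.
move=> c; rewrite ipBl [ip _ (_ - _)]ipBr [ip (psum c n) (_ - _)]ipBr.
rewrite (ipC v (psum c n)) ip_psum_psum//.
have -> : ip (psum c n) v = qsum c n.
  rewrite /psum ip_suml; apply: eq_bigr => k _.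
  by rewrite ipZl ipC expr2.
have -> : \sum_(1 <= k < n.+1) c k * c k = qsum c n by apply: eq_bigr => k _; rewrite expr2.
ring.
Qed.

Lemma bessel (v : L2D R) n : qsum (fun k => ip v (phi k)) n <= ip v v.
Proof. by rewrite -subr_ge0 -ip_sub_psum ip_ge0. Qed.

(** The limit is built pointwise along a subsequence whose successive differences [g j] have squared
    norm at most 4^(-j). Almost everywhere they decay geometrically, so the subsequence converges;
    Fatou's lemma then bounds the distance of any partial sum to the limit, which gives convergence
    of the full sequence. *)
Lemma riesz_fischer (c : nat -> R) (M : R) : (forall n, qsum c n <= M) ->
  exists w : L2D R, L2_cvg (psum c) w.
Proof.
move=> cM.
have cvq : cvgn (qsum c).
  apply: nondecreasing_is_cvgn; first exact: qsum_nd.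
  by exists M => _ [n _ <-].
pose Q := limn (qsum c).
have qQ n : qsum c n <= Q by apply: nondecreasing_cvgn_le => //; exact: qsum_nd.
have /choice[N hN] : forall j : nat, exists N, Q - 4^-1 ^+ j <= qsum c N.
  move=> j; have e0 : 0 < 4^-1 ^+ j :> R by rewrite exprn_gt0// invr_gt0.
  have h : Q - 4^-1 ^+ j < Q by rewrite gtrBl.
  have [N _ /(_ N (leqnn N)) hN] := cvgr_gt _ cvq _ h.
  by exists N; exact: ltW.
(* Accumulating the indices N i + 1 makes the subsequence at once nondecreasing, at least j, and at
   least N j. *)
pose nn j := (\sum_(i < j.+1) (N i).+1)%N.
have nnJ j : (j <= nn j)%N.
  elim: j => // j IH; rewrite /nn big_ord_recr/= addnS ltnS; apply: (leq_trans IH); exact: leq_addr.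

have nnS j : (nn j <= nn j.+1)%N by rewrite /nn [leqRHS]big_ord_recr/= leq_addr.
have nnN j : (N j <= nn j)%N by rewrite /nn big_ord_recr/= (leq_trans (leqnSn _))// leq_addl.
have nnQ j m : (nn j <= m)%N -> qsum c m - qsum c (nn j) <= 4^-1 ^+ j.
  move=> jm; have := hN j; have := qsum_nd c (nnN j) => h1 h2.
  rewrite lerBlDr (le_trans (qQ m))// -lerBlDl; exact: le_trans h2 h1.
pose g j : L2D R := psum c (nn j.+1) - psum c (nn j).
have gE j x : g j x = psum c (nn j.+1) x - psum c (nn j) x by [].
have ipg j : ip (g j) (g j) <= 4^-1 ^+ j by rewrite ip_psumB// nnQ.
(* The weight 2^j keeps the integrals summable, at most 2^(-j), while finiteness of the sum at x
   forces |g j x| <= C 2^(- j / 2). *)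
pose h j (x : measurableTypeR R) := (2 ^+ j * g j x ^+ 2)%:E.
have mh j : measurable_fun setT (h j).
  apply/measurable_EFinP; apply: measurable_funM; first exact: measurable_cst.
  by apply: measurable_funX; exact: measurable_L2.
have h0 j x : (0 <= h j x)%E by rewrite lee_fin; apply: mulr_ge0; [exact: exprn_ge0|exact: sqr_ge0].
pose G x := (\sum_(j <oo) h j x)%E.
have mG : measurable_fun setT G by apply: ge0_emeasurable_sum => // j x _ _; exact: h0.
have G0 x : (0 <= G x)%E by apply: nneseries_ge0 => j _ _; exact: h0.
have IG : (\int[muD]_x G x < +oo)%E.
  rewrite /G integral_nneseries//.
  have hj j : (\int[muD]_x h j x <= (2^-1 ^+ j)%:E)%E.
    have -> : (\int[muD]_x h j x = (2 ^+ j * ip (g j) (g j))%:E)%E.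
      rewrite EFinM ipE -[RHS](@ge0_integralZl _ _ _ muD).
      - by apply: eq_integral => x _; rewrite /h EFinM expr2.
      - exact: measurableT.
      - by apply/measurable_EFinP; apply: measurable_funM; exact: measurable_L2.
      - by move=> x _; rewrite lee_fin -expr2 sqr_ge0.
      - by rewrite lee_fin exprn_ge0.
    rewrite lee_fin (le_trans (ler_wpM2l _ (ipg j))) ?exprn_ge0//.
    by rewrite -exprMn (_ : 2 * 4^-1 = 2^-1 :> R)//; field.
  apply: (@le_lt_trans _ _ 2%:E); last exact: ltry.
  apply: lime_le; first by apply: is_cvg_nneseries => j _ _; exact: integral_ge0.
  apply: nearW => n; apply: (@le_trans _ _ (\sum_(0 <= j < n) (2^-1 ^+ j)%:E)%E).
    by apply: lee_sum => j _; exact: hj.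
  rewrite sumEFin lee_fin.
  have := @geometric_seriesE R 1 2^-1.
  rewrite -[X in X <= _](_ : series (geometric 1 2^-1) n = _); last first.
    by rewrite /series/=; apply: eq_bigr => j _; rewrite mul1r.
  move=> ->; last by rewrite lt_eqF// invf_lt1// ltr1n.
  rewrite /= mul1r (_ : 1 - 2^-1 = 2^-1 :> R); last by field.
  by rewrite invrK ler_piMl// lerBlDr lerDl exprn_ge0// invr_ge0.
pose A := [set x | (G x < +oo)%E].
have mA : measurable A by rewrite -[A]setTI; exact: emeasurable_fun_infty_o.
have intG : (@muD R).-integrable setT G.
  apply/integrableP; split => //.
  by under eq_integral do rewrite gee0_abs//.
have muA : {ae (@muD R), forall x, A x}.
  apply: filterS (integrable_ae measurableT intG) => x /(_ I) Gx.
  by rewrite /A/= ltey_eq Gx.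
have cvA x : A x -> cvgn (fun J => psum c (nn J) x).
  move=> Ax; have Gfin : G x \is a fin_num by rewrite ge0_fin_numE.
  have hC j : 2 ^+ j * g j x ^+ 2 <= fine (G x).
    rewrite -lee_fin fineK//.
    apply: (@le_trans _ _ (\sum_(0 <= i < j.+1) h i x)%E).
      rewrite big_nat_recr//= leeDr// sume_ge0// => i _; exact: h0.
    by apply: nneseries_lim_ge => i _ _; exact: h0.
  have C0 : 0 <= fine (G x) by apply: fine_ge0.
  pose q := Num.sqrt (2^-1 : R).
  have q0 : 0 <= q by exact: sqrtr_ge0.
  have q1 : `|q| < 1.
    by rewrite ger0_norm// -(@ltr_pXn2r _ 2)// ?nnegrE// sqr_sqrtr ?invr_ge0// expr1n invf_lt1// ltr1n.
  have sg : cvgn (series (fun j => g j x)).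
    apply: normed_cvg; apply: (series_le_cvg _ _ _ (is_cvg_geometric_series (a := Num.sqrt (fine (G x))) q1)).
    - by move=> j; exact: normr_ge0.
    - by move=> j /=; rewrite mulr_ge0 ?sqrtr_ge0 ?exprn_ge0.
    - move=> j /=; rewrite -(@ler_pXn2r _ 2)// ?nnegrE ?mulr_ge0 ?sqrtr_ge0 ?exprn_ge0//.
      rewrite real_normK ?num_real// exprMn sqr_sqrtr// -exprM mulnC exprM sqr_sqrtr ?invr_ge0//.
      rewrite exprVn ler_pdivlMr ?exprn_gt0// mulrC; exact: hC.
  have E J : psum c (nn J) x = psum c (nn 0%N) x + series (fun j => g j x) J.
    rewrite (_ : series _ J = \sum_(0 <= j < J) (psum c (nn j.+1) x - psum c (nn j) x))//.
    by rewrite (telescope_sumr (fun j => psum c (nn j) x))// addrC subrK.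
  rewrite (_ : (fun J => _) = fun J => psum c (nn 0%N) x + series (fun j => g j x) J).
    by apply: is_cvgD => //; exact: is_cvg_cst.
  by apply/funext.
(* Setting the sequence to 0 off the convergence set [A] makes it converge everywhere, so that its
   limit is measurable. *)
pose hJ J (x : measurableTypeR R) := psum c (nn J) x * \1_A x.
have mhJ J : measurable_fun setT (hJ J).
  by apply: measurable_funM; [exact: measurable_L2|exact: measurable_indic].
pose w x := limn (hJ ^~ x).
have hw x : hJ J x @[J --> \oo] --> w x.
  suff : cvgn (hJ ^~ x) by [].
  rewrite /hJ; have [xA|xA] := pselect (A x).
    by apply: is_cvgMl; exact: cvA.
  have -> : (fun J => psum c (nn J) x * \1_A x) = fun=> 0.
    by apply/funext => J; rewrite indicE memNset// mulr0.
  exact: is_cvg_cst.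
have mw : measurable_fun setT w by apply: (measurable_fun_cvg mhJ) => x _; exact: hw.
have bound (v0 : L2D R) (B : R) J0 :
    (forall J, (J0 <= J)%N -> ip (psum c (nn J) - v0) (psum c (nn J) - v0) <= B) ->
    (\int[muD]_x ((w x - v0 x) ^+ 2)%:E <= B%:E)%E.
  move=> hB; apply: (@fatou_le _ _ _ _ _ (fun J x => ((hJ (J + J0)%N x - v0 x) ^+ 2)%:E)) => //.
  - move=> J; apply/measurable_EFinP; apply: measurable_funX; apply: measurable_funB;
      [exact: mhJ|exact: measurable_L2].
  - by move=> J x _; rewrite lee_fin sqr_ge0.
  - move=> x _; apply: cvg_EFin; first exact: nearW.
    rewrite (_ : _ \o _ = fun J => (hJ (J + J0)%N x - v0 x) ^+ 2)//.
    apply: (@cvg_comp _ _ _ (fun J => hJ (J + J0)%N x) (fun y => (y - v0 x) ^+ 2) _ (nbhs (w x))).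
      by rewrite (cvg_shiftn J0 (fun J => hJ J x)); exact: hw.
    by apply: cvgM; apply: cvgB; try exact: cvg_id; exact: cvg_cst.
  - move=> J; rewrite -[leRHS]/(B%:E); apply: le_trans _ (_ : (ip (psum c (nn (J + J0)) - v0) (psum c (nn (J + J0)) - v0))%:E <= B%:E)%E; last first.
      by rewrite lee_fin hB// leq_addl.
    rewrite ipE le_eqVlt; apply/orP; left; apply/eqP; apply: ae_eq_integral => //.
    + apply/measurable_EFinP; apply: measurable_funX; apply: measurable_funB;
        [exact: mhJ|exact: measurable_L2].
    + by apply/measurable_EFinP; apply: measurable_funM; exact: measurable_L2.
    + apply: filterS muA => x Ax _; rewrite /hJ indicE mem_set// mulr1 expr2//.
have fw : (\int[mu]_(x in D) (w x ^+ 2)%:E < +oo)%E.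
  rewrite -integral_muD; last by apply/measurable_EFinP; exact: measurable_funX.
  apply: (@le_lt_trans _ _ M%:E); last exact: ltry.
  have := bound 0 M 0%N; under eq_integral do rewrite subr0.
  apply => J _; rewrite subr0 ip_psum_psum//.
  by apply: le_trans (cM (nn J)); apply: ler_sum => k _; rewrite expr2.
have [W WE] := exists_L2 mw fw.
exists W; apply/L2_cvgP.
apply/cvgrPdist_le => e e0.
have [j0 _ /(_ j0 (leqnn j0)) hj0] : \forall j \near \oo, (4^-1 ^+ j : R) < e.
  have : geometric 1 (4^-1 : R) j @[j --> \oo] --> 0.
    by apply: cvg_geometric; rewrite ger0_norm// invf_lt1// ltr1n.
  by move=> /cvgr_lt/(_ _ e0); apply: filterS => j; rewrite /geometric/= mul1r.
exists (nn j0) => // m /= jm.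
rewrite sub0r normrN ger0_norm ?ip_ge0// (le_trans _ (ltW hj0))//.
have -> : ip (psum c m - W) (psum c m - W) = ip (W - psum c m) (W - psum c m).
  by rewrite -opprB -scaleN1r ipZl ipZr mulrA mulrNN !mul1r.
rewrite -lee_fin ipE.
have := bound (psum c m) (4^-1 ^+ j0) m.
have -> : (\int[muD]_x ((w x - psum c m x) ^+ 2)%:E =
    \int[muD]_x ((W - psum c m) x * (W - psum c m) x)%:E)%E.
  by apply: eq_integral => x _; rewrite expr2 -WE.
apply => J mJ; have mJ' := leq_trans mJ (nnJ J).
by rewrite ip_psumB// (le_trans _ (nnQ j0 (nn J) _))// ?(leq_trans jm)// lerD2l lerN2 qsum_nd.
Qed.

Hypothesis complete : forall v : L2D R,
  (forall k, (1 <= k)%N -> ip v (phi k) = 0) -> L2norm v = 0%E.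

Lemma ip_null (u v : L2D R) : ip u u = 0 -> ip u v = 0.
Proof.
move=> u0; have := ip_CS u v; rewrite u0 mul0r => h.
by apply/eqP; rewrite -sqrf_eq0 eq_le h sqr_ge0.
Qed.

(** Riesz-Fischer yields w with the same coefficients as v; completeness makes v - w null, and (w,
    w) is the limit of the sums [qsum]. All norm estimates of the drift go through this inequality
    and bounds on coefficients. *)
Lemma parseval_le (v : L2D R) (B : R) :
  (forall n, qsum (fun k => ip v (phi k)) n <= B) -> ip v v <= B.
Proof.
move=> hB; have [w hw] := riesz_fischer (fun n => bessel v n).
have vw : ip (v - w) (v - w) = 0.
  apply/L2norm_eq0/complete => k k1; rewrite ipBl.
  apply/eqP; rewrite subr_eq0; apply/eqP.
  apply: (cvg_unique _ _ (ip_cvg (g := phi k) hw)) => //.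
  apply: cvg_near_cst; exists k => // n /= kn.
  by rewrite ip_psum_phi// kn.
have {}vw : ip v v = ip w w.
  have h1 := ip_null v vw; have h2 := ip_null w vw.
  rewrite !ipBl in h1 h2; rewrite (ipC w v) in h1.
  by apply/eqP; rewrite -subr_eq0; apply/eqP; lra.
rewrite vw; apply: (cvgn_le (ip_cvg_diag hw)) => n.
rewrite ip_psum_psum//; apply: le_trans (hB n).
by apply: ler_sum => k _; rewrite expr2.
Qed.

(** [L2_lim] picks an arbitrary representative, or 0 in case of divergence. Riesz-Fischer excludes
    divergence, and coefficients do not depend on the representative. *)
Lemma L2_lim_psum (c : nat -> R) (M : R) k : (forall n, qsum c n <= M) -> (1 <= k)%N ->
  ip (L2_lim (psum c)) (phi k) = c k.
Proof.
move=> cM k1; have hex := riesz_fischer cM.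
have hw : L2_cvg (psum c) (L2_lim (psum c)) by exact: (xgetPex 0 hex).
apply: (cvg_unique _ (ip_cvg (g := phi k) hw)) => //.
apply: cvg_near_cst; exists k => // n /= kn.
by rewrite ip_psum_phi// kn.
Qed.

End orthonormal.

(** * Dirichlet eigenfunctions *)

Section trig.
Context {R : realType}.
Notation mu := (@lebesgue_measure R).

Lemma is_derive_sinM (c x : R) : is_derive x (1 : R) (fun x => sin (c * x)) (c * cos (c * x)).
Proof.
have h : is_derive x (1 : R) (fun x : R => c * x) c.
  by apply: is_derive_eq; rewrite /GRing.scale/= mulr1.
have := @is_derive1_comp R sin (fun x : R => c * x) x (cos (c * x)) c (is_derive_sin _) h.
by rewrite mulrC.
Qed.

Lemma is_derive_cosM (c x : R) : is_derive x (1 : R) (fun x => cos (c * x)) (- (c * sin (c * x))).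
Proof.
have h : is_derive x (1 : R) (fun x : R => c * x) c.
  by apply: is_derive_eq; rewrite /GRing.scale/= mulr1.
have := @is_derive1_comp R cos (fun x : R => c * x) x (- sin (c * x)) c (is_derive_cos _) h.
by rewrite mulNr mulrC.
Qed.

Lemma continuous_sinM (c : R) : continuous (fun x => sin (c * x)).
Proof.
move=> x; apply: (@continuous_comp _ _ _ (fun x => c * x) sin).
  by apply: cvgMr; exact: cvg_id.
exact: continuous_sin.
Qed.

Lemma continuous_cosM (c : R) : continuous (fun x => cos (c * x)).
Proof.
move=> x; apply: (@continuous_comp _ _ _ (fun x => c * x) cos).
  by apply: cvgMr; exact: cvg_id.
exact: continuous_cos.
Qed.

Lemma sin_npi (n : nat) : sin (n%:R * pi) = 0 :> R.
Proof.
have := alternatingn (@sinDpi R) n 0; rewrite add0r mulr_natl => ->.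
by rewrite sin0 mulr0.
Qed.

Lemma cos_npi (n : nat) : cos (n%:R * pi) = (-1) ^+ n :> R.
Proof.
have := alternatingn (@cosDpi R) n 0; rewrite add0r mulr_natl => ->.
by rewrite cos0 mulr1.
Qed.

(** Subtract the largest multiple of pi not exceeding w: if the remainder in [0, pi[ were positive,
    its sine would be positive as well. *)
Lemma sin_eq0 (w : R) : 0 < w -> sin w = 0 -> exists2 n : nat, (1 <= n)%N & w = n%:R * pi.
Proof.
move=> w0 sw; pose n := Num.truncn (w / pi).
have wp : 0 <= w / pi by rewrite divr_ge0 ?pi_ge0 ?ltW.
have /andP[h1 h2] := truncn_itv wp.
have r0 : 0 <= w - n%:R * pi by rewrite subr_ge0 -ler_pdivlMr ?pi_gt0.
have r1 : w - n%:R * pi < pi.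
  rewrite ltrBlDr (_ : pi + n%:R * pi = n.+1%:R * pi); last by rewrite -natr1; ring.
  by rewrite -ltr_pdivrMr ?pi_gt0.
have wE : w = n%:R * pi.
  move: r0; rewrite le_eqVlt => /predU1P[/eqP|r0].
    by rewrite eq_sym subr_eq0 => /eqP.
  have : 0 < sin (w - n%:R * pi) by rewrite sin_gt0_pi// r0 r1.
  have := alternatingn (@sinDpi R) n (w - n%:R * pi).
  rewrite -(mulr_natl pi) subrK sw => /esym/eqP.
  by rewrite mulf_eq0 signr_eq0/= => /eqP ->; rewrite ltxx.
exists n => //; rewrite lt0n; apply/eqP => n0.
by move: w0; rewrite wE n0 mul0r ltxx.
Qed.

Lemma int_cos (c t : R) : c != 0 -> 0 <= t ->
  (\int[mu]_(x in `[0%R, t]) (cos (c * x))%:E = (sin (c * t) / c)%:E)%E.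
Proof.
move=> c0 t0.
have h1 x : 0 <= x <= t -> is_derive x (1 : R) (fun x => c^-1 * sin (c * x)) (cos (c * x)).
  move=> _; rewrite (_ : cos (c * x) = c^-1 *: (c * cos (c * x))).
    by apply: is_deriveZ; exact: is_derive_sinM.
  by rewrite /GRing.scale/= mulrA mulVf// mul1r.
rewrite (FTC2_cc t0 h1) ?mulr0 ?sin0 ?mulr0 ?subr0 1?mulrC//.
by move=> x _; exact: continuous_cosM.
Qed.

Lemma int_sin (c t : R) : c != 0 -> 0 <= t ->
  (\int[mu]_(x in `[0%R, t]) (sin (c * x))%:E = ((1 - cos (c * t)) / c)%:E)%E.
Proof.
move=> c0 t0.
have h1 x : 0 <= x <= t -> is_derive x (1 : R) (fun x => - c^-1 * cos (c * x)) (sin (c * x)).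
  move=> _; rewrite (_ : sin (c * x) = - c^-1 *: (- (c * sin (c * x)))).
    by apply: is_deriveZ; exact: is_derive_cosM.
  by rewrite /GRing.scale/= mulrNN mulrA mulVf// mul1r.
rewrite (FTC2_cc t0 h1) ?mulr0 ?cos0.
  by congr (_%:E); field.
by move=> x _; exact: continuous_sinM.
Qed.

Lemma continuous_integrable (f : R -> R) (a b : R) : continuous f ->
  mu.-integrable `[a, b] (EFin \o f).
Proof.
move=> cf; apply: continuous_compact_integrable; first exact: segment_compact.
exact: continuous_subspaceT.
Qed.

Lemma int_lin2 (f g : R -> R) (a b : R) : continuous f -> continuous g ->
  (\int[mu]_(x in `[0%R, 1%R]) (a * f x + b * g x)%:E =
   a%:E * \int[mu]_(x in `[0%R, 1%R]) (f x)%:E +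
   b%:E * \int[mu]_(x in `[0%R, 1%R]) (g x)%:E)%E.
Proof.
move=> cf cg; have if' := continuous_integrable 0 1 cf.
have ig := continuous_integrable 0 1 cg.
transitivity (\int[mu]_(x in `[0%R, 1%R]) (a%:E * (f x)%:E + b%:E * (g x)%:E))%E.
  by apply: eq_integral => x _; rewrite EFinD !EFinM.
rewrite integralD//; last 2 first.
- exact: integrableZl.
- exact: integrableZl.
by congr (_ + _)%E; exact: integralZl.
Qed.

Lemma int_cosn (n : nat) :
  (\int[mu]_(x in `[0%R, 1%R]) (cos (n%:R * pi * x))%:E = (n == 0%N)%:R%:E)%E.
Proof.
have [->|n0] := eqVneq n 0%N.
  under eq_integral => x _ do rewrite !mul0r cos0.
  rewrite integral_cst//= lebesgue_measure_itv/= lte_fin ltr01 -EFinB subr0.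
  by rewrite -EFinM mulr1.
by rewrite int_cos ?ler01 ?mulf_neq0 ?pnatr_eq0 ?lt0r_neq0 ?pi_gt0// mulr1 sin_npi mul0r.
Qed.

Lemma int_cosB (n m : nat) :
  (\int[mu]_(x in `[0%R, 1%R]) (cos (n%:R * pi * x - m%:R * pi * x))%:E = (n == m)%:R%:E)%E.
Proof.
wlog nm : n m / (m <= n)%N.
  move=> h; have [/h//|mn] := leqP m n.
  rewrite eq_sym -(h m n (ltnW mn)); apply: eq_integral => x _.
  by rewrite -cosN opprB.
move: (subnK nm); move: (n - m)%N => k <-.
rewrite -[X in _ == X]add0n eqn_add2r -int_cosn.
by apply: eq_integral => x _; rewrite natrD; congr (cos _)%:E; ring.
Qed.

Lemma int_sinsin (n m : nat) : (1 <= n)%N ->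
  (\int[mu]_(x in `[0%R, 1%R]) (sin (n%:R * pi * x) * sin (m%:R * pi * x))%:E =
   ((n == m)%:R / 2)%:E)%E.
Proof.
move=> n1; transitivity (\int[mu]_(x in `[0%R, 1%R])
   (2^-1 * cos (n%:R * pi * x - m%:R * pi * x) + (- 2^-1) * cos ((n + m)%:R * pi * x))%:E)%E.
  apply: eq_integral => x _; congr (_%:E).
  by rewrite natrD 2!mulrDl cosB cosD; field.
rewrite int_lin2; last 2 first.
- move=> x; rewrite (_ : (fun _ => _) = fun x : R => cos ((n%:R * pi - m%:R * pi) * x)).
    exact: continuous_cosM.
  by apply/funext => y; rewrite mulrBl.
- exact: continuous_cosM.
rewrite int_cosB int_cosn addn_eq0 (gtn_eqF n1)/= mule0 adde0 -EFinM.
by rewrite mulrC.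
Qed.

Lemma int_coscos (n m : nat) : (1 <= n)%N ->
  (\int[mu]_(x in `[0%R, 1%R]) (cos (n%:R * pi * x) * cos (m%:R * pi * x))%:E =
   ((n == m)%:R / 2)%:E)%E.
Proof.
move=> n1; transitivity (\int[mu]_(x in `[0%R, 1%R])
   (2^-1 * cos (n%:R * pi * x - m%:R * pi * x) + 2^-1 * cos ((n + m)%:R * pi * x))%:E)%E.
  apply: eq_integral => x _; congr (_%:E).
  by rewrite natrD 2!mulrDl cosB cosD; field.
rewrite int_lin2; last 2 first.
- move=> x; rewrite (_ : (fun _ => _) = fun x : R => cos ((n%:R * pi - m%:R * pi) * x)).
    exact: continuous_cosM.
  by apply/funext => y; rewrite mulrBl.
- exact: continuous_cosM.
rewrite int_cosB int_cosn addn_eq0 (gtn_eqF n1)/= mule0 adde0 -EFinM.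
by rewrite mulrC.
Qed.

End trig.

(** * Identification of the Dirichlet eigenpairs *)

Section eigen.
Context {R : realType}.
Notation mu := (@lebesgue_measure R).

Lemma derive0_cst (f : R -> R) (x y : R) :
  (forall z : R, z \in `]0, 1[ -> is_derive z (1 : R) f 0) ->
  x \in `]0, 1[ -> y \in `]0, 1[ -> f x = f y.
Proof.
move=> df; wlog xy : x y / x <= y.
  by move=> h x01 y01; have [/h|/ltW/h] := leP x y => ->.
rewrite !in_itv/= => /andP[x0 x1] /andP[y0 y1].
have inI z : x <= z -> z <= y -> z \in `]0, 1[.
  by move=> xz zy; rewrite in_itv/= (lt_le_trans x0)//= (le_lt_trans zy).
have h1 (z : R) : z \in `]x, y[ -> is_derive z (1 : R) f (cst 0 z).
  by rewrite in_itv/= => /andP[/ltW xz /ltW zy]; apply: df; exact: inI.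
have h2 : {within `[x, y], continuous f}.
  apply: continuous_in_subspaceT => z /set_mem/=; rewrite in_itv/= => /andP[xz zy].
  apply: differentiable_continuous; apply/derivable1_diffP.
  by have [] := df z (inI _ xz zy).
have [c _] := MVT_segment xy h1 h2.
move=> /=; rewrite mul0r => /eqP; rewrite subr_eq0 => /eqP ->//.
Qed.

Lemma within_eq (v g : R -> R) : {within `[0, 1], continuous v} -> continuous g ->
  {in `]0, 1[, v =1 g} -> {in `[0, 1], v =1 g}.
Proof.
move=> /(continuous_within_itvP _ ltr01)[_ v0 v1] cg vg x.
rewrite in_itv/= => /andP[]; rewrite le_eqVlt => /predU1P[<- _|x0].
  apply: (cvg_unique _ v0) => //.
  have : g x @[x --> 0^'+] --> g 0 by apply: cvg_at_right_filter; exact: cg.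
  apply: cvg_trans; apply: near_eq_cvg; near=> z; apply/esym/vg.
  by rewrite in_itv/=; apply/andP; split; near: z; [exact: nbhs_right_gt|exact: nbhs_right_lt].
rewrite le_eqVlt => /predU1P[->|x1]; last by apply: vg; rewrite in_itv/= x0.
apply: (cvg_unique _ v1) => //.
have : g x @[x --> 1^'-] --> g 1 by apply: cvg_at_left_filter; exact: cg.
apply: cvg_trans; apply: near_eq_cvg; near=> z; apply/esym/vg.
by rewrite in_itv/=; apply/andP; split; near: z; [exact: nbhs_left_gt|exact: nbhs_left_lt].
Unshelve. all: by end_near. Qed.

Lemma eigenpair_is_derive (l : R) (v : L2D R) (x : R) : dirichlet_eigenpair l v -> x \in `]0, 1[ ->
  is_derive x (1 : R) v (derive1 v x) /\
  is_derive x (1 : R) (derive1 v) (- (l * v x)).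
Proof.
move=> [_ _ h] x01; have [d1 d2 E] := h _ x01.
split; first by rewrite derive1E; exact: derivableP.
rewrite -E opprK derive1E; exact: derivableP.
Qed.

(** For l <= 0 one has (v^2)'' = 2 (v'^2 - l v^2) >= 0, so v^2 is convex and vanishes at both ends.
    If v c were nonzero, the mean value theorem would give a positive slope of v^2 before c and a
    negative one after c. *)
Lemma eigenvalue_gt0 (l : R) (v dv : R -> R) :
  {within `[0, 1], continuous v} -> v 0 = 0 -> v 1 = 0 ->
  (forall x : R, x \in `]0, 1[ -> is_derive x (1 : R) v (dv x) /\
    is_derive x (1 : R) dv (- (l * v x))) -> l <= 0 ->
  forall x : R, x \in `]0, 1[ -> v x = 0.
Proof.
move=> cv v0 v1 d l0 c c01.
apply/eqP/negPn/negP => vc.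
have vc2 : 0 < v c ^+ 2 by rewrite lt_neqAle eq_sym sqrf_eq0 vc sqr_ge0.
move: (c01); rewrite in_itv/= => /andP[c0 c1].
pose w x := v x * dv x *+ 2.
have dv2 (x : R) : x \in `]0, 1[ -> is_derive x (1 : R) (fun x => v x ^+ 2) (w x).
  move=> x01; have [d1 _] := d x x01.
  rewrite (_ : (fun x => _) = v * v); last by apply/funext => z; rewrite expr2.
  by apply: is_derive_eq; rewrite /w/= /GRing.scale/= mulr2n.
have cv2 : {within `[0, 1], continuous (fun x => v x ^+ 2)}.
  rewrite (_ : (fun x => _) = (fun x => v x * v x)); last first.
    by apply/funext => x; rewrite expr2.
  by move=> x; apply: cvgM; exact: cv.
have sub a b : 0 <= a -> b <= 1 -> {within `[a, b], continuous (fun x => v x ^+ 2)}.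
  move=> a0 b1; apply: continuous_subspaceW cv2 => x /=; rewrite !in_itv/= => /andP[ax xb].
  by rewrite (le_trans a0)//= (le_trans xb).
have h1 (x : R) : x \in `]0, c[ -> is_derive x (1 : R) (fun x => v x ^+ 2) (w x).
  rewrite in_itv/= => /andP[x0 xc]; apply: dv2.
  by rewrite in_itv/= x0 (lt_trans xc).
have h1c := sub 0 c (lexx 0) (ltW c1).
have [x1 + E1] := MVT c0 h1 h1c.
have h2 (x : R) : x \in `]c, 1[ -> is_derive x (1 : R) (fun x => v x ^+ 2) (w x).
  rewrite in_itv/= => /andP[x0 xc]; apply: dv2.
  by rewrite in_itv/= xc (lt_trans c0).
have h2c := sub c 1 (ltW c0) (lexx 1).
have [x2 + E2] := MVT c1 h2 h2c.
rewrite !in_itv/= => /andP[cx2 x21] /andP[x10 x1c].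
have w1 : 0 < w x1.
  rewrite -(pmulr_lgt0 _ (_ : 0 < c - 0)) ?subr0// -[X in _ * X]subr0 -E1.
  by rewrite v0 expr0n/= subr0.
have w2 : w x2 < 0.
  rewrite -(pmulr_llt0 _ (_ : 0 < 1 - c)) ?subr_gt0// -E2.
  by rewrite v1 expr0n/= sub0r oppr_lt0.
have dw (x : R) : x \in `]0, 1[ -> is_derive x (1 : R) w ((dv x ^+ 2 - l * v x ^+ 2) *+ 2).
  move=> x01; have [d1 d2] := d x x01.
  rewrite /w (_ : (fun x => _) = (v * dv) *+ 2); last first.
    by apply/funext => z; rewrite !mulr2n.
  apply: is_derive_eq; rewrite /GRing.scale/=; congr (_ *+ 2).
  by move: (v x) (dv x) => p q; ring.
have h3 (x : R) : x \in `]x1, x2[ ->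
    is_derive x (1 : R) w ((dv x ^+ 2 - l * v x ^+ 2) *+ 2).
  rewrite in_itv/= => /andP[x1x xx2]; apply: dw.
  by rewrite in_itv/= (lt_trans x10)//= (lt_trans xx2).
have h3c : {within `[x1, x2], continuous w}.
  apply: continuous_in_subspaceT => x /set_mem/=; rewrite in_itv/= => /andP[x1x xx2].
  apply: differentiable_continuous; apply/derivable1_diffP.
  have x01 : x \in `]0, 1[ by rewrite in_itv/= (lt_le_trans x10)//= (le_lt_trans xx2).
  by have [] := dw x x01.
have [z + E] := MVT (lt_trans x1c cx2) h3 h3c.
move=> _; have : 0 <= w x2 - w x1.
  rewrite E mulr_ge0 ?subr_ge0 ?(ltW (lt_trans x1c cx2))//.
  rewrite mulrn_wge0// subr_ge0 (le_trans (_ : _ <= 0))// ?sqr_ge0//.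
  by rewrite mulr_le0_ge0// sqr_ge0.
by rewrite leNgt subr_lt0 (lt_trans w2).
Qed.

(** [A] and [B] are the Wronskian-type first integrals of v'' = - w^2 v against sin (w x) and cos (w
    x). They are constant, and solving the two linear relations for v gives a combination of cosine
    and sine; the value at 0 removes the cosine. *)
Lemma eigenfunction_sin (l : R) (v dv : R -> R) :
  {within `[0, 1], continuous v} -> v 0 = 0 -> v 1 = 0 ->
  (forall x : R, x \in `]0, 1[ -> is_derive x (1 : R) v (dv x) /\
    is_derive x (1 : R) dv (- (l * v x))) -> 0 < l ->
  exists a, {in `[0, 1], forall x : R, v x = a * sin (Num.sqrt l * x)}
    /\ a * sin (Num.sqrt l) = 0.
Proof.
move=> cv v0 v1 d l0.
pose w := Num.sqrt l; have w0 : 0 < w by rewrite sqrtr_gt0.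
have wl : l = w ^+ 2 by rewrite sqr_sqrtr// ltW.
pose A x := v x * (w * cos (w * x)) - dv x * sin (w * x).
pose B x := v x * (w * sin (w * x)) + dv x * cos (w * x).
have dA (x : R) : x \in `]0, 1[ -> is_derive x (1 : R) A 0.
  move=> /d[d1 d2]; have ds := is_derive_sinM w x; have dc := is_derive_cosM w x.
  rewrite /A (_ : (fun x => _) = v * (w *: (fun x => cos (w * x))) -
     dv * (fun x => sin (w * x))); last by apply/funext => z.
  apply: is_derive_eq; rewrite /GRing.scale/= /GRing.scale/= wl.
  by move: (v x) (dv x) (cos _) (sin _) => p q r u; ring.
have dB (x : R) : x \in `]0, 1[ -> is_derive x (1 : R) B 0.
  move=> /d[d1 d2]; have ds := is_derive_sinM w x; have dc := is_derive_cosM w x.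
  rewrite /B (_ : (fun x => _) = v * (w *: (fun x => sin (w * x))) +
     dv * (fun x => cos (w * x))); last by apply/funext => z.
  apply: is_derive_eq; rewrite /GRing.scale/= /GRing.scale/= wl.
  by move: (v x) (dv x) (cos _) (sin _) => p q r u; ring.
have h01 : (2^-1 : R) \in `]0, 1[ by rewrite in_itv/= invr_gt0 ltr0n invf_lt1// ltr1n.
pose a := A 2^-1 / w; pose b := B 2^-1 / w.
have E : {in `]0, 1[, v =1 fun x => a * cos (w * x) + b * sin (w * x)}.
  move=> x x01; rewrite /a /b (derive0_cst dA h01 x01) (derive0_cst dB h01 x01) /A /B.
  have tr := cos2Dsin2 (w * x).
  move: (cos _) (sin _) tr (v x) (dv x) => C S tr p q.
  rewrite -[LHS]mulr1 -tr; field.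
  by rewrite lt0r_neq0.
have {}E := within_eq cv _ E.
have {}E : {in `[0, 1], v =1 fun x => a * cos (w * x) + b * sin (w * x)}.
  apply: E => x; apply: cvgD; apply: cvgMr; [exact: continuous_cosM|exact: continuous_sinM].
have a0 : a = 0.
  have := E 0; rewrite in_itv/= lexx ler01 => /(_ isT).
  by rewrite v0 mulr0 cos0 sin0 mulr0 mulr1 addr0.
exists b; split; first by move=> x /E ->; rewrite a0 mul0r add0r.
have := E 1; rewrite in_itv/= lexx ler01 => /(_ isT).
by rewrite v1 mulr1 a0 mul0r add0r.
Qed.


Lemma ip_eq_sin (u v : L2D R) (a b : R) (n m : nat) : (1 <= n)%N ->
  (forall x : R, 0 <= x <= 1 -> u x = a * sin (n%:R * pi * x)) ->
  (forall x : R, 0 <= x <= 1 -> v x = b * sin (m%:R * pi * x)) ->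
  ip u v = a * b * ((n == m)%:R / 2).
Proof.
move=> n1 hu hv; apply: EFin_inj; rewrite ipED EFinM -(int_sinsin _ n1).
have i1 : mu.-integrable `[0, 1]
    (fun x : R => (sin (n%:R * pi * x) * sin (m%:R * pi * x))%:E).
  apply: continuous_integrable => x.
  by apply: cvgM; exact: continuous_sinM.
rewrite -(integralZl _ i1)//.
rewrite /D -(@integral_itv_bndoo _ _ _ _ true false); last first.
  apply/measurable_EFinP; apply: measurable_funTS.
  by apply: measurable_funM; exact: measurable_L2.
apply: eq_integral => x; rewrite inE/= in_itv/= => x01.
by rewrite -EFinM hu// hv//; congr (_%:E); ring.
Qed.

Lemma exists_sin (n : nat) : exists u : L2D R,
  forall x, u x = sin (n%:R * pi * x).
Proof.
have [||u E] := @exists_L2 R (fun x => sin (n%:R * pi * x)).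
- by apply: continuous_measurable_fun; exact: continuous_sinM.
- apply: (@le_lt_trans _ _ (\int[mu]_(x in D) (cst 1 x))%E).
    apply: ge0_le_int; first exact: measurable_D.
    + by move=> x _; rewrite lee_fin sqr_ge0.
    + apply: measurable_funTS; apply/measurable_EFinP; apply: measurable_funX.
      by apply: continuous_measurable_fun; exact: continuous_sinM.
    + exact: measurable_cst.
    + by move=> x _; rewrite lee_fin sin2cos2 gerBl sqr_ge0.
  rewrite integral_cst ?mul1e; last exact: measurable_D.
  have := @lebesgue_measure_itv R `]0%R, 1%R[.
  by rewrite /= lte_fin ltr01 -EFinB => ->; rewrite ltry.
by exists u => x; rewrite E.
Qed.

Lemma eigenpair_sin (l : R) (v : L2D R) : dirichlet_eigenpair l v -> ip v v = 1 ->
  exists n : nat, exists a, [/\ (1 <= n)%N, l = (n%:R * pi) ^+ 2, a ^+ 2 = 2 &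
    {in `[0, 1], forall x : R, v x = a * sin (n%:R * pi * x)}].
Proof.
move=> hv v1; have d x := @eigenpair_is_derive l v x hv; have [cv [v_0 v_1] _] := hv.
have ipn0 : ~ (forall x, x \in `]0, 1[ -> v x = 0).
  move=> h; suff : ip v v = 0 by rewrite v1 => /eqP; rewrite oner_eq0.
  apply: EFin_inj; rewrite ipED integral0_eq// => x; rewrite /D/= => xD.
  by rewrite h// mul0r.
have [l0|l0] := leP l 0.
  by exfalso; apply: ipn0; exact: (eigenvalue_gt0 cv v_0 v_1 d l0).
have [a [va a0]] := eigenfunction_sin cv v_0 v_1 d l0.
have an0 : a != 0.
  apply/eqP => a0'; apply: ipn0 => x x01; rewrite va ?a0' ?mul0r//.
  by apply: subset_itv_oo_cc.
have /eqP := a0; rewrite mulf_eq0 (negbTE an0)/= => /eqP sw.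
have w0 : 0 < Num.sqrt l by rewrite sqrtr_gt0.
have [n n1 wE] := sin_eq0 w0 sw.
rewrite wE in va.
exists n, a; split => //; first by rewrite -wE sqr_sqrtr// ltW.
have hx (x : R) : 0 <= x <= 1 -> v x = a * sin (n%:R * pi * x).
  by move=> x01; apply: va; rewrite in_itv/=.
have := ip_eq_sin n1 hx hx; rewrite v1 eqxx -expr2 => h.
by move: h; rewrite mulr1n; move: (a ^+ 2) => q; lra.
Qed.

(** Each phi k is a multiple of some sin (n k pi x). Orthonormality makes n injective, the ordering
    of the eigenvalues makes it nondecreasing, and completeness makes it surjective, because a
    missing sine would be orthogonal to every phi k. The identity is the only such map. *)
Lemma spectrum_sin (lam : nat -> R) (phi : nat -> L2D R) : dirichlet_spectrum lam phi ->
  exists a : nat -> R, forall k, (1 <= k)%N ->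
  [/\ lam k = (k%:R * pi) ^+ 2, a k ^+ 2 = 2 &
    {in `[0, 1], forall x : R, phi k x = a k * sin (k%:R * pi * x)}].
Proof.
move=> [he ho hm hc].
have /choice[n /choice[a hna]] : forall k, exists n : nat, exists a, (1 <= k)%N ->
  [/\ (1 <= n)%N, lam k = (n%:R * pi) ^+ 2, a ^+ 2 = 2 &
    {in `[0, 1], forall x : R, phi k x = a * sin (n%:R * pi * x)}].
  move=> k; have [k1|k0] := leqP 1 k; last by exists 0%N, 0.
  have [|m [b h]] := eigenpair_sin (he k k1); first by rewrite ho// eqxx.
  by exists m, b.
have hx k : (1 <= k)%N -> forall x : R, 0 <= x <= 1 -> phi k x = a k * sin ((n k)%:R * pi * x).
  by move=> k1 x x01; have [_ _ _ ->//] := hna k k1.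
have n1 k : (1 <= k)%N -> (1 <= n k)%N by move=> /hna[].
have pi0 := @pi_gt0 R.
have ninj j k : (1 <= j)%N -> (1 <= k)%N -> n j = n k -> j = k.
  move=> j1 k1 jk; apply/eqP/negPn/negP => jnk.
  have := ip_eq_sin (n1 j j1) (hx j j1) (hx k k1).
  rewrite ho// (negbTE jnk) jk eqxx => /esym/eqP.
  have [_ _ aj _] := hna j j1; have [_ _ ak _] := hna k k1.
  rewrite mulf_eq0 mul1r invr_eq0 pnatr_eq0/= orbF mulf_eq0 -!(sqrf_eq0 (a _)) aj ak.
  by rewrite pnatr_eq0.
have nmono j k : (1 <= j)%N -> (j <= k)%N -> (n j <= n k)%N.
  move=> j1 jk; have k1 := leq_trans j1 jk.
  have := hm j k j1 jk; have [_ -> _ _] := hna j j1; have [_ -> _ _] := hna k k1.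
  by rewrite ler_pXn2r ?nnegrE ?mulr_ge0 ?(ltW pi0)// ler_pM2r// ler_nat.
have nsurj m : (1 <= m)%N -> exists2 k, (1 <= k)%N & n k = m.
  move=> m1; apply: contrapT => hne; have [u hu] := exists_sin m.
  have hu' (x : R) : 0 <= x <= 1 -> u x = 1 * sin (m%:R * pi * x) by rewrite hu mul1r.
  have : ip u u = 0.
    apply/L2norm_eq0/hc => k k1; rewrite (ip_eq_sin m1 hu' (hx k k1)).
    case: eqP => [E|_]; last by rewrite mul0r mulr0.
    by exfalso; apply: hne; exists k.
  rewrite (ip_eq_sin m1 hu' hu') eqxx => /eqP.
  by rewrite !mul1r invr_eq0 pnatr_eq0.
have nlt j k : (1 <= j)%N -> (j < k)%N -> (n j < n k)%N.
  move=> j1 jk; rewrite ltn_neqAle nmono ?(ltnW jk)// andbT.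
  apply/eqP => /(ninj _ _ j1 (leq_trans j1 (ltnW jk))) E.
  by move: jk; rewrite E ltnn.
(* Strong induction: the index i with n i = k cannot be smaller than k, where n is already the
   identity, nor larger, since n is strictly increasing and n k >= k. *)
have nk k : (1 <= k)%N -> n k = k.
  elim/ltn_ind: k => k IH k1.
  have [i i1 ni] := nsurj k k1.
  have [ik|ki|E] := ltngtP i k; last by rewrite -{1}E.
    by move: (IH i ik i1) (ik); rewrite ni => ->; rewrite ltnn.
  have h : (k <= n k)%N.
    have [k2|] := leqP 2 k; last by case: (k) k1 => [|[|]]// _ _; exact: n1.
    have k1' : (1 <= k.-1)%N by rewrite -ltnS prednK.
    have := nlt k.-1 k k1'; rewrite prednK// => /(_ (leqnn _)).
    by rewrite IH ?prednK.
  by have := nlt k i k1 ki; rewrite ni ltnNge h.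
exists a => k k1; have [_ h1 h2 h3] := hna k k1.
by rewrite (nk k k1) in h1 h3.
Qed.

End eigen.

(** * Fourier expansion of the fractional Brownian covariance *)

Section helpers.
Context {R : realType}.
Notation mu := (@lebesgue_measure R).

Lemma sin_le_id (x : R) : 0 <= x -> sin x <= x.
Proof.
move=> x0; have := @int_cos R 1 x (oner_neq0 _) x0.
rewrite mul1r divr1 => E; rewrite -lee_fin -E.
apply: (@le_trans _ _ (\int[mu]_(y in `[0%R, x]) (cst 1 y))%E).
  apply: le_integral => //.
  - by apply: continuous_integrable; exact: continuous_cosM.
  - by apply: (@continuous_integrable R (cst 1)); exact: cst_continuous.
  - by move=> y _; rewrite lee_fin cos_le1.
rewrite integral_cst//= mul1e lebesgue_measure_itv/= lte_fin.
by case: ltP => _; rewrite ?lee_fin// subr0 lexx.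
Qed.

Lemma norm_sin_le (x : R) : `|sin x| <= `|x|.
Proof.
wlog x0 : x / 0 <= x.
  move=> h; have [/h//|/ltW x0] := leP 0 x.
  by have := h (- x); rewrite sinN !normrN oppr_ge0 => /(_ x0).
rewrite (ger0_norm x0); have [x1|x1] := leP x 1; last by rewrite (le_trans _ (ltW x1))// sin_max.
rewrite ger0_norm ?sin_le_id// sin_ge0_pi// x0 (le_trans x1)// (le_trans _ (pi_ge2 _))// ler1n//.
Qed.

Lemma onem_cosE (x : R) : 1 - cos x = (sin (x / 2)) ^+ 2 *+ 2.
Proof.
have -> : cos x = cos ((x / 2) *+ 2) by congr cos; rewrite mulr2n; lra.
by rewrite cos_mulr2n sin2cos2; ring.
Qed.

Lemma onem_cos_ge0 (x : R) : 0 <= 1 - cos x.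
Proof. by rewrite subr_ge0 cos_le1. Qed.

Lemma onem_cos_le2 (x : R) : 1 - cos x <= 2.
Proof. by have := cos_geN1 x; lra. Qed.

Lemma onem_cos_le (x : R) : 1 - cos x <= x ^+ 2.
Proof.
rewrite onem_cosE; have : sin (x / 2) ^+ 2 <= (x / 2) ^+ 2.
  by rewrite -(real_normK (num_real (sin _))) -(real_normK (num_real (x / 2))) ler_pXn2r ?nnegrE// norm_sin_le.
by move: (sin _) => S; have := sqr_ge0 x; move=> h1 h2; rewrite -mulr_natl; nra.
Qed.

Lemma bounded_integrable_itv (f : R -> R) (a b M : R) :
  measurable_fun (setT : set (measurableTypeR R)) f ->
  (forall x, a <= x <= b -> `|f x| <= M) -> mu.-integrable `[a, b] (EFin \o f).
Proof.
move=> mf fM; apply: measurable_bounded_integrable => //.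
- rewrite /= lebesgue_measure_itv/=; case: ifP => _; last exact: ltry.
  by rewrite -EFinB ltry.
- exact: measurable_funTS.
- exists M; split; first exact: num_real.
  by move=> N MN x /=; rewrite in_itv/= => xab; rewrite (le_trans (fM _ xab))// ltW.
Qed.

End helpers.

Section fourier.
Context {R : realType}.
Notation mu := (@lebesgue_measure R).
Variable p : R.
Hypothesis p0 : 0 < p.
Hypothesis p1 : p <= 1.

(* Cosine coefficients: t ^ p is the sum of [fcoef k * (1 - cos (k pi t))] on [0, 1]. *)
Definition fcoef (k : nat) : R :=
  - 2 * \int[mu]_(t in `[0%R, 1%R]) (t `^ p * cos (k%:R * pi * t)).

Lemma powR01 (t : R) : 0 <= t <= 1 -> 0 <= t `^ p <= 1.
Proof.
move=> /andP[t0 t1]; rewrite powR_ge0/=.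
by have := le_powR (ltW p0) t0 t1; rewrite powR1.
Qed.

Lemma fcoef_int k : (\int[mu]_(t in `[0%R, 1%R]) (t `^ p * cos (k%:R * pi * t))%:E =
  (- (fcoef k / 2))%:E)%E.
Proof.
have i : mu.-integrable `[0, 1] (fun t : R => (t `^ p * cos (k%:R * pi * t))%:E).
  apply: (@bounded_integrable_itv _ (fun t => t `^ p * cos (k%:R * pi * t)) _ _ 1).
    apply: measurable_funM; first exact: measurable_powR.
    by apply: continuous_measurable_fun; exact: continuous_cosM.
  move=> x /powR01/andP[h1 h2]; rewrite normrM (ger0_norm h1) mulr_ile1// ?norm_cos_le1//.
  exact: cos_max.
rewrite -[LHS]fineK; last exact: integrable_fin_num.
by rewrite /fcoef /Rintegral; congr (_%:E); move: (fine _) => q; field.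
Qed.

Section one.
Variable k : nat.
Hypothesis k1 : (1 <= k)%N.
Let w := k%:R * pi : R.
Lemma w0 : 0 < w.
Proof. by rewrite mulr_gt0 ?pi_gt0// ltr0n. Qed.
Let j (t : R) := t `^ (p - 2) * (1 - cos (w * t)).

Lemma j_ge0 t : 0 <= j t.
Proof. by rewrite mulr_ge0 ?powR_ge0 ?onem_cos_ge0. Qed.

Lemma j_le t : 0 <= t -> j t <= w ^+ 2 * t `^ p.
Proof.
rewrite le_eqVlt => /predU1P[<-|t0].
  by rewrite /j mulr0 cos0 subrr mulr0 mulr_ge0 ?sqr_ge0 ?powR_ge0.
rewrite -[in leRHS](subrK 2 p) powRD_gt0// powR_mulrn ?(ltW t0)//.
rewrite mulrCA ler_wpM2l ?powR_ge0// -exprMn; exact: onem_cos_le.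
Qed.

Lemma mj : measurable_fun (setT : set (measurableTypeR R)) j.
Proof.
apply: measurable_funM; first exact: measurable_powR.
apply: measurable_funB => //.
by apply: continuous_measurable_fun; exact: continuous_cosM.
Qed.

Lemma ij : mu.-integrable `[0, 1] (EFin \o j).
Proof.
apply: (@bounded_integrable_itv _ _ _ _ (w ^+ 2)); first exact: mj.
move=> x x01; have j_ge0 := j_ge0.
have /andP[x0 _] := x01; have /andP[_ h2] := powR01 x01.
by rewrite ger0_norm// (le_trans (j_le x0))// ler_piMr// sqr_ge0.
Qed.

(** Two integrations by parts. Taking 1 - cos as the primitive of the sine makes the boundary terms
    at 0 vanish, and both terms on the right become visibly nonnegative when p <= 1. *)
Lemma fcoefE : fcoef k * w ^+ 2 = (2 * p) *
  ((1 - cos w) + (1 - p) * \int[mu]_(t in `[0%R, 1%R]) j t).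
Proof.
have w0 := w0; have ij := ij; have mj := mj; have j_ge0 := j_ge0; have j_le := j_le.
pose Phi (t : R) := t `^ (p - 1) * (1 - cos (w * t)) - (w / p) * (t `^ p * sin (w * t)).
pose g (t : R) := - (1 - p) * j t - (w ^+ 2 / p) * (t `^ p * cos (w * t)).
have gb t : 0 <= t -> `|g t| <= (w ^+ 2 * (1 + p^-1)) * t `^ p.
  move=> t0; apply: (le_trans (ler_normB _ _)); rewrite mulrDr mulr1 mulrDl.
  apply: lerD.
    rewrite normrM normrN (ger0_norm (j_ge0 t)) (le_trans _ (j_le _ t0))//.
    by rewrite ger0_norm ?subr_ge0// ler_piMl ?j_ge0// gerBl ltW.
  rewrite normrM (@ger0_norm _ (_ / _)) ?divr_ge0 ?sqr_ge0 ?(ltW p0)//.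
  rewrite ler_wpM2l ?divr_ge0 ?sqr_ge0 ?(ltW p0)// normrM (ger0_norm (powR_ge0 _ _)).
  by rewrite ler_piMr ?powR_ge0 ?cos_max.
have dPhi (t : R) : 0 < t -> is_derive t (1 : R) Phi (g t).
  move=> t0.
  have d1 : is_derive t (1 : R) (fun t : R => t `^ (p - 1)) ((p - 1) * t `^ (p - 1 - 1)).
    by apply: is_derive1_powR.
  have d2 : is_derive t (1 : R) (fun t : R => t `^ p) (p * t `^ (p - 1)).
    by apply: is_derive1_powR.
  have ds := is_derive_sinM w t; have dc := is_derive_cosM w t.
  rewrite /Phi (_ : (fun t => _) = (fun t : R => t `^ (p - 1)) *
    (cst 1 - (fun t => cos (w * t))) - (w / p) *: ((fun t : R => t `^ p) * (fun t => sin (w * t)))); last first.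
    by apply/funext => z.
  apply: is_derive_eq; rewrite /GRing.scale/= /GRing.scale/= /g /j.
  rewrite (_ : p - 1 - 1 = p - 2); last by ring.
  rewrite [X in X * ((p - 1) * _)](_ : _ = 1 - cos (w * t))//.
  move: (t `^ _) (t `^ _) (t `^ _) (cos _) (sin _) => x1 x2 x3 C S.
  by field; rewrite lt0r_neq0.
have Phi0 : Phi 0 = 0 by rewrite /Phi !mulr0 cos0 sin0 subrr !mulr0 subrr.
have Phi1 : Phi 1 = 1 - cos w.
  by rewrite /Phi !powR1 !mul1r !mulr1 sin_npi mulr0 subr0.
have g0 : g t @[t --> 0^'+] --> g 0.
  have -> : g 0 = 0 by have := gb 0 (lexx _); rewrite powR0 ?gt_eqF// mulr0 normr_le0 => /eqP.
  have lim : (w ^+ 2 * (1 + p^-1)) * t `^ p @[t --> 0^'+] --> (0 : R).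
    by rewrite -[X in _ --> X](mulr0 (w ^+ 2 * (1 + p^-1))); apply: cvgMr; exact: powR_cvg0.
  apply: (squeeze_cvgr (f := fun t : R => - ((w ^+ 2 * (1 + p^-1)) * t `^ p)) (h := fun t : R => (w ^+ 2 * (1 + p^-1)) * t `^ p)) => //.
  - near=> t; rewrite -ler_norml gb//; near: t; exact: nbhs_right_ge.
  - by rewrite -[X in _ --> X]oppr0; exact: cvgN.
have cg t : 0 < t -> {for t, continuous g}.
  move=> t0; apply: cvgB; apply: cvgMr.
    by apply: cvgM; [exact: continuous_powR_gt0|apply: cvgB; [exact: cvg_cst|exact: continuous_cosM]].
  by apply: cvgM; [exact: continuous_powR_gt0|exact: continuous_cosM].
have cgw : {within `[0, 1], continuous g}.
  apply/continuous_within_itvP => //; split => //.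
  - by move=> t; rewrite in_itv/= => /andP[t0 _]; exact: cg.
  - by apply: cvg_at_left_filter; exact: cg.
have cP t : 0 < t -> {for t, continuous Phi}.
  move=> t0; apply: differentiable_continuous; apply/derivable1_diffP.
  by have [] := dPhi t t0.
have LR : derivable_oo_LRcontinuous Phi 0 1.
  split.
  - by move=> t; rewrite in_itv/= => /andP[t0 _]; have [] := dPhi t t0.
  - rewrite Phi0.
    have hb t : 0 < t -> `|Phi t| <= (w ^+ 2 + w ^+ 2 / p) * (t `^ p * t).
      move=> t0; apply: (le_trans (ler_normB _ _)); rewrite mulrDl; apply: lerD.
        rewrite normrM (ger0_norm (powR_ge0 _ _)) (ger0_norm (onem_cos_ge0 _)).
        rewrite (le_trans (ler_wpM2l (powR_ge0 _ _) (onem_cos_le _)))//.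
        have -> : t `^ p = t `^ (p - 1) * t by rewrite -{1}(subrK 1 p) (@powRD_gt0 _ _ (p - 1) 1)// powRr1// ltW.
        by apply: le_of_eq; move: (t `^ _) => q; ring.
      have wp0 : 0 <= w / p by rewrite divr_ge0// ltW.
      rewrite normrM (ger0_norm wp0) normrM (ger0_norm (powR_ge0 _ _)).
      have := norm_sin_le (w * t); rewrite (ger0_norm (ltW (mulr_gt0 w0 t0))) => hs.
      rewrite (_ : w ^+ 2 / p * (t `^ p * t) = w / p * (t `^ p * (w * t))); last by move: (t `^ _) => q; ring.
      by rewrite ler_wpM2l ?divr_ge0 ?(ltW w0) ?(ltW p0)// ler_wpM2l ?powR_ge0.
    have lim : (w ^+ 2 + w ^+ 2 / p) * (t `^ p * t) @[t --> 0^'+] --> (0 : R).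
      rewrite -[X in _ --> X](mulr0 (w ^+ 2 + w ^+ 2 / p)); apply: cvgMr.
      rewrite -[X in _ --> X](mulr0 0); apply: cvgM; first exact: powR_cvg0.
      by apply: cvg_at_right_filter; exact: cvg_id.
    apply: (squeeze_cvgr (f := fun t : R => - ((w ^+ 2 + w ^+ 2 / p) * (t `^ p * t))) (h := fun t : R => (w ^+ 2 + w ^+ 2 / p) * (t `^ p * t))) => //.
      near=> t; rewrite -ler_norml hb//; near: t; exact: nbhs_right_gt.
    by rewrite -[X in _ --> X]oppr0; exact: cvgN.
  - by apply: cvg_at_left_filter; exact: cP.
have F := @continuous_FTC2 R g Phi 0 1 ltr01 cgw LR.
have {}F : (\int[mu]_(x in `[0%R, 1%R]) (g x)%:E = (1 - cos w)%:E)%E.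
  rewrite F ?Phi0 ?Phi1 ?sube0// => t; rewrite in_itv/= => /andP[t0 _].
  by have d := dPhi t t0; rewrite derive1E derive_val.
have ic : mu.-integrable `[0, 1] (fun t : R => (t `^ p * cos (w * t))%:E).
  apply: (@bounded_integrable_itv _ (fun t => t `^ p * cos (w * t)) _ _ 1).
    apply: measurable_funM; first exact: measurable_powR.
    by apply: continuous_measurable_fun; exact: continuous_cosM.
  move=> x /powR01/andP[h1 h2]; rewrite normrM (ger0_norm h1) mulr_ile1// ?norm_cos_le1//.
  exact: cos_max.
have : (\int[mu]_(x in `[0%R, 1%R]) (g x)%:E =
    (- (1 - p))%:E * \int[mu]_(x in `[0%R, 1%R]) (j x)%:E +
    (- (w ^+ 2 / p))%:E * \int[mu]_(x in `[0%R, 1%R]) (x `^ p * cos (w * x))%:E)%E.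
  transitivity (\int[mu]_(x in `[0%R, 1%R]) ((- (1 - p))%:E * (j x)%:E +
     (- (w ^+ 2 / p))%:E * (x `^ p * cos (w * x))%:E))%E.
    by apply: eq_integral => x _; rewrite -!EFinM -EFinD /g; congr (_ + _)%:E; rewrite mulNr.
  rewrite integralD//; [|exact: integrableZl|exact: integrableZl].
  by congr (_ + _)%E; exact: integralZl.
rewrite F fcoef_int -[X in (_ * X + _)%E]fineK; last exact: integrable_fin_num.
rewrite -!EFinM -EFinD => -[]; rewrite -/(Rintegral _ _ _).
move: (Rintegral _ _ _) (fcoef k) (cos w) => J a C h.
have -> : 1 - C = - (1 - p) * J + w ^+ 2 / p * (a / 2) by rewrite h; ring.
by field; rewrite lt0r_neq0.
Unshelve. all: by end_near. Qed.

Lemma fcoef_ge0 : 0 <= fcoef k.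
Proof.
have w0 := w0; have ij := ij; have mj := mj; have j_ge0 := j_ge0; have j_le := j_le.
have w20 : 0 < w ^+ 2 by rewrite exprn_gt0.
rewrite -(pmulr_lge0 _ w20) fcoefE.
rewrite mulr_ge0 ?mulr_ge0 ?(ltW p0)// addr_ge0 ?onem_cos_ge0//.
by rewrite mulr_ge0 ?subr_ge0// Rintegral_ge0.
Qed.

Lemma kinv_gt0 : 0 < k%:R^-1 :> R. Proof. by rewrite invr_gt0 ltr0n. Qed.
Lemma kinv1 : k%:R^-1 <= 1 :> R. Proof. by rewrite invf_le1 ?ltr0n// ler1n. Qed.
Lemma kpow q : (k%:R^-1 : R) `^ q = k%:R `^ (- q).
Proof. by rewrite -powR_inv1 ?ler0n// -powRrM mulN1r. Qed.

(** In [fcoefE] the integral of [j] is split at 1 / k: below, 1 - cos x <= x^2; above, 1 - cos x <=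
    2, so both parts have order k^(1-p). The second part is computed by division by 1 - p, hence the
    separate case p = 1, where the term carries the factor 0. *)
Lemma fcoef_sqr_le : fcoef k * w ^+ 2 <= 2 * (4 + pi ^+ 2) * k%:R `^ (1 - p).
Proof.
have w0 := w0; have ij := ij; have mj := mj; have j_ge0 := j_ge0; have j_le := j_le.
have kinv_gt0 := kinv_gt0; have kinv1 := kinv1.
have kp1 : 1 <= (k%:R : R) `^ (1 - p).
  by rewrite -[leLHS](powRr0 k%:R) ler_powR ?ler1n// subr_ge0.
rewrite fcoefE.
have : (1 - p) * \int[mu]_(t in `[0%R, 1%R]) j t <= (pi ^+ 2 + 2) * k%:R `^ (1 - p).
  have [->|pn1] := eqVneq p 1.
    by rewrite subrr mul0r mulr_ge0 ?powR_ge0// addr_ge0// sqr_ge0.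
  have {}pn1 : 0 < 1 - p by rewrite subr_gt0 lt_neqAle pn1.
  rewrite -ler_pdivlMl// -lee_fin /Rintegral fineK; last exact: integrable_fin_num.
  rewrite -integral_itv_obnd_cbnd; last by apply/measurable_EFinP; exact: measurable_funTS.
  have -> : `]0%R, 1%R]%classic = `]0%R, k%:R^-1]%classic `|` `]k%:R^-1, 1%R]%classic :> set R.
    by rewrite -itv_bndbnd_setU// bnd_simp.
  have mje (A : set (measurableTypeR R)) : measurable_fun A (fun t => (j t)%:E).
    by apply/measurable_EFinP; exact: measurable_funTS.
  rewrite ge0_integral_setU//; last 2 first.
  - by move=> t _; rewrite lee_fin.
  - apply/disj_setPS => t [] /=; rewrite !in_itv/= => /andP[_ h1] /andP[h2 _].
    by move: h2; rewrite ltNge h1.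
  have E1 : (\int[mu]_(t in `]0%R, k%:R^-1%R]) (j t)%:E <= (pi ^+ 2 * k%:R `^ (1 - p))%:E)%E.
    apply: (@le_trans _ _ (\int[mu]_(t in `]0%R, k%:R^-1%R]) ((w ^+ 2)%:E * (t `^ (p + 1 - 1))%:E))%E).
      apply: ge0_le_int => //.
      - by move=> t _; rewrite lee_fin.
      - by apply: measurable_funeM; exact: measurable_EFin_powR.
      - by move=> t; rewrite /= in_itv/= => /andP[/ltW t0 _]; rewrite -EFinM lee_fin addrK j_le.
    rewrite ge0_integralZl//; last 3 first.
    - exact: measurable_EFin_powR.
    - by move=> t _; rewrite lee_fin powR_ge0.
    - by rewrite lee_fin sqr_ge0.
    have p10 : 0 < p + 1 by rewrite addr_gt0.
    rewrite integral_powR ?(ltW kinv_gt0)// -EFinM lee_fin.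
    have kE : (k%:R : R) ^+ 2 * (k%:R^-1 `^ (p + 1)) = k%:R `^ (1 - p).
      rewrite kpow -powR_mulrn ?ler0n// -powRD_gt0 ?ltr0n//.
      by congr (_ `^ _); ring.
    rewrite (_ : w ^+ 2 * _ = pi ^+ 2 * k%:R `^ (1 - p) / (p + 1)); last first.
      by rewrite -kE /w; move: (_ `^ _) => q; ring.
    rewrite ler_pdivrMr// ler_peMr ?mulr_ge0 ?sqr_ge0 ?powR_ge0 ?pi_ge0//.
    by rewrite lerDr ltW.
  have E2 : (\int[mu]_(t in `]k%:R^-1%R, 1%R]) (j t)%:E <= (2 / (1 - p) * k%:R `^ (1 - p))%:E)%E.
    rewrite integral_itv_obnd_cbnd; last exact: mje.
    apply: (@le_trans _ _ (\int[mu]_(t in `[k%:R^-1%R, 1%R]) (2 * t `^ (p - 2))%:E)%E).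
      apply: ge0_le_int => //.
      - by move=> t _; rewrite lee_fin.
      - by apply/measurable_EFinP; apply: measurable_funM => //; apply: measurable_funTS; exact: measurable_powR.
      - by move=> t _; rewrite lee_fin /j mulrC ler_wpM2r ?powR_ge0 ?onem_cos_le2.
    have F1 (t : R) : k%:R^-1 <= t <= 1 -> is_derive t (1 : R) (fun t => 2 / (p - 1) * t `^ (p - 1)) (2 * t `^ (p - 2)).
      move=> /andP[t0 _]; have {}t0 := lt_le_trans kinv_gt0 t0.
      have d1 : is_derive t (1 : R) (fun t : R => t `^ (p - 1)) ((p - 1) * t `^ (p - 1 - 1)).
        by apply: is_derive1_powR.
      have -> : 2 * t `^ (p - 2) = 2 / (p - 1) *: ((p - 1) * t `^ (p - 1 - 1)); last exact: is_deriveZ.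
      rewrite /GRing.scale/= (_ : p - 1 - 1 = p - 2); last by ring.
      move: (_ `^ _) => q; field.
      by rewrite -opprB oppr_eq0 lt0r_neq0.
    have F2 (t : R) : k%:R^-1 <= t <= 1 -> {for t, continuous (fun t => 2 * t `^ (p - 2))}.
      move=> /andP[t0 _]; have {}t0 := lt_le_trans kinv_gt0 t0.
      by apply: cvgMr; exact: continuous_powR_gt0.
    rewrite (FTC2_cc kinv1 F1 F2).
    rewrite lee_fin powR1 mulr1 kpow opprB.
    rewrite (_ : _ - _ = 2 / (1 - p) * k%:R `^ (1 - p) - 2 / (1 - p)).
      by rewrite gerBl divr_ge0// ltW.
    move: (_ `^ _) => q; field.
    by rewrite (gt_eqF pn1) -opprB oppr_eq0 (gt_eqF pn1).
  apply: (le_trans (leeD E1 E2)).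
  rewrite -EFinD lee_fin ler_pdivlMl// (_ : _ * _ = (1 - p) * pi ^+ 2 * k%:R `^ (1 - p) + 2 * k%:R `^ (1 - p)); last first.
    by move: (_ `^ _) => q; field; rewrite lt0r_neq0.
  rewrite [leRHS]mulrDl lerD2r ler_wpM2r ?powR_ge0// ler_piMl ?sqr_ge0//.
  by rewrite gerBl ltW.
have := onem_cos_le2 w; have := onem_cos_ge0 w.
have kp0 : 0 <= (k%:R : R) `^ (1 - p) by rewrite powR_ge0.
move: (cos w) ((1 - p) * _) kp0 kp1 => C I; move: (k%:R `^ _) => K K0 K1 C0 C2 h.
apply: (@le_trans _ _ (2 * p * ((4 + pi ^+ 2) * K))).
  by rewrite ler_wpM2l ?mulr_ge0 ?(ltW p0)// (_ : _ * K = 2 * K + (pi ^+ 2 + 2) * K); [lra|ring].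
rewrite -!mulrA ler_wpM2l// ler_piMl// mulr_ge0// addr_ge0 ?sqr_ge0//.
Qed.

Lemma fcoef_le : fcoef k <= 2 * (4 + pi ^+ 2) * k%:R `^ (- (1 + p)).
Proof.
have k0 : 0 < (k%:R : R) by rewrite ltr0n.
have w20 : 0 < w ^+ 2 by rewrite exprn_gt0// w0.
rewrite -(ler_pM2r w20) (le_trans fcoef_sqr_le)//.
rewrite -!mulrA ler_wpM2l// ler_wpM2l ?addr_ge0 ?sqr_ge0//.
rewrite (_ : 1 - p = - (1 + p) + 2); last by ring.
rewrite powRD_gt0// ler_wpM2l ?powR_ge0// powR_mulrn ?ler0n// /w exprMn.
by rewrite ler_peMr ?sqr_ge0// exprn_ege1// (le_trans _ (pi_ge2 _))// ler1n.
Qed.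

(** The integral of [j] is restricted to [1 / (2 k), 1 / k]: there the angle lies in [pi / 2, pi],
    so 1 - cos is at least 1, and t^(p-2) is at least k^(2-p). *)
Lemma fcoef_sqr_ge : 2 * p * ((1 - cos w) + (1 - p) * (k%:R `^ (1 - p) / 2)) <= fcoef k * w ^+ 2.
Proof.
have kinv_gt0 := kinv_gt0; have kinv1 := kinv1; have w0 := w0.
have k0 : 0 < (k%:R : R) by rewrite ltr0n.
rewrite fcoefE ler_wpM2l ?mulr_ge0 ?(ltW p0)// lerD2l ler_wpM2l ?subr_ge0//.
rewrite -lee_fin /Rintegral fineK; last exact: integrable_fin_num ij.
have kh : k%:R^-1 / 2 <= k%:R^-1 :> R by rewrite ler_pdivrMr// ler_peMr ?ler1n// ltW.
have kh0 : 0 < k%:R^-1 / 2 :> R by rewrite divr_gt0.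
apply: (@le_trans _ _ (\int[mu]_(t in `[(k%:R^-1 / 2)%R, k%:R^-1%R]) (j t)%:E)%E); last first.
  apply: ge0_subset_integral => //=.
  - by apply/measurable_EFinP; apply: measurable_funTS; exact: mj.
  - by move=> t _; rewrite lee_fin j_ge0.
  - move=> t /=; rewrite !in_itv/= => /andP[h1 h2]; rewrite (le_trans h2)// andbT.
    by rewrite (le_trans _ h1)// ltW.
apply: (@le_trans _ _ (\int[mu]_(t in `[(k%:R^-1 / 2)%R, k%:R^-1%R]) (cst (k%:R `^ (2 - p))%:E t))%E).
  rewrite integral_cst//= lebesgue_measure_itv/= lte_fin ltr_pdivrMr// ltr_pMr// ltr1n/=.
  rewrite -EFinB -EFinM lee_fin (_ : 2 - p = 1 - p + 1); last by ring.
  rewrite (@powRD_gt0 _ _ (1 - p) 1)// powRr1 ?(ltW k0)//; apply: le_of_eq.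
  by move: (_ `^ _) => q; field; rewrite lt0r_neq0.
apply: ge0_le_int => //.
- by move=> t _; rewrite lee_fin powR_ge0.
- by apply/measurable_EFinP; apply: measurable_funTS; exact: mj.
move=> t /=; rewrite in_itv/= => /andP[h1 h2]; rewrite lee_fin.
have t0 := lt_le_trans kh0 h1.
have hc : 1 <= 1 - cos (w * t).
  rewrite lerBrDr gerDl -oppr_ge0 (_ : - cos (w * t) = sin (w * t - pi / 2)); last first.
    by rewrite sinBpihalf.
  have e1 : pi / 2 <= w * t.
    have := ler_wpM2l (ltW w0) h1; apply: le_trans; apply: le_of_eq.
    by rewrite /w; field; rewrite lt0r_neq0.
  have e2 : w * t <= pi.
    have := ler_wpM2l (ltW w0) h2; move/le_trans; apply; apply: le_of_eq.
    by rewrite /w; field; rewrite lt0r_neq0.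
  apply: sin_ge0_pi; rewrite subr_ge0 e1/= lerBlDr (le_trans e2)// lerDl.
  by rewrite divr_ge0// pi_ge0.
rewrite -[leLHS]mulr1; apply: ler_pM; rewrite ?powR_ge0 ?ler01//.
rewrite (_ : 2 - p = - (p - 2)); last by ring.
rewrite -kpow -[X in _ <= t `^ X]opprK -[X in X <= _]/(k%:R^-1 `^ _) -{1}[p - 2]opprK.
rewrite !(powRN _ (- _)) lef_pV2 ?posrE ?powR_gt0//.
by rewrite le_powR ?(ltW t0)// oppr_ge0 subr_le0 (le_trans p1)// ler1n.
Qed.

End one.

(** Oddness of k gives 1 - cos (k pi) = 2. It cannot be dropped at p = 1, that is for Brownian
    noise, where the coefficients of even index vanish. This lower bound feeds the divergent series
    of [no_rough_conv]. *)
Lemma fcoef_sqr_lb : exists2 c : R, 0 < c &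
  forall k, odd k -> c * k%:R `^ (1 - p) <= fcoef k * (k%:R * pi) ^+ 2.
Proof.
have h k : odd k -> 2 * p * (2 + (1 - p) * (k%:R `^ (1 - p) / 2)) <= fcoef k * (k%:R * pi) ^+ 2.
  case: k => // k ok; have := @fcoef_sqr_ge k.+1 isT.
  by rewrite cos_npi -signr_odd ok expr1 opprK.
have [pE|pn1] := eqVneq p 1.
  exists 1 => // k /h; rewrite pE subrr mul0r addr0 powRr0; lra.
have {}pn1 : 0 < 1 - p by rewrite subr_gt0 lt_neqAle pn1.
exists (p * (1 - p)); first by rewrite mulr_gt0.
move=> k /h; apply: le_trans.
rewrite (_ : 2 * p * _ = 4 * p + p * (1 - p) * k%:R `^ (1 - p)).
  by rewrite lerDr mulr_ge0// ltW.
by move: (_ `^ _) => q; field.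
Qed.

End fourier.

(** * Convergence of the cosine series of a power and expansion of the covariance *)

Section expansion.
Context {R : realType}.
Notation mu := (@lebesgue_measure R).

Lemma sum_nat_delta (c : nat -> R) n N : (1 <= n <= N)%N ->
  \sum_(1 <= k < N.+1) c k * (k == n)%:R = c n.
Proof.
move=> /andP[n1 nN]; rewrite (bigD1_seq n) ?mem_index_iota ?iota_uniq ?n1//= eqxx mulr1.
by rewrite big1 ?addr0// => i /negbTE ->; rewrite mulr0.
Qed.

Lemma continuous_int0 (g : R -> R) : measurable_fun (setT : set (measurableTypeR R)) g ->
  (forall x : R, x \in `]0, 1[ -> {for x, continuous g}) -> (forall x, 0 <= g x) ->
  (\int[mu]_(x in D) (g x)%:E = 0)%E -> forall x : R, x \in `]0, 1[ -> g x = 0.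
Proof.
move=> mg cg g0 ig x x01; apply/eqP/negPn/negP => gx.
have {}gx : 0 < g x / 2 by rewrite divr_gt0// lt_neqAle eq_sym gx g0.
have H : \forall z \near x, g x / 2 < g z.
  by apply: (cvgr_gt _ (cg x x01)); rewrite ltr_pdivrMr// ltr_pMr// ?ltr1n// -(pmulr_lgt0 _ (_ : 0 < 2^-1)).
have [e /= e0 He] := H.
move: x01; rewrite in_itv/= => /andP[x0 x1].
pose d := Num.min (e / 2) (Num.min (x / 2) ((1 - x) / 2)).
have d0 : 0 < d by rewrite !lt_min !divr_gt0// subr_gt0.
have de : d < e.
  by rewrite (le_lt_trans (_ : _ <= e / 2))// ?ge_min ?lexx// ltr_pdivrMr// ltr_pMr// ltr1n.
have dx : d < x.
  by rewrite (le_lt_trans (_ : _ <= x / 2))// ?ge_min ?lexx ?orbT// ltr_pdivrMr// ltr_pMr// ltr1n.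
have dx1 : d < 1 - x.
  by rewrite (le_lt_trans (_ : _ <= (1 - x) / 2))// ?ge_min ?lexx ?orbT// ltr_pdivrMr ?ltr_pMr ?ltr1n ?subr_gt0.
have : (\int[mu]_(z in `[x, (x + d / 2)%R]) (cst (g x / 2)%:E z) <= 0)%E.
  rewrite -ig; apply: (@le_trans _ _ (\int[mu]_(z in `[x, (x + d / 2)%R]) (g z)%:E)%E).
    apply: ge0_le_int => //.
    - by move=> z _; rewrite lee_fin ltW.
    - by apply/measurable_EFinP; exact: measurable_funTS.
    - move=> z /=; rewrite in_itv/= => /andP[h1 h2]; rewrite lee_fin.
      have dz : `|x - z| < d.
        rewrite distrC ger0_norm ?subr_ge0// ltrBlDl (le_lt_trans h2)// ltrD2l.
        by rewrite ltr_pdivrMr// ltr_pMr// ltr1n.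
      by apply: ltW; apply: He; exact: lt_trans dz de.
  apply: ge0_subset_integral => //; first exact: measurable_D.
  - by apply/measurable_EFinP; exact: measurable_funTS.
  - by move=> z _; rewrite lee_fin.
  - move=> z; rewrite /D /= !in_itv/= => /andP[h1 h2]; rewrite (lt_le_trans x0)//=.
    rewrite (le_lt_trans h2)// -ltrBrDl (le_lt_trans _ dx1)//.
    by rewrite ler_pdivrMr// ler_peMr ?ler1n// ltW.
rewrite integral_cst//= lebesgue_measure_itv/= lte_fin ltrDl divr_gt0// -EFinB -EFinM lee_fin.
by rewrite leNgt mulr_gt0// addrC addKr divr_gt0.
Qed.

Variables (lam : nat -> R) (phi : nat -> L2D R).
Hypothesis hA : dirichlet_spectrum lam phi.

(** Completeness of the sines is inherited from the completeness clause of [dirichlet_spectrum], the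
    phi k being multiples of sines by [spectrum_sin]; continuity upgrades almost everywhere to
    everywhere. *)
Lemma sin_complete (h : R -> R) : measurable_fun (setT : set (measurableTypeR R)) h ->
  (forall x : R, x \in `]0, 1[ -> {for x, continuous h}) ->
  (exists M, forall x : R, 0 <= x <= 1 -> `|h x| <= M) ->
  (forall k, (1 <= k)%N -> \int[mu]_(x in `[0%R, 1%R]) (h x * sin (k%:R * pi * x))%:E = 0)%E ->
  forall x : R, x \in `]0, 1[ -> h x = 0.
Proof.
move=> mh ch [M hM] h0.
have mh2 : measurable_fun (setT : set (measurableTypeR R)) (fun x => h x ^+ 2).
  exact: measurable_funX.
have M0 : 0 <= M by rewrite (le_trans _ (hM 0 _))// lexx ler01.
have [|v vE] := exists_L2 mh.
  apply: (@le_lt_trans _ _ (\int[mu]_(x in D) (cst (M ^+ 2)%:E x))%E).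
    apply: ge0_le_int; first exact: measurable_D.
    + by move=> x _; rewrite lee_fin sqr_ge0.
    + by apply/measurable_EFinP; exact: measurable_funTS.
    + exact: measurable_cst.
    + move=> x; rewrite /D /= in_itv/= => /andP[x0 x1].
      rewrite lee_fin -(real_normK (num_real (h x))) ler_pXn2r ?nnegrE//.
      by rewrite hM// !ltW.
  rewrite integral_cst; last exact: measurable_D.
  have := @lebesgue_measure_itv R `]0%R, 1%R[.
  by rewrite /= lte_fin ltr01 -EFinB => ->; rewrite -EFinM ltry.
have [_ _ _ hc] := hA; have [a ha] := spectrum_sin hA.
have vv : ip v v = 0.
  apply/L2norm_eq0/hc => k k1; apply: EFin_inj; rewrite ipED.
  have [_ _ pk] := ha k k1.
  have ms : measurable_fun (setT : set (measurableTypeR R)) (fun x => h x * sin (k%:R * pi * x)).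
    by apply: measurable_funM => //; apply: continuous_measurable_fun; exact: continuous_sinM.
  have is' : mu.-integrable `[0, 1] (EFin \o (fun x => h x * sin (k%:R * pi * x))).
    apply: (@bounded_integrable_itv _ _ _ _ M) => // x x01.
    by rewrite normrM -[leRHS]mulr1 ler_pM// ?hM// sin_max.
  transitivity (\int[mu]_(x in D) ((a k)%:E * (h x * sin (k%:R * pi * x))%:E))%E.
    apply: eq_integral => x; rewrite inE /D/= => xD.
    by rewrite vE pk ?(subset_itv_oo_cc xD)// -EFinM; congr (_%:E); ring.
  rewrite /D -(@integral_itv_bndoo _ _ _ _ true false); last first.
    by apply: measurable_funeM; apply/measurable_EFinP; exact: measurable_funTS.
  rewrite integralZl//; first by rewrite h0// mule0.
move=> x x01; apply/eqP; rewrite -sqrf_eq0; apply/eqP.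
apply: (continuous_int0 mh2) => //.
- by move=> z z01; rewrite (_ : (fun _ => _) = fun x => h x * h x)//; apply: cvgM; exact: ch.
- by move=> z; exact: sqr_ge0.
- transitivity ((ip v v)%:E); last by rewrite vv.
  by rewrite ipED; apply: eq_integral => z _; rewrite vE expr2.
Qed.

Variable p : R.
Hypothesis p0 : 0 < p.
Hypothesis p1 : p <= 1.
Local Notation a := (fcoef p).
Let S n (t : R) := \sum_(1 <= k < n.+1) a k * (1 - cos (k%:R * pi * t)).
Let A n := \sum_(1 <= k < n.+1) a k.

Lemma fcoef_sum_le : exists2 M : R, 0 < M & forall n, A n <= M.
Proof.
have q1 : 1 < 1 + p by rewrite ltrDl.
have [C C0 hC] := sum_invpowR_le q1.
have B0 : 0 < 2 * (4 + pi ^+ 2) :> R by rewrite mulr_gt0// ltr_wpDr// sqr_ge0.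
exists (2 * (4 + pi ^+ 2) * C); first exact: mulr_gt0.
move=> n; apply: le_trans (ler_wpM2l (ltW B0) (hC n)); rewrite mulr_sumr /A.
by rewrite !big_nat; apply: ler_sum => k /andP[k1 _]; exact: fcoef_le.
Qed.

(** The coefficients are nonnegative and summable, so the series converges uniformly to a continuous
    [L]. The difference [G] between t^p and [L] has no cosine coefficient of index n >= 1, hence is
    constant on ]0, 1[ and, by continuity and G 0 = 0, vanishes on [0, 1]. *)
Lemma powR_fourier (t : R) : 0 <= t <= 1 -> S n t @[n --> \oo] --> t `^ p.
Proof.
have [M M0 hM] := fcoef_sum_le.
have a0 k : (1 <= k)%N -> 0 <= a k by move=> k1; exact: fcoef_ge0.
have Snd n m t' : (n <= m)%N -> S n t' <= S m t' /\ S m t' - S n t' <= 2 * (A m - A n).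
  move=> nm; have sp (F : nat -> R) : \sum_(1 <= k < m.+1) F k = \sum_(1 <= k < n.+1) F k + \sum_(n.+1 <= k < m.+1) F k.
    by rewrite (big_cat_nat _ (n := n.+1)).
  rewrite /S /A !sp ![_ + _ - _]addrAC !subrr !add0r lerDl.
  split; first by rewrite big_nat sumr_ge0// => k /andP[nk _]; rewrite mulr_ge0 ?onem_cos_ge0// a0// (leq_trans _ nk).
  rewrite mulr_sumr big_nat [leRHS]big_nat; apply: ler_sum => k /andP[nk _].
  by rewrite mulrC ler_wpM2r ?onem_cos_le2// a0// (leq_trans _ nk).
have And n m : (n <= m)%N -> A n <= A m.
  by move=> nm; have [h1 h2] := Snd n m 0 nm; move: h1 h2; lra.
have cA : cvgn A by apply: nondecreasing_is_cvgn; [exact: And|exists M => _ [n _ <-]].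
pose B := limn A.
have AB n : A n <= B by apply: nondecreasing_cvgn_le => //; exact: And.
have A0 n : 0 <= A n by rewrite /A big_nat sumr_ge0// => k /andP[k1 _]; exact: a0.
have S0 n t' : 0 <= S n t'.
  by rewrite /S big_nat sumr_ge0// => k /andP[k1 _]; rewrite mulr_ge0 ?onem_cos_ge0// a0.
have SM n t' : S n t' <= 2 * M.
  have [_ h] := Snd 0%N n t' (leq0n n); have hn := hM n.
  have e1 : S 0%N t' = 0 by rewrite /S big_geq.
  have e2 : A 0%N = 0 by rewrite /A big_geq.
  by move: h; rewrite e1 e2 !subr0 => /le_trans; apply; rewrite ler_wpM2l.
have cS t' : cvgn (S^~ t').
  apply: nondecreasing_is_cvgn; first by move=> n m nm; have [] := Snd n m t' nm.
  by exists (2 * M) => _ [n _ <-].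
pose L t' := limn (S^~ t').
have LS n t' : S n t' <= L t' <= S n t' + 2 * (B - A n).
  apply/andP; split.
    by apply: nondecreasing_cvgn_le => //; move=> i j ij; have [] := Snd i j t' ij.
  apply: limr_le => //; exists n => // m /= nm; have [_ h] := Snd n m t' nm.
  by rewrite addrC -lerBlDr (le_trans h)// ler_wpM2l// lerD2r.
have LM t' : `|L t'| <= 2 * M.
  have /andP[h _] := LS 0%N t'; rewrite ger0_norm ?(le_trans (S0 _ _) h)//.
  by apply: limr_le => //; apply: nearW => n; exact: SM.
have contS n : continuous (S n).
  elim: n => [|n IH] x.
    rewrite (_ : S 0%N = cst 0); first exact: cst_continuous.
    by apply/funext => z; rewrite /S big_geq.
  rewrite (_ : S n.+1 = fun z => S n z + a n.+1 * (1 - cos (n.+1%:R * pi * z))).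
    apply: cvgD; first exact: IH.
    by apply: cvgMr; apply: cvgB; [exact: cvg_cst|exact: continuous_cosM].
  by apply/funext => z; rewrite /S big_nat_recr.
have cL : continuous L.
  move=> x; apply/cvgrPdist_lt => e e0.
  have [n _ /(_ n (leqnn n)) hn] : \forall n \near \oo, B - A n < e / 8.
    have := cA; move=> /cvgrPdist_lt/(_ (e / 8)) h; have {}h := h (divr_gt0 e0 (ltr0n _ 8)).
    by apply: filterS h => n; rewrite ger0_norm// subr_ge0.
  have := contS n x => /cvgrPdist_lt/(_ (e / 2) (divr_gt0 e0 (ltr0n _ 2))).
  apply: filterS => z; rewrite !ltr_distl => /andP[h1 h2].
  have /andP[l1 l2] := LS n x; have /andP[l3 l4] := LS n z.
  by apply/andP; split; lra.
have contG x : 0 < x -> {for x, continuous (fun x => x `^ p - L x)}.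
  by move=> x0; apply: cvgB; [exact: continuous_powR_gt0|exact: cL].
have mS n : measurable_fun (setT : set (measurableTypeR R)) (S n).
  exact: continuous_measurable_fun.
have mL : measurable_fun (setT : set (measurableTypeR R)) L by exact: continuous_measurable_fun.
have mp : measurable_fun (setT : set (measurableTypeR R)) (fun x : R => x `^ p).
  exact: measurable_powR.
have mc n : measurable_fun (setT : set (measurableTypeR R)) (fun x => cos (n%:R * pi * x)).
  by apply: continuous_measurable_fun; exact: continuous_cosM.
have p01 (x : R) : 0 <= x <= 1 -> 0 <= x `^ p <= 1 by exact: powR01.
pose f n N x := (x `^ p - S N x) * cos (n%:R * pi * x).
have mf n N : measurable_fun (setT : set (measurableTypeR R)) (f n N).
  by apply: measurable_funM => //; exact: measurable_funB.
have fb n N (x : R) : 0 <= x <= 1 -> `|f n N x| <= 1 + 2 * M.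
  move=> /p01/andP[h1 h2]; rewrite normrM -[leRHS]mulr1 ler_pM ?cos_max//.
  by rewrite (le_trans (ler_normB _ _))// !ger0_norm// lerD.
have If n N : (1 <= n)%N -> (\int[mu]_(x in `[0%R, 1%R]) (f n N x)%:E =
    (- (a n / 2) + \sum_(1 <= k < N.+1) a k / 2 * (k == n)%:R)%:E)%E.
  move=> n1; elim: N => [|N IH].
    rewrite big_geq// addr0 -fcoef_int//; apply: eq_integral => x _.
    by rewrite /f /S big_geq// subr0.
  rewrite big_nat_recr//= addrA EFinD -IH.
  transitivity (\int[mu]_(x in `[0%R, 1%R]) ((f n N x)%:E + (- a N.+1 * cos (n%:R * pi * x) +
      a N.+1 * (cos (N.+1%:R * pi * x) * cos (n%:R * pi * x)))%:E))%E.
    apply: eq_integral => x _; rewrite -EFinD /f /S big_nat_recr//=; congr (_%:E).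
    by move: (\sum_(_ <= _ < _) _) (cos _) (cos _) (x `^ _) => s1 s2 s3 s4; ring.
  have cc : continuous (fun x : R => cos (N.+1%:R * pi * x) * cos (n%:R * pi * x)).
    by move=> x; apply: cvgM; exact: continuous_cosM.
  rewrite integralD//; last 2 first.
  - exact: (bounded_integrable_itv (mf n N) (fb n N)).
  - apply: (@continuous_integrable R (fun x : R => - a N.+1 * cos (n%:R * pi * x) +
      a N.+1 * (cos (N.+1%:R * pi * x) * cos (n%:R * pi * x)))) => x.
    by apply: cvgD; apply: cvgMr; [exact: continuous_cosM|exact: cc].
  rewrite int_lin2//; last exact: continuous_cosM.
  by rewrite int_cosn int_coscos// (gtn_eqF n1) mule0 add0e -EFinM; congr (_ + _%:E)%E; ring.
pose G x := x `^ p - L x.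
have mG : measurable_fun (setT : set (measurableTypeR R)) G by exact: measurable_funB.
have Gb (x : R) : 0 <= x <= 1 -> `|G x| <= 1 + 2 * M.
  by move=> /p01/andP[h1 h2]; rewrite (le_trans (ler_normB _ _))// (ger0_norm h1) lerD.
have IG n : (1 <= n)%N -> (\int[mu]_(x in `[0%R, 1%R]) (G x * cos (n%:R * pi * x))%:E = 0)%E.
  move=> n1.
  have h1 N : measurable_fun (`[0%R, 1%R] : set (measurableTypeR R)) (fun x => (f n N x)%:E).
    by apply/measurable_EFinP; exact: measurable_funTS.
  have h2 : measurable_fun (`[0%R, 1%R] : set (measurableTypeR R)) (fun x => (G x * cos (n%:R * pi * x))%:E).
    by apply/measurable_EFinP; apply: measurable_funTS; exact: measurable_funM.
  have h3 : {ae mu, forall x, (`[0%R, 1%R]%classic : set R) x -> (f n N x)%:E @[N --> \oo] --> (G x * cos (n%:R * pi * x))%:E}.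
    apply: aeW => x _; apply: cvg_EFin; first exact: nearW.
    rewrite (_ : _ \o _ = (f n)^~ x)//; apply: cvgMl; apply: cvgB; [exact: cvg_cst|exact: cS].
  have h4 : mu.-integrable `[0%R, 1%R] (cst (1 + 2 * M)%:E).
    exact: (@continuous_integrable R (cst (1 + 2 * M)) 0 1 (@cst_continuous _ _ _)).
  have h5 : {ae mu, forall x N, (`[0%R, 1%R]%classic : set R) x -> (`|(f n N x)%:E| <= (cst (1 + 2 * M)%:E) x)%E}.
    by apply: aeW => x N; rewrite /= in_itv/= => x01; rewrite lee_fin fb.
  have [_ _ h] := @dominated_convergence _ _ R mu `[0%R, 1%R] (measurable_itv _) _ _ _ h1 h2 h3 h4 h5.
  apply: (cvg_unique _ h) => //; apply: cvg_near_cst; exists n => // N /= nN.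
  by rewrite If// sum_nat_delta ?n1// addNr.
(* The coefficient of index 0 is not matched by the series; subtracting the mean of [G] cancels it
   as well. *)
pose kap := fine (\int[mu]_(x in `[0%R, 1%R]) (G x)%:E)%E.
have iG : mu.-integrable `[0, 1] (EFin \o G) by exact: bounded_integrable_itv Gb.
have kE : (\int[mu]_(x in `[0%R, 1%R]) (G x)%:E = kap%:E)%E.
  by rewrite /kap fineK//; exact: integrable_fin_num.
have iGc n : mu.-integrable `[0, 1] (EFin \o (fun x => G x * cos (n%:R * pi * x))).
  apply: (@bounded_integrable_itv _ _ _ _ (1 + 2 * M)); first exact: measurable_funM.
  by move=> x /Gb h; rewrite normrM -[leRHS]mulr1 ler_pM ?cos_max.
have IG0 n : (\int[mu]_(x in `[0%R, 1%R]) ((G x - kap) * cos (n%:R * pi * x))%:E = 0)%E.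
  transitivity (\int[mu]_(x in `[0%R, 1%R]) ((G x * cos (n%:R * pi * x))%:E - (kap * cos (n%:R * pi * x))%:E))%E.
    by apply: eq_integral => x _; rewrite -EFinB mulrBl.
  have ik : mu.-integrable `[0, 1] (EFin \o (fun x => kap * cos (n%:R * pi * x))).
    by apply: continuous_integrable => x; apply: cvgMr; exact: continuous_cosM.
  have ig := iGc n; rewrite integralB//.
  have -> : (\int[mu]_(x in `[0%R, 1%R]) (kap * cos (n%:R * pi * x))%:E = kap%:E * (n == 0%N)%:R%:E)%E.
    transitivity (\int[mu]_(x in `[0%R, 1%R]) (kap%:E * (cos (n%:R * pi * x))%:E))%E.
      by apply: eq_integral => x _; rewrite EFinM.
    by rewrite integralZl ?int_cosn//; exact: continuous_integrable (@continuous_cosM R _).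
  have [n0|n0] : n = 0%N \/ (0 < n)%N by case: (n) => [|?]; [left|right].
    rewrite (_ : (\int[mu]_(x in `[0%R, 1%R]) (G x * cos (n%:R * pi * x))%:E = kap%:E)%E).
      by rewrite n0 (_ : (0 == 0)%N%:R = 1 :> R)// mule1 subee.
    by rewrite -kE; apply: eq_integral => x _; rewrite n0 !mul0r cos0 mulr1.
  by rewrite IG// (gtn_eqF n0) mule0 sube0.
have mh : measurable_fun (setT : set (measurableTypeR R)) (fun x => (G x - kap) * sin (pi * x)).
  apply: measurable_funM; first exact: measurable_funB.
  by apply: continuous_measurable_fun; exact: continuous_sinM.
(* Multiplication by sin (pi x) turns cosine coefficients into sine coefficients: sin (pi x) sin (k
   pi x) is half the difference of the cosines of index k - 1 and k + 1. Index 0 occurs for k = 1,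
   which is why the mean was removed. The factor sin (pi x) has no zero in ]0, 1[. *)
have Gkap : {in `]0, 1[, G =1 cst kap}.
  move=> x x01; have := x01; rewrite in_itv/= => /andP[x0 x1].
  have s0 : sin (pi * x) != 0.
    by rewrite gt_eqF// sin_gt0_pi// mulr_gt0 ?pi_gt0//= gtr_pMr ?pi_gt0.
  apply/eqP; rewrite -subr_eq0 -(mulIr_eq0 _ (mulIf s0)); apply/eqP.
  apply: (sin_complete mh _ _ _ x01).
  - move=> z; rewrite in_itv/= => /andP[z0 _]; apply: cvgM; last exact: continuous_sinM.
    by apply: cvgB; [exact: contG|exact: cvg_cst].
  - exists (1 + 2 * M + `|kap|) => z /Gb h; rewrite normrM -[leRHS]mulr1 ler_pM ?sin_max//.
    by rewrite (le_trans (ler_normB _ _))// lerD2r.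
  - move=> k k1; transitivity (\int[mu]_(z in `[0%R, 1%R])
      ((2^-1)%:E * ((G z - kap) * cos (k.-1%:R * pi * z))%:E +
       (- 2^-1)%:E * ((G z - kap) * cos (k.+1%:R * pi * z))%:E))%E.
      apply: eq_integral => z _; rewrite -!EFinM -EFinD; congr (_%:E).
      rewrite -{1}(prednK k1) -natr1.
      rewrite (_ : k.-1%:R * pi * z = k%:R * pi * z - pi * z); last first.
        by rewrite -{2}(prednK k1) -natr1; ring.
      rewrite (_ : k.+1%:R * pi * z = k%:R * pi * z + pi * z); last by rewrite -natr1; ring.
      rewrite natr1 prednK// cosB cosD.
      by move: (G z) (cos _) (cos _) (sin _) (sin _) => g c1 c2 s1 s2; field.
    have ig n : mu.-integrable `[0, 1] (EFin \o (fun z => (G z - kap) * cos (n%:R * pi * z))).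
      apply: (@bounded_integrable_itv _ _ _ _ (1 + 2 * M + `|kap|)).
        by apply: measurable_funM => //; exact: measurable_funB.
      move=> z /Gb h; rewrite normrM -[leRHS]mulr1 ler_pM ?cos_max//.
      by rewrite (le_trans (ler_normB _ _))// lerD2r.
    rewrite integralD//; [|by apply: integrableZl => //; exact: ig|by apply: integrableZl => //; exact: ig].
    by rewrite !integralZl ?ig// !IG0 !mule0 adde0.
have G0 : G 0 = 0.
  rewrite /G powR0 ?gt_eqF// sub0r (_ : L 0 = 0) ?oppr0//.
  rewrite /L (_ : S^~ 0 = cst 0); first exact: lim_cst.
  by apply/funext => n; rewrite /S big1// => k _; rewrite mulr0 cos0 subrr mulr0.
have wG : {within `[0, 1], continuous G}.
  apply/continuous_within_itvP => //; split => //.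
  - by move=> x; rewrite in_itv/= => /andP[x0 _]; exact: contG.
  - rewrite /G powR0 ?gt_eqF//; apply: cvgB; first exact: powR_cvg0.
    by apply: cvg_at_right_filter; exact: cL.
  - by apply: cvg_at_left_filter; exact: contG.
have E := within_eq wG (@cst_continuous _ _ kap) Gkap.
have k0 : kap = 0 by rewrite -G0 E// in_itv/= lexx ler01.
move=> t01; have : G t = 0 by rewrite E ?in_itv//= k0.
move=> /eqP; rewrite subr_eq0 => /eqP ->; exact: cS.
Qed.

(** The identity (1 - cos a)(1 - cos b) + sin a sin b = (1 - cos a) + (1 - cos b) - (1 - cos (a -
    b)), applied term by term to the series of x^p, y^p and |x - y|^p. *)
Lemma fbm_cov_fourier (x y : R) : 0 <= x <= 1 -> 0 <= y <= 1 ->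
  \sum_(1 <= k < n.+1) (a k / 2 * ((1 - cos (k%:R * pi * x)) * (1 - cos (k%:R * pi * y)) +
     sin (k%:R * pi * x) * sin (k%:R * pi * y))) @[n --> \oo] --> fbm_cov (p / 2) x y.
Proof.
move=> hx hy; have hxy : 0 <= `|x - y| <= 1.
  by move: hx hy => /andP[x0 x1] /andP[y0 y1]; rewrite normr_ge0/= ler_norml; apply/andP; split; lra.
have E n : \sum_(1 <= k < n.+1) (a k / 2 * ((1 - cos (k%:R * pi * x)) * (1 - cos (k%:R * pi * y)) +
     sin (k%:R * pi * x) * sin (k%:R * pi * y))) = (S n x + S n y - S n `|x - y|) / 2.
  rewrite /S -big_split/= -sumrB mulr_suml; apply: eq_bigr => k _.
  have -> : cos (k%:R * pi * `|x - y|) = cos (k%:R * pi * x - k%:R * pi * y).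
    case: (ger0P (x - y)) => h; first by rewrite mulrBr.
    by rewrite mulrN cosN mulrBr.
  by rewrite cosB; move: (cos _) (cos _) (sin _) (sin _) (a k) => c1 c2 s1 s2 q; field.
under eq_cvg do rewrite E.
rewrite /fbm_cov (_ : 2 * (p / 2) = p); last by field.
apply: cvgMl; apply: cvgB; last exact: powR_fourier.
by apply: cvgD; exact: powR_fourier.
Qed.

End expansion.

(** * Mean squares of Wiener integrals *)

Lemma integral_lincomb d (T : measurableType d) (R : realType) (mu : {measure set T -> \bar R})
    (A : set T) (I : eqType) (s : seq I) (c : I -> R) (h : I -> T -> R) (k : I -> R) :
  measurable A -> (forall i, i \in s -> mu.-integrable A (EFin \o h i)) ->
  (forall i, i \in s -> \int[mu]_(x in A) (h i x)%:E = (k i)%:E)%E ->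
  mu.-integrable A (EFin \o (fun x => \sum_(i <- s) c i * h i x)) /\
  (\int[mu]_(x in A) (\sum_(i <- s) c i * h i x)%:E = (\sum_(i <- s) c i * k i)%:E)%E.
Proof.
move=> mA; elim: s => [|i s IH] hi hk.
  rewrite big_nil; split.
    rewrite (_ : _ \o _ = cst 0%E); first exact: integrable0.
    by apply/funext => x /=; rewrite big_nil.
  by under eq_integral do rewrite big_nil; rewrite integral0.
have [|| h1 h2] := IH; first by move=> j js; apply: hi; rewrite inE js orbT.
  by move=> j js; apply: hk; rewrite inE js orbT.
have ii := hi i (mem_head _ _); have ik := hk i (mem_head _ _).
have iz : mu.-integrable A (fun x => (c i)%:E * (h i x)%:E)%E by exact: integrableZl.
have E x : (\sum_(j <- i :: s) c j * h j x)%:E =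
    ((c i)%:E * (h i x)%:E + (\sum_(j <- s) c j * h j x)%:E)%E.
  by rewrite big_cons EFinD EFinM.
split.
  rewrite (_ : _ \o _ = fun x => ((c i)%:E * (h i x)%:E + (\sum_(j <- s) c j * h j x)%:E)%E).
    exact: integrableD.
  by apply/funext => x; exact: E.
under eq_integral do rewrite E.
rewrite integralD// integralZl// ik h2 big_cons EFinD EFinM//.
Qed.

(** The quadratic form of a tensor product of two finite-rank diagonalized kernels is a weighted sum
    of squares. *)
Lemma sum_gram (R : comNzRingType) (Z I J : Type) (s : seq Z) (r : seq I) (q : seq J)
    (a : Z -> R) (u : I -> R) (v : J -> R) (f : I -> Z -> R) (g : J -> Z -> R) :
  \sum_(z <- s) \sum_(y <- s) a z * a y *
     ((\sum_(i <- r) u i * f i z * f i y) * (\sum_(j <- q) v j * g j z * g j y)) =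
  \sum_(i <- r) \sum_(j <- q) u i * v j * (\sum_(z <- s) a z * f i z * g j z) ^+ 2.
Proof.
transitivity (\sum_(z <- s) \sum_(y <- s) \sum_(i <- r) \sum_(j <- q)
    u i * v j * ((a z * f i z * g j z) * (a y * f i y * g j y))).
  apply: eq_bigr => z _; apply: eq_bigr => y _.
  rewrite mulr_suml mulr_sumr; apply: eq_bigr => i _.
  by rewrite !mulr_sumr; apply: eq_bigr => j _; ring.
transitivity (\sum_(z <- s) \sum_(i <- r) \sum_(j <- q) \sum_(y <- s)
    u i * v j * ((a z * f i z * g j z) * (a y * f i y * g j y))).
  apply: eq_bigr => z _; rewrite exchange_big/=; apply: eq_bigr => i _.
  by rewrite exchange_big.
rewrite exchange_big/=; apply: eq_bigr => i _; rewrite exchange_big/=.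
apply: eq_bigr => j _; rewrite expr2 mulr_suml mulr_sumr; apply: eq_bigr => z _.
by rewrite !mulr_sumr.
Qed.

Lemma cvg_sum_seq (R : realType) (I : Type) (s : seq I) (f : I -> nat -> R) (l : I -> R) :
  (forall i, f i n @[n --> \oo] --> l i) ->
  \sum_(i <- s) f i n @[n --> \oo] --> \sum_(i <- s) l i.
Proof.
move=> fl; elim: s => [|i s IH].
  by rewrite big_nil; under eq_fun do rewrite big_nil; exact: cvg_cst.
by rewrite big_cons; under eq_fun do rewrite big_cons; exact: cvgD.
Qed.

(** * Trigonometric modes and the variance as a quadratic form *)

Section modes.
Context {R : realType}.

(* The mode (j, b) is sin (j pi x) for b = true and cos (j pi x) for b = false. *)
Definition mode := (nat * bool)%type.
Definition modes M : seq mode := [seq (j, b) | j <- iota 1 M, b <- [:: true; false]].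

Lemma big_modes (F : mode -> R) M :
  \sum_(i <- modes M) F i = \sum_(1 <= j < M.+1) (F (j, true) + F (j, false)).
Proof.
rewrite /modes big_allpairs_dep /index_iota subn1/=; apply: eq_bigr => j _.
by rewrite !big_cons big_nil addr0.
Qed.

Lemma mem_modes M (i : mode) : i \in modes M -> (1 <= i.1)%N.
Proof. by case: i => j b /allpairsP[[j' b'] [/= + _ [-> _]]]; rewrite mem_iota => /andP[]. Qed.

Lemma ler_modes (F G : mode -> R) M : (forall i, (1 <= i.1)%N -> F i <= G i) ->
  \sum_(i <- modes M) F i <= \sum_(i <- modes M) G i.
Proof.
by move=> FG; rewrite big_seq [leRHS]big_seq; apply: ler_sum => i /mem_modes; exact: FG.
Qed.

Lemma modes_ge0 (F : mode -> R) M : (forall i, (1 <= i.1)%N -> 0 <= F i) ->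
  0 <= \sum_(i <- modes M) F i.
Proof. by move=> F0; rewrite big_seq; apply: sumr_ge0 => i /mem_modes; exact: F0. Qed.

Lemma modes_nd (F : mode -> R) M N : (forall i, (1 <= i.1)%N -> 0 <= F i) -> (M <= N)%N ->
  \sum_(i <- modes M) F i <= \sum_(i <- modes N) F i.
Proof.
move=> F0 MN; rewrite !big_modes [leRHS](big_cat_nat _ (n := M.+1))//= lerDl big_nat.
by apply: sumr_ge0 => j /andP[Mj _]; rewrite addr_ge0// F0//= (leq_trans _ Mj).
Qed.

Definition trig (i : mode) (x : R) := if i.2 then sin (i.1%:R * pi * x) else cos (i.1%:R * pi * x).
(** j pi times the primitive of the mode [trig i] vanishing at 0. These are the factors of the
    covariance expansion, and their increments over an interval are the moments of its indicator
    against [mode_deriv]. *)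
Definition trig_prim (i : mode) (x : R) :=
  if i.2 then 1 - cos (i.1%:R * pi * x) else sin (i.1%:R * pi * x).
Definition mode_weight (H : R) (i : mode) := fcoef (2 * H) i.1 / 2.

End modes.

Section quadratic.
Context {R : realType}.
Variables (lam : nat -> R) (phi : nat -> L2D R).
Hypothesis hA : dirichlet_spectrum lam phi.

Lemma mode_weight_ge0 (H : R) (i : mode) : 0 < H <= 2^-1 -> (1 <= i.1)%N -> 0 <= mode_weight H i.
Proof.
move=> /andP[H0 H1] i1; rewrite /mode_weight divr_ge0//; apply: fcoef_ge0 => //.
  by rewrite mulr_gt0.
by rewrite -ler_pdivlMl// mulr1.
Qed.

Lemma fbm_cov_modes (H x y : R) : 0 < H <= 2^-1 -> 0 <= x <= 1 -> 0 <= y <= 1 ->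
  \sum_(i <- modes M) mode_weight H i * trig_prim i x * trig_prim i y
    @[M --> \oo] --> fbm_cov H x y.
Proof.
move=> /andP[H0 H1] hx hy.
have p0 : 0 < 2 * H by rewrite mulr_gt0.
have p1 : 2 * H <= 1 by rewrite -ler_pdivlMl// mulr1.
have := fbm_cov_fourier hA p0 p1 hx hy.
rewrite (_ : 2 * H / 2 = H); last by field.
apply: cvg_trans; apply: near_eq_cvg; apply: nearW => M /=; rewrite big_modes.
by apply: eq_bigr => j _; rewrite /trig_prim/= /mode_weight/=; ring.
Qed.

(** Self-similarity reduces times in [0, T] to [0, 1], where the expansion of the covariance
    holds. *)
Lemma fbm_cov_scale (H T t r : R) : 0 < T -> 0 <= t -> 0 <= r ->
  fbm_cov H t r = T `^ (2 * H) * fbm_cov H (t / T) (r / T).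
Proof.
move=> T0 t0 r0; have TN0 : T != 0 by rewrite gt_eqF.
have h z : 0 <= z -> z `^ (2 * H) = T `^ (2 * H) * (z / T) `^ (2 * H).
  by move=> z0; rewrite -powRM ?divr_ge0 ?(ltW T0)//; congr (_ `^ _); field.
rewrite /fbm_cov (h t t0) (h r r0) (h `|t - r| (normr_ge0 _)).
rewrite (_ : `|t / T - r / T| = `|t - r| / T); last first.
  by rewrite -mulrBl normrM (@ger0_norm _ T^-1)// invr_ge0 ltW.
by move: (_ `^ _) (_ `^ _) (_ `^ _) (_ `^ _) => q1 q2 q3 q4; ring.
Qed.

Context d (Omega : measurableType d) (P : probability Omega R).
Variables (H1 H2 T : R).
Hypothesis hH1 : 0 < H1 <= 2^-1.
Hypothesis hH2 : 0 < H2 <= 2^-1.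
Hypothesis T0 : 0 < T.
Variables (F : R -> set (set Omega)) (W : R -> R -> {RV P >-> R}).
Hypothesis hW : is_fractional_brownian_sheet H1 H2 T F W.

(* If f lists the moments of a step function g against the modes, the supremum over M
   is the mean square of the Wiener integral of g. *)
Definition mode_quad M (f : mode -> mode -> R) :=
  \sum_(i <- modes M) \sum_(k <- modes M)
    mode_weight H1 i * (T `^ (2 * H2) * mode_weight H2 k) * f i k ^+ 2.

Lemma weight_ge0 i k : (1 <= i.1)%N -> (1 <= k.1)%N ->
  0 <= mode_weight H1 i * (T `^ (2 * H2) * mode_weight H2 k).
Proof. by move=> i1 k1; apply: mulr_ge0; [|apply: mulr_ge0; [exact: powR_ge0|]]; exact: mode_weight_ge0. Qed.

Lemma mode_quad_ge0 M f : 0 <= mode_quad M f.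
Proof.
by apply: modes_ge0 => i i1; apply: modes_ge0 => k k1; rewrite mulr_ge0 ?sqr_ge0 ?weight_ge0.
Qed.

Lemma mode_quad_nd M N f : (M <= N)%N -> mode_quad M f <= mode_quad N f.
Proof.
move=> MN; apply: (@le_trans _ _ (\sum_(i <- modes M) \sum_(k <- modes N)
    mode_weight H1 i * (T `^ (2 * H2) * mode_weight H2 k) * f i k ^+ 2)).
  apply: ler_modes => i i1; apply: modes_nd => // k k1.
  by rewrite mulr_ge0 ?sqr_ge0 ?weight_ge0.
apply: modes_nd => // i i1; apply: modes_ge0 => k k1.
by rewrite mulr_ge0 ?sqr_ge0 ?weight_ge0.
Qed.

Lemma mode_quadD M f g : mode_quad M (fun i k => f i k + g i k) <=
  2 * mode_quad M f + 2 * mode_quad M g.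
Proof.
rewrite /mode_quad !mulr_sumr -big_split/=; apply: ler_modes => i i1.
rewrite !mulr_sumr -big_split/=; apply: ler_modes => k k1.
have := weight_ge0 i1 k1; move: (_ * (_ * _)) => w w0.
rewrite !(mulrCA 2) -mulrDr ler_wpM2l//.
by have := sqr_ge0 (f i k - g i k); nra.
Qed.

Lemma mode_quad_cvg M (f : nat -> mode -> mode -> R) g :
  (forall i k, f n i k @[n --> \oo] --> g i k) -> mode_quad M (f n) @[n --> \oo] --> mode_quad M g.
Proof.
move=> fg; apply: cvg_sum_seq => i; apply: cvg_sum_seq => k.
by apply: cvgMr; rewrite expr2; under eq_fun do rewrite expr2; exact: cvgM.
Qed.

(** A triple (a, x, t) stands for the multiple a W(x, t) of a value of the sheet; a list of triples
    encodes a linear combination. *)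
Let pt := (R * R * R)%type.
Let valid (z : pt) := (z.1.2 \in `]0, 1[) /\ 0 <= z.2 <= T.
Let L (s : seq pt) w := \sum_(z <- s) z.1.1 * W z.1.2 z.2 w.
Let K (z y : pt) := fbm_cov H1 z.1.2 y.1.2 * fbm_cov H2 z.2 y.2.

Lemma sheet_prod z y : valid z -> valid y ->
  P.-integrable setT (EFin \o (fun w => W z.1.2 z.2 w * W y.1.2 y.2 w)) /\
  (\int[P]_w (W z.1.2 z.2 w * W y.1.2 y.2 w)%:E = (K z y)%:E)%E.
Proof.
have [_ _ hcov] := hW.
have sq x : valid x -> P.-integrable setT (EFin \o (fun w => W x.1.2 x.2 w * W x.1.2 x.2 w)).
  move=> [x1 x2]; apply/integrableP; split.
    by apply/measurable_EFinP; exact: measurable_funM.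
  have := hcov _ _ _ _ x1 x1 x2 x2; rewrite unlock => h.
  rewrite (eq_integral (fun w => (W x.1.2 x.2 w * W x.1.2 x.2 w)%:E)); first by rewrite h ltry.
  by move=> w _ /=; rewrite ger0_norm// -expr2 sqr_ge0.
move=> hz hy; split; last first.
  by have [z1 z2] := hz; have [y1 y2] := hy; have := hcov _ _ _ _ z1 y1 z2 y2; rewrite unlock.
apply: (le_integrable _ _ _ (integrableD _ (sq z hz) (sq y hy))) => //.
  by apply/measurable_EFinP; exact: measurable_funM.
move=> w _ /=; rewrite lee_fin; move: (W _ _ w) (W _ _ w) => p q.
rewrite [leRHS]ger0_norm -!expr2 ?addr_ge0 ?sqr_ge0//.
rewrite ler_norml; apply/andP; split.
  by have := sqr_ge0 (p + q); nra.
by have := sqr_ge0 (p - q); nra.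
Qed.

Lemma sheet_sqr s : (forall z, z \in s -> valid z) ->
  (\int[P]_w (L s w ^+ 2)%:E = (\sum_(z <- s) \sum_(y <- s) z.1.1 * y.1.1 * K z y)%:E)%E.
Proof.
move=> vs.
have h1 z : z \in s -> P.-integrable setT (EFin \o (fun w => W z.1.2 z.2 w * L s w)) /\
    (\int[P]_w (W z.1.2 z.2 w * L s w)%:E = (\sum_(y <- s) y.1.1 * K z y)%:E)%E.
  move=> zs; have [|||i1 i2] := @integral_lincomb _ _ _ P setT _ s (fun y => y.1.1)
    (fun y w => W z.1.2 z.2 w * W y.1.2 y.2 w) (K z).
  - exact: measurableT.
  - by move=> y ys; have [] := sheet_prod (vs z zs) (vs y ys).
  - by move=> y ys; have [] := sheet_prod (vs z zs) (vs y ys).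
  have E w : W z.1.2 z.2 w * L s w = \sum_(y <- s) y.1.1 * (W z.1.2 z.2 w * W y.1.2 y.2 w).
    by rewrite mulr_sumr; apply: eq_bigr => y _; rewrite mulrCA.
  split; last by rewrite -i2; apply: eq_integral => w _; rewrite E.
  by rewrite (_ : _ \o _ = EFin \o (fun w => \sum_(y <- s) y.1.1 * (W z.1.2 z.2 w * W y.1.2 y.2 w)))//;
    apply/funext => w /=; rewrite E.
have [|||_ i2] := @integral_lincomb _ _ _ P setT _ s (fun z => z.1.1)
    (fun z w => W z.1.2 z.2 w * L s w) (fun z => \sum_(y <- s) y.1.1 * K z y).
- exact: measurableT.
- by move=> z /h1[].
- by move=> z /h1[].
rewrite (_ : \sum_(z <- s) _ = \sum_(z <- s) z.1.1 * \sum_(y <- s) y.1.1 * K z y).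
  rewrite -i2; apply: eq_integral => w _; congr (_%:E).
  by rewrite expr2 {1}/L mulr_suml; apply: eq_bigr => z _; rewrite mulrA.
by apply: eq_bigr => z _; rewrite mulr_sumr; apply: eq_bigr => y _; rewrite mulrA.
Qed.

Let feat s (i k : mode) := \sum_(z <- s) z.1.1 * trig_prim i z.1.2 * trig_prim k (z.2 / T).

(** Replacing both covariances by their truncated expansions turns the variance of a linear
    combination of sheet values into [mode_quad] by [sum_gram]; the truncations converge at each
    pair of points. *)
Lemma sheet_quad s : (forall z, z \in s -> valid z) ->
  mode_quad M (feat s) @[M --> \oo] -->
    \sum_(z <- s) \sum_(y <- s) z.1.1 * y.1.1 * K z y.
Proof.
move=> vs.
pose K1 M (z y : pt) := (\sum_(i <- modes M) mode_weight H1 i * trig_prim i z.1.2 * trig_prim i y.1.2) *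
   (\sum_(k <- modes M) T `^ (2 * H2) * mode_weight H2 k * trig_prim k (z.2 / T) * trig_prim k (y.2 / T)).
have E M : mode_quad M (feat s) = \sum_(z <- s) \sum_(y <- s) z.1.1 * y.1.1 * K1 M z y.
  by rewrite /mode_quad/= /K1 -sum_gram.
rewrite (eq_cvg _ _ E).
under eq_fun do rewrite big_seq. rewrite big_seq.
have K1c z y : valid z -> valid y -> K1 M z y @[M --> \oo] --> K z y.
  move=> [z1 /andP[z2 z3]] [y1 /andP[y2 y3]]; apply: cvgM.
    apply: fbm_cov_modes => //.
      by move: z1; rewrite in_itv/= => /andP[/ltW -> /ltW ->].
    by move: y1; rewrite in_itv/= => /andP[/ltW -> /ltW ->].
  rewrite (fbm_cov_scale _ T0 z2 y2).
  have h : T `^ (2 * H2) * (\sum_(k <- modes M) mode_weight H2 k * trig_prim k (z.2 / T) * trig_prim k (y.2 / T))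
      @[M --> \oo] --> T `^ (2 * H2) * fbm_cov H2 (z.2 / T) (y.2 / T).
    apply: cvgMr; apply: fbm_cov_modes => //; rewrite divr_ge0 ?(ltW T0)//=.
      by rewrite ler_pdivrMr// mul1r.
    by rewrite ler_pdivrMr// mul1r.
  apply: (cvg_trans _ h); apply: near_eq_cvg; apply: nearW => M /=; rewrite mulr_sumr.
  by apply: eq_bigr => k _; rewrite !mulrA.
have cs (f : pt -> nat -> R) (l : pt -> R) : (forall z, z \in s -> f z M @[M --> \oo] --> l z) ->
    \sum_(z <- s | z \in s) f z M @[M --> \oo] --> \sum_(z <- s | z \in s) l z.
  move=> h; rewrite big_mkcond/=; under eq_fun do rewrite big_mkcond/=.
  apply: cvg_sum_seq => z; have [zs|zs] := boolP (z \in s); [exact: h|exact: cvg_cst].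
apply: (cs (fun z M => \sum_(y <- s) z.1.1 * y.1.1 * K1 M z y)) => z zs.
under eq_fun do rewrite big_seq. rewrite big_seq.
apply: (cs (fun y M => z.1.1 * y.1.1 * K1 M z y)) => y ys.
by apply: cvgMr; apply: K1c; exact: vs.
Qed.

(** The moments of a step function against products of a space and a time mode, evaluated through
    primitives at the corners of the boxes; [step_fun_mode] identifies them with integrals. *)
Definition step_mode (n : nat) (c : 'I_n -> R) (b : 'I_n -> box) (i k : mode) :=
  \sum_(m < n) c m * (trig_prim i (y_hi (b m)) - trig_prim i (y_lo (b m))) *
    (trig_prim k (r_hi (b m) / T) - trig_prim k (r_lo (b m) / T)).

Lemma step_quad (n : nat) (c : 'I_n -> R) (b : 'I_n -> box) : (forall i, box_in T (b i)) ->
  exists V : R, [/\ (\int[P]_w (step_integral W c b w ^+ 2)%:E = V%:E)%E,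
    mode_quad M (step_mode c b) @[M --> \oo] --> V &
    forall M, mode_quad M (step_mode c b) <= V].
Proof.
move=> hb.
(* A rectangular increment is a signed sum over the four corners of the box. *)
pose cor (m : 'I_n) : seq pt := [:: (c m, y_hi (b m), r_hi (b m)); (- c m, y_lo (b m), r_hi (b m));
  (- c m, y_hi (b m), r_lo (b m)); (c m, y_lo (b m), r_lo (b m))].
pose s := flatten [seq cor m | m <- index_enum 'I_n].
have vs z : z \in s -> valid z.
  move=> /flattenP[_ /mapP[m _ ->]] zc.
  have [[y0 y01 y1] [r0 r01 r1]] := hb m.
  have e1 := lt_le_trans y0 y01; have e2 := le_lt_trans y01 y1.
  have e3 := le_trans r0 r01; have e4 := le_trans r01 r1.
  by move: zc; rewrite !inE => /or4P[] /eqP ->; split; rewrite /= ?in_itv/=; apply/andP; split.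
have SE w : step_integral W c b w = L s w.
  rewrite /L /s big_flatten big_map; apply: eq_bigr => m _.
  by rewrite !big_cons big_nil/= /increment; ring.
have fE i k : step_mode c b i k = feat s i k.
  rewrite /feat /s big_flatten big_map; apply: eq_bigr => m _.
  by rewrite !big_cons big_nil/=; ring.
have cv := sheet_quad vs.
have {}cv : mode_quad M (step_mode c b) @[M --> \oo] --> \sum_(z <- s) \sum_(y <- s) z.1.1 * y.1.1 * K z y.
  by rewrite (_ : step_mode c b = feat s)//; apply/funext => i; apply/funext => k; exact: fE.
exists (\sum_(z <- s) \sum_(y <- s) z.1.1 * y.1.1 * K z y); split => //.
  by rewrite -sheet_sqr//; apply: eq_integral => w _; rewrite SE.
move=> M; rewrite -(cvg_lim _ cv)//; apply: nondecreasing_cvgn_le.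
  by move=> a a' aa'; exact: mode_quad_nd.
by apply/cvg_ex; eexists; exact: cv.
Qed.

End quadratic.

Section product_integrals.
Context {R : realType}.
Notation mu := (@lebesgue_measure R).
Notation mu2 := (mu \x mu)%E.
Notation TS := (measurableTypeR R).

Lemma Rintegral_prodM (A B : set TS) (f g : TS -> R) : measurable A -> measurable B ->
  mu.-integrable A (EFin \o f) -> mu.-integrable B (EFin \o g) ->
  mu2.-integrable (A `*` B) (EFin \o (fun p => f p.1 * g p.2)) /\
  \int[mu2]_(p in A `*` B) (f p.1 * g p.2) =
    (\int[mu]_(x in A) f x) * (\int[mu]_(x in B) g x).
Proof.
move=> mA mB iF iG.
have mAB : measurable (A `*` B) by exact: measurableX.
pose fA := f \_ A; pose gB := g \_ B.
have ifA : mu.-integrable setT (EFin \o fA) by rewrite -restrict_EFin; apply: (iffLR (integrable_mkcond _ mA)).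
have igB : mu.-integrable setT (EFin \o gB) by rewrite -restrict_EFin; apply: (iffLR (integrable_mkcond _ mB)).
have mfA : measurable_fun setT fA by apply/measurable_EFinP; exact: measurable_int ifA.
have mgB : measurable_fun setT gB by apply/measurable_EFinP; exact: measurable_int igB.
pose K (p : TS * TS) := fA p.1 * gB p.2.
have mK : measurable_fun setT (EFin \o K).
  apply/measurable_EFinP; apply: measurable_funM.
    exact: (measurableT_comp mfA measurable_fst).
  exact: (measurableT_comp mgB measurable_snd).
have [c cE] : exists c : R, (\int[mu]_y `|(gB y)%:E| = c%:E)%E.
  exists (fine (\int[mu]_y `|(gB y)%:E|)%E); rewrite fineK// ge0_fin_numE.
    by have /integrableP[_] := igB.
  by apply: integral_ge0 => y _; exact: abse_ge0.
have iK : mu2.-integrable setT (EFin \o K).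
  apply/integrable12ltyP => //.
  rewrite (eq_integral (fun x => `|(fA x)%:E| * c%:E)%E); last first.
    move=> x _; rewrite -cE -ge0_integralZl//.
    - by apply: eq_integral => y _; rewrite /K/= normrM.
    - by apply: measurableT_comp => //; exact/measurable_EFinP.
  rewrite (eq_integral (fun x => c%:E * `|(fA x)%:E|)%E); last by move=> x _; rewrite muleC.
  rewrite ge0_integralZl//.
  - by rewrite lte_mul_pinfty// ?lee_fin; [rewrite -lee_fin -cE; apply: integral_ge0|have /integrableP[] := ifA].
  - by apply: measurableT_comp => //; exact/measurable_EFinP.
  - by rewrite -cE; apply: integral_ge0.
have KE : (fun p : TS * TS => f p.1 * g p.2) \_ (A `*` B) = K.
  apply/funext => -[x y]; rewrite /K /fA /gB !patchE in_setX/=.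
  by case: (x \in A); case: (y \in B); rewrite ?mul0r ?mulr0.
split.
  by apply/integrable_mkcond => //; rewrite restrict_EFin KE.
rewrite Rintegral_mkcond KE [in RHS]Rintegral_mkcond [X in _ * X]Rintegral_mkcond.
rewrite -/fA -/gB {1}/Rintegral -integral12_prod_meas1//.
rewrite (eq_integral (fun x => (\int[mu]_y gB y)%R%:E * (fA x)%:E)%E); last first.
  move=> x _; rewrite /fubini_F /Rintegral fineK; last exact: integrable_fin_num.
  rewrite muleC -integralZl//; by apply: eq_integral => y _; rewrite /K/= EFinM.
rewrite (integralZl _ ifA)//.
by rewrite -(fineK (integrable_fin_num measurableT ifA)) -EFinM /= mulrC.
Qed.

Lemma Rintegral_indicM (A : set TS) (F f : R -> R) (lo hi : R) : measurable A ->
  lo <= hi -> (forall x, lo < x <= hi -> A x) ->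
  (forall x : R, is_derive x (1 : R) F (f x)) -> continuous f ->
  mu.-integrable A (EFin \o (fun x => \1_`]lo, hi] x * f x)) /\
  \int[mu]_(x in A) (\1_`]lo, hi] x * f x) = F hi - F lo.
Proof.
move=> mA lohi sA dF cf.
have E : (fun x => \1_`]lo, hi] x * f x) = f \_ `]lo, hi].
  apply/funext => x; rewrite patchE indicE.
  by case: (x \in _); rewrite ?mul1r ?mul0r.
have AI : A `&` `]lo, hi] = `]lo, hi]%classic.
  by apply/setIidr => x /=; rewrite in_itv/= => /sA.
have i1 : mu.-integrable `]lo, hi] (EFin \o f).
  apply: (@integrableS _ _ _ mu `[lo, hi]) => //; last exact: continuous_integrable.
  by move=> x /=; rewrite !in_itv/= => /andP[/ltW -> ->].
split.
  rewrite E -restrict_EFin; apply/integrable_restrict => //.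
  by rewrite AI.
rewrite E -Rintegral_mkcondr AI Rintegral_itv_obnd_cbnd// /Rintegral.
by rewrite (@FTC2_cc _ F f)// => x _; exact: cf.
Qed.

(** On a set of finite measure L^2 convergence gives L^1 convergence, through |h| <= h^2 / (2 a) + a
    / 2 with a proportional to the target accuracy. *)
Lemma int_norm_cvg0 d (T : measurableType d) (nu : {measure set T -> \bar R}) (A : set T)
    (h : nat -> T -> R) (C : R) : measurable A -> (nu A = C%:E)%E ->
  (forall n, measurable_fun A (h n)) ->
  (\int[nu]_(x in A) (h n x ^+ 2)%:E @[n --> \oo] --> 0)%E ->
  forall e, 0 < e -> \forall n \near \oo, (\int[nu]_(x in A) (`|h n x|)%:E <= e%:E)%E.
Proof.
move=> mA nuA mh h0 e e0.
have C0 : 0 <= C by rewrite -lee_fin -nuA measure_ge0.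
have C1 : 0 < C + 1 by rewrite ltr_wpDl.
pose a := e / (C + 1); have a0 : 0 < a by exact: divr_gt0.
have b0 : 0 < e * a by exact: mulr_gt0.
have H : \forall n \near \oo, (\int[nu]_(x in A) (h n x ^+ 2)%:E < (e * a)%:E)%E.
  have := h0 => /(_ [set x | x < (e * a)%:E]%E); apply.
  exact: (open_ereal_lt' (_ : (0 < (e * a)%:E)%E)).
apply: (filterS _ H) => n hn.
apply: (@le_trans _ _ (\int[nu]_(x in A) ((2 * a)^-1%:E * (h n x ^+ 2)%:E + (cst (a / 2)%:E) x))%E).
  apply: ge0_le_int => //.
  - by apply/measurable_EFinP; exact: measurableT_comp.
  - apply: emeasurable_funD; last exact: measurable_cst.
    by apply: measurable_funeM; apply/measurable_EFinP; exact: measurable_funX.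
  - move=> x _; rewrite -EFinM -EFinD lee_fin -(real_normK (num_real (h n x))).
    rewrite -subr_ge0 (_ : _ - _ = (`|h n x| - a) ^+ 2 / (2 * a)); last first.
      by move: `|_| => q; field; rewrite gt_eqF.
    by rewrite divr_ge0 ?sqr_ge0// mulr_ge0// ltW.
have m2 : measurable_fun A (fun x => (h n x ^+ 2)%:E).
  by apply/measurable_EFinP; exact: measurable_funX.
have a2 : 0 <= (2 * a)^-1 by rewrite invr_ge0 mulr_ge0// ltW.
rewrite ge0_integralD//; last 3 first.
- by move=> x _; rewrite -EFinM lee_fin mulr_ge0// sqr_ge0.
- exact: measurable_funeM.
- by move=> x _; rewrite lee_fin divr_ge0// ltW.
rewrite ge0_integralZl//; last first.
- by move=> x _; rewrite lee_fin sqr_ge0.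
rewrite integral_cst// nuA.
apply: (@le_trans _ _ ((2 * a)^-1%:E * (e * a)%:E + (a / 2)%:E * C%:E)%E).
  by rewrite leeD2r// lee_wpmul2l ?lee_fin// ltW.
rewrite -!EFinM -EFinD lee_fin.
rewrite (_ : (2 * a)^-1 * (e * a) = e / 2); last by field; rewrite gt_eqF.
rewrite [leRHS](_ : e = e / 2 + a / 2 * (C + 1)); last by rewrite /a; field; rewrite gt_eqF.
by rewrite lerD2l ler_wpM2l ?lerDl// divr_ge0// ltW.
Qed.

End product_integrals.

(** * Moments of integrands and approximation by step functions *)

Section wiener.
Context {R : realType}.
Notation mu := (@lebesgue_measure R).
Notation mu2 := (mu \x mu)%E.
Notation TS := (measurableTypeR R).

Definition mode_deriv (i : mode) (x : R) := i.1%:R * pi * trig i x.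

Lemma is_derive_trig_prim (i : mode) (x : R) :
  is_derive x (1 : R) (trig_prim i) (mode_deriv i x).
Proof.
case: i => j [] /=; rewrite /trig_prim /mode_deriv /trig /=; last exact: is_derive_sinM.
have h := is_derive_cosM (j%:R * pi) x.
rewrite (_ : (fun x => _) = cst 1 - (fun x => cos (j%:R * pi * x))); last by apply/funext.
by apply: is_derive_eq; rewrite sub0r opprK.
Qed.

Lemma continuous_trig (i : mode) : continuous (trig i : R -> R).
Proof. by case: i => j [] /=; [exact: continuous_sinM|exact: continuous_cosM]. Qed.

Lemma continuous_mode_deriv (i : mode) : continuous (mode_deriv i).
Proof. by move=> x; apply: cvgMr; exact: continuous_trig. Qed.

Lemma norm_trig_le1 (i : mode) (x : R) : `|trig i x| <= 1.
Proof. by case: i => j [] /=; [exact: sin_max|exact: cos_max]. Qed.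

Variable T : R.
Hypothesis T0 : 0 < T.

Definition mode_time (k : mode) (r : R) := mode_deriv k (r / T) / T.

Lemma is_derive_mode_time (k : mode) (r : R) :
  is_derive r (1 : R) (fun r => trig_prim k (r / T)) (mode_time k r).
Proof.
have h : is_derive r (1 : R) (fun x : R => x / T) T^-1.
  rewrite (_ : (fun x => _) = T^-1 *: id); last by apply/funext => z /=; rewrite mulrC.
  by apply: is_derive_eq; rewrite /GRing.scale/= mulr1.
have := @is_derive1_comp R (trig_prim k) (fun x : R => x / T) r _ _ (is_derive_trig_prim k _) h.
by [].
Qed.

Lemma continuous_mode_time (k : mode) : continuous (mode_time k).
Proof.
move=> x; apply: cvgMl.
apply: (@cvg_comp _ _ _ (fun r : R => r / T) (mode_deriv k) _ (nbhs (x / T))).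
  by apply: cvgMl; exact: cvg_id.
exact: continuous_mode_deriv.
Qed.

Definition slab (t : R) : set (TS * TS) := D `*` `[0, t].

Lemma measurable_slab t : measurable (slab t).
Proof. by apply: measurableX; [exact: measurable_D|exact: measurable_itv]. Qed.

Lemma slab_measure t : 0 <= t -> (mu2 (slab t) = t%:E)%E.
Proof.
move=> t0; rewrite product_measure1E//; last exact: measurable_D.
have := @lebesgue_measure_itv R `]0%R, 1%R[; rewrite /= lte_fin ltr01 => ->.
have := @lebesgue_measure_itv R `[0%R, t]; rewrite /= lte_fin => ->.
rewrite -EFinB subr0 mul1e; move: t0; rewrite le_eqVlt => /predU1P[<-|->].
  by rewrite ltxx.
by rewrite -EFinB subr0.
Qed.

Definition kernel_mode (i k : mode) (p : R * R) := mode_deriv i p.1 * mode_time k p.2.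

Definition integrand_mode t (g : R * R -> R) (i k : mode) : R :=
  \int[mu2]_(p in slab t) (g p * kernel_mode i k p).

Lemma kernel_mode_bound i k : exists2 C, 0 < C & forall p, `|kernel_mode i k p| <= C.
Proof.
exists (`|i.1%:R * pi| * (`|k.1%:R * pi| * T^-1) + 1); first by rewrite ltr_wpDl// !mulr_ge0// invr_ge0 ltW.
move=> p; rewrite /kernel_mode /mode_time /mode_deriv !normrM (@ger0_norm _ T^-1) ?invr_ge0 ?(ltW T0)//.
rewrite ler_wpDr// -!normrM.
have h1 := norm_trig_le1 i p.1; have h2 := norm_trig_le1 k (p.2 / T).
have f (a b : R) : `|b| <= 1 -> `|a * b| <= `|a| by move=> hb; rewrite normrM ler_piMr.
apply: ler_pM; [by []|by rewrite divr_ge0// ltW|exact: f|].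
by rewrite ler_wpM2r ?invr_ge0 ?(ltW T0)// f.
Qed.

Lemma measurable_kernel_mode i k : measurable_fun (setT : set (TS * TS)) (kernel_mode i k).
Proof.
apply: measurable_funM.
  apply: (measurableT_comp _ measurable_fst).
  by apply: continuous_measurable_fun; exact: continuous_mode_deriv.
apply: (measurableT_comp _ measurable_snd).
by apply: continuous_measurable_fun; exact: continuous_mode_time.
Qed.

Lemma step_fun_mode t (n : nat) (c : 'I_n -> R) (b : 'I_n -> box) i k :
  (forall m, box_in t (b m)) ->
  mu2.-integrable (slab t) (EFin \o (fun p => step_fun c b p * kernel_mode i k p)) /\
  integrand_mode t (step_fun c b) i k = step_mode T c b i k.
Proof.
move=> hb.
have h m : mu2.-integrable (slab t) (EFin \o (fun p => \1_(box_set (b m)) p * kernel_mode i k p)) /\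
   \int[mu2]_(p in slab t) (\1_(box_set (b m)) p * kernel_mode i k p) =
   (trig_prim i (y_hi (b m)) - trig_prim i (y_lo (b m))) *
    (trig_prim k (r_hi (b m) / T) - trig_prim k (r_lo (b m) / T)).
  have [[y0 y01 y1] [r0 r01 r1]] := hb m.
  have s1 x : y_lo (b m) < x <= y_hi (b m) -> D x.
    move=> /andP[h1 h2]; rewrite /D /= in_itv/=.
    by rewrite (lt_trans y0)//= (le_lt_trans h2).
  have s2 x : r_lo (b m) < x <= r_hi (b m) -> `[0, t]%classic x.
    move=> /andP[h1 h2]; rewrite /= in_itv/=.
    by rewrite (le_trans r0 (ltW h1))//= (le_trans h2).
  have [i1 e1] := Rintegral_indicM measurable_D y01 s1 (is_derive_trig_prim i) (@continuous_mode_deriv i).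
  have [i2 e2] := Rintegral_indicM (measurable_itv _) r01 s2 (is_derive_mode_time k) (@continuous_mode_time k).
  have [i3 e3] := Rintegral_prodM measurable_D (measurable_itv _) i1 i2.
  have E p : \1_(box_set (b m)) p * kernel_mode i k p =
    (\1_`]y_lo (b m), y_hi (b m)] p.1 * mode_deriv i p.1) * (\1_`]r_lo (b m), r_hi (b m)] p.2 * mode_time k p.2).
    rewrite /kernel_mode !indicE /box_set; case: p => y r /=; rewrite in_setX/=.
    by case: (_ \in _); case: (_ \in _); rewrite /= ?mul0r ?mulr0 ?mul1r.
  have EE : (fun p => \1_(box_set (b m)) p * kernel_mode i k p) = fun p =>
    (\1_`]y_lo (b m), y_hi (b m)] p.1 * mode_deriv i p.1) * (\1_`]r_lo (b m), r_hi (b m)] p.2 * mode_time k p.2).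
    by apply/funext => p; exact: E.
  by rewrite EE; split => //; rewrite e3 e1 e2.
pose hh m p := \1_(box_set (b m)) p * kernel_mode i k p.
pose kk m := (trig_prim i (y_hi (b m)) - trig_prim i (y_lo (b m))) *
    (trig_prim k (r_hi (b m) / T) - trig_prim k (r_lo (b m) / T)).
have [|||i1 e1] := @integral_lincomb _ _ R mu2 (slab t) _ (index_enum 'I_n) c hh kk.
- exact: measurable_slab.
- by move=> m _; have [] := h m.
- move=> m _; have [im em] := h m.
  by rewrite /kk -em /Rintegral fineK//; apply: integrable_fin_num => //; exact: measurable_slab.
have E p : step_fun c b p * kernel_mode i k p = \sum_(m <- index_enum 'I_n) c m * hh m p.
  by rewrite /step_fun mulr_suml; apply: eq_bigr => m _; rewrite /hh -mulrA.
have EE : (fun p => step_fun c b p * kernel_mode i k p) = (fun p => \sum_(m <- index_enum 'I_n) c m * hh m p).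
  by apply/funext => p; exact: E.
rewrite /integrand_mode EE; split => //; rewrite /Rintegral e1 /=.
by rewrite /step_mode; apply: eq_bigr => m _; rewrite mulrA.
Qed.

Lemma integrable_step_fun t (n : nat) (c : 'I_n -> R) (b : 'I_n -> box) : 0 <= t ->
  mu2.-integrable (slab t) (EFin \o step_fun c b).
Proof.
move=> t0; apply: measurable_bounded_integrable.
- exact: measurable_slab.
- by rewrite [X in (X < _)%E](slab_measure t0) ltry.
- apply: measurable_funTS; apply: measurable_sum => m.
  apply: measurable_funM => //; apply: measurable_indic.
  by apply: measurableX; exact: measurable_itv.
- exists (\sum_(m < n) `|c m|); split; first exact: num_real.
  move=> M MM p _ /=; rewrite (le_trans _ (ltW MM))// (le_trans (ler_norm_sum _ _ _))//.
  apply: ler_sum => m _; rewrite normrM indicE.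
  by case: (_ \in _); rewrite ?normr1 ?normr0 ?mulr1 ?mulr0.
Qed.

Context d (Omega : measurableType d) (P : probability Omega R).
Variable W : R -> R -> {RV P >-> R}.

(* X is a Wiener integral of which only the moments f of the integrand are remembered. *)
Definition approximable (X : Omega -> R) (f : mode -> mode -> R) : Prop :=
  measurable_fun setT X /\
  exists (n : nat -> nat) (c : forall m, 'I_(n m) -> R) (b : forall m, 'I_(n m) -> box),
    [/\ forall m i, box_in T (b m i),
        forall i k, step_mode T (c m) (b m) i k @[m --> \oo] --> f i k &
        (\int[P]_w ((step_integral W (c m) (b m) w - X w) ^+ 2)%:E @[m --> \oo] --> 0)%E ].

(** The functions [kernel_mode] are bounded and the slab has finite measure, so moments are
    continuous for the L^2 convergence of the step functions. *)
Lemma wiener_approximable t g X : 0 <= t <= T -> is_wiener_integral W t g X ->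
  approximable X (integrand_mode t g).
Proof.
move=> /andP[t0 tT] [mg mX [n [c [b [hb hg hX]]]]]; split => //; exists n, c, b; split.
- move=> m i; have [h [r0 r01 r1]] := hb m i; split => //; split => //.
  exact: le_trans r1 tT.
- move=> i k.
  have [C C0 hC] := kernel_mode_bound i k.
  have mst m : measurable_fun (slab t) (step_fun (c m) (b m)).
    by apply/measurable_EFinP; exact: measurable_int (integrable_step_fun _ _ t0).
  have msg m : measurable_fun (slab t) (fun p => step_fun (c m) (b m) p - g p).
    by apply: measurable_funB.
  have H := int_norm_cvg0 (measurable_slab t) (slab_measure t0) msg hg.
  have ih m : (\int[mu2]_(x in slab t) (`|step_fun (c m) (b m) x - g x|)%:E < +oo)%E ->
      mu2.-integrable (slab t) (EFin \o (fun p => step_fun (c m) (b m) p - g p)).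
    by move=> h; apply/integrableP; split => //; exact/measurable_EFinP.
  have igk (h : R * R -> R) : mu2.-integrable (slab t) (EFin \o h) ->
      mu2.-integrable (slab t) (EFin \o (fun p => h p * kernel_mode i k p)).
    move=> ih'; have ihC : mu2.-integrable (slab t) (fun p => C%:E * (h p)%:E)%E.
      by apply: integrableZl => //; exact: measurable_slab.
    apply: (le_integrable (measurable_slab t) _ _ ihC) => /=.
      apply/measurable_EFinP; apply: measurable_funM.
        by apply/measurable_EFinP; exact: measurable_int ih'.
      by apply: measurable_funTS; exact: measurable_kernel_mode.
    move=> p _; rewrite lee_fin normrM [leRHS]normrM mulrC (ger0_norm (ltW C0)).
    by rewrite ler_wpM2r.
  have [m0 hm0] : exists m, (\int[mu2]_(x in slab t) (`|step_fun (c m) (b m) x - g x|)%:E < +oo)%E.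
    have [m _ /(_ m (leqnn m)) hm] := H 1 ltr01; exists m.
    by apply: (le_lt_trans hm); exact: ltry.
  (* Integrability of g is recovered from a single step function at finite distance from it. *)
  have ig : mu2.-integrable (slab t) (EFin \o g).
    have := integrableB (measurable_slab t) (integrable_step_fun (c m0) (b m0) t0) (ih m0 hm0).
    rewrite (_ : (_ \- _)%E = EFin \o g)//; apply/funext => p /=.
    by rewrite -EFinB; congr (_%:E); ring.
  apply/cvgrPdist_le => e e0.
  have eC : 0 < e / C by exact: divr_gt0.
  apply: (filterS _ (H _ eC)) => m hm.
  have hmy := le_lt_trans hm (ltry _).
  have [is1 e1] := step_fun_mode (c m) i k (hb m).
  rewrite -e1 /integrand_mode distrC -RintegralB//; last 2 first.
  - exact: measurable_slab.
  - exact: igk.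
  have E : (fun p => step_fun (c m) (b m) p * kernel_mode i k p - g p * kernel_mode i k p) =
     (fun p => (step_fun (c m) (b m) p - g p) * kernel_mode i k p).
    by apply/funext => p; rewrite mulrBl.
  rewrite E.
  have ihm := ih m hmy; have ik := igk _ ihm.
  apply: (le_trans (le_normr_Rintegral (measurable_slab t) ik)).
  have ia : mu2.-integrable (slab t) (EFin \o (fun p => `|step_fun (c m) (b m) p - g p|)).
    exact: integrable_norm ihm.
  apply: (@le_trans _ _ (\int[mu2]_(p in slab t) (C * `|step_fun (c m) (b m) p - g p|))).
    apply: le_Rintegral.
    + exact: measurable_slab.
    + exact: (integrable_norm ik).
    + rewrite (_ : _ \o _ = fun p => (C%:E * (`|step_fun (c m) (b m) p - g p|)%:E)%E)//.
      by apply: integrableZl => //; exact: measurable_slab.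
    + by move=> p _; rewrite normrM mulrC ler_wpM2r.
  rewrite RintegralZl//; last exact: measurable_slab.
  rewrite -ler_pdivlMl// mulrC -lee_fin /Rintegral fineK//.
  by apply: integrable_fin_num => //; exact: measurable_slab.
- by move: hX; rewrite unlock.
Qed.

End wiener.

Section mean_square.
Context d (Omega : measurableType d) {R : realType} (P : probability Omega R).
Notation ex2 Y := (\int[P]_w ((Y w) ^+ 2)%:E)%E.

Lemma measurable_sqrE d' (T : measurableType d') (A : set T) (Y : T -> R) :
  measurable_fun A Y -> measurable_fun A (fun w => ((Y w) ^+ 2)%:E).
Proof. by move=> mY; apply/measurable_EFinP; exact: measurable_funX. Qed.

Lemma mean_square_add (Y Z : Omega -> R) : measurable_fun setT Y -> measurable_fun setT Z ->
  (ex2 (fun w => Y w + Z w) <= 2%:E * ex2 Y + 2%:E * ex2 Z)%E.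
Proof.
move=> mY mZ.
have m2 (V : Omega -> R) : measurable_fun setT V -> measurable_fun setT (fun w => (2%:E * (V w ^+ 2)%:E)%E).
  by move=> mV; apply: measurable_funeM; exact: measurable_sqrE.
have p2 (V : Omega -> R) w : (0 <= 2%:E * (V w ^+ 2)%:E)%E.
  by rewrite -EFinM lee_fin mulr_ge0// sqr_ge0.
have i2 (V : Omega -> R) : measurable_fun setT V ->
    (\int[P]_w (2%:E * (V w ^+ 2)%:E) = 2%:E * ex2 V)%E.
  move=> mV; rewrite ge0_integralZl//; first exact: measurable_sqrE.
  by move=> w _; rewrite lee_fin sqr_ge0.
apply: (@le_trans _ _ (\int[P]_w (2%:E * (Y w ^+ 2)%:E + 2%:E * (Z w ^+ 2)%:E))%E).
  apply: ge0_le_int => //.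
  - by move=> w _; rewrite lee_fin sqr_ge0.
  - by apply: measurable_sqrE; exact: measurable_funD.
  - by apply: emeasurable_funD; exact: m2.
  - move=> w _; rewrite -!EFinM -EFinD lee_fin.
    by have := sqr_ge0 (Y w - Z w); nra.
rewrite ge0_integralD//; [|exact: m2|exact: m2].
by rewrite !i2.
Qed.

Lemma mean_square_sub (Y Z : Omega -> R) : measurable_fun setT Y -> measurable_fun setT Z ->
  (ex2 (fun w => Y w - Z w) <= 2%:E * ex2 Y + 2%:E * ex2 Z)%E.
Proof.
move=> mY mZ; have mN : measurable_fun setT (fun w => - Z w) by exact: measurable_funN.
have := mean_square_add mY mN.
by rewrite [X in (_ <= _ + 2%:E * X)%E -> _](_ : _ = ex2 Z)//; apply: eq_integral => w _; rewrite sqrrN.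
Qed.

End mean_square.

Section approximation.
Context {R : realType}.
Variables (lam : nat -> R) (phi : nat -> L2D R).
Hypothesis hA : dirichlet_spectrum lam phi.
Context d (Omega : measurableType d) (P : probability Omega R).
Variables (H1 H2 T : R).
Hypothesis hH1 : 0 < H1 <= 2^-1.
Hypothesis hH2 : 0 < H2 <= 2^-1.
Hypothesis T0 : 0 < T.
Variables (F : R -> set (set Omega)) (W : R -> R -> {RV P >-> R}).
Hypothesis hW : is_fractional_brownian_sheet H1 H2 T F W.
Notation ex2 Y := (\int[P]_w ((Y w) ^+ 2)%:E)%E.
Notation mq := (mode_quad H1 H2 T).

Lemma measurable_step_integral n (c : 'I_n -> R) (b : 'I_n -> box) :
  measurable_fun setT (step_integral W c b).
Proof.
apply: measurable_sum => i; apply: measurable_funM => //.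
by apply: measurable_funD => //; apply: measurable_funB => //; exact: measurable_funB.
Qed.

Lemma step_sub (n n' : nat) (c : 'I_n -> R) (b : 'I_n -> box) (c' : 'I_n' -> R) (b' : 'I_n' -> box) :
  (forall i, box_in T (b i)) -> (forall i, box_in T (b' i)) ->
  exists (m : nat) (cc : 'I_m -> R) (bb : 'I_m -> box),
   [/\ forall i, box_in T (bb i),
       forall w, step_integral W cc bb w = step_integral W c b w - step_integral W c' b' w &
       forall i k, step_mode T cc bb i k = step_mode T c b i k - step_mode T c' b' i k].
Proof.
move=> hb hb'; exists (n + n')%N.
exists (fun i : 'I_(n + n') => match fintype.split i with inl j => c j | inr j => (- c' j)%R end).
exists (fun i : 'I_(n + n') => match fintype.split i with inl j => b j | inr j => b' j end).
split.
- by move=> i; case: (fintype.split i) => j.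
- move=> w; rewrite /step_integral big_split_ord/= -sumrN; congr (_ + _); apply: eq_bigr => i _.
    by rewrite (unsplitK (inl i)).
  by rewrite (unsplitK (inr i)) mulNr.
- move=> i k; rewrite /step_mode big_split_ord/= -sumrN; congr (_ + _); apply: eq_bigr => j _.
    by rewrite (unsplitK (inl j)).
  by rewrite (unsplitK (inr j)) !mulNr.
Qed.

(** The moments f enter only as limits of moments of step functions. Two late step functions differ
    by at most 4 e in mean square, which by [step_quad] bounds [mode_quad] of the difference of
    their moments; letting the second index tend to infinity replaces it by f. *)
Lemma approximable_step X f e : approximable T W X f -> 0 < e ->
  exists (n : nat) (c : 'I_n -> R) (b : 'I_n -> box),
   [/\ forall i, box_in T (b i), (ex2 (fun w => step_integral W c b w - X w) <= e%:E)%E &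
       forall M, mq M (fun i k => step_mode T c b i k - f i k) <= 4 * e].
Proof.
move=> [mX [n [c [b [hb hf hX]]]]] e0.
have : \forall m \near \oo, (ex2 (fun w => step_integral W (c m) (b m) w - X w) <= e%:E)%E.
  have e0' : (0 < e%:E)%E by rewrite lte_fin.
  have H : \forall m \near \oo, (ex2 (fun w => step_integral W (c m) (b m) w - X w) < e%:E)%E.
    exact: (hX _ (open_ereal_lt' e0')).
  by apply: (filterS _ H) => m; exact: ltW.
move=> [m _ hm]; exists (n m), (c m), (b m); split => //; first exact: hm m (leqnn m).
move=> M.
have cv : mq M (fun i k => step_mode T (c m) (b m) i k - step_mode T (c m') (b m') i k)
    @[m' --> \oo] --> mq M (fun i k => step_mode T (c m) (b m) i k - f i k).
  apply: (@mode_quad_cvg _ _ _ _ M (fun m' i k => step_mode T (c m) (b m) i k - step_mode T (c m') (b m') i k)).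
  by move=> i k; apply: cvgB; [exact: cvg_cst|exact: hf].
rewrite -(cvg_lim _ cv)//; apply: limr_le; first by apply/cvg_ex; eexists; exact: cv.
exists m => // m' /= mm'.
have [N [cc [bb [hbb hS hM]]]] := step_sub (c m) (c m') (hb m) (hb m').
have [V [hV _ hVM]] := step_quad hA hH1 hH2 T0 hW cc hbb.
rewrite (_ : (fun i k => _) = step_mode T cc bb); last first.
  by apply/funext => i; apply/funext => k; rewrite hM.
apply: (le_trans (hVM M)); rewrite -lee_fin -hV.
rewrite (eq_integral (fun w => (((step_integral W (c m) (b m) w - X w) - (step_integral W (c m') (b m') w - X w)) ^+ 2)%:E)); last first.
  by move=> w _; rewrite hS; congr (_ ^+ 2)%:E; ring.
have mS k : measurable_fun setT (fun w => step_integral W (c k) (b k) w - X w).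
  by apply: measurable_funB => //; exact: measurable_step_integral.
apply: (le_trans (mean_square_sub P (mS m) (mS m'))).
have h1 := hm m (leqnn m); have h2 := hm m' mm'.
have -> : (4 * e)%:E = (2%:E * e%:E + 2%:E * e%:E)%E by rewrite -!EFinM -EFinD; congr (_%:E); ring.
by apply: leeD; rewrite lee_wpmul2l ?lee_fin.
Qed.

(** The factor 4 comes from using (a + b)^2 <= 2 a^2 + 2 b^2 twice in place of an exact isometry;
    only the order of magnitude matters later. *)
Lemma approximable_ub X f B : approximable T W X f -> (forall M, mq M f <= B) ->
  (ex2 X <= (4 * B)%:E)%E.
Proof.
move=> aX hB; have mX := aX.1; apply/lee_addgt0Pr => e e0.
(* The error is met 2 (2 * 4) + 2 = 18 times. *)
have e18 : 0 < e / 18 by exact: divr_gt0.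
have [n [c [b [hb hS hM]]]] := approximable_step aX e18.
have [V [hV cV _]] := step_quad hA hH1 hH2 T0 hW c hb.
have VB : V <= 2 * B + 2 * (4 * (e / 18)).
  rewrite -(cvg_lim _ cV)//; apply: limr_le; first by apply/cvg_ex; eexists; exact: cV.
  apply: nearW => M.
  rewrite (_ : step_mode T c b = fun i k => f i k + (step_mode T c b i k - f i k)); last first.
    by apply/funext => i; apply/funext => k; ring.
  apply: (le_trans (mode_quadD T hH1 hH2 _ _ _)).
  by apply: lerD; rewrite ler_wpM2l.
have mS := measurable_step_integral c b.
have := mean_square_sub P mS (measurable_funB mS mX).
rewrite (eq_integral (fun w => (X w ^+ 2)%:E)); last first.
  by move=> w _; congr (_ ^+ 2)%:E; rewrite /=; ring.
move/le_trans; apply; rewrite hV.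
apply: (@le_trans _ _ (2%:E * (2 * B + 2 * (4 * (e / 18)))%:E + 2%:E * (e / 18)%:E)%E).
  by apply: leeD; rewrite lee_wpmul2l ?lee_fin.
by rewrite -!EFinM -!EFinD lee_fin; lra.
Qed.

(** The energy of the moments of any Wiener integral is finite. This makes the limits in
    [field_mean_square] real numbers and is what [no_rough_conv] contradicts. *)
Lemma approximable_lb X f : approximable T W X f -> exists B, forall M, mq M f <= B.
Proof.
move=> aX; have [n [c [b [hb _ hM]]]] := approximable_step aX ltr01.
have [V [_ _ hV]] := step_quad hA hH1 hH2 T0 hW c hb.
exists (2 * V + 2 * (4 * 1)) => M.
rewrite (_ : f = fun i k => step_mode T c b i k + (- (step_mode T c b i k - f i k))); last first.
  by apply/funext => i; apply/funext => k; ring.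
apply: (le_trans (mode_quadD T hH1 hH2 _ _ _)).
apply: lerD; rewrite ler_wpM2l//.
rewrite (_ : mq M _ = mq M (fun i k => step_mode T c b i k - f i k))//.
by apply: eq_bigr => i _; apply: eq_bigr => k _; rewrite sqrrN.
Qed.

Lemma approximable_sub X f X' f' : approximable T W X f -> approximable T W X' f' ->
  approximable T W (fun w => X w - X' w) (fun i k => f i k - f' i k).
Proof.
move=> [mX [n [c [b [hb hf hX]]]]] [mX' [n' [c' [b' [hb' hf' hX']]]]].
split; first exact: measurable_funB.
have /choice[q hq] : forall m, exists q : {N : nat & (('I_N -> R) * ('I_N -> box))%type},
   [/\ forall i, box_in T ((projT2 q).2 i),
       forall w, step_integral W (projT2 q).1 (projT2 q).2 w = step_integral W (c m) (b m) w - step_integral W (c' m) (b' m) w &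
       forall i k, step_mode T (projT2 q).1 (projT2 q).2 i k = step_mode T (c m) (b m) i k - step_mode T (c' m) (b' m) i k].
  move=> m; have [N [cc [bb h]]] := step_sub (c m) (c' m) (hb m) (hb' m).
  by exists (existT _ N (cc, bb)).
exists (fun m => projT1 (q m)), (fun m => (projT2 (q m)).1), (fun m => (projT2 (q m)).2); split.
- by move=> m; have [] := hq m.
- move=> i k; have h : step_mode T (c m) (b m) i k - step_mode T (c' m) (b' m) i k @[m --> \oo] --> f i k - f' i k.
    by apply: cvgB; [exact: hf|exact: hf'].
  apply: (cvg_trans _ h); apply: near_eq_cvg; apply: nearW => m /=.
  by have [_ _ ->] := hq m.
- have mS m := measurable_step_integral (c m) (b m).
  have mS' m := measurable_step_integral (c' m) (b' m).
  have h : (2%:E * ex2 (fun w => step_integral W (c m) (b m) w - X w) +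
      2%:E * ex2 (fun w => step_integral W (c' m) (b' m) w - X' w) @[m --> \oo] --> 0)%E.
    have -> : (0 = 2%:E * 0 + 2%:E * 0 :> \bar R)%E by rewrite mule0 adde0.
    by apply: cvgeD; [rewrite mule0|apply: cvgeZl|apply: cvgeZl].
  apply: (squeeze_cvge _ (cvg_cst 0%E) h); apply: nearW => m.
  rewrite integral_ge0/=; last by move=> w _; rewrite lee_fin sqr_ge0.
  apply: le_trans (mean_square_sub P (measurable_funB (mS m) mX) (measurable_funB (mS' m) mX')).
  rewrite le_eqVlt; apply/orP; left; apply/eqP; apply: eq_integral => w _.
  by have [_ -> _] := hq m; congr (_ ^+ 2)%:E; rewrite /=; ring.
Qed.

End approximation.

(** * Time responses *)

Section symbol_bounds.
Context {R : realType}.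
Notation mu := (@lebesgue_measure R).
Variables (alpha s : R) (lam : nat -> R) (phi : nat -> L2D R).
Hypotheses (halpha : 0 < alpha < 1) (hs : 0 < s < 1).
Hypothesis hA : dirichlet_spectrum lam phi.
Notation e := (symbol alpha s lam).

Lemma sym_arg_ge0 k (t : R) : 0 <= lam k `^ s * t `^ alpha.
Proof. by rewrite mulr_ge0// powR_ge0. Qed.

Lemma lamE k : (1 <= k)%N -> lam k = (k%:R * pi) ^+ 2.
Proof. by have [a h] := spectrum_sin hA => /h[]. Qed.

Lemma lam_powE k : (1 <= k)%N -> lam k `^ s = (k%:R * pi) `^ (2 * s).
Proof.
by move=> k1; rewrite lamE// powRrM powR_mulrn// mulr_ge0// pi_ge0.
Qed.

Lemma sym_gt0 k t : 0 < e k t.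
Proof.
have /andP[a0 a1] := halpha.
by rewrite /symbol; have := ml_gt0 a0 a1 (sym_arg_ge0 k t).
Qed.

Lemma sym_le1 k t : e k t <= 1.
Proof.
have /andP[a0 a1] := halpha.
by rewrite /symbol; have := ml_le1 a0 a1 (sym_arg_ge0 k t).
Qed.

Lemma sym_nincr k (t u : R) : 0 <= t -> t <= u -> e k u <= e k t.
Proof.
have /andP[a0 a1] := halpha.
move=> t0 tu; rewrite /symbol; apply: (ml_nincr a0 a1); first exact: sym_arg_ge0.
by rewrite ler_wpM2l ?powR_ge0// le_powR// ltW.
Qed.

Lemma sym_nincr_index j k (t : R) : (1 <= j)%N -> (j <= k)%N -> e k t <= e j t.
Proof.
have /andP[a0 a1] := halpha; have /andP[s0 s1] := hs.
move=> j1 jk; rewrite /symbol; apply: (ml_nincr a0 a1); first exact: sym_arg_ge0.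
rewrite ler_wpM2r ?powR_ge0// !lam_powE//; last exact: leq_trans jk.
apply: le_powR; rewrite ?mulr_ge0 ?pi_ge0 ?(ltW s0)//.
by rewrite ler_wpM2r ?pi_ge0// ler_nat.
Qed.

Lemma measurable_sym k : measurable_fun (setT : set (measurableTypeR R)) (e k).
Proof.
have /andP[a0 a1] := halpha.
apply: (measurableT_comp (continuous_measurable_fun (@ml_continuous R alpha a0 1 ltr01))).
by apply: measurable_funN; apply: measurable_funM => //; exact: measurable_powR.
Qed.

(** Interpolation between E <= 1 and E <= C / x, where x = lam_k^s t^alpha. The parameter th trades
    decay in the eigenvalue index against the singularity at t = 0. *)
Lemma sym_le (th : R) : 0 <= th <= 1 -> exists2 C : R, 0 < C &
  forall k t, (1 <= k)%N -> 0 < t -> e k t <= C * k%:R `^ (- (2 * s * th)) * t `^ (- (alpha * th)).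
Proof.
have /andP[a0 a1] := halpha; have /andP[s0 s1] := hs.
move=> /andP[th0 th1]; have [C C0 hC] := ml_ub a0 a1.
exists (1 + C); first by rewrite addr_gt0.
move=> k t k1 t0; have k0 : 0 < (k%:R : R) by rewrite ltr0n.
have kp0 : 0 < (k%:R * pi : R) by rewrite mulr_gt0// pi_gt0.
pose x := lam k `^ s * t `^ alpha.
have x0 : 0 < x by rewrite mulr_gt0 ?powR_gt0// lamE// exprn_gt0.
have h : e k t <= (1 + C) * x `^ (- th).
  have [x1|x1] := leP x 1.
    rewrite (le_trans (sym_le1 k t))// -[leLHS]mulr1; apply: ler_pM => //.
      by rewrite lerDl ltW.
    rewrite powRN invf_ge1 ?powR_gt0//.
    by have := le_powR th0 (ltW x0) x1; rewrite powR1.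
  apply: (le_trans (hC x x0)); rewrite -(powR_inv1 (ltW x0)).
  apply: ler_pM; rewrite ?powR_ge0 ?(ltW C0)// ?lerDr//.
  by rewrite ler_powR// ?(ltW x1)// lerN2.
apply: (le_trans h); rewrite -mulrA ler_wpM2l ?addr_ge0 ?(ltW C0)//.
rewrite /x lam_powE// powRM ?powR_ge0// -!powRrM !mulrN.
rewrite ler_wpM2r ?powR_ge0//.
rewrite !powRN lef_pV2 ?posrE ?powR_gt0// le_powR ?(ltW k0) ?mulr_ge0 ?(ltW s0)//.
by rewrite ler_peMr ?(ltW k0)// (le_trans _ (pi_ge2 _))// ler1n.
Qed.

Lemma sym_ge t0 : 0 < t0 -> exists2 c : R, 0 < c & exists k0, forall k t, (k0 <= k)%N -> (1 <= k)%N ->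
  t0 <= t -> c * k%:R `^ (- (2 * s)) * t `^ (- alpha) <= e k t.
Proof.
have /andP[a0 a1] := halpha; have /andP[s0 s1] := hs.
move=> t00; have [c c0 hc] := ml_lb a0 a1.
have p2 : 0 < (pi : R) `^ (- (2 * s)) by rewrite powR_gt0 ?pi_gt0.
exists (c * pi `^ (- (2 * s))); first exact: mulr_gt0.
(* From this index on lam_k^s t0^alpha >= 1, the range in which [ml_lb] applies. *)
exists (Num.truncn ((t0 `^ (- alpha)) `^ ((2 * s)^-1))).+1 => k t kk k1 t0t.
have k0 : 0 < (k%:R : R) by rewrite ltr0n.
have t1 : 0 < t := lt_le_trans t00 t0t.
have kpi0 : 0 < (k%:R * pi : R) by rewrite mulr_gt0// pi_gt0.
have x0 : 0 < lam k `^ s * t `^ alpha by rewrite mulr_gt0 ?powR_gt0// lamE// exprn_gt0.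
have x1 : 1 <= lam k `^ s * t `^ alpha.
  have h1 : t0 `^ (- alpha) <= lam k `^ s.
    have y0 : 0 <= t0 `^ (- alpha) by rewrite powR_ge0.
    have {1}-> : t0 `^ (- alpha) = (t0 `^ (- alpha)) `^ ((2 * s)^-1) `^ (2 * s).
      by rewrite -[RHS]powRrM mulVf ?gt_eqF ?mulr_gt0// powRr1.
    rewrite lam_powE// le_powR ?mulr_ge0 ?powR_ge0 ?(ltW s0)//.
    apply: (@le_trans _ _ (k%:R : R)).
      by rewrite (le_trans (ltW (truncnS_gt _)))// ler_nat.
    by rewrite ler_peMr ?(ltW k0)// (le_trans _ (pi_ge2 _))// ler1n.
  apply: (@le_trans _ _ (t0 `^ (- alpha) * t0 `^ alpha)).
    by rewrite -powRD_gt0// addNr powRr0.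
  by apply: ler_pM; rewrite ?powR_ge0// le_powR// ltW.
apply: le_trans (hc _ x1).
rewrite lam_powE// invfM -!powRN powRM ?(ltW k0) ?pi_ge0//.
by apply: le_of_eq; move: (_ `^ _) (_ `^ _) (_ `^ _) => q1 q2 q3; ring.
Qed.

End symbol_bounds.

Section bounded_measurable.
Context {R : realType}.
Notation mu := (@lebesgue_measure R).
Notation TS := (measurableTypeR R).

(** A class closed under products, sums, shifts and reflections and integrable on every bounded
    interval, so that integrability follows from the shape of the integrand. *)
Definition bmeas (f : R -> R) : Prop :=
  measurable_fun (setT : set TS) f /\ exists M, forall x, `|f x| <= M.

Lemma bmeasM f g : bmeas f -> bmeas g -> bmeas (fun x => f x * g x).
Proof.
move=> [mf [M hM]] [mg [N hN]]; split; first exact: measurable_funM.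
by exists (M * N) => x; rewrite normrM ler_pM.
Qed.

Lemma bmeasD f g : bmeas f -> bmeas g -> bmeas (fun x => f x + g x).
Proof.
move=> [mf [M hM]] [mg [N hN]]; split; first exact: measurable_funD.
by exists (M + N) => x; rewrite (le_trans (ler_normD _ _))// lerD.
Qed.

Lemma bmeas_cst c : bmeas (fun=> c).
Proof. by split => //; exists `|c|. Qed.

Lemma bmeasN f : bmeas f -> bmeas (fun x => - f x).
Proof.
move=> [mf [M hM]]; split; first exact: measurable_funN.
by exists M => x; rewrite normrN.
Qed.

Lemma bmeasB f g : bmeas f -> bmeas g -> bmeas (fun x => f x - g x).
Proof. by move=> bf bg; apply: bmeasD => //; exact: bmeasN. Qed.

Lemma bmeas_norm f : bmeas f -> bmeas (fun x => `|f x|).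
Proof.
move=> [mf [M hM]]; split; first exact: measurableT_comp.
by exists M => x; rewrite normr_id.
Qed.

Lemma bmeas_comp f g : bmeas f -> measurable_fun (setT : set TS) (g : TS -> TS) -> bmeas (fun x => f (g x)).
Proof.
move=> [mf [M hM]] mg; split; first exact: (measurableT_comp mf mg).
by exists M => x.
Qed.

Lemma bmeas_shift f c : bmeas f -> bmeas (fun x => f (x + c)).
Proof. by move=> bf; apply: bmeas_comp => //; exact: measurable_funD. Qed.

Lemma bmeas_reflect f c : bmeas f -> bmeas (fun x => f (c - x)).
Proof. by move=> bf; apply: bmeas_comp => //; exact: measurable_funB. Qed.

Lemma bmeas_integrable f (A : set TS) : bmeas f -> measurable A -> (mu A < +oo)%E ->
  mu.-integrable A (EFin \o f).
Proof.
move=> [mf [M hM]] mA Aoo; apply: measurable_bounded_integrable => //.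
  exact: measurable_funTS.
exists M; split; first exact: num_real.
by move=> N MN x _ /=; rewrite (le_trans (hM x))// ltW.
Qed.

Lemma itv_finite (i : interval R) (a b : R) : ([set` i] `<=` `[a, b]) -> (mu [set` i] < +oo)%E.
Proof.
move=> h; apply: (@le_lt_trans _ _ (mu `[a, b])); first by apply: le_measure; rewrite ?inE.
by rewrite lebesgue_measure_itv/=; case: ifP => _; rewrite -?EFinB ltry.
Qed.

(** Half-open intervals split without overlap and keep their form under translation. *)
Definition J (a b : R) (f : R -> R) : R := \int[mu]_(x in `]a, b]) f x.

Lemma int_oc f a b : bmeas f -> mu.-integrable `]a, b] (EFin \o f).
Proof.
move=> bf; apply: bmeas_integrable => //; apply: (@itv_finite _ a b).
by move=> x /=; rewrite !in_itv/= => /andP[/ltW -> ->].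
Qed.

Lemma J_EFin f a b : bmeas f -> (\int[mu]_(x in `]a, b]) (f x)%:E = (J a b f)%:E)%E.
Proof. by move=> bf; rewrite /J /Rintegral fineK//; apply: integrable_fin_num => //; exact: int_oc. Qed.

Lemma J_cc f a b : bmeas f -> \int[mu]_(x in `[a, b]) f x = J a b f.
Proof. by move=> bf; rewrite /J Rintegral_itv_obnd_cbnd//; exact: int_oc. Qed.

Lemma J_split f a b c : bmeas f -> a <= b -> b <= c -> J a c f = J a b f + J b c f.
Proof.
move=> bf ab bc; rewrite /J -(@Rintegral_itvB _ f (BRight a) (BRight c) b) ?bnd_simp//; last exact: int_oc.
by rewrite addrC subrK.
Qed.

Lemma J_shift f a b c : bmeas f -> J (a + c) (b + c) f = J a b (fun x => f (x + c)).
Proof.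
move=> bf; rewrite /J /Rintegral (integral_shift c)//; last first.
  by apply/measurable_EFinP; apply: measurable_funTS; exact: bf.1.
congr (fine (integral _ _ _)); apply/seteqP; split => x /=; rewrite !in_itv/= ltrD2r lerD2r//.
Qed.

Lemma J_reflect f t a b : bmeas f -> J a b (fun x => f (t - x)) = J (t - b) (t - a) f.
Proof.
move=> bf; rewrite -(J_cc _ _ bf) /J.
rewrite /Rintegral (integral_reflect t)//; last first.
  by apply/measurable_EFinP; apply: measurable_funTS; exact: (bmeas_reflect t bf).1.
rewrite -integral_itv_bndo_bndc; last by apply/measurable_EFinP; apply: measurable_funTS; exact: bf.1.
congr fine; rewrite (_ : [set x | _] = `[(t - b)%R, (t - a)%R[%classic); last first.
  by apply/seteqP; split => x /=; rewrite !in_itv/= => /andP[h1 h2]; apply/andP; split; lra.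
by apply: eq_integral => x _; rewrite subKr.
Qed.

Lemma J_le f g a b : bmeas f -> bmeas g -> (forall x, a < x <= b -> f x <= g x) -> J a b f <= J a b g.
Proof. by move=> bf bg h; apply: le_Rintegral => //; try exact: int_oc; move=> x /=; rewrite in_itv/=; exact: h. Qed.

Lemma J_ge0 f a b : (forall x, a < x <= b -> 0 <= f x) -> 0 <= J a b f.
Proof. by move=> h; apply: Rintegral_ge0 => x /=; rewrite in_itv/=; exact: h. Qed.

Lemma J_norm f a b : bmeas f -> `|J a b f| <= J a b (fun x => `|f x|).
Proof. by move=> bf; apply: le_normr_Rintegral => //; exact: int_oc. Qed.

Lemma JB f g a b : bmeas f -> bmeas g -> J a b (fun x => f x - g x) = J a b f - J a b g.
Proof. by move=> bf bg; apply: RintegralB => //; exact: int_oc. Qed.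

Lemma JZ c f a b : bmeas f -> J a b (fun x => c * f x) = c * J a b f.
Proof. by move=> bf; apply: RintegralZl => //; exact: int_oc. Qed.

Lemma J_norm_le f g a b : bmeas f -> bmeas g -> (forall x, a < x <= b -> `|f x| <= g x) ->
  `|J a b f| <= J a b g.
Proof. by move=> bf bg h; apply: (le_trans (J_norm _ _ bf)); apply: J_le => //; exact: bmeas_norm. Qed.

Lemma eq_J f g a b : (forall x, a < x <= b -> f x = g x) -> J a b f = J a b g.
Proof. by move=> h; apply: eq_Rintegral => x; rewrite inE/= in_itv/=; exact: h. Qed.

(* Oscillation: shifting by a half period h and averaging the two expressions leaves only
   increments of the monotone factor. *)
Lemma osc_le (e g : R -> R) (h t : R) : bmeas e -> bmeas g -> 0 < h -> 0 <= t ->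
  (forall x, 0 <= e x) -> (forall x y, 0 <= x -> x <= y -> e y <= e x) ->
  (forall x, `|g x| <= 1) -> (forall x, g (x + h) = - g x) ->
  `|J 0 t (fun x => e x * g x)| <= J 0 h e.
Proof.
move=> be bg h0 t0 e0 en g1 gh; have beg := bmeasM be bg.
have eg x : `|e x * g x| <= e x by rewrite normrM ger0_norm// ler_piMr.
have [th|ht] := leP t h.
  apply: (@le_trans _ _ (J 0 t e)); first by apply: J_norm_le => // x _; exact: eg.
  by rewrite (J_split be t0 th) lerDl J_ge0.
have th0 : 0 <= t - h by rewrite subr_ge0 ltW.
have tht : t - h <= t by rewrite gerBl ltW.
pose X x := e x * g x.
have beh : bmeas (fun x => e (x + h)) by exact: bmeas_shift.
have bY : bmeas (fun x => e (x + h) * g x) by exact: bmeasM.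
have E1 : J 0 t X = J 0 h X - J 0 (t - h) (fun x => e (x + h) * g x).
  rewrite (J_split beg (ltW h0) (ltW ht)); congr (_ + _).
  rewrite -{1}(add0r h) -{1}(subrK h t) J_shift//.
  by rewrite -[RHS]mulN1r -JZ//; apply: eq_J => x _; rewrite gh; ring.
have E2 : J 0 t X = J 0 (t - h) X + J (t - h) t X by apply: J_split.
have E3 : J 0 (t - h) (fun x => (e x - e (x + h)) * g x) =
    J 0 (t - h) X - J 0 (t - h) (fun x => e (x + h) * g x).
  by rewrite -JB//; apply: eq_J => x _; rewrite mulrBl.
have I1 : `|J 0 h X| <= J 0 h e by apply: J_norm_le => // x _; exact: eg.
have I2 : `|J (t - h) t X| <= J (t - h) t e by apply: J_norm_le => // x _; exact: eg.
have I3 : `|J 0 (t - h) (fun x => (e x - e (x + h)) * g x)| <= J 0 (t - h) (fun x => e x - e (x + h)).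
  apply: J_norm_le; [by apply: bmeasM => //; exact: bmeasB|exact: bmeasB|].
  move=> x /andP[/ltW x0 _]; have d0 : 0 <= e x - e (x + h).
    by rewrite subr_ge0 en// lerDl ltW.
  by rewrite normrM (ger0_norm d0) ler_piMr.
rewrite JB// in I3.
have F1 : J 0 t e = J 0 (t - h) e + J (t - h) t e by apply: J_split.
have F2 : J 0 t e = J 0 h e + J h t e by apply: J_split => //; exact: ltW.
have F3 : J h t e = J 0 (t - h) (fun x => e (x + h)).
  by rewrite -{1}(add0r h) -{1}(subrK h t) J_shift.
move: I1 I2 I3; rewrite E3 F3 in F2 *.
rewrite -/X.
move: (J 0 t X) (J 0 h X) (J (t - h) t X) (J 0 (t - h) X) (J 0 (t - h) (fun x => e (x + h) * g x)) E1 E2.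
move: (J 0 t e) (J 0 (t - h) e) (J (t - h) t e) (J 0 h e) (J 0 (t - h) (fun x => e (x + h))) F1 F2.
move=> p1 p2 p3 p4 p5 f1 f2 q1 q2 q3 q4 q5 e1 e2.
rewrite !ler_norml => /andP[a1 a2] /andP[b1 b2] /andP[c1 c2].
by apply/andP; split; lra.
Qed.

(** The difference consists of the integral over ]t', t] and of the one over ]0, t'] against e (t' -
    r) - e (t - r), which is nonnegative by monotonicity. Both have absolute value at most the
    integral of e over ]0, t - t']. *)
Lemma shift_diff_le (e g : R -> R) (t' t : R) : bmeas e -> bmeas g -> 0 <= t' -> t' <= t ->
  (forall x, 0 <= e x) -> (forall x y, 0 <= x -> x <= y -> e y <= e x) -> (forall x, `|g x| <= 1) ->
  `|J 0 t (fun r => e (t - r) * g r) - J 0 t' (fun r => e (t' - r) * g r)| <= 2 * J 0 (t - t') e.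
Proof.
move=> be bt t'0 t't e0 en n1.
have b1 := bmeas_reflect t be; have b2 := bmeas_reflect t' be.
have b3 := bmeasM b1 bt; have b4 := bmeasM b2 bt.
rewrite (J_split b3 t'0 t't) addrAC -(JB _ _ b3 b4).
have I1 : `|J t' t (fun r => e (t - r) * g r)| <= J t' t (fun r => e (t - r)).
  by apply: (J_norm_le b3 b1) => x _; rewrite normrM ger0_norm ?ler_piMr.
have I2 : `|J 0 t' (fun x => e (t - x) * g x - e (t' - x) * g x)| <=
    J 0 t' (fun r => e (t' - r) - e (t - r)).
  apply: (J_norm_le (bmeasB b3 b4) (bmeasB b2 b1)).
  move=> x /andP[x0 xt']; rewrite -mulrBl normrM distrC.
  have d0 : 0 <= e (t' - x) - e (t - x).
    by rewrite subr_ge0 en ?subr_ge0// lerD2r.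
  by rewrite (ger0_norm d0) ler_piMr.
rewrite (JB _ _ b2 b1) in I2.
rewrite !(J_reflect _ _ _ be) !subr0 ?subrr in I1 I2.
have F1 : J 0 t e = J 0 (t - t') e + J (t - t') t e.
  by apply: (J_split be); rewrite ?subr_ge0// gerBl.
have F2 : J 0 t e = J 0 t' e + J t' t e by exact: (J_split be).
have F3 : 0 <= J t' t e by exact: J_ge0.
apply: (le_trans (ler_normD _ _)).
move: (`|J 0 t' _|) (`|J t' t _|) (J 0 t e) (J 0 (t - t') e) (J (t - t') t e) (J 0 t' e) (J t' t e) I1 I2 F1 F2 F3.
by move=> n2 n3 p1 p2 p3 p4 p5 f1 f2 f3 i1 i2; lra.
Qed.

End bounded_measurable.

Section response.
Context {R : realType}.
Notation mu := (@lebesgue_measure R).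
Notation TS := (measurableTypeR R).
Variables (alpha s T : R) (lam : nat -> R) (phi : nat -> L2D R).
Hypotheses (halpha : 0 < alpha < 1) (hs : 0 < s < 1) (T0 : 0 < T).
Hypothesis hA : dirichlet_spectrum lam phi.
Notation e := (symbol alpha s lam).

Definition response k (t : R) (j : mode) : R :=
  \int[mu]_(r in `[0%R, t]) (e k (t - r) * mode_time T j r).

Lemma bmeas_sym k : bmeas (e k).
Proof.
split; first exact: measurable_sym.
by exists 1 => x; rewrite ger0_norm ?sym_le1// ltW// sym_gt0.
Qed.

Definition time_trig (j : mode) (r : R) := trig j (r / T).

Lemma bmeas_time_trig j : bmeas (time_trig j).
Proof.
split; last by exists 1 => x; exact: norm_trig_le1.
apply: (measurableT_comp (continuous_measurable_fun (@continuous_trig R j))).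
by apply: measurable_funM.
Qed.

Lemma time_trig_half j r : (1 <= j.1)%N -> time_trig j (r + T / j.1%:R) = - time_trig j r.
Proof.
case: j => l b /= l1; rewrite /time_trig /trig/=.
have -> : l%:R * pi * ((r + T / l%:R) / T) = l%:R * pi * (r / T) + pi.
  by field; rewrite (gt_eqF T0) pnatr_eq0 -lt0n.
by case: b; [exact: (@sinDpi R)|exact: (@cosDpi R)].
Qed.

Let amp (j : mode) : R := j.1%:R * pi / T.

Lemma mode_timeE j r : mode_time T j r = amp j * time_trig j r.
Proof. by rewrite /mode_time /mode_deriv /amp /time_trig; ring. Qed.

Lemma amp_ge0 j : 0 <= amp j.
Proof. by rewrite divr_ge0 ?mulr_ge0 ?pi_ge0 ?(ltW T0). Qed.

Lemma responseE k t j : response k t j = amp j * J 0 t (fun r => e k (t - r) * time_trig j r).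
Proof.
have b := bmeasM (bmeas_reflect t (bmeas_sym k)) (bmeas_time_trig j).
rewrite -JZ// /response J_cc; last first.
  rewrite (_ : (fun _ => _) = fun r => amp j * (e k (t - r) * time_trig j r)).
    by apply: bmeasM => //; exact: bmeas_cst.
  by apply/funext => r; rewrite mode_timeE mulrCA.
by apply: eq_J => r _; rewrite mode_timeE mulrCA.
Qed.

Lemma response_osc k t j : (1 <= j.1)%N -> 0 <= t -> `|response k t j| <= amp j * J 0 (T / j.1%:R) (e k).
Proof.
move=> j1 t0; rewrite responseE normrM (ger0_norm (amp_ge0 j)) ler_wpM2l ?amp_ge0//.
pose g r := time_trig j (t - r).
have bg : bmeas g by apply: bmeas_reflect; exact: bmeas_time_trig.
have b := bmeasM (bmeas_sym k) bg.
have -> : J 0 t (fun r => e k (t - r) * time_trig j r) = J 0 t (fun r => e k r * g r).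
  transitivity (J (t - t) (t - 0) (fun r => e k r * g r)); last by rewrite subrr subr0.
  by rewrite -J_reflect//; apply: eq_J => r _; rewrite /g subKr.
have j0 : 0 < (j.1%:R : R) by rewrite ltr0n.
apply: osc_le => //.
- exact: bmeas_sym.
- by rewrite divr_gt0.
- by move=> x; apply/ltW/sym_gt0.
- by move=> x y; exact: sym_nincr.
- by move=> x; exact: norm_trig_le1.
- move=> x; rewrite /g opprD addrA.
  by rewrite -[in RHS](subrK (T / j.1%:R) (t - x)) time_trig_half// opprK.
Qed.

Lemma response_diff k t' t j : 0 <= t' -> t' <= t ->
  `|response k t j - response k t' j| <= amp j * (2 * J 0 (t - t') (e k)).
Proof.
move=> t'0 t't; rewrite !responseE -mulrBr normrM (ger0_norm (amp_ge0 j)) ler_wpM2l ?amp_ge0//.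
apply: (shift_diff_le (bmeas_sym k) (bmeas_time_trig j) t'0 t't).
- by move=> x; apply/ltW/sym_gt0.
- by move=> x y; exact: sym_nincr.
- by move=> x; exact: norm_trig_le1.
Qed.

Lemma J_sym_le th : 0 <= th <= 1 -> exists2 C : R, 0 < C &
  forall k h, (1 <= k)%N -> 0 <= h -> J 0 h (e k) <= C * k%:R `^ (- (2 * s * th)) * h `^ (1 - alpha * th).
Proof.
move=> th01; have [C C0 hC] := sym_le halpha hs hA th01.
have /andP[a0 a1] := halpha; have /andP[th0 th1] := th01.
have q0 : 0 < 1 - alpha * th.
  by rewrite subr_gt0 (le_lt_trans _ a1)// ler_piMr// ltW.
exists (C / (1 - alpha * th)); first exact: divr_gt0.
move=> k h k1 h0; rewrite -lee_fin -J_EFin; last exact: bmeas_sym.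
have Ck : 0 <= C * k%:R `^ (- (2 * s * th)) by rewrite mulr_ge0 ?powR_ge0 ?(ltW C0).
apply: (@le_trans _ _ (\int[mu]_(x in `]0%R, h]) ((C * k%:R `^ (- (2 * s * th)))%:E * (x `^ (1 - alpha * th - 1))%:E))%E).
  apply: ge0_le_int => //.
  - by move=> x _; rewrite lee_fin ltW// sym_gt0.
  - by apply/measurable_EFinP; apply: measurable_funTS; exact: measurable_sym.
  - by apply: measurable_funeM; exact: measurable_EFin_powR.
  - move=> x /=; rewrite in_itv/= => /andP[x0 _]; rewrite -EFinM lee_fin.
    by rewrite (_ : 1 - alpha * th - 1 = - (alpha * th)) ?hC//; ring.
rewrite ge0_integralZl//; last 2 first.
- exact: measurable_EFin_powR.
- by move=> x _; rewrite lee_fin powR_ge0.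
rewrite integral_powR// -EFinM lee_fin.
by apply: le_of_eq; move: (_ `^ _) (_ `^ _) => q1 q2; ring.
Qed.

(** Put q = 1 - alpha th and h = T / j, the half period. Shifting gives the order tau^q with tau = t
    - t', oscillation gives h^q; the minimum of the two is at most tau^ga h^(q - ga), and the
    amplitude of the mode contributes one more factor j. *)
Lemma response_le th ga : 0 <= th <= 1 -> 0 <= ga <= 1 - alpha * th -> exists2 C : R, 0 < C &
  forall k t' t j, (1 <= k)%N -> (1 <= j.1)%N -> 0 <= t' -> t' <= t ->
  `|response k t j - response k t' j| <=
    C * k%:R `^ (- (2 * s * th)) * (t - t') `^ ga * j.1%:R `^ (1 - (1 - alpha * th - ga)).
Proof.
move=> th01 /andP[ga0 gaq]; have [C C0 hC] := J_sym_le th01.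
set q := 1 - alpha * th.
have q0 : 0 <= q by exact: le_trans gaq.
exists (2 * C * pi / T * T `^ (q - ga)).
  by rewrite !mulr_gt0 ?powR_gt0 ?invr_gt0 ?pi_gt0.
move=> k t' t j k1 j1 t'0 t't.
have j0 : 0 < (j.1%:R : R) by rewrite ltr0n.
set tau := t - t'; have tau0 : 0 <= tau by rewrite subr_ge0.
set h := T / j.1%:R; have h0 : 0 < h by rewrite divr_gt0.
have jp : amp j * h `^ (q - ga) = pi / T * T `^ (q - ga) * j.1%:R `^ (1 - (q - ga)).
  rewrite /h powRM ?invr_ge0 ?(ltW T0) ?(ltW j0)// -(powR_inv1 (ltW j0)) -powRrM mulN1r.
  rewrite (powRD_gt0 1 _ j0) powRr1 ?(ltW j0)// /amp.
  by move: (_ `^ _) (_ `^ _) => u v; ring.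
have kp : 0 <= C * k%:R `^ (- (2 * s * th)) by rewrite mulr_ge0 ?powR_ge0 ?(ltW C0).
have B : `|response k t j - response k t' j| <= amp j * (2 * (C * k%:R `^ (- (2 * s * th)) * (tau `^ ga * h `^ (q - ga)))).
  have [th'|ht] := leP tau h.
    apply: (le_trans (response_diff _ _ t'0 t't)).
    rewrite ler_wpM2l ?amp_ge0// ler_wpM2l//.
    have [tz|tn] := eqVneq tau 0.
      rewrite -/tau tz /J set_itvoc0 Rintegral_set0 mulr_ge0// mulr_ge0// ?powR_ge0//.
    have tp : 0 < tau by rewrite lt_neqAle eq_sym tn.
    apply: (le_trans (hC _ _ k1 tau0)); rewrite ler_wpM2l// -/q.
    rewrite -{1}(subrK ga q) addrC (powRD_gt0 _ _ tp) ler_wpM2l ?powR_ge0// le_powR// subr_ge0//.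
  have tp : 0 < tau := lt_trans h0 ht.
  apply: (le_trans (ler_normB _ _)).
  have R1 := response_osc k j1 (le_trans t'0 t't); have R2 := response_osc k j1 t'0.
  apply: (le_trans (lerD R1 R2)); rewrite -mulrDr ler_wpM2l ?amp_ge0//.
  have -> : forall z : R, z + z = 2 * z by move=> z; ring.
  rewrite ler_wpM2l//.
  apply: (le_trans (hC _ _ k1 (ltW h0))); rewrite ler_wpM2l// -/q.
  rewrite -{1}(subrK ga q) addrC (powRD_gt0 _ _ h0) ler_wpM2r ?powR_ge0// le_powR// ltW//.
apply: (le_trans B).
rewrite (_ : amp j * _ = 2 * (C * k%:R `^ (- (2 * s * th)) * tau `^ ga) * (amp j * h `^ (q - ga))); last first.
  by move: (_ `^ _) (_ `^ _) (_ `^ _) => u v w; ring.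
rewrite jp; apply: le_of_eq.
by move: (_ `^ _) (_ `^ _) (_ `^ _) (_ `^ _) => u v w z; ring.
Qed.

End response.

Ltac pos := repeat first [ by [] | exact: pi_gt0 | apply: powR_gt0 | apply: exprn_gt0 | apply: mulr_gt0
  | apply: addr_gt0 | apply: divr_gt0 ].

(** * Spatial overlaps of the eigenfunctions with the modes *)

Section overlap.
Context {R : realType}.
Notation mu := (@lebesgue_measure R).

(** For n <> m the value is (1 - (-1)^(n+m)) n / (pi (n^2 - m^2)). The bound is stated without
    division so that it also makes sense for n = m. *)
Lemma int_sincos (n m : nat) : (1 <= n)%N ->
  exists v : R, [/\ (\int[mu]_(x in `[0%R, 1%R]) (sin (n%:R * pi * x) * cos (m%:R * pi * x))%:E = v%:E)%E,
   n = m -> v = 0 &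
   v ^+ 2 * ((n%:R - m%:R) ^+ 2 * (n%:R + m%:R) ^+ 2 * pi ^+ 2) <= 4 * n%:R ^+ 2].
Proof.
move=> n1; have pi0 := @pi_gt0 R.
have E : (\int[mu]_(x in `[0%R, 1%R]) (sin (n%:R * pi * x) * cos (m%:R * pi * x))%:E =
   (2^-1)%:E * \int[mu]_(x in `[0%R, 1%R]) (sin ((n%:R + m%:R) * pi * x))%:E +
   (2^-1)%:E * \int[mu]_(x in `[0%R, 1%R]) (sin ((n%:R - m%:R) * pi * x))%:E)%E.
  rewrite -int_lin2; [|exact: continuous_sinM|exact: continuous_sinM].
  apply: eq_integral => x _; congr (_%:E).
  have -> : (n%:R + m%:R) * pi * x = n%:R * pi * x + m%:R * pi * x by ring.
  have -> : (n%:R - m%:R) * pi * x = n%:R * pi * x - m%:R * pi * x by ring.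
  by rewrite sinD sinB; field.
have n0 : 0 < n%:R :> R by rewrite ltr0n.
have nm0 : n%:R + m%:R != 0 :> R by rewrite gt_eqF// ltr_wpDr.
have c1 : cos ((n%:R + m%:R) * pi * 1) = (-1) ^+ n * (-1) ^+ m :> R.
  by rewrite mulr1 mulrDl cosD !cos_npi !sin_npi mul0r subr0.
have c2 : cos ((n%:R - m%:R) * pi * 1) = (-1) ^+ n * (-1) ^+ m :> R.
  by rewrite mulr1 mulrBl cosB !cos_npi !sin_npi mul0r addr0.
have e1 : (\int[mu]_(x in `[0%R, 1%R]) (sin ((n%:R + m%:R) * pi * x))%:E =
    ((1 - (-1) ^+ n * (-1) ^+ m) / ((n%:R + m%:R) * pi))%:E)%E.
  by rewrite int_sin ?c1// mulf_neq0// gt_eqF.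
have [nm|nm] := eqVneq n m.
  exists 0; split => //; last by rewrite expr0n/= mul0r mulr_ge0// sqr_ge0.
  rewrite E e1 nm subrr; under eq_integral do rewrite !mul0r sin0.
  by rewrite integral0 mule0 adde0 -expr2 sqrr_sign subrr mul0r mule0.
have nm1 : n%:R - m%:R != 0 :> R by rewrite subr_eq0 eqr_nat.
have e2 : (\int[mu]_(x in `[0%R, 1%R]) (sin ((n%:R - m%:R) * pi * x))%:E =
    ((1 - (-1) ^+ n * (-1) ^+ m) / ((n%:R - m%:R) * pi))%:E)%E.
  by rewrite int_sin ?c2// mulf_neq0// gt_eqF.
set sg := (-1) ^+ n * (-1) ^+ m : R.
exists (2^-1 * ((1 - sg) / ((n%:R + m%:R) * pi)) + 2^-1 * ((1 - sg) / ((n%:R - m%:R) * pi))).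
split; [by rewrite E e1 e2 -!EFinM -EFinD|by move=> nm'; rewrite nm' eqxx in nm|].
rewrite [leLHS](_ : _ = (1 - sg) ^+ 2 * n%:R ^+ 2); last first.
  have pn0 : pi != 0 :> R by rewrite gt_eqF.
  have -> : n%:R = ((n%:R + m%:R) + (n%:R - m%:R)) / 2 :> R by field.
  rewrite (_ : n%:R + m%:R + (n%:R - m%:R) = 2 * n%:R); last by ring.
  move: (sg) (pi) pn0 (n%:R) (m%:R) nm0 nm1 => g p pn0 x y xy0 xy1; field.
  by rewrite ?xy0 ?xy1 ?pn0.
rewrite ler_wpM2r ?sqr_ge0//.
have sg1 : `|sg| = 1 by rewrite normrM !normrX !normrN1 !expr1n mulr1.
have : -1 <= sg <= 1 by rewrite -ler_norml sg1.
by move=> /andP[h1 h2]; nra.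
Qed.

Lemma sum_inv_sqr_shift : exists2 C : R, 0 < C &
  forall j M, \sum_(1 <= m < M.+1) (m != j)%:R * ((j%:R - m%:R) ^+ 2)^-1 <= C.
Proof.
have [C C0 hC] := @sum_invpowR_le R 2 (ltr1n _ 2).
have hC' n : \sum_(1 <= k < n.+1) (k%:R ^+ 2 : R)^-1 <= C.
  apply: le_trans (hC n); apply: le_of_eq; apply: eq_bigr => k _.
  by rewrite powRN powR_mulrn.
exists (2 * C); first by rewrite mulr_gt0.
move=> j M; pose Fm m := (m != j)%:R * ((j%:R - m%:R) ^+ 2)^-1 : R.
have F0 m : 0 <= Fm m by rewrite mulr_ge0// invr_ge0 sqr_ge0.
have h1 : \sum_(1 <= m < M.+1) Fm m <= \sum_(0 <= m < j + M.+1) Fm m.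
  rewrite [leRHS](big_cat_nat _ (n := 1))//= ?addnS//.
  rewrite ler_wpDl//; first by rewrite big_nat1.
  rewrite [leRHS](big_cat_nat _ (n := M.+1))//= ?leq_addl// -?addnS ?leq_addl//.
  by rewrite lerDl sumr_ge0.
apply: (le_trans h1).
rewrite (big_cat_nat _ (n := j)) ?leq_addr//= mulrDl mul1r; apply: lerD.
  rewrite big_nat_rev/= add0n; apply: le_trans (hC' j).
  case: j => [|j] in Fm F0 h1 *; first by rewrite !big_geq.
  rewrite /= big_add1/= big_nat [leRHS]big_nat; apply: ler_sum => k /andP[_ kj].
  rewrite /Fm subSS natrB; last by rewrite -ltnS.
  rewrite (_ : j.+1%:R - (j%:R - k%:R) = k.+1%:R); last by rewrite -!natr1; ring.
  by rewrite -[leRHS]mul1r ler_wpM2r ?invr_ge0 ?sqr_ge0//; case: (_ != _).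
rewrite -{1}(add0n j) big_addn addKn big_nat_recl//= /Fm add0n eqxx mul0r add0r.
apply: le_trans (hC' M); rewrite big_add1/=; apply: ler_sum => k _.
rewrite natrD (_ : _ - _ = - k.+1%:R); last by ring.
by rewrite sqrrN -[leRHS]mul1r ler_wpM2r ?invr_ge0 ?sqr_ge0//; case: (_ != _).
Qed.

Variables (lam : nat -> R) (phi : nat -> L2D R).
Hypothesis hA : dirichlet_spectrum lam phi.

Definition overlap (j : nat) (i : mode) : R := \int[mu]_(x in D) (phi j x * mode_deriv i x).

Lemma overlapE (j : nat) (i : mode) : (1 <= j)%N -> exists2 a, a ^+ 2 = 2 &
  (overlap j i)%:E = ((a * (i.1%:R * pi))%:E * \int[mu]_(x in `[0%R, 1%R]) (sin (j%:R * pi * x) * trig i x)%:E)%E.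
Proof.
move=> j1; have [a ha] := spectrum_sin hA; have [_ a2 pj] := ha j j1; exists (a j) => //.
have c : continuous (fun x : R => sin (j%:R * pi * x) * trig i x).
  by move=> x; apply: cvgM; [exact: continuous_sinM|exact: continuous_trig].
have E : (\int[mu]_(x in D) (phi j x * mode_deriv i x)%:E =
    (a j * (i.1%:R * pi))%:E * \int[mu]_(x in `[0%R, 1%R]) (sin (j%:R * pi * x) * trig i x)%:E)%E.
  rewrite -integralZl//; last exact: continuous_integrable.
  rewrite [in RHS](@integral_itv_bndoo _ _ _ _ true false); last first.
    apply: measurable_funeM; apply/measurable_EFinP; apply: measurable_funTS.
    exact: continuous_measurable_fun.
  apply: eq_integral => x; rewrite inE /D/= => xD.
  by rewrite pj ?(subset_itv_oo_cc xD)// -EFinM /mode_deriv; congr (_%:E); ring.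
rewrite /overlap /Rintegral fineK// E.
have ic := @continuous_integrable R _ 0 1 c.
by rewrite fin_numM//; apply: (integrable_fin_num _ ic).
Qed.

(** Among the sine modes only m = j contributes, with order j^(1-2H). For the cosine modes the
    weighted square has order m^(1-2H) j^2 / ((j - m)^2 (j + m)^2), which is at most j^(1-2H) / (j -
    m)^2, summable in m uniformly in j. *)
Lemma overlap_sum (H : R) : 0 < H <= 2^-1 -> exists2 C : R, 0 < C &
  forall j M, (1 <= j)%N ->
  \sum_(i <- modes M) mode_weight H i * overlap j i ^+ 2 <= C * j%:R `^ (1 - 2 * H).
Proof.
move=> /andP[H0 H1].
have p0 : 0 < 2 * H by rewrite mulr_gt0.
have p1 : 2 * H <= 1 by rewrite -ler_pdivlMl// mulr1.
have [C2 C20 hC2] := sum_inv_sqr_shift.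
have [K K0 hK] : exists2 K : R, 0 < K & forall m, (1 <= m)%N ->
    fcoef (2 * H) m * (m%:R * pi) ^+ 2 <= K * m%:R `^ (1 - 2 * H).
  exists (2 * (4 + pi ^+ 2)); first by rewrite mulr_gt0// ltr_wpDr// sqr_ge0.
  by move=> m m1; apply: fcoef_sqr_le.
have f0 m : (1 <= m)%N -> 0 <= fcoef (2 * H) m by move=> m1; exact: fcoef_ge0.
exists (K + 4 * K * C2); first by pos.
move=> j M j1; have jp : 0 <= (j%:R : R) `^ (1 - 2 * H) by rewrite powR_ge0.
have j0 : 0 < (j%:R : R) by rewrite ltr0n.
rewrite big_modes big_split/= mulrDl; apply: lerD.
  apply: (@le_trans _ _ (\sum_(1 <= m < M.+1) (K * m%:R `^ (1 - 2 * H)) * (m == j)%:R)).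
    rewrite big_nat [leRHS]big_nat; apply: ler_sum => m /andP[m1 _].
    have [a a2 oE] := overlapE (m, true) j1.
    have oV : overlap j (m, true) = a * (m%:R * pi) * ((j == m)%:R / 2).
      by apply: EFin_inj; rewrite oE/= int_sinsin.
    rewrite oV /mode_weight/= (eq_sym j m); have [mj|mj] := eqVneq m j; last first.
      by rewrite /= ?mulr0n mul0r mulr0 expr0n/= !mulr0.
    rewrite mulr1 !exprMn a2 (le_trans _ (hK m m1))// -subr_ge0.
    rewrite (_ : _ - _ = fcoef (2 * H) m * (m%:R * pi) ^+ 2 * (3 / 4)).
      by rewrite mulr_ge0// mulr_ge0 ?f0 ?sqr_ge0.
    by rewrite (_ : true%:R = 1 :> R)//; field.
  have [jM|Mj] := leqP j M; first by rewrite sum_nat_delta ?j1.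
  rewrite big_nat big1 ?mulr_ge0 ?powR_ge0 ?(ltW K0)// => m /andP[_ mM].
  by rewrite (ltn_eqF (leq_trans mM Mj)) mulr0.
apply: (@le_trans _ _ (\sum_(1 <= m < M.+1) (4 * K * j%:R `^ (1 - 2 * H)) * ((m != j)%:R * ((j%:R - m%:R) ^+ 2)^-1))); last first.
  rewrite -mulr_sumr (_ : 4 * K * C2 * _ = 4 * K * j%:R `^ (1 - 2 * H) * C2); last by move: (_ `^ _) => q; ring.
  by rewrite ler_wpM2l// mulr_ge0// mulr_ge0// ltW.
rewrite big_nat [leRHS]big_nat; apply: ler_sum => m /andP[m1 _].
have [a a2 oE] := overlapE (m, false) j1.
have [v [vE v0 hv]] := int_sincos m j1.
have oV : overlap j (m, false) = a * (m%:R * pi) * v.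
  by apply: EFin_inj; rewrite oE/= vE.
rewrite oV /mode_weight/=.
have m0 : 0 < (m%:R : R) by rewrite ltr0n.
have [jm|jm] := eqVneq m j.
  by rewrite v0// mulr0 expr0n/= mulr0 mul0r mulr0.
have jm' : j != m by rewrite eq_sym.
have d0 : 0 < (j%:R - m%:R) ^+ 2 :> R.
  by rewrite lt_neqAle eq_sym sqr_ge0 andbT sqrf_eq0 subr_eq0 eqr_nat.
have s0 : 0 < (j%:R + m%:R) ^+ 2 :> R by rewrite exprn_gt0// addr_gt0.
rewrite mul1r ler_pdivlMr// -(ler_pM2r s0).
(* Write j^2 = j^(1-2H) j^(1+2H) and (j + m)^2 likewise, then bound m and j by j + m. *)
have hq : m%:R `^ (1 - 2 * H) * j%:R ^+ 2 <= j%:R `^ (1 - 2 * H) * (j%:R + m%:R) ^+ 2 :> R.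
  have q0 : 0 <= 1 - 2 * H by rewrite subr_ge0.
  have sp : 0 < j%:R + m%:R :> R by rewrite addr_gt0.
  apply: (@le_trans _ _ ((j%:R + m%:R) `^ (1 - 2 * H) * j%:R ^+ 2)).
    by rewrite ler_wpM2r ?sqr_ge0// le_powR ?(ltW m0)// lerDr ltW.
  have e2 (x : R) : 0 < x -> x ^+ 2 = x `^ (1 - 2 * H) * x `^ (1 + 2 * H).
    by move=> x0; rewrite -powRD_gt0// (_ : _ + _ = 2%:R) ?powR_mulrn ?(ltW x0)//; ring.
  rewrite (e2 _ j0) (e2 _ sp) [leLHS]mulrCA ler_wpM2l ?powR_ge0// ler_wpM2l ?powR_ge0//.
  rewrite le_powR ?(ltW j0)// ?lerDl ?(ltW m0)//.
  by rewrite addr_ge0// ltW.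
have := hK m m1; have := f0 m m1.
move: (fcoef _ _) => f f00 hKm.
have pi2 : 0 < (pi : R) ^+ 2 by rewrite exprn_gt0// pi_gt0.
rewrite [leLHS](_ : _ = f * (m%:R * pi) ^+ 2 / pi ^+ 2 *
   (v ^+ 2 * ((j%:R - m%:R) ^+ 2 * (j%:R + m%:R) ^+ 2 * pi ^+ 2))); last first.
  have pn0 : pi != 0 :> R by rewrite gt_eqF// pi_gt0.
  rewrite !exprMn a2; move: (pi) pn0 (j%:R) (m%:R) => p' pn0' x' y'.
  by field; rewrite ?pn0'.
apply: (@le_trans _ _ (f * (m%:R * pi) ^+ 2 / pi ^+ 2 * (4 * j%:R ^+ 2))).
  by rewrite ler_wpM2l// mulr_ge0 ?invr_ge0 ?(ltW pi2)// mulr_ge0 ?sqr_ge0.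
apply: (@le_trans _ _ (f * (m%:R * pi) ^+ 2 * (4 * j%:R ^+ 2))).
  have ip : (pi ^+ 2)^-1 <= 1 :> R.
    by rewrite invf_le1// exprn_ege1// (le_trans _ (pi_ge2 _))// ler1n.
  by rewrite ler_wpM2r ?mulr_ge0 ?sqr_ge0// ler_piMr// mulr_ge0 ?sqr_ge0.
apply: (@le_trans _ _ (K * m%:R `^ (1 - 2 * H) * (4 * j%:R ^+ 2))).
  by rewrite ler_wpM2r ?mulr_ge0 ?sqr_ge0.
rewrite [leLHS](_ : _ = 4 * K * (m%:R `^ (1 - 2 * H) * j%:R ^+ 2)); last by move: (_ `^ _) => q; ring.
by rewrite -[leRHS]mulrA ler_wpM2l// mulr_ge0// ltW.
Qed.

End overlap.

(** * The double series over eigenvalues and modes *)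

Section spacetime.
Context {R : realType}.
Variables (alpha s T : R) (lam : nat -> R) (phi : nat -> L2D R).
Hypotheses (halpha : 0 < alpha < 1) (hs : 0 < s < 1) (T0 : 0 < T).
Hypothesis hA : dirichlet_spectrum lam phi.
Notation resp := (response alpha s T lam).

(** The weights decay like l^(-1-2H) and the squared responses grow like l^(2 (alpha th + ga)); the
    product is summable exactly when alpha th + ga < H. *)
Lemma response_sum (H th ga : R) : 0 < H <= 2^-1 -> 0 <= th <= 1 -> 0 <= ga -> alpha * th + ga < H ->
  exists2 C : R, 0 < C & forall k t' t M, (1 <= k)%N -> 0 <= t' -> t' <= t ->
  \sum_(j <- modes M) T `^ (2 * H) * mode_weight H j * (resp k t j - resp k t' j) ^+ 2 <=
   C * k%:R `^ (- (4 * s * th)) * ((t - t') `^ ga) ^+ 2.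
Proof.
move=> hH th01 ga0 hlt; have /andP[H0 H1] := hH.
have p0 : 0 < 2 * H by rewrite mulr_gt0.
have p1 : 2 * H <= 1 by rewrite -ler_pdivlMl// mulr1.
have hga : 0 <= ga <= 1 - alpha * th.
  have Hle : H <= 1 by rewrite (le_trans H1)// invf_le1// ler1n.
  by rewrite ga0/=; lra.
have [C C0 hC] := response_le halpha hs T0 hA th01 hga.
pose q := 1 + 2 * (H - alpha * th - ga).
have q1 : 1 < q by rewrite /q; lra.
have [C2 C20 hC2] := sum_invpowR_le q1.
have [K K0 hK] : exists2 K : R, 0 < K & forall m, (1 <= m)%N -> fcoef (2 * H) m <= K * m%:R `^ (- (1 + 2 * H)).
  exists (2 * (4 + pi ^+ 2)); first by rewrite mulr_gt0// ltr_wpDr// sqr_ge0.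
  by move=> m m1; apply: fcoef_le.
exists (T `^ (2 * H) * K * C ^+ 2 * C2); first by pos.
move=> k t' t M k1 t'0 t't.
have k0 : 0 < (k%:R : R) by rewrite ltr0n.
set X := k%:R `^ (- (4 * s * th)) * ((t - t') `^ ga) ^+ 2.
have X0 : 0 <= X by rewrite mulr_ge0 ?powR_ge0 ?sqr_ge0.
have term l b : (1 <= l)%N ->
    T `^ (2 * H) * mode_weight H (l, b) * (resp k t (l, b) - resp k t' (l, b)) ^+ 2 <=
    T `^ (2 * H) * K * C ^+ 2 * X / 2 * l%:R `^ (- q).
  move=> l1; have l0 : 0 < (l%:R : R) by rewrite ltr0n.
  have h := hC k t' t (l, b) k1 l1 t'0 t't.
  have {}h : (resp k t (l, b) - resp k t' (l, b)) ^+ 2 <=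
      C ^+ 2 * X * (l%:R `^ (1 - (1 - alpha * th - ga))) ^+ 2.
    rewrite -(real_normK (num_real (_ - _))).
    rewrite (_ : C ^+ 2 * X * _ = (C * k%:R `^ (- (2 * s * th)) * (t - t') `^ ga * l%:R `^ (1 - (1 - alpha * th - ga))) ^+ 2).
      by rewrite ler_pXn2r// ?nnegrE// !mulr_ge0 ?powR_ge0 ?(ltW C0).
    rewrite /X !exprMn (_ : (k%:R `^ (- (2 * s * th))) ^+ 2 = k%:R `^ (- (4 * s * th))).
      by move: (_ `^ _) (_ `^ _) (_ `^ _) => u v w; ring.
    by rewrite -powR_mulrn ?powR_ge0// -powRrM; congr (_ `^ _); ring.
  have w0 : 0 <= mode_weight H (l, b) by exact: mode_weight_ge0.
  have hf : mode_weight H (l, b) <= K / 2 * l%:R `^ (- (1 + 2 * H)).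
    by rewrite /mode_weight/= [leRHS]mulrAC ler_wpM2r// hK.
  have st := ler_wpM2l (powR_ge0 T (2 * H)) (ler_pM w0 (sqr_ge0 _) hf h).
  rewrite -mulrA; apply: (le_trans st).
  have -> : l%:R `^ (- q) = l%:R `^ (- (1 + 2 * H)) * (l%:R `^ (1 - (1 - alpha * th - ga))) ^+ 2.
    rewrite -powR_mulrn ?powR_ge0// -powRrM -powRD_gt0//; congr (_ `^ _); rewrite /q; ring.
  by apply: le_of_eq; move: (X) (_ `^ _) (_ `^ _) (_ `^ _) => x u v z; field.
rewrite big_modes.
apply: (@le_trans _ _ (\sum_(1 <= l < M.+1) (T `^ (2 * H) * K * C ^+ 2 * X) * l%:R `^ (- q))).
  rewrite big_nat [leRHS]big_nat; apply: ler_sum => l /andP[l1 _].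
  apply: (le_trans (lerD (term l true l1) (term l false l1))).
  by apply: le_of_eq; move: (X) (_ `^ _) (_ `^ _) => x u v; field.
rewrite -mulr_sumr [leRHS](_ : _ = T `^ (2 * H) * K * C ^+ 2 * X * C2); last first.
  by rewrite -mulrA -/X; move: (X) (_ `^ _) => x u; ring.
by rewrite ler_wpM2l// mulr_ge0// mulr_ge0 ?sqr_ge0// mulr_ge0 ?powR_ge0 ?(ltW K0).
Qed.

Lemma spacetime_sum (H1 H2 ga : R) : 0 < H1 <= 2^-1 -> 0 < H2 <= 2^-1 -> 1 - H1 < 2 * s ->
  0 <= ga -> ga < H2 + alpha * (H1 - 1) / (2 * s) ->
  exists2 C : R, 0 < C & forall t' t N M, 0 <= t' -> t' <= t ->
  \sum_(1 <= k < N.+1) (\sum_(i <- modes M) mode_weight H1 i * overlap phi k i ^+ 2) *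
    (\sum_(j <- modes M) T `^ (2 * H2) * mode_weight H2 j * (resp k t j - resp k t' j) ^+ 2) <=
   C * ((t - t') `^ ga) ^+ 2.
Proof.
move=> hH1 hH2 hcase ga0 hga; have /andP[s0 s1] := hs; have /andP[a0 a1] := halpha.
have /andP[H10 H11] := hH1; have /andP[H20 H21] := hH2.
(* [lo] is the threshold above which the series over k, of order k^(1 - 2 H1 - 4 s th), converges;
   [hi] collects the constraint of [response_sum] and the range th <= 1 of the interpolation. The
   hypotheses say exactly that lo < hi, and any value in between will do. *)
pose lo := (1 - H1) / (2 * s); pose hi := Num.min 1 ((H2 - ga) / alpha).
have lohi : lo < hi.
  rewrite lt_min; apply/andP; split; first by rewrite ltr_pdivrMr ?mul1r// mulr_gt0.
  rewrite ltr_pdivlMr// ltrBrDr -ltrBrDl (lt_le_trans hga)//.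
  by apply: le_of_eq; rewrite /lo; field; rewrite gt_eqF.
pose th := (lo + hi) / 2.
have lth : lo < th by rewrite /th; lra.
have thi : th < hi by rewrite /th; lra.
have lo0 : 0 < lo.
  by rewrite divr_gt0// ?mulr_gt0// subr_gt0 (le_lt_trans H11)// invf_lt1// ltr1n.
have th01 : 0 <= th <= 1.
  rewrite (ltW (lt_trans lo0 lth))/=; apply: ltW; apply: (lt_le_trans thi).
  by rewrite ge_min lexx.
have hsum : alpha * th + ga < H2.
  have : th < (H2 - ga) / alpha by apply: (lt_le_trans thi); rewrite ge_min lexx orbT.
  by rewrite ltr_pdivlMr// mulrC; lra.
have [C1 C10 h1] := overlap_sum hA hH1.
have [C2 C20 h2] := response_sum hH2 th01 ga0 hsum.
pose q := 4 * s * th - (1 - 2 * H1).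
have q1 : 1 < q.
  have : (1 - H1) < 2 * s * th by move: lth; rewrite /lo ltr_pdivrMr ?mulr_gt0// mulrC.
  by rewrite /q; lra.
have [C3 C30 h3] := sum_invpowR_le q1.
exists (C1 * C2 * C3); first by pos.
move=> t' t N M t'0 t't; set X := ((t - t') `^ ga) ^+ 2.
apply: (@le_trans _ _ (\sum_(1 <= k < N.+1) C1 * C2 * X * k%:R `^ (- q))).
  rewrite big_nat [leRHS]big_nat; apply: ler_sum => k /andP[k1 _].
  have k0 : 0 < (k%:R : R) by rewrite ltr0n.
  have e1 : 0 <= \sum_(i <- modes M) mode_weight H1 i * overlap phi k i ^+ 2.
    by apply: modes_ge0 => i i1; rewrite mulr_ge0 ?sqr_ge0 ?mode_weight_ge0.
  have e2 : 0 <= \sum_(j <- modes M) T `^ (2 * H2) * mode_weight H2 j * (resp k t j - resp k t' j) ^+ 2.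
    by apply: modes_ge0 => i i1; rewrite mulr_ge0 ?sqr_ge0// mulr_ge0 ?powR_ge0 ?mode_weight_ge0.
  apply: (le_trans (ler_pM e1 e2 (h1 k M k1) (h2 k t' t M k1 t'0 t't))).
  have -> : k%:R `^ (- q) = k%:R `^ (1 - 2 * H1) * k%:R `^ (- (4 * s * th)).
    by rewrite -powRD_gt0//; congr (_ `^ _); rewrite /q; ring.
  by apply: le_of_eq; rewrite -/X; move: (X) (_ `^ _) (_ `^ _) => x u v; ring.
rewrite -mulr_sumr (_ : C1 * C2 * C3 * X = C1 * C2 * X * C3); last by ring.
by rewrite ler_wpM2l// mulr_ge0 ?sqr_ge0// mulr_ge0// ltW.
Qed.

End spacetime.

(** * Fourier moments of the Green function *)

Section abel.
Context {R : realType}.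

(* Abel summation against the telescoping factor [s k - s k.-1]. *)
Lemma abel_sum (e u : nat -> R) m n : (forall k, 0 <= e k) ->
  (forall j k, (m < j)%N -> (j <= k)%N -> e k <= e j) -> (forall k, `|u k| <= 1) ->
  `|\sum_(m.+1 <= k < n) e k * (u k - u k.-1)| <= 2 * e m.+1.
Proof.
move=> e0 en u1; have [nm|mn] := leqP n m.+1.
  by rewrite big_geq// normr0 mulr_ge0.
have -> : n = (n - m.+2 + m.+2)%N by rewrite subnK.
move: (n - m.+2)%N => i.
suff h : `|\sum_(m.+1 <= k < i + m.+2) e k * (u k - u k.-1) - e (i + m.+1)%N * u (i + m.+1)%N| <=
    2 * e m.+1 - e (i + m.+1)%N.
  rewrite -[X in `|X|](subrK (e (i + m.+1)%N * u (i + m.+1)%N)).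
  apply: (le_trans (ler_normD _ _)); rewrite -[leRHS](subrK (e (i + m.+1)%N)).
  by apply: lerD => //; rewrite normrM ger0_norm// ler_piMr.
elim: i => [|i IH].
  rewrite !add0n big_nat1 /= (_ : _ - _ = - (e m.+1 * u m)); last by ring.
  rewrite normrN normrM ger0_norm// (_ : 2 * e m.+1 - e m.+1 = e m.+1); last by ring.
  by rewrite ler_piMr.
have E1 : (i.+1 + m.+2 = (i + m.+1).+2)%N by rewrite addSn !addnS.
have E2 : (i.+1 + m.+1 = (i + m.+1).+1)%N by rewrite addSn.
have E3 : (i + m.+2 = (i + m.+1).+1)%N by rewrite !addnS.
have lt1 : (m.+1 <= (i + m.+1).+1)%N by rewrite (leq_trans (leq_addl i _)).
rewrite E3 in IH; rewrite E1 E2 big_nat_recr//=.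
rewrite [X in `|X|](_ : _ = (\sum_(m.+1 <= k < (i + m.+1).+1) e k * (u k - u k.-1) -
   e (i + m.+1)%N * u (i + m.+1)%N) + (e (i + m.+1)%N - e (i + m.+1).+1) * u (i + m.+1)%N); last by ring.
have d : 0 <= e (i + m.+1)%N - e (i + m.+1).+1.
  by rewrite subr_ge0 en// leq_addl.
apply: (le_trans (ler_normD _ _)).
apply: (@le_trans _ _ ((2 * e m.+1 - e (i + m.+1)%N) + (e (i + m.+1)%N - e (i + m.+1).+1))).
  by apply: lerD => //; rewrite normrM (ger0_norm d) ler_piMr.
by rewrite addrA subrK.
Qed.

(** Twice sin (pi z / 2) times cos (k pi z) equals u k - u (k - 1) for [u] k = sin ((2 k + 1) pi z /
    2), which is the telescoping form required by [abel_sum]. *)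
Lemma cos_sum_tail (e : nat -> R) (z : R) m n : (forall k, 0 <= e k) ->
  (forall j k, (m < j)%N -> (j <= k)%N -> e k <= e j) ->
  `|sin (pi * z / 2)| * `|\sum_(m.+1 <= k < n) e k * cos (k%:R * pi * z)| <= e m.+1.
Proof.
move=> e0 en; pose u k := sin ((2 * k%:R + 1) * (pi * z / 2)).
have := abel_sum (u := u) n e0 en (fun k => sin_max _).
rewrite -(@ler_pM2l _ 2^-1) ?invr_gt0// mulrA mulVf ?pnatr_eq0// mul1r.
move=> h; apply: le_trans h; apply: le_of_eq.
rewrite [RHS](_ : _ = `|2^-1 * \sum_(m.+1 <= k < n) e k * (u k - u k.-1)|); last first.
  by rewrite normrM [X in _ = X * _]ger0_norm// invr_ge0.
rewrite -normrM.
congr `|_|; rewrite !mulr_sumr; rewrite !big_nat; apply: eq_bigr => k /andP[mk _].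
rewrite /u (_ : (2 * k%:R + 1) * (pi * z / 2) = k%:R * pi * z + pi * z / 2); last by field.
rewrite (_ : (2 * k.-1%:R + 1) * (pi * z / 2) = k%:R * pi * z - pi * z / 2); last first.
  by rewrite -[in RHS](prednK (leq_ltn_trans (leq0n m) mk)) -natr1; field.
by rewrite sinD sinB; field.
Qed.

(** Concavity of the sine: the difference of the two sides vanishes at 0 and 1. If it had the wrong
    sign at x, its derivative would take a negative and then a positive value, whereas the cosine
    decreases. *)
Lemma jordan (x : R) : 0 <= x <= 1 -> x <= sin (pi * x / 2).
Proof.
move=> /andP[x0 x1]; rewrite leNgt; apply/negP => sx.
have x0' : 0 < x.
  by rewrite lt_neqAle x0 andbT; apply/eqP => x00; move: sx; rewrite -x00 mulr0 mul0r sin0 ltxx.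
have x1' : x < 1.
  rewrite lt_neqAle x1 andbT; apply/eqP => x11; move: sx.
  by rewrite x11 mulr1 sin_pihalf ltxx.
pose g (y : R) := sin (pi / 2 * y) - y.
have dg (y : R) : is_derive y (1 : R) g (pi / 2 * cos (pi / 2 * y) - 1).
  by rewrite /g; have h := is_derive_sinM (pi / 2) y; apply: is_deriveB.
have cg : continuous g.
  by move=> y; apply: cvgB; [exact: continuous_sinM|exact: cvg_id].
have gx : g x < 0 by rewrite /g subr_lt0 (_ : pi / 2 * x = pi * x / 2)//; ring.
have [c1 + E1] := MVT x0' (fun y _ => dg y) (continuous_subspaceT cg).
have [c2 + E2] := MVT x1' (fun y _ => dg y) (continuous_subspaceT cg).
rewrite !in_itv/= => /andP[xc2 c21] /andP[c10 c1x].
have g0 : g 0 = 0 by rewrite /g mulr0 sin0 subr0.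
have g1 : g 1 = 0 by rewrite /g mulr1 sin_pihalf subrr.
have h1 : pi / 2 * cos (pi / 2 * c1) - 1 < 0.
  by move: E1; rewrite g0 !subr0 => E1; rewrite -(pmulr_llt0 _ x0') -E1.
have h2 : 0 < pi / 2 * cos (pi / 2 * c2) - 1.
  by rewrite -(@pmulr_lgt0 _ (1 - x)) ?subr_gt0// -E2 g1 sub0r oppr_gt0.
have p2 : 0 < pi / 2 :> R by rewrite divr_gt0// pi_gt0.
have cl : cos (pi / 2 * c2) <= cos (pi / 2 * c1).
  have : cos (pi / 2 * c2) < cos (pi / 2 * c1) by rewrite ltr_cos ?ltr_pM2l ?(lt_trans c1x)// in_itv/=; apply/andP; split; nra.
  exact: ltW.
by have := ler_wpM2l (ltW p2) cl; lra.
Qed.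

Lemma sum_powR_le (s : R) m : 0 < s < 1 ->
  \sum_(1 <= k < m.+1) k%:R `^ (- s) <= m%:R `^ (1 - s) / (1 - s).
Proof.
move=> /andP[s0 s1]; have t0 : 0 < 1 - s by rewrite subr_gt0.
elim: m => [|m IH].
  by rewrite big_geq// mulr_ge0 ?powR_ge0// invr_ge0 ltW.
rewrite big_nat_recr//= -lerBrDr (le_trans IH)// lerBrDr.
have [->|m0] := posnP m.
  rewrite powR0 ?gt_eqF// mul0r add0r !powR1 mul1r -[leLHS]invr1 lef_pV2 ?posrE//.
  by rewrite gerBl ltW.
have mp : 0 < m%:R :> R by rewrite ltr0n.
have mm : (m%:R : R) < m.+1%:R by rewrite ltr_nat.
have dd (y : R) : y \in `]m%:R, m.+1%:R[ -> is_derive y (1 : R) (fun x : R => x `^ (1 - s)) ((1 - s) * y `^ (1 - s - 1)).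
  rewrite in_itv/= => /andP[my _]; apply: is_derive1_powR.
  by rewrite (lt_trans mp).
have cc : {within `[m%:R, m.+1%:R], continuous (fun x : R => x `^ (1 - s))}.
  apply: continuous_in_subspaceT => y /set_mem/=; rewrite in_itv/= => /andP[my _].
  by apply: continuous_powR_gt0; exact: lt_le_trans mp my.
have [c + E] := MVT mm dd cc; rewrite in_itv/= => /andP[mc cm].
have {}E : m.+1%:R `^ (1 - s) - m%:R `^ (1 - s) = (1 - s) * c `^ (- s).
  by rewrite E -natr1 (_ : m%:R + 1 - m%:R = 1) ?mulr1; [congr (_ * _ `^ _); ring|ring].
rewrite -lerBrDl -mulrBl E mulrAC mulfV ?gt_eqF// mul1r.
have c0 := lt_trans mp mc.
by rewrite !powRN lef_pV2 ?posrE ?powR_gt0// ?ltr0n// le_powR ?(ltW s0) ?(ltW c0) ?(ltW cm).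
Qed.

(* Splitting at k ~ 1/d: below, the terms are summed trivially; above, Abel summation. *)
Lemma cos_sum_bound (e : nat -> R) (s B z d : R) n : 0 < s < 1 -> 0 <= B -> (forall k, 0 <= e k) ->
  (forall j k, (0 < j)%N -> (j <= k)%N -> e k <= e j) ->
  (forall k, (0 < k)%N -> e k <= B * k%:R `^ (- s)) ->
  0 < d <= 1 -> d <= `|sin (pi * z / 2)| ->
  `|\sum_(1 <= k < n.+1) e k * cos (k%:R * pi * z)| <= B * (1 + (1 - s)^-1) * d `^ (s - 1).
Proof.
move=> s01 B0 e0 en eB /andP[d0 d1] hd; have /andP[s0 s1] := s01.
have t0 : 0 < 1 - s by rewrite subr_gt0.
pose m := Num.truncn d^-1.
have dm : 0 <= d^-1 by rewrite invr_ge0 ltW.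
have /andP[md dm1] := truncn_itv dm.
have S1 n' : (n' <= m)%N -> `|\sum_(1 <= k < n'.+1) e k * cos (k%:R * pi * z)| <= B * (1 - s)^-1 * d `^ (s - 1).
  move=> nm; apply: (le_trans (ler_norm_sum _ _ _)).
  apply: (@le_trans _ _ (\sum_(1 <= k < n'.+1) B * k%:R `^ (- s))).
    rewrite big_nat [leRHS]big_nat; apply: ler_sum => k /andP[k1 _].
    by rewrite normrM ger0_norm// (le_trans _ (eB k k1))// ler_piMr// cos_max.
  rewrite -mulr_sumr -mulrA ler_wpM2l// (le_trans (sum_powR_le _ s01))// mulrC.
  rewrite ler_wpM2l ?invr_ge0 ?(ltW t0)//.
  apply: (@le_trans _ _ (d^-1 `^ (1 - s))).
    rewrite le_powR ?(ltW t0) ?ler0n//; apply: le_trans md; rewrite ler_nat//.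
  by rewrite -powR_inv1 ?(ltW d0)// -powRrM mulN1r opprB.
have S2 n' : `|\sum_(m.+1 <= k < n') e k * cos (k%:R * pi * z)| <= B * d `^ (s - 1).
  have h := cos_sum_tail z n' e0 (fun j k mj jk => en j k (leq_ltn_trans (leq0n m) mj) jk).
  have h2 : d * `|\sum_(m.+1 <= k < n') e k * cos (k%:R * pi * z)| <= B * d `^ s.
    apply: (@le_trans _ _ (e m.+1)).
      by apply: le_trans h; rewrite ler_wpM2r.
    apply: (le_trans (eB m.+1 isT)); rewrite ler_wpM2l//.
    rewrite powRN -[leRHS]invrK lef_pV2 ?posrE ?invr_gt0 ?powR_gt0 ?ltr0n//.
    rewrite -powRN -[in leLHS](mulN1r s) powRrM powR_inv1 ?(ltW d0)//.
    by rewrite le_powR ?(ltW s0)// ltW.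
  rewrite -(ler_pM2l d0) (le_trans h2)// mulrCA ler_wpM2l//.
  rewrite -{2}(powRr1 (ltW d0)) -powRD_gt0//.
  by rewrite (_ : 1 + (s - 1) = s)//; ring.
rewrite mulrDr mulr1 mulrDl.
have [nm|mn] := leqP n m.
  by apply: (le_trans (S1 n nm)); rewrite lerDr mulr_ge0 ?powR_ge0.
rewrite (big_cat_nat _ (n := m.+1))//=; last by rewrite ltnS ltnW.
by rewrite addrC (le_trans (ler_normD _ _))// lerD// S1.
Qed.

End abel.

Section green_modes.
Context {R : realType}.
Notation mu := (@lebesgue_measure R).
Notation mu2 := (mu \x mu)%E.
Notation TS := (measurableTypeR R).
Variables (alpha s T : R) (lam : nat -> R) (phi : nat -> L2D R).
Hypotheses (halpha : 0 < alpha < 1) (hs : 0 < s < 1) (T0 : 0 < T).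
Hypothesis hA : dirichlet_spectrum lam phi.
Notation e := (symbol alpha s lam).

Lemma phi_prod k (x y : R) : (1 <= k)%N -> 0 < x < 1 -> 0 < y < 1 ->
  phi k x * phi k y = cos (k%:R * pi * (x - y)) - cos (k%:R * pi * (x + y)).
Proof.
move=> k1 /andP[x0 x1] /andP[y0 y1]; have [a ha] := spectrum_sin hA; have [_ a2 pk] := ha k k1.
rewrite !pk ?in_itv/= ?(ltW x0) ?(ltW x1) ?(ltW y0) ?(ltW y1)//.
have -> : k%:R * pi * (x - y) = k%:R * pi * x - k%:R * pi * y by ring.
have -> : k%:R * pi * (x + y) = k%:R * pi * x + k%:R * pi * y by ring.
rewrite cosB cosD.
transitivity (a k ^+ 2 * (sin (k%:R * pi * x) * sin (k%:R * pi * y))); first by ring.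
by rewrite a2; ring.
Qed.

Definition green_psum (t x : R) N (p : R * R) : R :=
  \sum_(1 <= k < N.+1) e k (t - p.2) * phi k x * phi k p.1.

Lemma cvg_of_tail (S : nat -> R) : (forall eps, 0 < eps -> exists m, forall n, (m <= n)%N -> `|S m - S n| < eps) ->
  cvgn S.
Proof.
move=> h; apply/cauchy_cvgP; apply: cauchy_exP => eps eps0.
by have [m hm] := h eps eps0; exists (S m); exists m.
Qed.

Lemma powR_small (C s' eps : R) : 0 < C -> 0 < s' -> 0 < eps -> exists m : nat, C * m.+1%:R `^ (- s') < eps.
Proof.
move=> C0 s0 eps0; pose y := (C / eps) `^ s'^-1.
exists (Num.truncn y).
have y0 : 0 < y by apply: powR_gt0; exact: divr_gt0.
have h : y < (Num.truncn y).+1%:R by rewrite truncnS_gt.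
have : y `^ s' < (Num.truncn y).+1%:R `^ s'.
  by apply: gt0_ltr_powR => //; rewrite nnegrE ltW.
rewrite /y -powRrM mulVf ?gt_eqF// powRr1 ?divr_ge0 ?(ltW C0) ?(ltW eps0)//.
rewrite ltr_pdivrMr// => h2; rewrite powRN ltr_pdivrMr ?powR_gt0//; last first.
  by rewrite mulrC.
Qed.

Let dx (x : R) := Num.min x (1 - x).

(** The reflected singularity of the Green function at x + y stays away for fixed x: the distance
    [dx] of x to the boundary bounds the sine from below uniformly in y. *)
Lemma sin_sum_ge (x y : R) : 0 < x < 1 -> 0 < y < 1 -> dx x <= `|sin (pi * (x + y) / 2)|.
Proof.
move=> /andP[x0 x1] /andP[y0 y1]; apply: le_trans (ler_norm _).
have [h|h] := leP (x + y) 1.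
  apply: le_trans (jordan _); last by rewrite h andbT addr_ge0// ltW.
  by rewrite ge_min lerDl (ltW y0).
have -> : pi * (x + y) / 2 = pi - pi * (2 - (x + y)) / 2 by field.
rewrite sinB sinpi cospi mul0r sub0r mulN1r opprK.
apply: le_trans (jordan _); last by apply/andP; split; lra.
by rewrite ge_min; apply/orP; right; lra.
Qed.

Lemma sin_dist_ge (x y : R) : 0 < x < 1 -> 0 < y < 1 -> `|x - y| <= `|sin (pi * (x - y) / 2)|.
Proof.
move=> /andP[x0 x1] /andP[y0 y1].
wlog xy : x y x0 x1 y0 y1 / y <= x.
  move=> h; have [/(h x y)|/ltW/(h y x)] := leP y x; first exact.
  move=> /(_ y0 y1 x0 x1); rewrite distrC => /le_trans; apply.
  by rewrite -(opprB x y) mulrN mulNr sinN normrN.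
rewrite ger0_norm ?subr_ge0//; apply: le_trans (ler_norm _).
by apply: jordan; apply/andP; split; lra.
Qed.

Lemma green_psumE t x N p : 0 < x < 1 -> 0 < p.1 < 1 ->
  green_psum t x N p = \sum_(1 <= k < N.+1) e k (t - p.2) * cos (k%:R * pi * (x - p.1)) -
    \sum_(1 <= k < N.+1) e k (t - p.2) * cos (k%:R * pi * (x + p.1)).
Proof.
move=> hx hy; rewrite /green_psum -sumrB !big_nat; apply: eq_bigr => k /andP[k1 _].
by rewrite -mulrA phi_prod// mulrBr.
Qed.

Lemma dx_gt0 x : 0 < x < 1 -> 0 < dx x <= 1.
Proof.
move=> /andP[x0 x1]; rewrite lt_min x0 subr_gt0 x1/= ge_min (ltW x1)//.
Qed.

Let e0 k r : 0 <= e k r.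
Proof. by apply: ltW; apply: sym_gt0. Qed.

Let en r j k : (0 < j)%N -> (j <= k)%N -> e k r <= e j r.
Proof. by move=> j1 jk; exact: (sym_nincr_index halpha hs hA). Qed.

(** Interpolating with th = 1/2 gives symbols of order k^(-s) t^(- alpha / 2), to which
    [cos_sum_bound] applies since s < 1. The bound is uniform in N and integrable over the slab,
    with singularities at y = x and r = t; the exponent is written as q - 1 with q = 1 - alpha / 2 >
    0, the form used by [integrable_powR_reflect]. *)
Lemma green_psum_le x : 0 < x < 1 -> exists2 C : R, 0 < C & forall t N p, 0 < p.1 < 1 -> p.1 != x -> p.2 < t ->
  `|green_psum t x N p| <= C * ((`|x - p.1| `^ (s - 1) + dx x `^ (s - 1)) * (t - p.2) `^ (1 - alpha / 2 - 1)).
Proof.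
move=> hx; have th : (0 : R) <= 2^-1 <= (1 : R) by apply/andP; split; lra.
have [C C0 hC] := sym_le halpha hs hA th; have /andP[s0 s1] := hs.
have t0 : 0 < 1 - s by rewrite subr_gt0.
exists (C * (1 + (1 - s)^-1)); first by rewrite mulr_gt0// addr_gt0// invr_gt0.
move=> t N p hy yx rt; have r0 : 0 < t - p.2 by rewrite subr_gt0.
rewrite green_psumE//.
set q := 1 - alpha / 2 - 1; pose B := C * (t - p.2) `^ q.
have B0 : 0 <= B by rewrite mulr_ge0 ?powR_ge0 ?(ltW C0).
have eB k : (0 < k)%N -> e k (t - p.2) <= B * k%:R `^ (- s).
  move=> k1; apply: (le_trans (hC k _ k1 r0)); apply: le_of_eq; rewrite /B /q.
  rewrite (_ : 2 * s * 2^-1 = s); last by field.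
  have -> : 1 - alpha / 2 - 1 = - (alpha * 2^-1) by ring.
  by move: (_ `^ _) (_ `^ _) => u v; ring.
have d1 : 0 < `|x - p.1| <= 1.
  rewrite normr_gt0 subr_eq0 eq_sym yx/=; move: hx hy => /andP[x0 x1] /andP[y0 y1].
  by rewrite ler_norml; apply/andP; split; lra.
have b1 := cos_sum_bound N hs B0 (fun k => e0 k (t - p.2)) (@en (t - p.2)) eB d1 (sin_dist_ge hx hy).
have b2 := cos_sum_bound N hs B0 (fun k => e0 k (t - p.2)) (@en (t - p.2)) eB (dx_gt0 hx) (sin_sum_ge hx hy).
apply: (le_trans (ler_normB _ _)); apply: (le_trans (lerD b1 b2)).
by apply: le_of_eq; rewrite /B; move: (_ `^ _) (_ `^ _) (_ `^ _) => u v w; ring.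
Qed.

(** Off the diagonal each of the two cosine series is Cauchy: by [cos_sum_tail] a tail is at most
    its first symbol divided by the sine factor, and the symbols tend to 0. *)
Lemma green_psum_cvg t x p : 0 < x < 1 -> 0 < p.1 < 1 -> p.1 != x -> p.2 < t ->
  green_psum t x N p @[N --> \oo] --> green alpha s lam phi (t - p.2) x p.1.
Proof.
move=> hx hy yx rt; have r0 : 0 < t - p.2 by rewrite subr_gt0.
have th : (0 : R) <= 2^-1 <= (1 : R) by apply/andP; split; lra.
have [C C0 hC] := sym_le halpha hs hA th; have /andP[s0 s1] := hs.
have /andP[dx0 _] := dx_gt0 hx.
pose B := C * (t - p.2) `^ (- (alpha / 2)).
have B0 : 0 < B by rewrite mulr_gt0 ?powR_gt0.
have cz (z d : R) : 0 < d -> d <= `|sin (pi * z / 2)| ->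
    cvgn (fun N => \sum_(1 <= k < N.+1) e k (t - p.2) * cos (k%:R * pi * z)).
  move=> d0 hd; apply: cvg_of_tail => eps eps0.
  have [m hm] := powR_small B0 s0 (mulr_gt0 d0 eps0).
  exists m => n mn.
  have -> : \sum_(1 <= k < n.+1) e k (t - p.2) * cos (k%:R * pi * z) =
    \sum_(1 <= k < m.+1) e k (t - p.2) * cos (k%:R * pi * z) +
    \sum_(m.+1 <= k < n.+1) e k (t - p.2) * cos (k%:R * pi * z).
    by rewrite (big_cat_nat _ (n := m.+1)).
  rewrite opprD addrA subrr sub0r normrN.
  have h := cos_sum_tail z n.+1 (fun k => e0 k (t - p.2))
     (fun j k mj jk => @en (t - p.2) _ _ (leq_ltn_trans (leq0n m) mj) jk).
  rewrite -(ltr_pM2l d0); apply: le_lt_trans hm.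
  apply: (@le_trans _ _ (e m.+1 (t - p.2))); first by apply: le_trans h; rewrite ler_wpM2r.
  apply: (le_trans (hC m.+1 _ isT r0)); apply: le_of_eq; rewrite /B.
  rewrite (_ : 2 * s * 2^-1 = s); last by field.
  by move: (_ `^ _) (_ `^ _) => u v; ring.
have d1 : 0 < `|x - p.1| by rewrite normr_gt0 subr_eq0 eq_sym.
have c1 := cz (x - p.1) _ d1 (sin_dist_ge hx hy).
have c2 := cz (x + p.1) _ dx0 (sin_sum_ge hx hy).
have c : cvgn (fun N => green_psum t x N p).
  rewrite (_ : (fun N => _) = (fun N => \sum_(1 <= k < N.+1) e k (t - p.2) * cos (k%:R * pi * (x - p.1)) -
    \sum_(1 <= k < N.+1) e k (t - p.2) * cos (k%:R * pi * (x + p.1)))).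
    exact: is_cvgB.
  by apply/funext => N; rewrite green_psumE.
exact: c.
Qed.

Lemma integrable_powR_reflect (q t : R) : 0 < q -> 0 <= t ->
  mu.-integrable `[0, t] (EFin \o (fun r => (t - r) `^ (q - 1))).
Proof.
move=> q0 t0.
have mf : measurable_fun (setT : set TS) (fun r : TS => ((t - r) `^ (q - 1))%:E).
  by apply/measurable_EFinP; apply: measurable_fun_powR; exact: measurable_funB.
apply/integrableP; split; first exact: measurable_funTS.
rewrite (eq_integral (fun r : TS => ((t - r) `^ (q - 1))%:E)); last first.
  by move=> r _ /=; rewrite ger0_norm ?powR_ge0.
rewrite (integral_reflect t)//; last exact: measurable_funTS.
rewrite (_ : [set x | _] = `[0, t]%classic); last first.
  by apply/seteqP; split => x /=; rewrite !in_itv/= => /andP[h1 h2]; apply/andP; split; lra.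
rewrite (eq_integral (fun r : TS => (r `^ (q - 1))%:E)); last by move=> r _; rewrite subKr.
rewrite -integral_itv_obnd_cbnd; last exact: measurable_EFin_powR.
by rewrite integral_powR// ltry.
Qed.

Lemma integrable_powR_dist (q x : R) : 0 < q -> 0 < x < 1 ->
  mu.-integrable D (EFin \o (fun y => `|x - y| `^ (q - 1))).
Proof.
move=> q0 /andP[x0 x1].
have mf : measurable_fun (setT : set TS) (fun y : TS => (`|x - y| `^ (q - 1))%:E).
  apply/measurable_EFinP; apply: measurable_fun_powR; apply: measurableT_comp => //.
  exact: measurable_funB.
have f0 y : (0 <= (`|x - y| `^ (q - 1))%:E)%E by rewrite lee_fin powR_ge0.
apply/integrableP; split; first exact: measurable_funTS.
rewrite (eq_integral (fun y : TS => (`|x - y| `^ (q - 1))%:E)); last first.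
  by move=> r _ /=; rewrite ger0_norm ?powR_ge0.
apply: (@le_lt_trans _ _ (\int[mu]_(y in `]0%R, x] `|` `]x, 1%R]) (`|x - y| `^ (q - 1))%:E)%E).
  apply: ge0_subset_integral => //.
  - exact: measurable_D.
  - exact: measurableU.
  - exact: measurable_funTS.
  - move=> y; rewrite /D/= !in_itv/= => /andP[y0 y1].
    by have [yx|xy] := leP y x; [left; rewrite y0|right; rewrite ltW].
rewrite ge0_integral_setU//; last 2 first.
- exact: measurable_funTS.
- apply/disj_setPS => y [] /=; rewrite !in_itv/= => /andP[_ h1] /andP[h2 _].
  by move: h2; rewrite ltNge h1.
apply: lte_add_pinfty.
  rewrite (integral_reflect x)//; last exact: measurable_funTS.
  rewrite (_ : [set z | `]0, x]%classic (x - z)] = `[0, x[%classic); last first.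
    by apply/seteqP; split => z /=; rewrite !in_itv/= => /andP[h1 h2]; apply/andP; split; lra.
  rewrite (eq_integral (fun r : TS => (r `^ (q - 1))%:E)); last first.
    by move=> r; rewrite inE/= in_itv/= => /andP[r0 _]; rewrite subKr ger0_norm.
  rewrite integral_itv_bndo_bndc; last exact: measurable_EFin_powR.
  rewrite -integral_itv_obnd_cbnd; last exact: measurable_EFin_powR.
  by rewrite integral_powR ?ltry// ltW.
rewrite (integral_shift x)//; last exact: measurable_funTS.
rewrite (_ : [set z | _] = `]0, 1 - x]%classic); last first.
  by apply/seteqP; split => z /=; rewrite !in_itv/= => /andP[h1 h2]; apply/andP; split; lra.
rewrite (eq_integral (fun r : TS => (r `^ (q - 1))%:E)); last first.
  move=> r; rewrite inE/= in_itv/= => /andP[r0 _].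
  by rewrite opprD addrA (addrAC x) subrr sub0r normrN ger0_norm// ltW.
by rewrite integral_powR ?ltry// subr_ge0 ltW.
Qed.

(** The lines on which the bound and the convergence of the Green series fail. *)
Lemma slab_null (x t : R) : {ae mu2, forall p : TS * TS, p.1 != x /\ p.2 != t}.
Proof.
exists (([set x] `*` setT) `|` (setT `*` [set t])); split.
- by apply: measurableU; apply: measurableX => //; exact: measurable_set1.
- have z1 : mu2 ([set x] `*` setT) = 0%E.
    rewrite product_measure1E//.
    transitivity (0 * mu setT)%E; last exact: mul0e.
    by congr (_ * _)%E; exact: lebesgue_measure_set1.
  have z2 : mu2 (setT `*` [set t]) = 0%E.
    rewrite product_measure1E//.
    transitivity (mu setT * 0)%E; last exact: mule0.
    by congr (_ * _)%E; exact: lebesgue_measure_set1.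
  apply/eqP; rewrite eq_le measure_ge0 andbT.
  apply: (le_trans (measureU2 _ _ _)).
  - by apply: measurableX => //; exact: measurable_set1.
  - by apply: measurableX => //; exact: measurable_set1.
  - by apply: (le_trans (leeD (_ : _ <= 0)%E (_ : _ <= 0)%E)); rewrite ?adde0//; [rewrite -z1|rewrite -z2].
- move=> -[y r] /= h; have [yx|yx] := eqVneq y x; first by left.
  have [rt|rt] := eqVneq r t; first by right.
  by exfalso; apply: h.
Qed.

Lemma bmeas_mode_time j : bmeas (mode_time T j).
Proof.
rewrite (_ : mode_time T j = fun r => (j.1%:R * pi / T) * time_trig T j r).
  by apply: bmeasM; [exact: bmeas_cst|exact: bmeas_time_trig].
by apply/funext => r; rewrite mode_timeE.
Qed.

Lemma integrable_phi_mode k i : (1 <= k)%N -> mu.-integrable D (EFin \o (fun y => phi k y * mode_deriv i y)).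
Proof.
move=> k1; have [a ha] := spectrum_sin hA; have [_ a2 pk] := ha k k1.
apply: measurable_bounded_integrable.
- exact: measurable_D.
- by apply: (@itv_finite _ _ 0 1) => x /=; exact: subset_itv_oo_cc.
- apply: measurable_funTS; apply: measurable_funM; first exact: measurable_L2.
  by apply: continuous_measurable_fun; exact: continuous_mode_deriv.
- exists (`|a k| * `|i.1%:R * pi|); split; first exact: num_real.
  move=> M hM x; rewrite /D/= => xD; rewrite (le_trans _ (ltW hM))//.
  rewrite pk ?(subset_itv_oo_cc xD)// normrM; apply: ler_pM => //.
    by rewrite normrM ler_piMr// sin_max.
  by rewrite /mode_deriv normrM ler_piMr// norm_trig_le1.
Qed.

(** Each term of a partial sum factors into an overlap in space and a response in time. The series
    converges only conditionally, so the exchange with the integral is by dominated convergence of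
    the partial sums and the result is a limit. *)
Lemma green_mode x t i j : 0 < x < 1 -> 0 <= t ->
  measurable_fun (slab t) (fun p => green alpha s lam phi (t - p.2) x p.1) ->
  \sum_(1 <= k < N.+1) phi k x * (overlap phi k i * response alpha s T lam k t j) @[N --> \oo] -->
    integrand_mode T t (fun p => green alpha s lam phi (t - p.2) x p.1) i j.
Proof.
move=> hx t0 mg; have mS := @measurable_slab R t.
pose f N (p : TS * TS) := (green_psum t x N p * kernel_mode T i j p)%:E.
pose h k (p : TS * TS) := (phi k p.1 * mode_deriv i p.1) * (e k (t - p.2) * mode_time T j p.2).
have be k : bmeas (e k) by exact: bmeas_sym.
have ih k : (1 <= k)%N -> mu2.-integrable (slab t) (EFin \o h k) /\
    (\int[mu2]_(p in slab t) (h k p)%:E = (overlap phi k i * response alpha s T lam k t j)%:E)%E.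
  move=> k1.
  have i2 : mu.-integrable `[0, t] (EFin \o (fun r => e k (t - r) * mode_time T j r)).
    apply: bmeas_integrable => //.
      by apply: bmeasM; [exact: bmeas_reflect|exact: bmeas_mode_time].
    by apply: (@itv_finite _ _ 0 t).
  have [i3 e3] := Rintegral_prodM measurable_D (measurable_itv _) (integrable_phi_mode i k1) i2.
  split => //; rewrite /overlap /response -e3 /Rintegral fineK//.
  exact: integrable_fin_num.
have fE N p : f N p = (\sum_(k <- index_iota 1 N.+1) phi k x * h k p)%:E.
  rewrite /f /green_psum mulr_suml; congr (_%:E); apply: eq_bigr => k _.
  by rewrite /h /kernel_mode; move: (phi k x) (phi k p.1) => u v; ring.
have If N : mu2.-integrable (slab t) (f N) /\ (\int[mu2]_(p in slab t) f N p =
    (\sum_(1 <= k < N.+1) phi k x * (overlap phi k i * response alpha s T lam k t j))%:E)%E.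
  have [|||i1 e1] := @integral_lincomb _ _ R mu2 (slab t) _ (index_iota 1 N.+1) (fun k => phi k x) h
    (fun k => overlap phi k i * response alpha s T lam k t j).
  - exact: mS.
  - by move=> k; rewrite mem_index_iota => /andP[k1 _]; have [] := ih k k1.
  - by move=> k; rewrite mem_index_iota => /andP[k1 _]; have [] := ih k k1.
  have -> : f N = EFin \o (fun p => \sum_(k <- index_iota 1 N.+1) phi k x * h k p).
    by apply/funext => p; exact: fE.
  by split.
have [C C0 hC] := green_psum_le hx; have [K K0 hK] := @kernel_mode_bound R T T0 i j.
have /andP[a0 a1] := halpha; have /andP[s0 s1] := hs.
have q0 : 0 < 1 - alpha / 2 by lra.
pose g1 (y : TS) := `|x - y| `^ (s - 1) + dx x `^ (s - 1).
pose g2 (r : TS) := (t - r) `^ (1 - alpha / 2 - 1).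
have ig1 : mu.-integrable D (EFin \o g1).
  have i1 := integrable_powR_dist s0 hx.
  have i2 : mu.-integrable D (EFin \o (cst (dx x `^ (s - 1)) : TS -> R)).
    apply: (@measurable_bounded_integrable _ _ _ mu (cst (dx x `^ (s - 1)))).
    - exact: measurable_D.
    - by apply: (@itv_finite _ _ 0 1) => y /=; exact: subset_itv_oo_cc.
    - exact: measurable_cst.
    - by exists (dx x `^ (s - 1)); split => [|M hM y _ /=]; rewrite ?num_real// ger0_norm ?powR_ge0// ltW.
  exact: (integrableD measurable_D i1 i2).
have ig2 := integrable_powR_reflect q0 t0.
have [iG _] := Rintegral_prodM measurable_D (measurable_itv _) ig1 ig2.
have iGG : mu2.-integrable (slab t) (fun p => (K * C)%:E * (g1 p.1 * g2 p.2)%:E)%E.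
  exact: integrableZl.
have mf N : measurable_fun (slab t) (f N) by exact: measurable_int (If N).1.
have mgk : measurable_fun (slab t) (fun p => (green alpha s lam phi (t - p.2) x p.1 * kernel_mode T i j p)%:E).
  apply/measurable_EFinP; apply: measurable_funM => //.
  by apply: measurable_funTS; exact: measurable_kernel_mode.
have ae1 : {ae mu2, forall p, slab t p ->
    f N p @[N --> \oo] --> (green alpha s lam phi (t - p.2) x p.1 * kernel_mode T i j p)%:E}.
  apply: filterS (slab_null x t) => p [p1 p2] [Dp].
  rewrite /= in_itv/= => /andP[r0 rt]; move: Dp; rewrite /D/= in_itv/= => Dp.
  apply: cvg_EFin; first exact: nearW.
  rewrite (_ : _ \o _ = fun N => green_psum t x N p * kernel_mode T i j p)//.
  apply: cvgMl; apply: green_psum_cvg => //.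
  by rewrite lt_neqAle p2.
have ae2 : {ae mu2, forall p N, slab t p -> (`|f N p| <= (K * C)%:E * (g1 p.1 * g2 p.2)%:E)%E}.
  apply: filterS (slab_null x t) => p [p1 p2] N [Dp].
  rewrite /= in_itv/= => /andP[r0 rt]; move: Dp; rewrite /D/= in_itv/= => Dp.
  rewrite -EFinM lee_fin normrM mulrC -mulrA ler_pM//.
  by apply: hC => //; rewrite lt_neqAle p2.
have [iL _ H] := dominated_convergence mS mf mgk ae1 iGG ae2.
have -> : integrand_mode T t (fun p => green alpha s lam phi (t - p.2) x p.1) i j =
  fine (\int[mu2]_(p in slab t) (green alpha s lam phi (t - p.2) x p.1 * kernel_mode T i j p)%:E)%E by [].
rewrite -(fineK (integrable_fin_num mS iL)) in H.
apply: (cvg_trans _ (fine_cvg H)); apply: near_eq_cvg; apply: nearW => N /=.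
by rewrite (If N).2.
Qed.

End green_modes.

(** * The stochastic convolution *)

Section conv.
Context {R : realType}.
Notation mu := (@lebesgue_measure R).
Notation TS := (measurableTypeR R).
Variables (lam : nat -> R) (phi : nat -> L2D R).
Hypothesis hA : dirichlet_spectrum lam phi.

Lemma phi_orth j k : (0 < j)%N -> (0 < k)%N -> ip (phi j) (phi k) = (j == k)%:R.
Proof. by case: hA => _ h _ _; exact: h. Qed.

Lemma integral_psum_sqr (c : nat -> R) N :
  mu.-integrable D (EFin \o (fun x => psum phi c N x ^+ 2)) /\
  (\int[mu]_(x in D) (psum phi c N x ^+ 2)%:E = (qsum c N)%:E)%E.
Proof.
have hq : ip (psum phi c N) (psum phi c N) = qsum c N.
  by rewrite (ip_psum_psum phi_orth)//; apply: eq_bigr => k _; rewrite expr2.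
have h : (\int[mu]_(x in D) (psum phi c N x ^+ 2)%:E = (qsum c N)%:E)%E.
  by rewrite -hq ipED; apply: eq_integral => x _; rewrite expr2.
split => //; apply/integrableP; split.
  by apply/measurable_funTS/measurable_sqrE; exact: measurable_L2.
rewrite (eq_integral (fun x => (psum phi c N x ^+ 2)%:E)); first by rewrite h ltry.
by move=> x _ /=; rewrite ger0_norm ?sqr_ge0.
Qed.

Lemma psum_subE (a b : nat -> R) N x :
  psum phi (fun k => a k - b k) N x = psum phi a N x - psum phi b N x.
Proof. by rewrite !psumE -sumrB; apply: eq_bigr => k _; rewrite mulrBl. Qed.

Variables (H1 H2 T : R) (hH1 : 0 < H1 <= 2^-1) (hH2 : 0 < H2 <= 2^-1) (T0 : 0 < T).

(** Orthonormality of the phi k removes the cross terms when integrating in x. *)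
Lemma integral_mode_quad_psum (c : nat -> mode -> mode -> R) N M :
  mu.-integrable D (EFin \o (fun x => mode_quad H1 H2 T M (fun i j => psum phi (fun k => c k i j) N x))) /\
  (\int[mu]_(x in D) (mode_quad H1 H2 T M (fun i j => psum phi (fun k => c k i j) N x))%:E =
   (\sum_(1 <= k < N.+1) mode_quad H1 H2 T M (c k))%:E)%E.
Proof.
pose w i j := mode_weight H1 i * (T `^ (2 * H2) * mode_weight H2 j).
pose p i j x := psum phi (fun k => c k i j) N x ^+ 2.
pose q i j := qsum (fun k => c k i j) N.
have h1 i : mu.-integrable D (EFin \o (fun x => \sum_(j <- modes M) w i j * p i j x)) /\
    (\int[mu]_(x in D) (\sum_(j <- modes M) w i j * p i j x)%:E = (\sum_(j <- modes M) w i j * q i j)%:E)%E.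
  by apply: integral_lincomb; [exact: measurable_D|move=> j _..]; have [] := integral_psum_sqr (fun k => c k i j) N.
have [h2 h3] := @integral_lincomb _ _ R mu D _ (modes M) (fun=> 1)
  (fun i x => \sum_(j <- modes M) w i j * p i j x) (fun i => \sum_(j <- modes M) w i j * q i j)
  measurable_D (fun i _ => (h1 i).1) (fun i _ => (h1 i).2).
have E x : \sum_(i <- modes M) 1 * (\sum_(j <- modes M) w i j * p i j x) =
    mode_quad H1 H2 T M (fun i j => psum phi (fun k => c k i j) N x).
  by apply: eq_bigr => i _; rewrite mul1r.
have E2 : \sum_(i <- modes M) 1 * (\sum_(j <- modes M) w i j * q i j) =
    \sum_(1 <= k < N.+1) mode_quad H1 H2 T M (c k).
  rewrite /mode_quad exchange_big/=; apply: eq_bigr => i _; rewrite mul1r exchange_big/=.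
  by apply: eq_bigr => j _; rewrite mulr_sumr.
split; first by apply: eq_integrable h2; [exact: measurable_D|move=> x _ /=; rewrite E].
by rewrite -E2 -h3; apply: eq_integral => x _; rewrite E.
Qed.

Lemma integral_domE d0 (X : measurableType d0) (nu : {measure set X -> \bar R}) (A : set X) (f : X -> R) :
  (\int[nu]_(x in A) (f x)%:E = \int[nu]_x (f x * \1_A x)%:E)%E.
Proof.
rewrite integral_mkcond; apply: eq_integral => x _; rewrite patchE indicE.
by case: ifP => _; rewrite ?mulr1 ?mulr0.
Qed.

Lemma fatou_einf_le d (X : measurableType d) (nu : {measure set X -> \bar R}) (A : set X)
    (f_ : nat -> X -> \bar R) (B : \bar R) :
  measurable A -> (forall n, measurable_fun A (f_ n)) ->
  (forall n x, A x -> 0 <= f_ n x)%E ->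
  (forall n, \int[nu]_(x in A) f_ n x <= B)%E -> (\int[nu]_(x in A) limn_einf (f_ ^~ x) <= B)%E.
Proof.
move=> mA mf f0 fB; apply: (le_trans (fatou nu mA mf f0)).
rewrite limn_einf_lim; apply: lime_le; first exact: is_cvg_einfs.
apply: nearW => n; apply: le_trans (fB n).
by apply: ereal_inf_lbound; exists n => /=.
Qed.

Lemma measurable_limn_einf d (X : measurableType d) (A : set X) (f_ : nat -> X -> \bar R) :
  measurable A -> (forall n, measurable_fun A (f_ n)) -> measurable_fun A (fun x => limn_einf (f_ ^~ x)).
Proof.
move=> mA mf; apply: (emeasurable_fun_cvg (fun n x => einfs (f_ ^~ x) n)).
  by move=> n; exact: measurable_fun_einfs.
by move=> x _; rewrite limn_einf_lim; exact: is_cvg_einfs.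
Qed.

Lemma limn_einf_ge0 (v : nat -> \bar R) : (forall n, 0 <= v n)%E -> (0 <= limn_einf v)%E.
Proof.
move=> v0; rewrite limn_einf_lim; apply: lime_ge; first exact: is_cvg_einfs.
by apply: nearW => n; apply: le_ereal_inf_tmp => _ [m _ <-].
Qed.

Context d (Omega : measurableType d) (P : probability Omega R).
Variables (F : R -> set (set Omega)) (W : R -> R -> {RV P >-> R}).
Hypothesis hW : is_fractional_brownian_sheet H1 H2 T F W.

(** For almost every x the mean square of Y at x is at most 4 times the energy of its moments, a
    limit in M of quadratic forms that are themselves limits in N of orthonormal sums. Bounds are
    available for finite N and M only, so Fatou's lemma is applied twice. *)
Lemma field_mean_square (Y : Omega -> TS -> R) (c : nat -> mode -> mode -> R) (B : R) :
  measurable_fun [set: Omega * TS] (fun p : Omega * TS => Y p.1 p.2) ->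
  {ae mu, forall x, D x -> exists2 f, approximable T W (fun w => Y w x) f &
     forall i j, psum phi (fun k => c k i j) N x @[N --> \oo] --> f i j} ->
  (forall N M, \sum_(1 <= k < N.+1) mode_quad H1 H2 T M (c k) <= B) ->
  (\int[P]_w \int[mu]_(x in D) (Y w x ^+ 2)%:E <= (4 * B)%:E)%E.
Proof.
move=> mY aeY hB.
pose g (p : Omega * TS) := (Y p.1 p.2 ^+ 2 * \1_D p.2)%:E.
have mg : measurable_fun setT g.
  apply/measurable_EFinP; apply: measurable_funM; first exact: measurable_funX.
  by apply: measurableT_comp => //; exact: measurable_indic measurable_D.
have g0 p : (0 <= g p)%E by rewrite lee_fin mulr_ge0 ?sqr_ge0.
rewrite (eq_integral (fun w => \int[mu]_x g (w, x))%E); last by move=> w _; rewrite integral_domE.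
rewrite (@fubini_tonelli _ _ _ _ _ P mu g mg g0).
pose p N M x := (mode_quad H1 H2 T M (fun i j => psum phi (fun k => c k i j) N x))%:E.
(* Lower limits are defined and measurable at every x; at the good points they are the actual
   limits. *)
pose Q M x := limn_einf (fun N => p N M x).
pose G x := limn_einf (fun M => Q M x).
have p0 N M x : (0 <= p N M x)%E by rewrite lee_fin mode_quad_ge0.
have mp N M : measurable_fun D (p N M) by exact: measurable_int (integral_mode_quad_psum c N M).1.
have Q0 M x : (0 <= Q M x)%E by exact: limn_einf_ge0.
have mQ M : measurable_fun D (Q M) by exact: (measurable_limn_einf (f_ := fun N => p N M) measurable_D (fun N => mp N M)).
have G0 x : (0 <= G x)%E by exact: limn_einf_ge0.
have mG : measurable_fun D G by exact: (measurable_limn_einf (f_ := Q) measurable_D mQ).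
have QB M : (\int[mu]_(x in D) Q M x <= B%:E)%E.
  apply: fatou_einf_le => //; first exact: measurable_D.
  by move=> N; rewrite (integral_mode_quad_psum c N M).2 lee_fin.
have GB : (\int[mu]_(x in D) G x <= B%:E)%E by apply: fatou_einf_le => //; exact: measurable_D.
apply: (@le_trans _ _ (\int[mu]_(x in D) (4%:E * G x))%E); last first.
  by rewrite ge0_integralZl//; [rewrite EFinM lee_wpmul2l|exact: measurable_D].
rewrite [leRHS]integral_mkcond; apply: ae_ge0_le_integral => //.
- by move=> x _; exact: integral_ge0.
- exact: measurable_fun_fubini_tonelli_G.
- by move=> x _; rewrite patchE; case: ifP => _ //; exact: mule_ge0.
- by apply/(measurable_restrictT _ _).1; [exact: measurable_D|exact: measurable_funeM].
apply: filterS aeY => x hx _; rewrite patchE; case: ifPn => [|xD]; last first.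
  by rewrite integral0_eq// => w _; rewrite /g/= indicE (negbTE xD) mulr0.
rewrite inE => Dx; have [f hf fc] := hx Dx.
have QE M : Q M x = (mode_quad H1 H2 T M f)%:E.
  have h : p N M x @[N --> \oo] --> (mode_quad H1 H2 T M f)%:E.
    by apply: cvg_EFin; [exact: nearW|exact: mode_quad_cvg].
  by rewrite /Q is_cvg_limn_einfE; [exact/cvg_lim|apply/cvg_ex; exists (mode_quad H1 H2 T M f)%:E].
have [B' hB'] := approximable_lb hA hH1 hH2 T0 hW hf.
pose m M := mode_quad H1 H2 T M f.
have mnd : nondecreasing_seq m by move=> a b ab; exact: mode_quad_nd.
have mc : cvgn m by apply: nondecreasing_is_cvgn; [exact: mnd|exists B' => _ [M _ <-]; exact: hB'].
have GE : G x = (limn m)%:E.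
  have h : Q M x @[M --> \oo] --> (limn m)%:E.
    by rewrite (_ : Q^~ x = EFin \o m); [apply: cvg_EFin; [exact: nearW|]|apply/funext => M; rewrite QE].
  by rewrite /G is_cvg_limn_einfE; [exact/cvg_lim|apply/cvg_ex; exists (limn m)%:E].
rewrite GE -EFinM (eq_integral (fun w => (Y w x ^+ 2)%:E)); last first.
  by move=> w _; rewrite /g/= indicE mem_set// mulr1.
apply: (approximable_ub hA hH1 hH2 T0 hW hf) => M.
exact: nondecreasing_cvgn_le.
Qed.

Variables (alpha s : R) (halpha : 0 < alpha < 1) (hs : 0 < s < 1).

Definition is_stochastic_conv (t : R) (conv : Omega -> L2D R) :=
  measurable_fun [set: Omega * measurableTypeR R] (fun p : Omega * measurableTypeR R => conv p.1 p.2) /\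
  {ae muD, forall x, is_wiener_integral W t
     (fun p => green alpha s lam phi (t - p.2) x p.1) (fun w => conv w x)}.

Lemma conv_approximable (t : R) conv : 0 <= t <= T -> is_stochastic_conv t conv ->
  {ae mu, forall x, D x -> exists2 f, approximable T W (fun w => conv w x) f &
    forall i j, psum phi (fun k => overlap phi k i * response alpha s T lam k t j) N x @[N --> \oo] --> f i j}.
Proof.
move=> tT [_ /ae_muDP h]; apply: filterS h => x hx Dx; have w := hx Dx.
have /andP[t0 _] := tT.
exists (integrand_mode T t (fun p => green alpha s lam phi (t - p.2) x p.1)).
  exact: wiener_approximable.
move=> i j; rewrite (_ : (fun N => _) = fun N => \sum_(1 <= k < N.+1) phi k x * (overlap phi k i * response alpha s T lam k t j)).
  by apply: green_mode => //; case: w.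
by apply/funext => N; rewrite psumE; apply: eq_bigr => k _; rewrite mulrC.
Qed.

Lemma response0 k j : response alpha s T lam k 0 j = 0.
Proof.
rewrite /response /Rintegral set_itv1 integral_set1//.
Qed.

Hypothesis hcase : 1 - H1 < 2 * s.

Lemma mode_quad_prod M (a b : mode -> R) : mode_quad H1 H2 T M (fun i j => a i * b j) =
  (\sum_(i <- modes M) mode_weight H1 i * a i ^+ 2) * \sum_(j <- modes M) T `^ (2 * H2) * mode_weight H2 j * b j ^+ 2.
Proof.
rewrite /mode_quad mulr_suml; apply: eq_bigr => i _; rewrite mulr_sumr; apply: eq_bigr => j _.
by rewrite exprMn; ring.
Qed.

Lemma conv_holder (ga : R) : 0 <= ga -> ga < H2 + alpha * (H1 - 1) / (2 * s) ->
  exists2 C : R, 0 < C & forall (t' t : R) conv' conv, 0 <= t' -> t' <= t -> t <= T ->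
    is_stochastic_conv t' conv' -> is_stochastic_conv t conv ->
    (\int[P]_w (ip (conv w - conv' w) (conv w - conv' w))%:E <= (C * (t - t') `^ ga ^+ 2)%:E)%E.
Proof.
move=> ga0 gaH; have [C C0 hC] := spacetime_sum halpha hs T0 hA hH1 hH2 hcase ga0 gaH.
exists (4 * C); first by rewrite mulr_gt0.
move=> t' t conv' conv t'0 t't tT hc' hc.
rewrite (eq_integral (fun w => \int[mu]_(x in D) ((conv w x - conv' w x) ^+ 2)%:E)%E); last first.
  by move=> w _; rewrite ipED; apply: eq_integral => x _; rewrite -expr2.
rewrite -mulrA.
pose c k i j := overlap phi k i * (response alpha s T lam k t j - response alpha s T lam k t' j).
apply: (@field_mean_square (fun w x => conv w x - conv' w x) c).
- by apply: measurable_funB; [case: hc|case: hc'].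
- have h1 := conv_approximable (_ : 0 <= t <= T) hc.
  have h2 := conv_approximable (_ : 0 <= t' <= T) hc'.
  have t0 : 0 <= t := le_trans t'0 t't.
  rewrite t0 tT in h1; rewrite t'0 (le_trans t't tT) in h2.
  apply: filterS2 (h1 isT) (h2 isT) => x a b Dx.
  have [f af cf] := a Dx; have [f' af' cf'] := b Dx.
  exists (fun i j => f i j - f' i j); first exact: approximable_sub.
  move=> i j; rewrite (_ : (fun N => _) = fun N => psum phi (fun k => overlap phi k i * response alpha s T lam k t j) N x -
     psum phi (fun k => overlap phi k i * response alpha s T lam k t' j) N x); first exact: cvgB.
  apply/funext => N; rewrite -psum_subE; congr (psum phi _ N x).
  by apply/funext => k; rewrite /c mulrBr.
- move=> N M; apply: le_trans (hC t' t N M t'0 t't); apply: ler_sum => k _.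
  by rewrite /c mode_quad_prod.
Qed.

(** The case t' = 0 of [spacetime_sum], all responses being 0 at time 0. *)
Lemma conv_moment (ga : R) : 0 <= ga -> ga < H2 + alpha * (H1 - 1) / (2 * s) ->
  exists2 C : R, 0 < C & forall t conv, 0 <= t -> t <= T -> is_stochastic_conv t conv ->
    (\int[P]_w (ip (conv w) (conv w))%:E <= (C * t `^ ga ^+ 2)%:E)%E.
Proof.
move=> ga0 gaH; have [C C0 hC] := spacetime_sum halpha hs T0 hA hH1 hH2 hcase ga0 gaH.
exists (4 * C); first by rewrite mulr_gt0.
move=> t conv t0 tT hc.
rewrite (eq_integral (fun w => \int[mu]_(x in D) ((conv w x) ^+ 2)%:E)%E); last first.
  by move=> w _; rewrite ipED; apply: eq_integral => x _; rewrite -expr2.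
rewrite -mulrA; pose c k i j := overlap phi k i * response alpha s T lam k t j.
apply: (@field_mean_square (fun w x => conv w x) c).
- by case: hc.
- by apply: conv_approximable => //; rewrite t0.
- move=> N M; have := hC 0 t N M (lexx 0) t0; rewrite subr0; apply: le_trans.
  apply: ler_sum => k _; rewrite /c mode_quad_prod le_eqVlt; apply/orP; left; apply/eqP; congr (_ * _).
  by apply: eq_bigr => j _; rewrite response0 subr0.
Qed.

End conv.

(** * Infinite energy when 2 s <= 1 - H1 *)

Section rough.
Context {R : realType}.
Notation mu := (@lebesgue_measure R).
Notation TS := (measurableTypeR R).
Variables (alpha s T : R) (lam : nat -> R) (phi : nat -> L2D R).
Hypotheses (halpha : 0 < alpha < 1) (hs : 0 < s < 1) (T0 : 0 < T).
Hypothesis hA : dirichlet_spectrum lam phi.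
Notation e := (symbol alpha s lam).

Lemma overlap_sin j m : (1 <= j)%N -> exists2 a : R, a ^+ 2 = 2 &
  overlap phi j (m, true) = a * (m%:R * pi) * ((j == m)%:R / 2).
Proof.
move=> j1; have [a a2 oE] := overlapE hA (m, true) j1; exists a => //.
by apply: EFin_inj; rewrite oE/= int_sinsin.
Qed.

Lemma J_cst (a b c : R) : a <= b -> J a b (fun=> c) = c * (b - a).
Proof.
move=> ab; rewrite /J Rintegral_cst//; congr (c * _).
have h : (lebesgue_measure (`]a, b] : set R) = (b - a)%:E)%E.
  rewrite lebesgue_measure_itv/= lte_fin.
  by move: ab; rewrite le_eqVlt => /predU1P[->|->] //=; rewrite ltxx subrr.
by move: h; rewrite /= => ->.
Qed.

(** The first sine mode in time is nonnegative on [0, T] and at least 1/2 on [T / 4, T / 2], and the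
    symbol is at least its value at T; hence there is no cancellation. *)
Lemma response_first_ge k : e k T * (pi / 8) <= response alpha s T lam k T (1%N, true).
Proof.
have [h1 h2 h3] : [/\ 0 <= T / 4, T / 4 <= T / 2 & T / 2 <= T] by move: T0 => T0'; split; lra.
have h13 := le_trans h2 h3.
have p0 := @pi_gt0 R.
have bt := bmeas_time_trig T (1%N, true).
have be := @bmeas_sym R alpha s lam halpha k.
have t0 r : 0 < r <= T -> 0 <= time_trig T (1%N, true) r.
  move=> /andP[r0 rT]; rewrite /time_trig /trig/= mul1r; apply: sin_ge0_pi.
  rewrite mulr_ge0 ?divr_ge0 ?(ltW p0) ?(ltW r0) ?(ltW T0)//=.
  by rewrite -[leRHS]mulr1 ler_wpM2l ?(ltW p0)// ler_pdivrMr// mul1r.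
have K : T / 8 <= J 0 T (time_trig T (1%N, true)).
  rewrite (@J_split R _ 0 (T / 4) T)//.
  rewrite (@J_split R _ (T / 4) (T / 2) T)//.
  have j1 : 0 <= J 0 (T / 4) (time_trig T (1%N, true)).
    by apply: J_ge0 => r /andP[r0 r1]; apply: t0; rewrite r0/=; lra.
  have j2 : 0 <= J (T / 2) T (time_trig T (1%N, true)).
    by apply: J_ge0 => r /andP[r0 r1]; apply: t0; apply/andP; split; lra.
  have j3 : J (T / 4) (T / 2) (fun=> 2^-1) <= J (T / 4) (T / 2) (time_trig T (1%N, true)).
    apply: J_le => //; first exact: bmeas_cst.
    move=> r /andP[r0 r1]; rewrite /time_trig /trig/= mul1r.
    have -> : pi * (r / T) = pi * (2 * (r / T)) / 2 by field; rewrite gt_eqF.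
    have q1 : 4^-1 <= r / T by rewrite ler_pdivlMr//; lra.
    have q2 : r / T <= 2^-1 by rewrite ler_pdivrMr//; lra.
    apply: le_trans (jordan _); first by lra.
    by apply/andP; split; lra.
  rewrite J_cst// in j3.
  by move: (J _ _ _) (J _ _ _) (J _ _ _) j1 j2 j3 => a b c; lra.
rewrite responseE//= mul1r.
have L : J 0 T (fun r => e k T * time_trig T (1%N, true) r) <= J 0 T (fun r => e k (T - r) * time_trig T (1%N, true) r).
  apply: J_le.
  - exact: (bmeasM (bmeas_cst _) bt).
  - exact: (bmeasM (bmeas_reflect T be) bt).
  - move=> r r0; apply: ler_wpM2r; first exact: t0.
    by move: r0 => /andP[r0 rT]; apply: sym_nincr => //; lra.
rewrite (JZ _ 0 T bt) in L.
apply: (@le_trans _ _ (pi / T * (e k T * J 0 T (time_trig T (1%N, true))))); last first.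
  by rewrite ler_wpM2l// divr_ge0 ?(ltW p0) ?(ltW T0).
have -> : e k T * (pi / 8) = pi / T * (e k T * (T / 8)) by field; rewrite gt_eqF.
rewrite ler_wpM2l ?divr_ge0 ?(ltW p0) ?(ltW T0)// ler_wpM2l//.
by apply: ltW; exact: (sym_gt0 s lam halpha).
Qed.

(** Two odd multiples a and b of th that differ by 2 th cannot both have a small sine: sin (2 th) =
    sin (b - a), and sin (b - a)^2 <= 2 (sin a^2 + sin b^2). *)
Lemma sin_sqr_odd (th : R) m : sin (2 * th) ^+ 2 / 2 <= sin ((4 * m).+1%:R * th) ^+ 2 + sin ((4 * m).+3%:R * th) ^+ 2.
Proof.
set a := (4 * m).+1%:R * th.
have -> : (4 * m).+3%:R * th = a + 2 * th by rewrite /a -(addn2 (4 * m).+1) natrD mulrDl.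
set b := a + 2 * th.
have -> : sin (2 * th) = sin b * cos a - cos b * sin a by rewrite -sinB /b addrC addKr.
have ca := cos2Dsin2 a; have cb := cos2Dsin2 b.
move: (sin a) (cos a) (sin b) (cos b) ca cb => sa ca sb cb h1 h2.
have h3 : 0 <= (sb * ca + cb * sa) ^+ 2 by exact: sqr_ge0.
have h4 : sb ^+ 2 * ca ^+ 2 <= sb ^+ 2 by rewrite -[leRHS]mulr1 ler_wpM2l ?sqr_ge0//; have := sqr_ge0 sa; lra.
have h5 : sa ^+ 2 * cb ^+ 2 <= sa ^+ 2 by rewrite -[leRHS]mulr1 ler_wpM2l ?sqr_ge0//; have := sqr_ge0 sb; lra.
rewrite ler_pdivrMr//.
have -> : (sb * ca - cb * sa) ^+ 2 = 2 * (sb ^+ 2 * ca ^+ 2) + 2 * (sa ^+ 2 * cb ^+ 2) - (sb * ca + cb * sa) ^+ 2 by ring.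
lra.
Qed.

(** Grouped in blocks of four consecutive indices, the sum dominates a positive multiple of the
    harmonic series, the two odd indices of each block being handled by [sin_sqr_odd]. *)
Lemma odd_sum_unbounded (g : nat -> R) (th A B : R) (k0 : nat) : 0 < A -> sin (2 * th) != 0 ->
  (forall j, 0 <= g j) ->
  (forall j, odd j -> (k0 <= j)%N -> A * j%:R^-1 * sin (j%:R * th) ^+ 2 <= g j) ->
  (forall M, \sum_(1 <= j < M.+1) g j <= B) -> False.
Proof.
move=> A0 th0 g0 hg hB.
(* The quarter comes from n <= 4 (m + 1) for the indices of block m, the half from [sin_sqr_odd]. *)
pose del := A / 4 * (sin (2 * th) ^+ 2 / 2).
have d0 : 0 < del by rewrite mulr_gt0// divr_gt0// exprn_even_gt0.
have step m : (k0 <= m)%N -> del * harmonic m <= g (4 * m).+1 + g (4 * m).+3.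
  move=> km; have k1 : (k0 <= (4 * m).+1)%N by rewrite ltnW// ltnS (leq_trans km)// leq_pmull.
  have k3 : (k0 <= (4 * m).+3)%N by apply: (leq_trans k1); rewrite !ltnS ltnW// ltnW.
  have o1 : odd (4 * m).+1 by rewrite /= oddM.
  have o3 : odd (4 * m).+3 by rewrite /= oddM.
  have := lerD (hg _ o1 k1) (hg _ o3 k3); apply: le_trans.
  have inv n : (0 < n)%N -> (n <= 4 * m.+1)%N -> A / 4 * harmonic m <= A * n%:R^-1.
    move=> n0 nm; rewrite /= -mulrA ler_wpM2l ?(ltW A0)// -invfM lef_pV2 ?posrE ?mulr_gt0 ?ltr0n//.
    by move: nm; rewrite -(ler_nat R) natrM.
  have i1 := inv (4 * m).+1 isT _; have i3 := inv (4 * m).+3 isT _.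
  rewrite mulnS !addSn add0n in i1 i3.
  have {}i1 := i1 (ltnW (ltnW (ltnW (leqnn _)))); have {}i3 := i3 (ltnW (leqnn _)).
  have := sin_sqr_odd th m; have q1 := sqr_ge0 (sin ((4 * m).+1%:R * th)).
  have q3 := sqr_ge0 (sin ((4 * m).+3%:R * th)) => hs2.
  have r1 := ler_wpM2r q1 i1; have r3 := ler_wpM2r q3 i3.
  apply: le_trans (lerD r1 r3); rewrite -mulrDr.
  rewrite (_ : del * harmonic m = A / 4 * harmonic m * (sin (2 * th) ^+ 2 / 2)); last by rewrite /del; ring.
  rewrite ler_wpM2l// mulr_ge0 ?harmonic_ge0//; lra.
have blocks n : \sum_(k0 <= m < k0 + n) del * harmonic m <= \sum_(1 <= j < (4 * (k0 + n)).+1) g j.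
  elim: n => [|n IH]; first by rewrite addn0 big_geq// sumr_ge0.
  rewrite addnS big_nat_recr ?leq_addr//= mulnS !addSn add0n.
  do 4! rewrite (@big_nat_recr _ _ _ _ 1%N)//=.
  have := step (k0 + n)%N (leq_addr _ _); have := g0 (4 * (k0 + n)).+2; have := g0 (4 * (k0 + n)).+4.
  move: IH; rewrite /=.
  move: (\sum_(_ <= _ < _) _) (\sum_(_ <= _ < _) _) (g _) (g _) (g _) (g _) (del * _) => a b c x y z w.
  lra.
apply: (@dvg_harmonic R); apply: nondecreasing_is_cvgn.
  by apply/nondecreasing_seqP => n; rewrite /series/= big_nat_recr//= lerDl harmonic_ge0.
exists (\sum_(0 <= m < k0) harmonic m + B / del) => _ [n _ <-].
apply: (@le_trans _ _ (series harmonic (k0 + n)%N)).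
  rewrite /series/= (@big_cat_nat _ _ _ n 0 (k0 + n))//= ?leq_addl// lerDl sumr_ge0// => i _; exact: harmonic_ge0.
rewrite /series/= (@big_cat_nat _ _ _ k0 0 (k0 + n))//= ?leq_addr// lerD2l.
by rewrite ler_pdivlMr// mulrC mulr_sumr (le_trans (blocks n)).
Qed.

Variables (H1 H2 : R) (hH1 : 0 < H1 <= 2^-1) (hH2 : 0 < H2 <= 2^-1).
Context d (Omega : measurableType d) (P : probability Omega R).
Variables (F : R -> set (set Omega)) (W : R -> R -> {RV P >-> R}).
Hypothesis hW : is_fractional_brownian_sheet H1 H2 T F W.

Lemma mode_quad_ge_sin M (f : mode -> mode -> R) : (1 <= M)%N ->
  \sum_(1 <= j < M.+1) mode_weight H1 (j, true) * (T `^ (2 * H2) * mode_weight H2 (1%N, true)) * f (j, true) (1%N, true) ^+ 2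
  <= mode_quad H1 H2 T M f.
Proof.
move=> M1; rewrite /mode_quad big_modes !big_nat; apply: ler_sum => j /andP[j1 _].
have w0 i k : (1 <= i.1)%N -> (1 <= k.1)%N -> 0 <= mode_weight H1 i * (T `^ (2 * H2) * mode_weight H2 k) * f i k ^+ 2.
  by move=> i1 k1; rewrite mulr_ge0 ?sqr_ge0// weight_ge0.
rewrite -[leLHS]addr0; apply: lerD; last by apply: modes_ge0 => k k1; exact: w0.
rewrite big_modes big_ltn// -[leLHS]addr0; apply: lerD.
  by rewrite lerDl w0.
by rewrite big_nat; apply: sumr_ge0 => k /andP[k1 _]; rewrite addr_ge0// w0// (ltnW k1).
Qed.

(* The modes i = (j, true), j odd, in space and (1, true) in time already contribute
   a multiple of the divergent sum of sin (j pi x) ^ 2 / j to the variance at x. *)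
Lemma no_rough_conv conv : 2 * s <= 1 - H1 -> ~ is_stochastic_conv lam phi W alpha s T conv.
Proof.
move=> hcase hc.
have TT : 0 <= T <= T by rewrite (ltW T0) lexx.
have [N [mN N0 hN]] := conv_approximable hA T0 halpha hs TT hc.
(* Restricting to x < 1/2 outside the null set ensures sin (2 pi x) <> 0, as [odd_sum_unbounded]
   requires. *)
have [x [xN x0 x1]] : exists x, [/\ ~ N x, 0 < x & x < 2^-1].
  apply: contrapT => hx.
  have : `]0, 2^-1[%classic `<=` N.
    move=> x /=; rewrite in_itv/= => /andP[x0 x1]; apply: contrapT => xN; apply: hx; by exists x.
  move=> sub; have mI : measurable (`]0, 2^-1[ : set TS) by exact: measurable_itv.
  have n0 : (mu N <= 0)%E by rewrite N0.
  have := le_trans (@le_measure _ _ _ mu _ _ (mem_set mI) (mem_set mN) sub) n0.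
  have := @lebesgue_measure_itv R `]0%R, 2^-1[; rewrite /= lte_fin invr_gt0 ltr0n => ->.
  by rewrite -EFinB subr0 lee_fin leNgt invr_gt0 ltr0n.
have Dx : D x by rewrite /D/= in_itv/= x0/=; lra.
have [f hf fc] : exists2 f, approximable T W (fun w => conv w x) f &
    forall i j, psum phi (fun k => overlap phi k i * response alpha s T lam k T j) N x @[N --> \oo] --> f i j.
  by apply: contrapT => h; apply: xN; apply: hN => /= h2; apply: h; exact: h2.
have [B hB] := approximable_lb hA hH1 hH2 T0 hW hf.
(* Against the sine mode of index j only phi j has a nonzero overlap, so the partial sums are
   constant from N = j on. *)
have fE j : (1 <= j)%N -> f (j, true) (1%N, true) = overlap phi j (j, true) * response alpha s T lam j T (1%N, true) * phi j x.
  move=> j1; have := fc (j, true) (1%N, true); move=> /cvg_lim <- //.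
  apply/cvg_lim => //; apply: cvg_near_cst; exists j => // n /= jn.
  rewrite psumE (bigD1_seq j)/= ?iota_uniq//; last by rewrite mem_index_iota j1 ltnS.
  rewrite big_nat_cond big1 ?addr0// => k /andP[/andP[k1 _] kj].
  by have [a _ ->] := overlap_sin j k1; rewrite (negbTE kj) mul0r mulr0 !mul0r.
have p1 : 0 < 2 * H1 by move: hH1 => /andP[? _]; lra.
have p2 : 2 * H1 <= 1 by move: hH1 => /andP[_ ?]; lra.
have q1 : 0 < 2 * H2 by move: hH2 => /andP[? _]; lra.
have q2 : 2 * H2 <= 1 by move: hH2 => /andP[_ ?]; lra.
have [c c0 hc1] := fcoef_sqr_lb p1 p2; have [c' c'0 hc2] := fcoef_sqr_lb q1 q2.
have [c2 c20 [k0 hk0]] := sym_ge halpha hs hA T0.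
have W2 : 0 < mode_weight H2 (1%N, true).
  have := hc2 1%N isT; rewrite powR1 mulr1 mul1r => h.
  rewrite /mode_weight/= divr_gt0// -(pmulr_lgt0 _ (exprn_gt0 2 (@pi_gt0 R))).
  exact: lt_le_trans h.
pose w := T `^ (2 * H2) * mode_weight H2 (1%N, true).
have w0 : 0 < w by rewrite mulr_gt0 ?powR_gt0.
have p0 := @pi_gt0 R.
pose K := c2 * T `^ (- alpha) * (pi / 8).
have K0 : 0 < K by rewrite !mulr_gt0 ?powR_gt0 ?invr_gt0.
pose g j := mode_weight H1 (j, true) * w * f (j, true) (1%N, true) ^+ 2.
apply: (@odd_sum_unbounded (fun j => if (1 <= j)%N then g j else 0) (pi * x) (c / 2 * w * K ^+ 2) B k0).
- by rewrite mulr_gt0 ?exprn_gt0// mulr_gt0// divr_gt0.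
- rewrite gt_eqF// sin_gt0_pi// !mulr_gt0//=.
  have -> : 2 * (pi * x) = pi * (2 * x) by ring.
  by rewrite -[ltRHS]mulr1 ltr_pM2l//; lra.
- move=> j; case: ifP => // j1; rewrite /g mulr_ge0 ?sqr_ge0//.
  by rewrite mulr_ge0 ?(ltW w0)// mode_weight_ge0.
- move=> j oj kj; have j1 : (1 <= j)%N by case: (j) oj.
  rewrite j1 /g fE//.
  have [a a2 ->] := overlap_sin j j1; rewrite eqxx.
  have [b hb] := spectrum_sin hA; have [_ b2 pj] := hb j j1.
  rewrite pj; last by rewrite in_itv/= (ltW x0)/=; lra.
  have jR : 0 < (j%:R : R) by rewrite ltr0n.
  have r1 : K * j%:R `^ (- (2 * s)) <= response alpha s T lam j T (1%N, true).
    apply: le_trans (response_first_ge j); rewrite /K.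
    rewrite (_ : _ * _ = c2 * j%:R `^ (- (2 * s)) * T `^ (- alpha) * (pi / 8)); last by ring.
    by rewrite ler_wpM2r ?divr_ge0 ?(ltW p0)// hk0.
  set r := response _ _ _ _ _ _ _ in r1 *.
  have r2 : (K * j%:R `^ (- (2 * s))) ^+ 2 <= r ^+ 2.
    have kr : 0 <= K * j%:R `^ (- (2 * s)) by rewrite mulr_ge0 ?powR_ge0 ?(ltW K0).
    by rewrite ler_pXn2r// nnegrE// (le_trans kr).
  have -> : mode_weight H1 (j, true) * w * (a * (j%:R * pi) * (true%:R / 2) * r * (b j * sin (j%:R * pi * x))) ^+ 2 =
     (fcoef (2 * H1) j * (j%:R * pi) ^+ 2) / 2 * w * r ^+ 2 * sin (j%:R * (pi * x)) ^+ 2.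
    have -> : j%:R * (pi * x) = j%:R * pi * x by ring.
    by rewrite /mode_weight/= !exprMn a2 b2; move: (sin _) (fcoef _ _) => u v; field.
  apply: ler_wpM2r; first exact: sqr_ge0.
  have f1 := hc1 j oj.
  (* The exponent 1 - 2 H1 - 4 s is at least -1 precisely when 2 s <= 1 - H1. *)
  have e1 : j%:R^-1 <= j%:R `^ (1 - 2 * H1) * (j%:R `^ (- (2 * s))) ^+ 2.
    rewrite -powR_mulrn ?powR_ge0// -powRrM -powRD; last by rewrite (gt_eqF jR) implybT.
    by rewrite -powR_inv1 ?(ltW jR)// ler_powR ?ler1n//; lra.
  apply: (@le_trans _ _ (c * j%:R `^ (1 - 2 * H1) / 2 * w * (K * j%:R `^ (- (2 * s))) ^+ 2)).
    rewrite (_ : c * _ / 2 * w * _ = c / 2 * w * K ^+ 2 * (j%:R `^ (1 - 2 * H1) * (j%:R `^ (- (2 * s))) ^+ 2)).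
      by rewrite ler_wpM2l// mulr_ge0 ?sqr_ge0// mulr_ge0 ?(ltW w0)// divr_ge0// ltW.
    by move: (_ `^ _) (_ `^ _) => u v; ring.
  apply: ler_pM => //.
  - by rewrite mulr_ge0 ?(ltW w0)// divr_ge0// mulr_ge0 ?powR_ge0// ltW.
  - exact: sqr_ge0.
  - by rewrite ler_wpM2r ?(ltW w0)// ler_wpM2r.
- move=> M; have [->|M1] := posnP M; first by rewrite big_nil (le_trans _ (hB 0%N))// mode_quad_ge0.
  apply: le_trans (hB M); apply: le_trans (mode_quad_ge_sin f M1).
  by rewrite !big_nat; apply: ler_sum => j /andP[-> _].
Qed.

End rough.

(** * The drift *)

Section drift.
Context {R : realType}.
Notation mu := (@lebesgue_measure R).
Notation TS := (measurableTypeR R).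
Variables (alpha s : R) (lam : nat -> R) (phi : nat -> L2D R).
Hypotheses (halpha : 0 < alpha < 1) (hs : 0 < s < 1).
Hypothesis hA : dirichlet_spectrum lam phi.
Notation e := (symbol alpha s lam).

Lemma bmeas_indic (A : set TS) : measurable A -> bmeas (\1_A : R -> R).
Proof.
move=> mA; split; first exact: measurable_indic.
by exists 1 => x; rewrite indicE; case: (_ \in _); rewrite ?normr1 ?normr0.
Qed.

(** The indicator extends the integral up to t' to all of [0, t], so that the difference of two
    drifts has a single kernel. Monotonicity of g removes the absolute values, and the integrals of
    g telescope down to one over an interval of length t - t'. *)
Lemma memory_kernel (g : R -> R) (t' t : R) : bmeas g -> 0 <= t' -> t' < t ->
  (forall x, 0 <= g x) -> (forall x, g x <= 1) -> (forall x y, 0 <= x -> x <= y -> g y <= g x) ->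
  [/\ bmeas (fun r => g (t - r) - \1_(`[0, t'] : set TS) r * g (t' - r)),
      forall r, `|g (t - r) - \1_(`[0, t'] : set TS) r * g (t' - r)| <= 1 &
      J 0 t (fun r => `|g (t - r) - \1_(`[0, t'] : set TS) r * g (t' - r)|) <= 2 * (t - t')].
Proof.
move=> bg t'0 t't g0 g1 gn.
have bind : bmeas (\1_(`[0, t'] : set TS) : R -> R) by apply: bmeas_indic; exact: measurable_itv.
have b1 := bmeas_reflect t bg; have b2 := bmeas_reflect t' bg.
have bk := bmeasB b1 (bmeasM bind b2); have bn := bmeas_norm bk.
split => //.
  move=> r; have := g0 (t - r); have := g1 (t - r); have := g0 (t' - r); have := g1 (t' - r).
  rewrite indicE; case: (_ \in _); rewrite ?mul1r ?mul0r.
    by move: (g _) (g _) => x y h1 h2 h3 h4; rewrite ler_norml; apply/andP; split; lra.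
  by move: (g _) (g _) => x y h1 h2 h3 h4; rewrite subr0 ger0_norm.
have tt0 : 0 <= t - t' by rewrite subr_ge0 ltW.
rewrite (J_split bn t'0 (ltW t't)).
have I1 : J t' t (fun r => `|g (t - r) - \1_(`[0, t'] : set TS) r * g (t' - r)|) <= J t' t (fun r => g (t - r)).
  apply: (J_le bn b1) => r /andP[r0 _].
  by rewrite indicE memNset ?mul0r ?subr0 ?ger0_norm//= in_itv/= [r <= t']leNgt r0 andbF.
have I2 : J 0 t' (fun r => `|g (t - r) - \1_(`[0, t'] : set TS) r * g (t' - r)|) <= J 0 t' (fun r => g (t' - r) - g (t - r)).
  apply: (J_le bn (bmeasB b2 b1)) => r /andP[r0 rt].
  rewrite indicE mem_set/= ?in_itv/= ?(ltW r0)// mul1r distrC.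
  by rewrite ger0_norm// subr_ge0 gn ?subr_ge0// lerD2r ltW.
rewrite (JB _ _ b2 b1) in I2.
have E1 := J_reflect t t' t bg; have E2 := J_reflect t' 0 t' bg; have E3 := J_reflect t 0 t' bg.
rewrite subrr in E1; rewrite subrr subr0 in E2; rewrite subr0 in E3.
rewrite E1 in I1; rewrite E2 E3 in I2.
have F1 : J 0 t g = J 0 (t - t') g + J (t - t') t g by apply: (J_split bg) => //; rewrite gerBl.
have F2 : J 0 t g = J 0 t' g + J t' t g by exact: (J_split bg t'0 (ltW t't)).
have F3 : 0 <= J t' t g by exact: J_ge0.
have F4 : J 0 (t - t') g <= t - t'.
  apply: (@le_trans _ _ (J 0 (t - t') (fun=> 1))); last by rewrite J_cst// mul1r subr0.
  by apply: (J_le bg (bmeas_cst _)) => r _; exact: g1.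
apply: (le_trans (lerD I2 I1)).
move: (J 0 t g) (J 0 (t - t') g) (J (t - t') t g) (J 0 t' g) (J t' t g) F1 F2 F3 F4.
by move=> *; lra.
Qed.

(* Cauchy-Schwarz: since |kap k| <= 1, |int kap a| ^ 2 <= int |kap| * int a ^ 2. *)
Lemma sum_int_sqr_le (n : nat) (kap a : nat -> R -> R) (Q : R -> R) (t L A : R) : 0 < L ->
  (forall k, bmeas (kap k)) -> (forall k r, 0 <= r <= t -> `|kap k r| <= 1) ->
  (forall k, J 0 t (fun r => `|kap k r|) <= L) ->
  (forall k, (1 <= k)%N -> measurable_fun (`[0, t] : set TS) (a k)) ->
  measurable_fun (`[0, t] : set TS) Q ->
  (forall r m, 0 <= r <= t -> qsum (fun k => a k r) m <= Q r) ->
  (\int[mu]_(r in `[0%R, t]) (Q r)%:E <= A%:E)%E ->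
  qsum (fun k => \int[mu]_(r in `[0, t]) (kap k r * a k r)) n <= L * A.
Proof.
move=> L0 bk k1 kL ma mQ aQ QA.
have mI : measurable (`[0, t] : set TS) by exact: measurable_itv.
have Q0 r : 0 <= r <= t -> 0 <= Q r by move=> rt; apply: le_trans (aQ r 0%N rt); rewrite /qsum big_nil.
have iQ : mu.-integrable `[0, t] (EFin \o Q).
  apply/integrableP; split; first exact/measurable_EFinP.
  rewrite (eq_integral (fun r : TS => (Q r)%:E)); first by rewrite (le_lt_trans QA)// ltry.
  by move=> r; rewrite inE/= in_itv/= => rt; rewrite ger0_norm ?Q0.
have a2 k r : (1 <= k)%N -> 0 <= r <= t -> a k r ^+ 2 <= Q r.
  move=> k0 rt; apply: le_trans (aQ r k rt).
  rewrite /qsum big_nat_recr//= lerDr sumr_ge0// => i _; exact: sqr_ge0.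
have ik k : mu.-integrable `[0, t] (EFin \o (fun r => `|kap k r|)).
  by apply: bmeas_integrable => //; [exact: bmeas_norm|exact: (@itv_finite _ _ 0 t)].
have ika k : (1 <= k)%N -> mu.-integrable `[0, t] (EFin \o (fun r => kap k r * a k r)).
  move=> k0; apply: (le_integrable mI _ _ (integrableD mI (ik k) iQ)).
    by apply/measurable_EFinP; apply: measurable_funM; [apply: measurable_funTS; exact: (bk k).1|exact: ma].
  move=> r; rewrite /= in_itv/= => rt; rewrite lee_fin.
  have h1 := k1 k r rt; have h2 := a2 k r k0 rt; have h3 := normr_ge0 (kap k r).
  rewrite (@ger0_norm _ (_ + Q r)) ?addr_ge0 ?Q0// normrM.
  have h4 : `|a k r| ^+ 2 = a k r ^+ 2 by rewrite real_normK ?num_real.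
  have h5 : `|a k r| <= 1 + Q r by have := sqr_ge0 (`|a k r| - 1); rewrite sqrrB h4; have := normr_ge0 (a k r); have := Q0 r rt; lra.
  have h6 : `|kap k r| * `|a k r| <= `|kap k r| * (1 + Q r) by rewrite ler_wpM2l.
  have h7 : `|kap k r| * Q r <= 1 * Q r by rewrite ler_wpM2r ?Q0.
  by lra.
pose Dk k := \int[mu]_(r in `[0, t]) (kap k r * a k r).
have Dk_E k : (1 <= k)%N -> (\int[mu]_(r in `[0%R, t]) (kap k r * a k r)%:E = (Dk k)%:E)%E.
  by move=> k0; rewrite /Dk /Rintegral fineK//; exact: integrable_fin_num (ika k k0).
(* The optimal multiplier: 2 c D is at most the integral of the squared coefficient plus c^2 times
   the integral of |kap|, and c = D / L makes the left side twice the last bound. *)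
pose c k := Dk k / L.
have idx k : k \in index_iota 1 n.+1 -> (1 <= k)%N by rewrite mem_index_iota => /andP[].
have [i1 e1] := @integral_lincomb _ _ R mu _ _ (index_iota 1 n.+1) (fun k => 2 * c k) (fun k r => kap k r * a k r) Dk mI
  (fun k hk => ika k (idx k hk)) (fun k hk => Dk_E k (idx k hk)).
have kE k : (\int[mu]_(r in `[0%R, t]) (`|kap k r|)%:E = (J 0 t (fun r => `|kap k r|))%:E)%E.
  rewrite -(J_cc _ _ (bmeas_norm (bk k))) /Rintegral fineK//; exact: integrable_fin_num (ik k).
have [i2 e2] := @integral_lincomb _ _ R mu _ _ (index_iota 1 n.+1) (fun k => c k ^+ 2) (fun k r => `|kap k r|)
  (fun k => J 0 t (fun r => `|kap k r|)) mI (fun k _ => ik k) (fun k _ => kE k).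
have main : ((\sum_(k <- index_iota 1 n.+1) 2 * c k * Dk k)%:E <=
    (A + \sum_(k <- index_iota 1 n.+1) c k ^+ 2 * J 0 t (fun r => `|kap k r|))%:E)%E.
  rewrite -e1 EFinD -e2; apply: le_trans (leeD2r _ QA).
  rewrite -(integralD mI iQ i2); apply: le_integral => //; first exact: (integrableD mI iQ i2).
  move=> r; rewrite inE/= in_itv/= => rt; rewrite -EFinD lee_fin.
  apply: le_trans (lerD (aQ r n rt) (lexx _)).
  rewrite /qsum -big_split/= !big_nat; apply: ler_sum => k /andP[k0 _].
  have := sqr_ge0 (`|c k| - `|a k r|); rewrite sqrrB !real_normK ?num_real// => h.
  have h1 := k1 k r rt; have h3 := normr_ge0 (kap k r).
  have h4 := ler_norm (2 * c k * (kap k r * a k r)); rewrite (normrM (2 * c k)) (normrM 2 (c k)) (normrM (kap k r)) (@ger0_norm _ 2)// in h4.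
  have h5 := ler_wpM2l h3 h.
  have h6 := ler_wpM2r (sqr_ge0 (a k r)) h1.
  apply: (le_trans h4); rewrite -subr_ge0.
  rewrite (_ : _ - _ = `|kap k r| * (c k ^+ 2 - `|c k| * `|a k r| *+ 2 + a k r ^+ 2) + (1 * a k r ^+ 2 - `|kap k r| * a k r ^+ 2)); last by ring.
  by rewrite mulr0 in h5; lra.
rewrite lee_fin in main.
have E1 : \sum_(k <- index_iota 1 n.+1) 2 * c k * Dk k = 2 / L * qsum Dk n.
  by rewrite /qsum mulr_sumr; apply: eq_bigr => k _; rewrite /c; field; rewrite gt_eqF.
have E2 : \sum_(k <- index_iota 1 n.+1) c k ^+ 2 * J 0 t (fun r => `|kap k r|) <= L^-1 * qsum Dk n.
  rewrite /qsum mulr_sumr; apply: ler_sum => k _.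
  apply: (le_trans (ler_wpM2l (sqr_ge0 _) (kL k))); rewrite le_eqVlt; apply/orP; left; apply/eqP.
  by rewrite /c; field; rewrite gt_eqF.
rewrite E1 in main; have := le_trans main (lerD (lexx _) E2).
rewrite mulrDl -/Dk => h; have : L^-1 * qsum Dk n <= A by lra.
by rewrite ler_pdivrMl.
Qed.

Lemma qsum_damp (c : nat -> R) (v : L2D R) n : (forall k, `|c k| <= 1) ->
  qsum (fun k => c k * ip v (phi k)) n <= ip v v.
Proof.
move=> c1; apply: le_trans (bessel (phi_orth hA) v n); apply: ler_sum => k _.
rewrite exprMn ler_piMl ?sqr_ge0//.
by rewrite -[c k ^+ 2]real_normK ?num_real// expr_le1.
Qed.

Lemma sym_norm k t : `|e k t| <= 1.
Proof. by rewrite ger0_norm ?sym_le1// ltW// sym_gt0. Qed.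

Lemma sol_op_coef t (v : L2D R) k : (1 <= k)%N ->
  ip (sol_op alpha s lam phi t v) (phi k) = e k t * ip v (phi k).
Proof.
exact: (L2_lim_psum (phi_orth hA) (fun n => qsum_damp v n (fun k => sym_norm k t))).
Qed.

Lemma phi_complete (v : L2D R) : (forall k, (1 <= k)%N -> ip v (phi k) = 0) -> L2norm v = 0%E.
Proof. by case: hA => _ _ _; exact. Qed.

Lemma sol_op_contract t (v : L2D R) :
  ip (sol_op alpha s lam phi t v) (sol_op alpha s lam phi t v) <= ip v v.
Proof.
apply: (parseval_le (phi_orth hA) phi_complete) => n.
apply: le_trans (qsum_damp v n (fun k => sym_norm k t)).
by rewrite /qsum !big_nat; apply: ler_sum => k /andP[k1 _]; rewrite sol_op_coef.
Qed.

Lemma bochner_point (F : R -> L2D R) : is_bochner_integral `[0, 0] F 0.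
Proof.
split.
- by move=> v; rewrite set_itv1; exact: measurable_fun_set1.
- by rewrite set_itv1 integral_set1 ltry.
- by move=> v; rewrite ip0l /Rintegral set_itv1 integral_set1.
Qed.

Variable v : R -> L2D R.

Definition drift_integrand (t r : R) : L2D R := sol_op alpha s lam phi (t - r) (v r).

(** The Bochner integral only provides measurability of the damped coefficients; dividing by the
    positive measurable symbol recovers those of v. *)
Lemma measurable_coef t I k : is_bochner_integral `[0, t] (drift_integrand t) I -> (1 <= k)%N ->
  measurable_fun (`[0, t] : set TS) (fun r => ip (v r) (phi k)).
Proof.
move=> [m _ _] k1.
have -> : (fun r => ip (v r) (phi k)) = fun r => e k (t - r) `^ (- 1) * ip (drift_integrand t r) (phi k).
  apply/funext => r; rewrite sol_op_coef// powR_inv1 ?ltW ?sym_gt0//.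
  by rewrite mulrA mulVf ?mul1r// gt_eqF// sym_gt0.
apply: measurable_funM; last exact: m.
apply: measurable_funTS; apply: measurable_fun_powR.
exact: (bmeas_reflect t (bmeas_sym s lam halpha k)).1.
Qed.

Lemma bochner_coef t I k : is_bochner_integral `[0, t] (drift_integrand t) I -> (1 <= k)%N ->
  ip I (phi k) = \int[mu]_(r in `[0, t]) (e k (t - r) * ip (v r) (phi k)).
Proof. by move=> [_ _ ->] k1; apply: eq_Rintegral => r _; rewrite sol_op_coef. Qed.

(** Testing the integral against I itself gives (I, I) <= |I| times the integral of K, because the
    solution operators are contractions. *)
Lemma drift_minkowski t I (K : R -> R) (B : R) : is_bochner_integral `[0, t] (drift_integrand t) I ->
  measurable_fun (`[0, t] : set TS) K -> (forall r, 0 <= K r) ->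
  (forall r, 0 <= r <= t -> ip (v r) (v r) <= K r ^+ 2) ->
  (\int[mu]_(r in `[0%R, t]) (K r)%:E <= B%:E)%E -> ip I I <= B ^+ 2.
Proof.
move=> [m _ h] mK K0 vK KB.
have mI : measurable (`[0, t] : set TS) by exact: measurable_itv.
have iK : mu.-integrable `[0, t] (EFin \o K).
  apply/integrableP; split; first exact/measurable_EFinP.
  by rewrite (eq_integral (fun r : TS => (K r)%:E)) ?(le_lt_trans KB) ?ltry// => r _ /=; rewrite ger0_norm.
have B0 : 0 <= B by rewrite -lee_fin; apply: le_trans KB; apply: integral_ge0 => r _; rewrite lee_fin.
pose q := Num.sqrt (ip I I).
have q0 : 0 <= q by exact: sqrtr_ge0.
have q2 : q ^+ 2 = ip I I by rewrite sqr_sqrtr// ip_ge0.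
have bd r : 0 <= r <= t -> `|ip (drift_integrand t r) I| <= q * K r.
  move=> rt; rewrite -(@ler_pXn2r _ 2)// ?nnegrE ?mulr_ge0// real_normK ?num_real//.
  apply: (le_trans (ip_CS _ _)); rewrite exprMn q2 mulrC ler_wpM2l ?ip_ge0//.
  exact: le_trans (sol_op_contract _ _) (vK r rt).
have iqK : mu.-integrable `[0, t] (EFin \o (fun r => q * K r)).
  by rewrite (_ : _ \o _ = fun r => (q%:E * (EFin \o K) r)%E)//; exact: integrableZl.
have iF : mu.-integrable `[0, t] (EFin \o (fun r => ip (drift_integrand t r) I)).
  apply: (le_integrable mI _ _ iqK); first by apply/measurable_EFinP; exact: m.
  move=> r /=; rewrite in_itv/= => rt; rewrite lee_fin (@ger0_norm _ (q * _)) ?mulr_ge0//.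
  exact: bd.
have H : ip I I <= q * B.
  rewrite h; apply: (@le_trans _ _ (\int[mu]_(r in `[0, t]) (q * K r))).
    apply: le_Rintegral => // r /=; rewrite in_itv/= => rt.
    exact: le_trans (ler_norm _) (bd r rt).
  rewrite RintegralZl// ler_wpM2l// -lee_fin /Rintegral fineK//.
  exact: integrable_fin_num.
have [q00|qn] := eqVneq q 0; first by rewrite -q2 q00 expr0n/= sqr_ge0.
have qp : 0 < q by rewrite lt_def qn.
by rewrite -q2 expr2 ler_pM2l// in H; rewrite -q2 ler_pXn2r// nnegrE.
Qed.

(** The k-th coefficient of I - I' is the integral of the kernel of [memory_kernel] against the
    coefficient of v, and [sum_int_sqr_le] applies with L = 2 (t - t'). *)
Lemma drift_diff_le t' t I' I (Q : R -> R) (A : R) : 0 <= t' -> t' < t ->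
  is_bochner_integral `[0, t'] (drift_integrand t') I' ->
  is_bochner_integral `[0, t] (drift_integrand t) I ->
  measurable_fun (`[0, t] : set TS) Q ->
  (forall r, 0 <= r <= t -> ip (v r) (v r) <= Q r) ->
  (\int[mu]_(r in `[0%R, t]) (Q r)%:E <= A%:E)%E ->
  ip (I - I') (I - I') <= 2 * (t - t') * A.
Proof.
move=> t'0 t't bI' bI mQ vQ QA.
have mI : measurable (`[0, t] : set TS) by exact: measurable_itv.
have be k : bmeas (e k) by exact: bmeas_sym.
have e0 k r : 0 <= e k r by apply: ltW; exact: sym_gt0.
have M k := memory_kernel (be k) t'0 t't (e0 k) (sym_le1 s lam halpha k) (fun x y => @sym_nincr _ _ s lam halpha k x y).
pose ind (r : R) : R := \1_(`[0, t'] : set TS) r.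
pose kap k r := e k (t - r) - ind r * e k (t' - r).
have bk k : bmeas (kap k) by have [] := M k.
have k1 k r : 0 <= r <= t -> `|kap k r| <= 1 by move=> _; have [_ h _] := M k; exact: h.
have kL k : J 0 t (fun r => `|kap k r|) <= 2 * (t - t') by have [] := M k.
have bind : bmeas ind by exact: bmeas_indic.
have b2 k : bmeas (fun r => e k (t' - r)) := bmeas_reflect t' (be k).
have ma k (k0 : (1 <= k)%N) := measurable_coef bI k0.
have aQ r m : 0 <= r <= t -> qsum (fun k => ip (v r) (phi k)) m <= Q r.
  by move=> rt; apply: le_trans (bessel (phi_orth hA) _ _) (vQ r rt).
have L0 : 0 < 2 * (t - t') by rewrite mulr_gt0// subr_gt0.
apply: (parseval_le (phi_orth hA) phi_complete) => n.
apply: le_trans (sum_int_sqr_le n L0 bk k1 kL ma mQ aQ QA).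
rewrite /qsum !big_nat; apply: ler_sum => k /andP[k0 _].
rewrite le_eqVlt; apply/orP; left; apply/eqP; congr (_ ^+ 2).
rewrite ipBl (bochner_coef bI k0) (bochner_coef bI' k0).
have Q0 r : 0 <= r <= t -> 0 <= Q r by move=> rt; apply: le_trans (vQ r rt); exact: ip_ge0.
have iQ : mu.-integrable `[0, t] (EFin \o (fun r => 1 + Q r)).
  apply: (@integrableD _ _ _ mu _ mI (EFin \o cst 1) (EFin \o Q)).
    by apply: bmeas_integrable => //; [exact: bmeas_cst|exact: (@itv_finite _ _ 0 t)].
  apply/integrableP; split; first exact/measurable_EFinP.
  rewrite (eq_integral (fun r : TS => (Q r)%:E)); first by rewrite (le_lt_trans QA)// ltry.
  by move=> r; rewrite inE/= in_itv/= => rt; rewrite ger0_norm ?Q0.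
have iga (g : R -> R) : bmeas g -> (forall r, 0 <= r <= t -> `|g r| <= 1) ->
    mu.-integrable `[0, t] (EFin \o (fun r => g r * ip (v r) (phi k))).
  move=> bg g1; apply: (le_integrable mI _ _ iQ).
    by apply/measurable_EFinP; apply: measurable_funM; [apply: measurable_funTS; exact: bg.1|exact: ma].
  move=> r /=; rewrite in_itv/= => rt; rewrite lee_fin.
  rewrite (@ger0_norm _ (1 + _)) ?addr_ge0 ?Q0// normrM.
  have h2 : ip (v r) (phi k) ^+ 2 <= Q r.
    apply: le_trans (aQ r k rt); rewrite /qsum big_nat_recr//= lerDr sumr_ge0// => i _; exact: sqr_ge0.
  have h5 : `|ip (v r) (phi k)| <= 1 + Q r.
    have := sqr_ge0 (`|ip (v r) (phi k)| - 1); rewrite sqrrB real_normK ?num_real//.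
    by have := normr_ge0 (ip (v r) (phi k)); have := Q0 r rt; lra.
  by rewrite -[leRHS]mul1r ler_pM// g1.
have i1 : mu.-integrable `[0, t] (EFin \o (fun r => e k (t - r) * ip (v r) (phi k))).
  by apply: (iga (fun r => e k (t - r))) => [|r _]; [exact: bmeas_reflect|exact: sym_norm].
have i2 : mu.-integrable `[0, t] (EFin \o (fun r => ind r * e k (t' - r) * ip (v r) (phi k))).
  apply: (iga (fun r => ind r * e k (t' - r))); first exact: bmeasM.
  move=> r _; rewrite /ind indicE; case: (_ \in _); first by rewrite mul1r sym_norm.
  by rewrite mul0r normr0.
have -> : \int[mu]_(r in `[0, t']) (e k (t' - r) * ip (v r) (phi k)) =
    \int[mu]_(r in `[0, t]) (ind r * e k (t' - r) * ip (v r) (phi k)).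
  rewrite /Rintegral; congr (fine _).
  rewrite (_ : `[0, t']%classic = `[0, t]%classic `&` `[0, t']%classic); last first.
    apply/seteqP; split => [r /=|r [_]//]; rewrite !in_itv/= => /andP[r0 rt].
    by rewrite r0 rt (le_trans rt (ltW t't)).
  rewrite integral_mkcondr; apply: eq_integral => r _; rewrite patchE /ind indicE.
  by case: (_ \in _); rewrite ?mul1r// !mul0r.
rewrite -RintegralB//; apply: eq_Rintegral => r _.
by rewrite /kap mulrBl.
Qed.

End drift.

(** * Gronwall's inequality *)

Section gronwall.
Context {R : realType}.
Notation mu := (@lebesgue_measure R).
Notation TS := (measurableTypeR R).

Lemma continuous_expRM (b : R) : continuous (fun r : R => expR (b * r)).
Proof.
move=> x; apply: continuous_comp; last exact: continuous_expR.
by apply: cvgM; [exact: cvg_cst|exact: cvg_id].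
Qed.

Lemma measurable_expRM (b : R) : measurable_fun (setT : set TS) (fun r : R => expR (b * r)).
Proof. by apply: continuous_measurable_fun; exact: continuous_expRM. Qed.

Lemma integral_expR (b t : R) : 0 < b -> 0 <= t ->
  (\int[mu]_(r in `[0%R, t]) (expR (b * r))%:E = ((expR (b * t) - 1) / b)%:E)%E.
Proof.
move=> b0 t0.
have d (x : R) : is_derive x (1 : R) (fun r : R => expR (b * r) / b) (expR (b * x)).
  have h1 : is_derive x (1 : R) (fun r : R => b * r) b.
    rewrite (_ : (fun r => _) = b *: id)//.
    by apply: is_derive_eq; rewrite /GRing.scale/= mulr1.
  have h2 := @is_derive1_comp R expR (fun r : R => b * r) x _ _ (is_derive_expR _) h1.
  apply: is_derive_eq; rewrite /GRing.scale/= ?mulr0 ?add0r.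
  by move: (expR _) => u; field; rewrite gt_eqF.
rewrite (@FTC2_cc _ (fun r => expR (b * r) / b) (fun r => expR (b * r)))//.
- by rewrite mulr0 expR0; congr (_%:E); field; rewrite gt_eqF.
- by move=> x _; exact: continuous_expRM.
Qed.

(** A bound c exp(2 B t) improves to (A + c / 2) exp(2 B t), and iterating drives c to the fixed
    point 2 A. The a priori bound G only starts the iteration and does not enter the conclusion. *)
Lemma gronwall (g : R -> R) (A B T G : R) : 0 <= A -> 0 < B ->
  measurable_fun (`[0, T] : set TS) g -> (forall t, 0 <= t <= T -> 0 <= g t <= G) ->
  (forall t, 0 <= t <= T -> g t <= A + B * \int[mu]_(r in `[0, t]) g r) ->
  forall t, 0 <= t <= T -> g t <= 2 * A * expR (2 * B * t).
Proof.
move=> A0 B0 mg gG gI.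
have b0 : 0 < 2 * B by rewrite mulr_gt0.
have ie (c t : R) : 0 <= t -> mu.-integrable `[0, t] (EFin \o (fun r => c * expR (2 * B * r))).
  move=> t0; rewrite (_ : _ \o _ = fun r => (c%:E * (EFin \o (fun r => expR (2 * B * r))) r)%E)//.
  apply: integrableZl => //; apply/integrableP; split.
    by apply/measurable_EFinP; apply: measurable_funTS; exact: measurable_expRM.
  rewrite (eq_integral (fun r : TS => (expR (2 * B * r))%:E)); first by rewrite integral_expR// ltry.
  by move=> r _ /=; rewrite ger0_norm// expR_ge0.
have step c : 0 <= c -> (forall t, 0 <= t <= T -> g t <= c * expR (2 * B * t)) ->
    forall t, 0 <= t <= T -> g t <= (A + c / 2) * expR (2 * B * t).
  move=> c0 hc t /andP[t0 tT]; have tT' : 0 <= t <= T by rewrite t0.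
  apply: (le_trans (gI t tT')).
  have ig : mu.-integrable `[0, t] (EFin \o g).
    apply: (le_integrable _ _ _ (ie c t t0)) => //.
      apply/measurable_EFinP; apply: measurable_funS mg => //.
      by move=> r /=; rewrite !in_itv/= => /andP[-> /le_trans->].
    move=> r /=; rewrite in_itv/= => /andP[r0 rt]; have rT : 0 <= r <= T by rewrite r0 (le_trans rt).
    have /andP[g0 _] := gG r rT; have h := hc r rT.
    by rewrite lee_fin !ger0_norm// mulr_ge0// expR_ge0.
  have h : \int[mu]_(r in `[0, t]) g r <= c * ((expR (2 * B * t) - 1) / (2 * B)).
    apply: (@le_trans _ _ (\int[mu]_(r in `[0, t]) (c * expR (2 * B * r)))).
      apply: le_Rintegral => //; first exact: (ie c t t0).
      by move=> r /=; rewrite in_itv/= => /andP[r0 rt]; apply: hc; rewrite r0 (le_trans rt).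
    rewrite /Rintegral; under eq_integral do rewrite EFinM.
    rewrite ge0_integralZl//; last first.
      by apply/measurable_EFinP; apply: measurable_funTS; exact: measurable_expRM.
    by rewrite integral_expR// -EFinM.
  have := ler_wpM2l (ltW B0) h.
  have -> : B * (c * ((expR (2 * B * t) - 1) / (2 * B))) = c / 2 * (expR (2 * B * t) - 1) by field; rewrite gt_eqF.
  have : 1 <= expR (2 * B * t) by rewrite -[leLHS]expR0 ler_expR (mulr_ge0 (ltW b0)).
  move: (expR _) (B * _) => E I E1 hI.
  have : A * 1 <= A * E by rewrite ler_wpM2l.
  by rewrite mulrDl; lra.
move=> t tT; have G0 : 0 <= G by have /andP[a b] := gG t tT; exact: le_trans a b.
have hn n : forall t, 0 <= t <= T -> g t <= (2 * A + G / 2 ^+ n) * expR (2 * B * t).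
  elim: n => [r rT|n IH r rT].
    have /andP[r0 _] := rT; have /andP[g0 g1] := gG r rT.
    have e1 : 1 <= expR (2 * B * r) by rewrite -[leLHS]expR0 ler_expR (mulr_ge0 (ltW b0)).
    rewrite expr0 divr1; apply: (le_trans g1); apply: (@le_trans _ _ ((2 * A + G) * 1)); first by lra.
    by rewrite ler_wpM2l//; lra.
  have c0 : 0 <= 2 * A + G / 2 ^+ n by rewrite addr_ge0 ?mulr_ge0 ?divr_ge0 ?exprn_ge0.
  apply: (le_trans (step _ c0 IH r rT)); rewrite le_eqVlt; apply/orP; left; apply/eqP.
  rewrite exprS; congr (_ * _); field.
  by rewrite expf_neq0// pnatr_eq0.
have hl : (2 * A + G / 2 ^+ n) * expR (2 * B * t) @[n --> \oo] --> (2 * A + G * 0) * expR (2 * B * t).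
  apply: cvgMl; apply: cvgD; first exact: cvg_cst.
  apply: cvgMr; rewrite (_ : (fun n => _) = fun n => 2^-1 ^+ n).
    by apply: cvg_expr; rewrite ger0_norm ?invr_ge0// invf_lt1// ltr1n.
  by apply/funext => n; rewrite exprVn.
rewrite mulr0 addr0 in hl; rewrite -subr_ge0.
have : g t - (2 * A + G / 2 ^+ n) * expR (2 * B * t) @[n --> \oo] --> g t - 2 * A * expR (2 * B * t).
  by apply: cvgB => //; exact: cvg_cst.
move=> h; rewrite subr_ge0 -subr_le0; apply: (cvgn_le h) => n.
by rewrite subr_le0; exact: hn.
Qed.

End gronwall.

(** * Second moments and increments *)

Section squares.
Context {R : realType}.
Notation mu := (@lebesgue_measure R).
Notation TS := (measurableTypeR R).

Lemma ip_add_le (a b : L2D R) : ip (a + b) (a + b) <= 2 * ip a a + 2 * ip b b.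
Proof.
have := ip_ge0 (a - b); rewrite ipBl !ipBr ipDl (ipC a (a + b)) (ipC b (a + b)) !ipDl (ipC b a).
by move: (ip a a) (ip a b) (ip b b) => x y z; lra.
Qed.

Lemma ip_ae_eq (a b : L2D R) : {ae muD, forall x, a x = b x} -> ip a a = ip b b.
Proof.
move=> h; apply: EFin_inj; rewrite !ipE; apply: ae_eq_integral => //.
- by apply/measurable_EFinP; apply: measurable_funM; exact: measurable_L2.
- by apply/measurable_EFinP; apply: measurable_funM; exact: measurable_L2.
- by apply: filterS h => x -> _.
Qed.

Lemma measurable_int_dom d (X : measurableType d) (A : set TS) (h : X * TS -> R) : measurable A ->
  measurable_fun setT h -> (forall p, 0 <= h p) ->
  measurable_fun setT (fun y => \int[mu]_(x in A) (h (y, x))%:E)%E.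
Proof.
move=> mA mh h0.
pose g p := (h p * \1_A p.2)%:E.
have mg : measurable_fun setT g.
  apply/measurable_EFinP; apply: measurable_funM => //.
  by apply: measurableT_comp => //; exact: measurable_indic.
have g0 p : (0 <= g p)%E by rewrite lee_fin mulr_ge0.
rewrite (_ : (fun y => _) = fubini_F mu g); first exact: measurable_fun_fubini_tonelli_F.
by apply/funext => y; rewrite integral_domE.
Qed.

Lemma measurable_ip_sqr d (X : measurableType d) (U : X -> L2D R) :
  measurable_fun setT (fun p : X * TS => U p.1 p.2) -> measurable_fun setT (fun y => ip (U y) (U y)).
Proof.
move=> mU; apply/measurable_EFinP.
rewrite (_ : _ \o _ = fun y => \int[mu]_(x in D) ((fun p => (U p.1 p.2) ^+ 2) (y, x))%:E)%E.
  exact: (@measurable_int_dom _ X D (fun p => U p.1 p.2 ^+ 2) measurable_D (measurable_funX 2 mU) (fun p => sqr_ge0 _)).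
by apply/funext => y /=; rewrite ipED; apply: eq_integral => x _ /=; rewrite expr2.
Qed.

Lemma tonelli_dom d (X : measurableType d) (P : probability X R) (A : set TS) (h : X * TS -> R) : measurable A ->
  measurable_fun setT h -> (forall p, 0 <= h p) ->
  (\int[P]_w \int[mu]_(r in A) (h (w, r))%:E = \int[mu]_(r in A) \int[P]_w (h (w, r))%:E)%E.
Proof.
move=> mA mh h0.
pose g p := (h p * \1_A p.2)%:E.
have mg : measurable_fun setT g.
  apply/measurable_EFinP; apply: measurable_funM => //.
  by apply: measurableT_comp => //; exact: measurable_indic.
have g0 p : (0 <= g p)%E by rewrite lee_fin mulr_ge0.
rewrite (eq_integral (fun w => \int[mu]_r g (w, r)))%E; last by move=> w _; rewrite integral_domE.
rewrite (@fubini_tonelli _ _ _ _ _ P mu g mg g0) [RHS]integral_mkcond; apply: eq_integral => r _.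
rewrite patchE; case: ifPn => rA.
  by apply: eq_integral => w _; rewrite /g/= indicE rA mulr1.
by rewrite integral0_eq// => w _; rewrite /g/= indicE (negbTE rA) mulr0.
Qed.

Lemma measurable_P_int d (X : measurableType d) (P : probability X R) (h : X * TS -> R) :
  measurable_fun setT h -> (forall p, 0 <= h p) ->
  measurable_fun setT (fun r => \int[P]_w (h (w, r))%:E)%E.
Proof.
move=> mh h0; apply: (@measurable_fun_fubini_tonelli_G _ _ _ _ _ P (fun p => (h p)%:E)).
  exact/measurable_EFinP.
by move=> p; rewrite lee_fin.
Qed.

End squares.

Section second_moment.
Context {R : realType}.
Notation mu := (@lebesgue_measure R).
Notation TS := (measurableTypeR R).
Context d (Omega : measurableType d) (P : probability Omega R).
Variables (alpha s T : R) (lam : nat -> R) (phi : nat -> L2D R).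
Hypotheses (halpha : 0 < alpha < 1) (hs : 0 < s < 1) (T0 : 0 < T).
Hypothesis hA : dirichlet_spectrum lam phi.
Variables (W : R -> R -> {RV P >-> R}) (f : L2D R -> L2D R) (Cf : R) (hCf : 0 < Cf).
Hypothesis f_growth : forall v : L2D R, (L2norm (f v) <= Cf%:E * (1 + L2norm v))%E.
Variables (u : R -> Omega -> L2D R) (hu : mild_solution alpha s T lam phi W f u).

Lemma f_growth_norm (v : L2D R) : ip (f v) (f v) <= (Cf * (1 + Num.sqrt (ip v v))) ^+ 2.
Proof.
have := f_growth v; rewrite !L2normE -EFinD -EFinM lee_fin => h.
by rewrite -[leLHS]sqr_sqrtr ?ip_ge0// ler_pXn2r// nnegrE ?sqrtr_ge0// (le_trans _ h) ?sqrtr_ge0.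
Qed.

Lemma f_growth_sqr (v : L2D R) : ip (f v) (f v) <= 2 * Cf ^+ 2 * (1 + ip v v).
Proof.
apply: (le_trans (f_growth_norm v)); rewrite exprMn (mulrC 2) -(mulrA (Cf ^+ 2)); apply: ler_wpM2l; first exact: sqr_ge0.
have := sqr_ge0 (1 - Num.sqrt (ip v v)); have := sqr_sqrtr (ip_ge0 v).
move=> e h; rewrite -[in leRHS]e; move: h; rewrite sqrrB sqrrD expr1n mul1r; lra.
Qed.

(** The cutoff to [0, T] makes the function measurable on the whole product space, u being jointly
    measurable on that time interval only. *)
Definition sqnorm (p : Omega * TS) : R := \1_(`[0, T] : set TS) p.2 * ip (u p.2 p.1) (u p.2 p.1).

Lemma sqnorm_ge0 p : 0 <= sqnorm p.
Proof. by rewrite mulr_ge0 ?ip_ge0. Qed.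

Lemma sqnormE r w : 0 <= r <= T -> sqnorm (w, r) = ip (u r w) (u r w).
Proof. by move=> rT; rewrite /sqnorm/= indicE mem_set//= ?in_itv//= mul1r. Qed.

Lemma measurable_process : measurable_fun setT
  (fun q : (Omega * TS) * TS => \1_(`[0, T] : set TS) q.1.2 * u q.1.2 q.1.1 q.2).
Proof.
have [m _ _ _] := hu.
have mA : measurable ((`[0, T] : set TS) `*` [set: Omega * TS]).
  by apply: measurableX => //; exact: measurable_itv.
have := (measurable_restrictT _ mA).1 m.
set h := _ \_ _ => mh.
rewrite (_ : (fun q => _) = h \o (fun q : (Omega * TS) * TS => (q.1.2, (q.1.1, q.2)))).
  apply: measurableT_comp => //; apply: measurable_fun_pair; first exact: measurableT_comp.
  by apply: measurable_fun_pair => //; exact: measurableT_comp.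
apply/funext => q /=; rewrite /h patchE/= indicE.
rewrite in_setX in_setT andbT/=.
by case: ifP => _; rewrite ?mul1r ?mul0r.
Qed.

Lemma measurable_sqnorm : measurable_fun setT sqnorm.
Proof.
apply/measurable_EFinP.
pose h (q : (Omega * TS) * TS) := (\1_(`[0, T] : set TS) q.1.2 * u q.1.2 q.1.1 q.2) ^+ 2.
rewrite (_ : _ \o _ = fun p => \int[mu]_(x in D) (h (p, x))%:E)%E.
  apply: measurable_int_dom => [||p]; [exact: measurable_D| |exact: sqr_ge0].
  by apply: measurable_funX; exact: measurable_process.
apply/funext => p /=; rewrite /sqnorm /h indicE; case: (_ \in _) => /=.
  by rewrite mul1r ipED; apply: eq_integral => x _ /=; rewrite mul1r expr2.
by rewrite mul0r integral0_eq// => x _; rewrite mul0r expr0n.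
Qed.

Lemma measurable_process_at t : 0 <= t <= T ->
  measurable_fun setT (fun p : Omega * TS => u t p.1 p.2).
Proof.
move=> tT.
rewrite (_ : (fun p => _) = (fun q : (Omega * TS) * TS => \1_(`[0, T] : set TS) q.1.2 * u q.1.2 q.1.1 q.2) \o
   (fun p : Omega * TS => ((p.1, t : TS), p.2))).
  apply: measurableT_comp; first exact: measurable_process.
  by apply: measurable_fun_pair => //; apply: measurable_fun_pair.
by apply/funext => p /=; rewrite indicE mem_set ?mul1r//= in_itv.
Qed.

Definition norm_int (w : Omega) : \bar R := (\int[mu]_(r in `[0%R, T]) (Num.sqrt (sqnorm (w, r)))%:E)%E.

Lemma measurable_sqrt_sqnorm : measurable_fun setT (fun p => Num.sqrt (sqnorm p)).
Proof.
apply: (measurableT_comp (f := @Num.sqrt R)); last exact: measurable_sqnorm.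
by apply: continuous_measurable_fun; exact: sqrt_continuous.
Qed.

Lemma measurable_norm_int : measurable_fun setT norm_int.
Proof.
apply: (@measurable_int_dom _ _ _ `[0, T] (fun p => Num.sqrt (sqnorm p))) => [||p].
- exact: measurable_itv.
- exact: measurable_sqrt_sqnorm.
- exact: sqrtr_ge0.
Qed.

Lemma norm_int_finite : {ae P, forall w, (norm_int w < +oo)%E}.
Proof.
have [_ h _ _] := hu; apply: filterS h => w; apply: le_lt_trans.
rewrite le_eqVlt; apply/orP; left; apply/eqP; apply: eq_integral => r.
by rewrite inE/= in_itv/= => rT; rewrite L2normE sqnormE.
Qed.

Lemma measurable_sqnorm_section w : measurable_fun (setT : set TS) (fun r => sqnorm (w, r)).
Proof. by apply: measurableT_comp; [exact: measurable_sqnorm|exact: measurable_pair1]. Qed.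

Definition drift_at t (w : Omega) (I : L2D R) :=
  is_bochner_integral `[0, t] (fun r => sol_op alpha s lam phi (t - r) (f (u r w))) I.

Lemma drift_truncated t w I (M : R) : 0 <= t <= T -> drift_at t w I -> (norm_int w <= M%:E)%E ->
  ip I I <= (Cf * (T + M)) ^+ 2.
Proof.
move=> /andP[t0 tT] hI hM.
have ms : measurable_fun (setT : set TS) (fun r => Num.sqrt (sqnorm (w, r))).
  by apply: (measurableT_comp (f := fun p => Num.sqrt (sqnorm p))); [exact: measurable_sqrt_sqnorm|exact: measurable_pair1].
have mK : measurable_fun (setT : set TS) (fun r => Cf * (1 + Num.sqrt (sqnorm (w, r)))).
  by apply: measurable_funM => //; exact: measurable_funD.
apply: (drift_minkowski halpha hA (v := fun r => f (u r w)) hI (K := fun r => Cf * (1 + Num.sqrt (sqnorm (w, r))))).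
- exact: measurable_funTS.
- by move=> r; rewrite mulr_ge0 ?(ltW hCf)// addr_ge0 ?sqrtr_ge0.
- move=> r /andP[r0 rt]; rewrite sqnormE ?r0 ?(le_trans rt)//; exact: f_growth_norm.
- apply: (@le_trans _ _ (\int[mu]_(r in `[0%R, T]) (Cf * (1 + Num.sqrt (sqnorm (w, r))))%:E)%E).
    apply: ge0_subset_integral => //.
    + by apply/measurable_EFinP; exact: measurable_funTS.
    + by move=> r _; rewrite lee_fin mulr_ge0 ?(ltW hCf)// addr_ge0 ?sqrtr_ge0.
    + by move=> r /=; rewrite !in_itv/= => /andP[-> /le_trans->].
  under eq_integral do rewrite EFinM EFinD.
  rewrite ge0_integralZl//; last 3 first.
  + by apply: emeasurable_funD => //; apply/measurable_EFinP; exact: measurable_funTS.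
  + by move=> r _; rewrite -EFinD lee_fin addr_ge0 ?sqrtr_ge0.
  + by rewrite lee_fin ltW.
  rewrite ge0_integralD//; last first.
    by apply/measurable_EFinP; exact: measurable_funTS.
  have i1 : (\int[mu]_(_ in `[0%R, T]) 1 = T%:E)%E.
    rewrite (@integral_cst _ _ _ mu _ (measurable_itv _) 1%E) mul1e.
    by have := @lebesgue_measure_itv R `[0%R, T]; rewrite /= lte_fin T0 => ->; rewrite -EFinB subr0.
  by rewrite i1 EFinM EFinD lee_wpmul2l ?lee_fin ?(ltW hCf)// leeD2l.
Qed.

(** Square integrability of the path of u is not known at this stage, so the estimate is stated in
    the extended reals, where the infinite case is trivial. *)
Lemma drift_diff_lee t' t w I' I : 0 <= t' -> t' < t -> t <= T -> drift_at t' w I' -> drift_at t w I ->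
  ((ip (I - I') (I - I'))%:E <= (2 * (t - t'))%:E *
     \int[mu]_(r in `[0%R, t]) (2 * Cf ^+ 2 * (1 + sqnorm (w, r)))%:E)%E.
Proof.
move=> t'0 t't tT hI' hI.
have t0 : 0 < 2 * (t - t') by rewrite mulr_gt0// subr_gt0.
have Q0 : (0 <= \int[mu]_(r in `[0%R, t]) (2 * Cf ^+ 2 * (1 + sqnorm (w, r)))%:E)%E.
  apply: integral_ge0 => r _; rewrite lee_fin; apply: mulr_ge0.
    by apply: mulr_ge0 => //; exact: sqr_ge0.
  by apply: addr_ge0 => //; exact: sqnorm_ge0.
have [fin|nfin] := boolP ((\int[mu]_(r in `[0%R, t]) (2 * Cf ^+ 2 * (1 + sqnorm (w, r)))%:E)%E \is a fin_num); last first.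
  have -> : (\int[mu]_(r in `[0%R, t]) (2 * Cf ^+ 2 * (1 + sqnorm (w, r)))%:E = +oo)%E.
    by apply/eqP; move: nfin; rewrite ge0_fin_numE// -leNgt leye_eq.
  by rewrite gt0_muley ?lte_fin// leey.
rewrite -(fineK fin) -EFinM lee_fin.
apply: (drift_diff_le halpha hA (v := fun r => f (u r w)) t'0 t't hI' hI (Q := fun r => 2 * Cf ^+ 2 * (1 + sqnorm (w, r)))).
- apply: measurable_funTS; apply: measurable_funM => //; apply: measurable_funD => //.
  exact: measurable_sqnorm_section.
- move=> r /andP[r0 rt]; rewrite sqnormE ?r0 ?(le_trans rt)//; exact: f_growth_sqr.
- by rewrite fineK.
Qed.

End second_moment.

(** * Truncated and full second moments of the solution *)

Section second_moment.
Context {R : realType}.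
Notation mu := (@lebesgue_measure R).
Notation TS := (measurableTypeR R).
Context d (Omega : measurableType d) (P : probability Omega R).
Variables (alpha s T : R) (lam : nat -> R) (phi : nat -> L2D R).
Hypotheses (halpha : 0 < alpha < 1) (hs : 0 < s < 1) (T0 : 0 < T).
Hypothesis hA : dirichlet_spectrum lam phi.
Variables (W : R -> R -> {RV P >-> R}) (f : L2D R -> L2D R) (Cf : R) (hCf : 0 < Cf).
Hypothesis f_growth : forall v : L2D R, (L2norm (f v) <= Cf%:E * (1 + L2norm v))%E.
Variables (u : R -> Omega -> L2D R) (hu : mild_solution alpha s T lam phi W f u).
Variables (Cc : R) (Cc0 : 0 < Cc).
Hypothesis hconv : forall t conv, 0 <= t -> t <= T -> is_stochastic_conv lam phi W alpha s t conv ->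
  (\int[P]_w (ip (conv w) (conv w))%:E <= Cc%:E)%E.
Notation sq := (sqnorm T u).
Notation drift t w I := (drift_at alpha s lam phi f u t w I).

(* Only the pathwise integrability of the norm of u is known; on [trunc M] the drift is
   bounded, which makes the second moments finite, as Gronwall requires. *)
Definition trunc (M : R) : set Omega := [set w | (norm_int T u w <= M%:E)%E].

Lemma measurable_trunc M : measurable (trunc M).
Proof.
rewrite -[trunc M]setTI; apply: emeasurable_fun_infty_c => //.
exact: (measurable_norm_int hu).
Qed.

Definition chi (M : R) (w : Omega) : R := \1_(trunc M) w.

Lemma measurable_trunc_sq M : measurable_fun setT (fun p : Omega * TS => chi M p.1 * sq p).
Proof.
apply: measurable_funM; last exact: (measurable_sqnorm hu).
by apply: measurableT_comp => //; apply: measurable_indic; exact: measurable_trunc.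
Qed.

Lemma trunc_sq_ge0 M p : 0 <= chi M p.1 * sq p.
Proof. by apply: mulr_ge0; [rewrite /chi indicE; case: (_ \in _)|exact: sqnorm_ge0]. Qed.

Lemma measurable_trunc_sq_at M t : measurable_fun setT (fun w => chi M w * sq (w, t)).
Proof.
exact: (measurableT_comp (measurable_trunc_sq M) (measurable_pair2 t)).
Qed.

Lemma measurable_sqr_conv conv t : is_stochastic_conv lam phi W alpha s t conv ->
  measurable_fun setT (fun w => ip (conv w) (conv w)).
Proof. by move=> [m _]; exact: measurable_ip_sqr. Qed.

Lemma mild_split t : 0 < t -> t <= T -> exists dr cv : Omega -> L2D R,
  [/\ {ae P, forall w, drift t w (dr w)}, is_stochastic_conv lam phi W alpha s t cv &
   {ae P, forall w, {ae muD, forall x, u t w x = dr w x + cv w x}}].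
Proof.
move=> t0 tT; have [_ _ _ /(_ t t0 tT) [dr [cv [h1 h2 h3 h4]]]] := hu.
by exists dr, cv; split.
Qed.

Definition trunc_moment M t : \bar R := (\int[P]_w (chi M w * sq (w, t))%:E)%E.

Lemma trunc_moment0 M : trunc_moment M 0 = 0%E.
Proof.
have [_ _ h _] := hu; rewrite /trunc_moment.
rewrite (ae_eq_integral (cst 0%E)) ?integral0//.
  by apply/measurable_EFinP; exact: measurable_trunc_sq_at.
apply: filterS h => w hw _; rewrite sqnormE ?lexx ?(ltW T0)//.
by rewrite (@ip_ae_eq _ _ (0 : L2D R) hw) ip0l mulr0.
Qed.

Lemma moment_bound_ge0 M : 0 <= 2 * (Cf * (T + M)) ^+ 2 + 2 * Cc.
Proof. by apply: addr_ge0; apply: mulr_ge0 => //; [exact: sqr_ge0|exact: ltW]. Qed.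

(** A crude bound growing with M; it provides the finiteness that starts [gronwall], whose
    conclusion no longer depends on it. *)
Lemma trunc_moment_le M t : 0 <= t <= T ->
  (trunc_moment M t <= (2 * (Cf * (T + M)) ^+ 2 + 2 * Cc)%:E)%E.
Proof.
move=> /andP[t0 tT].
have [->|tn0] := eqVneq t 0.
  by rewrite trunc_moment0 lee_fin moment_bound_ge0.
have tp : 0 < t by rewrite lt_def tn0.
have [dr [cv [h1 h2 h3]]] := mild_split tp tT.
have mc := measurable_sqr_conv h2.
apply: (@le_trans _ _ (\int[P]_w ((2 * (Cf * (T + M)) ^+ 2)%:E + 2%:E * (ip (cv w) (cv w))%:E))%E).
  apply: ae_ge0_le_integral => //.
  - by move=> w _; rewrite lee_fin (trunc_sq_ge0 M (w, t)).
  - by apply/measurable_EFinP; exact: measurable_trunc_sq_at.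
  - by move=> w _; rewrite -EFinM -EFinD lee_fin addr_ge0// mulr_ge0 ?sqr_ge0 ?ip_ge0.
  - by apply: emeasurable_funD => //; apply: measurable_funeM; apply/measurable_EFinP.
  - apply: filterS2 h1 h3 => w b1 b3 _; rewrite -EFinM -EFinD lee_fin /chi indicE.
    have [wM|wM] := boolP (w \in trunc M); last first.
      by rewrite mul0r addr_ge0// mulr_ge0 ?sqr_ge0 ?ip_ge0.
    rewrite mul1r sqnormE ?t0// (@ip_ae_eq _ _ (dr w + cv w) b3).
    apply: (le_trans (ip_add_le _ _)); rewrite lerD2r ler_wpM2l//.
    apply: (drift_truncated halpha T0 hA hCf f_growth hu _ b1); first by rewrite t0.
    by move: wM; rewrite inE.
rewrite ge0_integralD//; last 3 first.
- by move=> w _; rewrite lee_fin mulr_ge0 ?sqr_ge0.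
- by move=> w _; rewrite -EFinM lee_fin mulr_ge0 ?ip_ge0.
- by apply: measurable_funeM; apply/measurable_EFinP.
rewrite (@integral_cst _ _ _ P _ measurableT (2 * (Cf * (T + M)) ^+ 2)%:E) [X in (_ * X)%E]probability_setT mule1.
rewrite ge0_integralZl//; last 2 first.
- by apply/measurable_EFinP.
- by move=> w _; rewrite lee_fin ip_ge0.
have hc := hconv t0 tT h2.
by rewrite [leRHS]EFinD leeD2l// [leRHS]EFinM; exact: lee_wpmul2l.
Qed.

Variables (B : R) (B0 : 0 < B) (hB : B = 8 * T * Cf ^+ 2).

(** The truncation set does not depend on time, so on it the factor [chi] can be reinserted under
    the time integral. The constant B = 8 T Cf^2 collects a 2 from splitting u into drift and
    convolution, 2 t <= 2 T from [drift_diff_lee] started at time 0 with zero drift, and 2 Cf^2 from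
    the growth of f. *)
Lemma trunc_moment_gronwall M t : 0 <= t <= T ->
  (trunc_moment M t <= (2 * Cc + B * T)%:E + B%:E * \int[mu]_(r in `[0%R, t]) trunc_moment M r)%E.
Proof.
move=> /andP[t0 tT].
have m0 r : (0 <= trunc_moment M r)%E.
  by apply: integral_ge0 => w _; rewrite lee_fin (trunc_sq_ge0 M (w, r)).
have [->|tn0] := eqVneq t 0.
  rewrite trunc_moment0; apply: adde_ge0.
    by rewrite lee_fin addr_ge0// mulr_ge0// ltW.
  by apply: mule_ge0; [rewrite lee_fin ltW|exact: integral_ge0].
have tp : 0 < t by rewrite lt_def tn0.
have [dr [cv [h1 h2 h3]]] := mild_split tp tT.
have mc := measurable_sqr_conv h2.
pose h (p : Omega * TS) := B * (1 + chi M p.1 * sq p).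
have h0 p : 0 <= h p by rewrite mulr_ge0 ?(ltW B0)// addr_ge0 ?trunc_sq_ge0.
have mh : measurable_fun setT h.
  by apply: measurable_funM => //; apply: measurable_funD => //; exact: measurable_trunc_sq.
have mI : measurable (`[0, t] : set TS) by exact: measurable_itv.
have mih := measurable_int_dom mI mh h0.
pose F2 w : \bar R := ((\int[mu]_(r in `[0%R, t]) (h (w, r))%:E)%E + (2%:E * (ip (cv w) (cv w))%:E)%E)%E.
apply: (@le_trans _ _ (\int[P]_w F2 w)%E).
  apply: ae_ge0_le_integral => //.
  - by move=> w _; rewrite lee_fin (trunc_sq_ge0 M (w, t)).
  - by apply/measurable_EFinP; exact: measurable_trunc_sq_at.
  - move=> w _; apply: adde_ge0; last by rewrite -EFinM lee_fin mulr_ge0 ?ip_ge0.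
    by apply: integral_ge0 => r _; rewrite lee_fin.
  - by apply: emeasurable_funD => //; apply: measurable_funeM; apply/measurable_EFinP.
  - apply: filterS2 h1 h3 => w b1 b3 _.
    have Ih : (0 <= \int[mu]_(r in `[0%R, t]) (h (w, r))%:E)%E by apply: integral_ge0 => r _; rewrite lee_fin.
    rewrite {1}/chi indicE; have [wM|wM] := boolP (w \in trunc M); last first.
      by rewrite mul0r adde_ge0// -EFinM lee_fin mulr_ge0 ?ip_ge0.
    rewrite mul1r sqnormE ?t0// (@ip_ae_eq _ _ (dr w + cv w) b3).
    apply: (@le_trans _ _ (2 * ip (dr w) (dr w) + 2 * ip (cv w) (cv w))%:E); first by rewrite lee_fin ip_add_le.
    rewrite EFinD -[X in (_ + X <= _)%E]EFinM; apply: leeD => //.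
    have hb : drift 0 w 0 by exact: bochner_point.
    have := drift_diff_lee halpha hA f_growth hu (lexx 0) tp tT hb b1.
    rewrite !subr0 => /(lee_wpmul2l (_ : (0 <= 2%:E)%E)) h4; rewrite EFinM; apply: (le_trans (h4 _)) => //.
    rewrite muleA -EFinM -ge0_integralZl//; last 3 first.
    + apply/measurable_EFinP; apply: measurable_funTS; apply: measurable_funM => //.
      by apply: measurable_funD => //; exact: (measurable_sqnorm_section hu).
    + move=> r _; rewrite lee_fin; apply: mulr_ge0; first by apply: mulr_ge0 => //; exact: sqr_ge0.
      by apply: addr_ge0 => //; exact: sqnorm_ge0.
    + by rewrite lee_fin !mulr_ge0.
    apply: ge0_le_integral => //.
    + move=> r _; rewrite -EFinM lee_fin; apply: mulr_ge0; first by rewrite !mulr_ge0.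
      apply: mulr_ge0; first by apply: mulr_ge0 => //; exact: sqr_ge0.
      by apply: addr_ge0 => //; exact: sqnorm_ge0.
    + apply: measurable_funeM; apply/measurable_EFinP; apply: measurable_funTS; apply: measurable_funM => //.
      by apply: measurable_funD => //; exact: (measurable_sqnorm_section hu).
    + by apply/measurable_EFinP; apply: measurable_funTS; apply: (measurableT_comp mh); exact: measurable_pair1.
    + move=> r _; rewrite -EFinM lee_fin /h/= /chi indicE wM mul1r mulrA ler_wpM2r//.
        by apply: addr_ge0 => //; exact: sqnorm_ge0.
      rewrite hB (_ : 2 * (2 * t) * (2 * Cf ^+ 2) = 8 * t * Cf ^+ 2); last by ring.
      by rewrite ler_wpM2r ?sqr_ge0// ler_wpM2l.
rewrite ge0_integralD//; last 3 first.
- by move=> w _; apply: integral_ge0 => r _; rewrite lee_fin.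
- by move=> w _; rewrite -EFinM lee_fin mulr_ge0 ?ip_ge0.
- by apply: measurable_funeM; apply/measurable_EFinP.
rewrite (tonelli_dom P mI mh h0).
rewrite ge0_integralZl//; last 2 first.
- by apply/measurable_EFinP.
- by move=> w _; rewrite lee_fin ip_ge0.
have mm : measurable_fun setT (trunc_moment M).
  exact: (@measurable_P_int _ _ _ P (fun p : Omega * TS => chi M p.1 * sq p) (measurable_trunc_sq M) (trunc_sq_ge0 M)).
have hE r : (\int[P]_w (h (w, r))%:E = B%:E * (1 + trunc_moment M r))%E.
  rewrite /h; under eq_integral do rewrite EFinM EFinD.
  rewrite ge0_integralZl//; last 3 first.
  - by apply: emeasurable_funD => //; apply/measurable_EFinP; exact: measurable_trunc_sq_at.
  - by move=> w _; rewrite -EFinD lee_fin addr_ge0 ?trunc_sq_ge0.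
  - by rewrite lee_fin ltW.
  rewrite ge0_integralD//; last 2 first.
  - by move=> w _; rewrite lee_fin (trunc_sq_ge0 M (w, r)).
  - by apply/measurable_EFinP; exact: measurable_trunc_sq_at.
  by rewrite (@integral_cst _ _ _ P _ measurableT 1%E) [X in (_ * (_ * X + _))%E]probability_setT mule1.
rewrite (eq_integral (fun r => B%:E * (1 + trunc_moment M r))%E); last by move=> r _.
rewrite ge0_integralZl//; last 3 first.
- by apply: emeasurable_funD => //; exact: measurable_funTS.
- by move=> r _; rewrite adde_ge0.
- by rewrite lee_fin ltW.
rewrite ge0_integralD//; last exact: measurable_funTS.
have -> : (\int[mu]_(r in `[0%R, t]) 1 = t%:E)%E.
  rewrite (@integral_cst _ _ _ mu _ mI 1%E) mul1e.
  by have := @lebesgue_measure_itv R `[0%R, t]; rewrite /= lte_fin tp => ->; rewrite -EFinB subr0.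
rewrite ge0_muleDr ?lee_fin//; last by apply: integral_ge0.
have hc := hconv t0 tT h2.
rewrite addeAC; apply: leeD => //; rewrite [leRHS]EFinD addeC; apply: leeD.
  by rewrite [leRHS]EFinM; exact: lee_wpmul2l.
by rewrite -EFinM lee_fin ler_wpM2l ?(ltW B0).
Qed.

Lemma trunc_moment_bound M t : 0 <= t <= T ->
  (trunc_moment M t <= (2 * (2 * Cc + B * T) * expR (2 * B * T))%:E)%E.
Proof.
move=> tT; pose g r := fine (trunc_moment M r).
have m0 r : (0 <= trunc_moment M r)%E.
  by apply: integral_ge0 => w _; rewrite lee_fin (trunc_sq_ge0 M (w, r)).
have gE r : 0 <= r <= T -> trunc_moment M r = (g r)%:E.
  move=> rT; rewrite /g fineK// ge0_fin_numE//; apply: le_lt_trans (trunc_moment_le M rT) _.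
  exact: ltry.
have mm : measurable_fun setT (trunc_moment M).
  exact: (@measurable_P_int _ _ _ P (fun p : Omega * TS => chi M p.1 * sq p) (measurable_trunc_sq M) (trunc_sq_ge0 M)).
have A0 : 0 <= 2 * Cc + B * T by apply: addr_ge0; apply: mulr_ge0 => //; exact: ltW.
have mg : measurable_fun (`[0, T] : set TS) g.
  by apply: measurable_funTS; apply: measurableT_comp.
have gb r : 0 <= r <= T -> 0 <= g r <= 2 * (Cf * (T + M)) ^+ 2 + 2 * Cc.
  by move=> rT; rewrite -!lee_fin -gE// m0 trunc_moment_le.
rewrite gE// lee_fin.
apply: (le_trans (gronwall A0 B0 mg gb _ tT)); last first.
  rewrite ler_wpM2l ?mulr_ge0// ler_expR ler_wpM2l ?mulr_ge0 ?(ltW B0)//.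
  by case/andP: tT.
move=> r rT; rewrite -lee_fin -gE//; apply: (le_trans (trunc_moment_gronwall M rT)).
have /andP[r0 rT'] := rT.
rewrite [leRHS]EFinD leeD2l// [leRHS]EFinM lee_wpmul2l ?lee_fin ?(ltW B0)// /Rintegral.
have E : (\int[mu]_(z in `[0%R, r]) trunc_moment M z = \int[mu]_(z in `[0%R, r]) (g z)%:E)%E.
  by apply: eq_integral => z; rewrite inE/= in_itv/= => /andP[z0 zr]; rewrite gE// z0 (le_trans zr).
rewrite -E fineK// ge0_fin_numE; last by apply: integral_ge0.
rewrite E; apply: (@le_lt_trans _ _ (\int[mu]_(z in `[0%R, r]) (2 * (Cf * (T + M)) ^+ 2 + 2 * Cc)%:E)%E).
  apply: ge0_le_integral => //.
  - move=> z; rewrite /= in_itv/= => /andP[z0 zr]; rewrite lee_fin.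
    by have /andP[] : 0 <= g z <= 2 * (Cf * (T + M)) ^+ 2 + 2 * Cc by rewrite gb// z0 (le_trans zr).
  - apply/measurable_EFinP; apply: measurable_funS mg => //.
    by move=> z /=; rewrite !in_itv/= => /andP[-> /le_trans->].
  - move=> z; rewrite /= in_itv/= => /andP[z0 zr]; rewrite lee_fin.
    by have /andP[] : 0 <= g z <= 2 * (Cf * (T + M)) ^+ 2 + 2 * Cc by rewrite gb// z0 (le_trans zr).
rewrite (@integral_cst _ _ _ mu _ (measurable_itv _)).
by rewrite lte_mul_pinfty ?lee_fin ?moment_bound_ge0//; exact: (@itv_finite _ _ 0 r).
Qed.

(** The Gronwall bound is uniform in M, so the truncation is removed by Fatou's lemma. *)
Lemma second_moment : exists2 K : R, 0 <= K &
  (\int[P]_w \int[mu]_(r in `[0%R, T]) (sq (w, r))%:E <= K%:E)%E.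
Proof.
pose G := 2 * (2 * Cc + B * T) * expR (2 * B * T).
have A0 : 0 <= 2 * Cc + B * T by apply: addr_ge0; apply: mulr_ge0 => //; exact: ltW.
have G0 : 0 <= G by rewrite mulr_ge0 ?expR_ge0// mulr_ge0.
exists (G * T); first by rewrite mulr_ge0// ltW.
have mI : measurable (`[0, T] : set TS) by exact: measurable_itv.
pose h (M : nat) w := (\int[mu]_(r in `[0%R, T]) (chi M%:R w * sq (w, r))%:E)%E.
have h0 M w : (0 <= h M w)%E by apply: integral_ge0 => r _; rewrite lee_fin (trunc_sq_ge0 M%:R (w, r)).
have mh M : measurable_fun setT (h M).
  exact: (@measurable_int_dom _ _ _ _ (fun p : Omega * TS => chi M%:R p.1 * sq p) mI (measurable_trunc_sq M%:R) (trunc_sq_ge0 M%:R)).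
have hGB M : (\int[P]_w h M w <= (G * T)%:E)%E.
  rewrite /h (tonelli_dom P mI (measurable_trunc_sq M%:R) (trunc_sq_ge0 M%:R)).
  apply: (@le_trans _ _ (\int[mu]_(r in `[0%R, T]) G%:E)%E).
    apply: ge0_le_integral => //.
    - by move=> r _; apply: integral_ge0 => w _; rewrite lee_fin (trunc_sq_ge0 M%:R (w, r)).
    - by apply: measurable_funTS; exact: (measurable_P_int P (measurable_trunc_sq M%:R) (trunc_sq_ge0 M%:R)).
    - by move=> r; rewrite /= in_itv/= => rT; exact: trunc_moment_bound.
  rewrite (@integral_cst _ _ _ mu _ mI G%:E) [leRHS]EFinM lee_wpmul2l ?lee_fin//.
  by have := @lebesgue_measure_itv R `[0%R, T]; rewrite /= lte_fin T0 => ->; rewrite -EFinB subr0.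
have := fatou_einf_le (nu := P) measurableT mh (fun M w _ => h0 M w) hGB.
apply: le_trans; rewrite le_eqVlt; apply/orP; left; apply/eqP.
apply: ae_eq_integral => //.
- apply: (measurable_int_dom mI (measurable_sqnorm hu)); exact: sqnorm_ge0.
- exact: (measurable_limn_einf (f_ := h) measurableT mh).
- apply: filterS (norm_int_finite hu) => w wfin _.
  have n0 : (0 <= norm_int T u w)%E by apply: integral_ge0 => r _; rewrite lee_fin sqrtr_ge0.
  (* A path whose norm has a finite time integral lies in every truncation set of large level, so
     the sequence is eventually constant. *)
  have cv : h M w @[M --> \oo] --> (\int[mu]_(r in `[0%R, T]) (sq (w, r))%:E)%E.
    apply: cvg_near_cst; exists (Num.truncn (fine (norm_int T u w))).+1 => // M /= MM.
    apply: eq_integral => r _; rewrite /chi indicE mem_set ?mul1r//=.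
    have nf : norm_int T u w \is a fin_num by rewrite ge0_fin_numE.
    rewrite /trunc/= -(fineK nf) lee_fin.
    by rewrite (le_trans (ltW (truncnS_gt _)))// ler_nat.
  rewrite is_cvg_limn_einfE; first by apply/esym/cvg_lim.
  by apply/cvg_ex; eexists; exact: cv.
Qed.

End second_moment.

(** * Increments of the mild solution *)

Section increments.
Context {R : realType}.
Notation mu := (@lebesgue_measure R).
Notation TS := (measurableTypeR R).
Context d (Omega : measurableType d) (P : probability Omega R).
Variables (alpha s T : R) (lam : nat -> R) (phi : nat -> L2D R).
Hypotheses (halpha : 0 < alpha < 1) (T0 : 0 < T).
Hypothesis hA : dirichlet_spectrum lam phi.
Variables (W : R -> R -> {RV P >-> R}) (f : L2D R -> L2D R) (Cf : R).
Hypothesis f_growth : forall v : L2D R, (L2norm (f v) <= Cf%:E * (1 + L2norm v))%E.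
Variables (u : R -> Omega -> L2D R) (hu : mild_solution alpha s T lam phi W f u).
Variable K : R.
Hypothesis hK : (\int[P]_w \int[mu]_(r in `[0%R, T]) (sqnorm T u (w, r))%:E <= K%:E)%E.
Variables (ga C1 C2 : R) (C10 : 0 < C1) (C20 : 0 < C2).
Hypothesis hC1 : forall (t' t : R) conv' conv, 0 <= t' -> t' <= t -> t <= T ->
    is_stochastic_conv lam phi W alpha s t' conv' -> is_stochastic_conv lam phi W alpha s t conv ->
    (\int[P]_w (ip (conv w - conv' w) (conv w - conv' w))%:E <= (C1 * (t - t') `^ ga ^+ 2)%:E)%E.
Hypothesis hC2 : forall t conv, 0 <= t -> t <= T -> is_stochastic_conv lam phi W alpha s t conv ->
    (\int[P]_w (ip (conv w) (conv w))%:E <= (C2 * t `^ ga ^+ 2)%:E)%E.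
Notation drift t w I := (drift_at alpha s lam phi f u t w I).

(** The mild equation is available at positive times only. For t' = 0 the solution vanishes, so the
    earlier drift is 0 and [cv] is the convolution at t alone, bounded through [C2]; this is why the
    two constants are added. *)
Lemma increment_split t' t : 0 <= t' -> t' < t -> t <= T -> exists dr' dr cv : Omega -> L2D R,
  [/\ {ae P, forall w, drift t' w (dr' w)}, {ae P, forall w, drift t w (dr w)},
   {ae P, forall w, {ae muD, forall x, u t w x - u t' w x = dr w x - dr' w x + cv w x}},
   measurable_fun setT (fun w => ip (cv w) (cv w)) &
   (\int[P]_w (ip (cv w) (cv w))%:E <= ((C1 + C2) * (t - t') `^ ga ^+ 2)%:E)%E].
Proof.
move=> t'0 t't tT; have t0 := le_lt_trans t'0 t't.
have [dr [cv [h1 h2 h3]]] := mild_split hu t0 tT.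
have p0 : 0 <= (t - t') `^ ga ^+ 2 by exact: sqr_ge0.
have [t'E|t'n] := eqVneq t' 0.
  exists (fun=> 0), dr, cv; split.
  - by apply: aeW => w; rewrite t'E; exact: bochner_point.
  - exact: h1.
  - have [_ _ h0 _] := hu; apply: filterS2 h0 h3 => w h0; apply: filterS2 h0 => x x0 ->.
    by rewrite t'E x0 subr0 subr0.
  - exact: measurable_sqr_conv h2.
  - apply: le_trans (hC2 (ltW t0) tT h2) _; rewrite t'E subr0 in p0 *.
    by rewrite lee_fin ler_wpM2r// lerDr ltW.
have t'p : 0 < t' by rewrite lt_def t'n.
have [dr' [cv' [h1' h2' h3']]] := mild_split hu t'p (le_trans (ltW t't) tT).
exists dr', dr, (fun w => cv w - cv' w); split.
- exact: h1'.
- exact: h1.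
- apply: filterS2 h3 h3' => w a b; apply: filterS2 a b => x -> ->.
  by rewrite /= opprD addrACA.
- by apply: measurable_ip_sqr; apply: measurable_funB; [case: h2|case: h2'].
- apply: le_trans (hC1 t'0 (ltW t't) tT h2' h2) _.
  by rewrite lee_fin ler_wpM2r// lerDl ltW.
Qed.

Lemma increment_moment t' t : 0 <= t' -> t' < t -> t <= T ->
  (\int[P]_w (ip (u t w - u t' w) (u t w - u t' w))%:E <=
    (4 * (t - t') * (2 * Cf ^+ 2 * (T + K)) + 2 * ((C1 + C2) * (t - t') `^ ga ^+ 2))%:E)%E.
Proof.
move=> t'0 t't tT; have t0 := le_lt_trans t'0 t't.
have [dr' [dr [cv [h1 h2 h3 mc hc]]]] := increment_split t'0 t't tT.
have mI : measurable (`[0, T] : set TS) by exact: measurable_itv.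
pose q (p : Omega * TS) := 2 * Cf ^+ 2 * (1 + sqnorm T u p).
have q0 p : 0 <= q p.
  by apply: mulr_ge0; [apply: mulr_ge0 => //; exact: sqr_ge0|apply: addr_ge0 => //; exact: sqnorm_ge0].
have mq : measurable_fun setT q.
  by apply: measurable_funM => //; apply: measurable_funD => //; exact: (measurable_sqnorm hu).
have tt0 : 0 <= 4 * (t - t') by rewrite mulr_ge0// subr_ge0 ltW.
pose F1 w := ((4 * (t - t'))%:E * \int[mu]_(r in `[0%R, T]) (q (w, r))%:E)%E.
pose F2 w := (2%:E * (ip (cv w) (cv w))%:E)%E.
have mq' := measurable_int_dom mI mq q0.
have Iq w : (0 <= \int[mu]_(r in `[0%R, T]) (q (w, r))%:E)%E by apply: integral_ge0 => r _; rewrite lee_fin.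
have F10 w : (0 <= F1 w)%E by apply: mule_ge0 => //; rewrite lee_fin.
have F20 w : (0 <= F2 w)%E by rewrite /F2 -EFinM lee_fin mulr_ge0 ?ip_ge0.
have mF1 : measurable_fun setT F1 by exact: measurable_funeM.
have mF2 : measurable_fun setT F2 by apply: measurable_funeM; apply/measurable_EFinP.
apply: (@le_trans _ _ (\int[P]_w (F1 w + F2 w))%E).
  apply: ae_ge0_le_integral => //.
  - by move=> w _; rewrite lee_fin ip_ge0.
  - apply/measurable_EFinP; apply: measurable_ip_sqr; apply: measurable_funB.
      by apply: (measurable_process_at hu); rewrite (ltW t0).
    by apply: (measurable_process_at hu); rewrite t'0 (le_trans (ltW t't)).
  - by move=> w _; exact: adde_ge0.
  - exact: emeasurable_funD.
  - apply: filterS3 h1 h2 h3 => w b1 b2 b3 _.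
    rewrite (@ip_ae_eq _ (u t w - u t' w) ((dr w - dr' w) + cv w) b3).
    apply: (@le_trans _ _ (2 * ip (dr w - dr' w) (dr w - dr' w) + 2 * ip (cv w) (cv w))%:E); first by rewrite lee_fin ip_add_le.
    rewrite EFinD; apply: leeD; last by rewrite /F2 EFinM.
    have h4 := drift_diff_lee halpha hA f_growth hu t'0 t't tT b1 b2.
    rewrite EFinM; apply: (le_trans (lee_wpmul2l _ h4)); first by rewrite lee_fin.
    rewrite muleA -EFinM /F1 (_ : 2 * (2 * (t - t')) = 4 * (t - t')); last by ring.
    apply: lee_wpmul2l; first by rewrite lee_fin.
    apply: ge0_subset_integral => //.
    + apply/measurable_EFinP; apply: measurable_funTS; apply: (measurableT_comp mq); exact: measurable_pair1.
    + by move=> r _; rewrite lee_fin (q0 (w, r)).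
    + by move=> r /=; rewrite !in_itv/= => /andP[-> /le_trans->].
rewrite ge0_integralD//.
rewrite [leRHS]EFinD; apply: leeD; last first.
  rewrite /F2 ge0_integralZl//; last 2 first.
  - by apply/measurable_EFinP.
  - by move=> w _; rewrite lee_fin ip_ge0.
  by rewrite [leRHS]EFinM; exact: lee_wpmul2l.
rewrite /F1 ge0_integralZl//.
rewrite [leRHS]EFinM; apply: lee_wpmul2l; first by rewrite lee_fin.
have ms := measurable_int_dom mI (measurable_sqnorm hu) (@sqnorm_ge0 _ _ _ _ _).
have I0 w : (0 <= \int[mu]_(r in `[0%R, T]) (sqnorm T u (w, r))%:E)%E.
  by apply: integral_ge0 => r _; rewrite lee_fin sqnorm_ge0.
have qE w : (\int[mu]_(r in `[0%R, T]) (q (w, r))%:E =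
    (2 * Cf ^+ 2)%:E * (T%:E + \int[mu]_(r in `[0%R, T]) (sqnorm T u (w, r))%:E))%E.
  rewrite /q; under eq_integral do rewrite EFinM EFinD.
  have ms' : measurable_fun (`[0, T] : set TS) (fun r => (sqnorm T u (w, r))%:E).
    by apply/measurable_EFinP; apply: measurable_funTS; exact: (measurable_sqnorm_section hu).
  rewrite ge0_integralZl//; last 3 first.
  - exact: emeasurable_funD.
  - by move=> r _; rewrite -EFinD lee_fin addr_ge0 ?sqnorm_ge0.
  - by rewrite lee_fin mulr_ge0 ?sqr_ge0.
  rewrite ge0_integralD//; last by move=> r _; rewrite lee_fin sqnorm_ge0.
  rewrite (@integral_cst _ _ _ mu _ mI 1%E) mul1e.
  by have := @lebesgue_measure_itv R `[0%R, T]; rewrite /= lte_fin T0 => ->; rewrite -EFinB subr0.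
rewrite (eq_integral _ _ (fun w _ => qE w)).
rewrite ge0_integralZl//; last 3 first.
- exact: emeasurable_funD.
- by move=> w _; apply: adde_ge0 => //; rewrite lee_fin ltW.
- by rewrite lee_fin mulr_ge0 ?sqr_ge0.
rewrite [leRHS]EFinM; apply: lee_wpmul2l; first by rewrite lee_fin mulr_ge0 ?sqr_ge0.
rewrite ge0_integralD//; last by move=> w _; rewrite lee_fin ltW.
rewrite (@integral_cst _ _ _ P _ measurableT T%:E) [X in (_ * X + _)%E]probability_setT mule1.
by rewrite EFinD leeD2l.
Qed.

End increments.

Theorem theorem2p5 (R : realType) (d : measure_display)
    (Omega : measurableType d) (P : probability Omega R)
    (alpha s H1 H2 T : R)
    (halpha : 0 < alpha < 1) (hs : 0 < s < 1)
    (hH1 : 0 < H1 <= 2^-1) (hH2 : 0 < H2 <= 2^-1) (hT : 0 < T)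
    (lam : nat -> R) (phi : nat -> L2D R) (hA : dirichlet_spectrum lam phi)
    (F : R -> set (set Omega)) (hF : is_filtration T F)
    (W : R -> R -> {RV P >-> R})
    (hW : is_fractional_brownian_sheet H1 H2 T F W)
    (f : L2D R -> L2D R) (Cf : R) (hCf : 0 < Cf)
    (f_growth : forall v : L2D R,
      (L2norm (f v) <= Cf%:E * (1 + L2norm v))%E)
    (f_lipschitz : forall v w : L2D R,
      (L2norm (f v - f w)%R <= Cf%:E * L2norm (v - w)%R)%E)
    (u : R -> Omega -> L2D R)
    (hu : mild_solution alpha s T lam phi W f u)
    (hcond : 0 < H2 + alpha * (H1 - 1) / (2 * s))
    (gamma : R)
    (hgamma : 0 < gamma < H2 + alpha * (H1 - 1) / (2 * s)) :
  exists C : R, forall tau t : R, 0 < tau -> tau <= t -> t <= T ->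
    (\int[P]_w (L2norm ((tau `^ gamma)^-1 *: (u t w - u (t - tau) w))%R ^+ 2)
      <= C%:E)%E.
Proof.
have hcase : 1 - H1 < 2 * s.
  rewrite ltNge; apply/negP => hc.
  have [dr [cv [_ h2 _]]] := mild_split hu hT (lexx T).
  exact: (no_rough_conv halpha hs hT hA hH1 hH2 hW hc h2).
have /andP[g0 g1] := hgamma.
(* The exponent 0 gives a bound on the second moment of the convolution uniform in time, the input
   of Gronwall's inequality. *)
have [Cc Cc0 hCc] := conv_moment hA hH1 hH2 hT hW halpha hs hcase (lexx 0) hcond.
have hCc' t conv : 0 <= t -> t <= T -> is_stochastic_conv lam phi W alpha s t conv ->
    (\int[P]_w (ip (conv w) (conv w))%:E <= Cc%:E)%E.
  by move=> a b c; have := hCc t conv a b c; rewrite powRr0 expr1n mulr1.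
have B0 : 0 < 8 * T * Cf ^+ 2 by rewrite mulr_gt0 ?exprn_gt0// mulr_gt0.
have [K K0 hK] := second_moment halpha hT hA hCf f_growth hu Cc0 hCc' B0 erefl.
have [C1 C10 hC1] := conv_holder hA hH1 hH2 hT hW halpha hs hcase (ltW g0) g1.
have [C2 C20 hC2] := conv_moment hA hH1 hH2 hT hW halpha hs hcase (ltW g0) g1.
(* Since gamma < H2 <= 1/2, the order tau of the drift increment is at most tau^(2 gamma) T^(1 - 2
   gamma): the noise alone determines the exponent. *)
have g2 : 2 * gamma <= 1.
  have /andP[a0 a1] := halpha; have /andP[s0 s1] := hs; have /andP[_ H22] := hH2; have /andP[_ H12] := hH1.
  have : alpha * (H1 - 1) / (2 * s) <= 0.
    by apply: mulr_le0_ge0; [apply: mulr_ge0_le0; lra|rewrite invr_ge0 mulr_ge0// ltW].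
  by move: (_ / (2 * s)) g1 => z; lra.
pose q := 2 * Cf ^+ 2 * (T + K).
have q0 : 0 <= q by apply: mulr_ge0; [apply: mulr_ge0 => //; exact: sqr_ge0|apply: addr_ge0 => //; exact: ltW].
exists (4 * q * T `^ (1 - 2 * gamma) + 2 * (C1 + C2)) => tau t tau0 taut tT.
have t'0 : 0 <= t - tau by rewrite subr_ge0.
have t't : t - tau < t by rewrite ltrBlDr ltrDl.
have := increment_moment halpha hT hA f_growth hu hK C10 C20 hC1 hC2 t'0 t't tT.
have -> : t - (t - tau) = tau by rewrite opprB addrC subrK.
set S := tau `^ gamma; have S0 : 0 < S by rewrite powR_gt0.
move=> h.
pose v w := u t w - u (t - tau) w.
have mv : measurable_fun setT (fun w => ip (v w) (v w)).
  apply: measurable_ip_sqr; apply: measurable_funB.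
    by apply: (measurable_process_at hu); rewrite (le_trans (ltW tau0))// tT.
  by apply: (measurable_process_at hu); rewrite t'0 (le_trans (ltW t't)).
rewrite (eq_integral (fun w => (S^-1 ^+ 2)%:E * (ip (v w) (v w))%:E)%E); last first.
  by move=> w _; rewrite L2norm_sqr ipZl ipZr mulrA -expr2 EFinM.
rewrite ge0_integralZl//; last 3 first.
- by apply/measurable_EFinP.
- by move=> w _; rewrite lee_fin ip_ge0.
- by rewrite lee_fin sqr_ge0.
apply: (le_trans (lee_wpmul2l _ h)); first by rewrite lee_fin sqr_ge0.
rewrite -EFinM lee_fin.
have tauE : tau <= S ^+ 2 * T `^ (1 - 2 * gamma).
  have tauT : tau <= T := le_trans taut tT.
  have e1 : tau = S ^+ 2 * tau `^ (1 - 2 * gamma).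
    rewrite /S -powR_mulrn ?powR_ge0// -powRrM -powRD; last by rewrite (gt_eqF tau0) implybT.
    by rewrite (_ : gamma * 2%:R + (1 - 2 * gamma) = 1) ?powRr1 ?(ltW tau0)//; ring.
  rewrite {1}e1; apply: ler_wpM2l; first exact: sqr_ge0.
  by apply: ge0_ler_powR => //; rewrite ?nnegrE ?subr_ge0//; exact: ltW.
rewrite -/q.
have -> : S^-1 ^+ 2 * (4 * tau * q + 2 * ((C1 + C2) * S ^+ 2)) = 4 * q * (tau / S ^+ 2) + 2 * (C1 + C2).
  by field; rewrite gt_eqF.
rewrite lerD2r; apply: ler_wpM2l; first exact: mulr_ge0.
by rewrite ler_pdivrMr ?exprn_gt0// mulrC.
Qed.
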